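(* There exist $m$ ($m\in\mathbb{Z}_+$ if $bc\in\{per,ap\}$, $m\in\mathbb{N}$ if $bc=dir$) giving a spectral splitting of $L_{bc}$ of the form described in the context, and a constant $C>0$, such that: for $bc\in\{per,ap\}$, $$\Big\|P(\sigma_{(m)},L_{bc})+\sum_{j=m+1}^n\widetilde{\mathbb{P}}_j-\sum_{j=0}^n\mathbb{P}_j\Big\|_2\le \frac{C}{n^{2k-3/2}},\quad n\ge m+1,$$ and for $bc=dir$, $$\Big\|P(\sigma_{(m)},L_{dir})+\sum_{j=m+1}^n\widetilde P_{j,dir}-\sum_{j=1}^nP_{j,dir}\Big\|_2\le \frac{C}{n^{2k-3/2}},\quad n\ge m+1.$$
   Context: $\mathbb{Z}_+=\mathbb{N}\cup\{0\}$. Let $k>1$ be an integer, $\omega>0$, $q\in L_2[0,\omega]$ complex-valued. $L_2[0,\omega]$ has inner product $(x,y)=\frac1\omega\int_0^\omega x\overline y\,d\tau$; $\|\cdot\|_2$ is the Hilbert-Schmidt norm of operators on $L_2[0,\omega]$. $H^{2k}[0,\omega]$ is the Sobolev space of $y$ with $y^{(2k-1)}$ absolutely continuous, $y^{(2k)}\in L_2[0,\omega]$. $L_{bc}y=(-1)^ky^{(2k)}-qy$ and $L^0_{bc}y=(-1)^ky^{(2k)}$, both with domain $\{y\in H^{2k}[0,\omega]: y\text{ satisfies } bc\}$, where: $bc=per$: $y^{(j)}(0)=y^{(j)}(\omega)$, $0\le j\le 2k-1$; $bc=ap$: $y^{(j)}(0)=-y^{(j)}(\omega)$, $0\le j\le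 2k-1$; $bc=dir$: $y^{(2i)}(0)=y^{(2i)}(\omega)=0$, $0\le i\le k-1$. Put $\theta=0$ for $per$, $\theta=1$ for $ap$. Unperturbed projections. For $bc\in\{per,ap\}$: $\lambda_n=(\pi(2n+\theta)/\omega)^{2k}$, $n\in\mathbb{Z}_+$, $e_n(t)=e^{-i\pi(2n+\theta)t/\omega}$, $n\in\mathbb{Z}$, and $\mathbb{P}_nx=(x,e_{-n-\theta})e_{-n-\theta}+(x,e_n)e_n$ (with $\mathbb{P}_0x=(x,e_0)e_0$ if $\theta=0$). For $bc=dir$: $\lambda_{n,dir}=(\pi n/\omega)^{2k}$, $e_{n,dir}(t)=\sqrt2\sin(\pi nt/\omega)$, $P_{n,dir}x=(x,e_{n,dir})e_{n,dir}$, $n\in\mathbb{N}$. Spectral splitting. $L_{bc}$ has discrete spectrum and $\sigma(L_{bc})=\sigma_{(m)}\cup\bigcup_{n\ge m+1}\sigma_n$ with mutually disjoint sets. For $bc\in\{per,ap\}$, $\sigma_{(m)}$ is finite with at most $2m+1$ points and $\sigma_n=\{\widetilde\lambda_n^-,\widetilde\lambda_n^+\}$ with $\widetilde\lambda_n^{\mp}=\lambda_n-\frac1\omega\int_0^\omega q\,dt+o(1)$ as $n\to\infty$. For $bc=dir$, $\sigma_{(m)}$ is finite with at most $m$ points and $\sigma_n=\{\widetilde\lambda_{n,dir}\}$ with $\widetilde\lambda_{n,dir}=\lambda_{n,dir}-\frac1\omega\int_0^\omega q\,dt+o(1)$. $\widetilde{\mathbb{P}}_n$ (for $per,ap$), resp.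 $\widetilde P_{n,dir}$ (for $dir$), is the Riesz projection of $L_{bc}$ for $\sigma_n$, $n\ge m+1$, and $P(\sigma_{(m)},L_{bc})$ is the Riesz projection of $L_{bc}$ for $\sigma_{(m)}$.
   Formalization: For bc=ap the bound on the number of points of σ_(m) is 2m+2 instead of 2m+1, because the sum of the projections P_0,…,P_m then has rank 2m+2 and the literal bound fails when all eigenvalues of L_ap are simple. *)

(* Defs.v *)
(* Conventions.  Elements of L_2[0,w] are represented by functions R -> R[i],
   of which only the restriction to [0,w], up to a.e. equality, matters; bounded
   operators on L_2[0,w] are represented by maps acting on representatives, and
   unbounded operators by their graphs. *)
From HB Require Import structures.
From mathcomp Require Import all_boot all_order all_algebra.
From mathcomp Require Import all_classical all_reals all_analysis.
From mathcomp Require Import complex.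

Set Implicit Arguments.
Unset Strict Implicit.
Unset Printing Implicit Defensive.
Import Order.TTheory GRing.Theory Num.Theory.
Import numFieldNormedType.Exports.

Local Open Scope classical_set_scope.
Local Open Scope complex_scope.
Local Open Scope ring_scope.

Section L2.
Context {R : realType}.
Local Notation C := R[i].
Local Notation mu := (@lebesgue_measure R).
Implicit Types (w : R) (f g x y : R -> C).

Definition cabs (z : C) : R := Normc.normc z.

Definition expi (s : R) : C := cos s +i* sin s.

Definition cintegral (D : set R) f : C :=
  (\int[mu]_(t in D) complex.Re (f t)) +i* (\int[mu]_(t in D) complex.Im (f t)).

Definition l2norm w f : \bar R :=
  sqrte ((w^-1)%:E * \int[mu]_(t in `[0%R, w]) ((cabs (f t)) ^+ 2)%:E).

Definition inL2 w f : Prop :=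
  [/\ measurable_fun `[0, w] (fun t => complex.Re (f t)),
      measurable_fun `[0, w] (fun t => complex.Im (f t))
    & (l2norm w f < +oo)%E].

Definition l2eq w f g : Prop := {ae mu, forall t, t \in `[0, w] -> f t = g t}.

Definition inner w x y : C :=
  (w^-1)%:C * cintegral `[0, w] (fun t => x t * (y t)^*).

Definition mean w f : C := (w^-1)%:C * cintegral `[0, w] f.

Definition onb w (f : nat -> R -> C) : Prop :=
  [/\ forall i, inL2 w (f i),
      forall i j, inner w (f i) (f j) = (i == j)%:R
    & forall x, inL2 w x -> (forall i, inner w x (f i) = 0) -> l2eq w x (fun=> 0)].

(* The sum does not depend on the orthonormal basis; the supremum over all bases
   is a choice-free way of denoting the common value. *)
Definition hs_norm w (T : (R -> C) -> R -> C) : \bar R :=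
  ereal_sup
    [set sqrte (\sum_(0 <= i <oo) (l2norm w (T (f i))) ^+ 2)%E | f in onb w].

Definition proj1 w (v x : R -> C) : R -> C := fun t => inner w x v * v t.

Definition finite_rank w (T : (R -> C) -> R -> C) : Prop :=
  exists (d : nat) (v : nat -> R -> C), (forall i, inL2 w (v i)) /\
    forall x, inL2 w x -> exists a : nat -> C,
      l2eq w (T x) (fun t => \sum_(i < d) a i * v i t).

End L2.

Section Spectrum.
Context {R : realType}.
Local Notation C := R[i].
Variables (w : R) (A : (R -> C) -> (R -> C) -> Prop).

(* [A y f] reads "y is in the domain of the operator and is mapped to f", so
   that (l - A) y = x iff [A y (fun t => l * y t - x t)]. *)
Definition res_eqn (l : C) (x y : R -> C) : Prop :=
  A y (fun t => l * y t - x t).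

Definition resolvent_set : set C :=
  [set l | (forall x, inL2 w x -> exists y, res_eqn l x y) /\
     exists M : R, forall x y, inL2 w x -> res_eqn l x y ->
       (l2norm w y <= M%:E * l2norm w x)%E].

Definition spectrum : set C := ~` resolvent_set.

(* (l - A)^-1 x; for l in the resolvent set the choice is unique up to a.e.
   equality. *)
Definition resolvent (l : C) (x : R -> C) : R -> C :=
  xget (fun=> 0) [set y | res_eqn l x y].

Definition circle_integral (c : C) (r : R) (F : C -> C) : C :=
  cintegral `[0, 2 * pi]
    (fun s => F (c + r%:C * expi s) * ((0 +i* 1) * r%:C * expi s)).

(* The boundary of the union of the discs (center, radius) of [D], which have
   disjoint closures, is a contour in the resolvent set that separates [S] from
   the rest of the spectrum. *)
Definition separating_discs (S : set C) (D : seq (C * R)) : Prop :=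
  [/\ forall p, p \in D ->
        0 < p.2 /\ forall z, cabs (z - p.1) = p.2 -> resolvent_set z,
      pairwise (fun p p' => p.2 + p'.2 < cabs (p.1 - p'.1)) D
    & S = spectrum `&` [set z | has (fun p => cabs (z - p.1) < p.2) D]].

(* P = (2 pi i)^-1 \oint (l - A)^-1 dl, as a weak operator integral. *)
Definition riesz_projection (S : set C) (P : (R -> C) -> R -> C) : Prop :=
  exists D : seq (C * R), separating_discs S D /\
    forall x, inL2 w x -> inL2 w (P x) /\
      forall y, inL2 w y ->
        inner w (P x) y = (2 * pi *i)^-1 *
          \sum_(p <- D) circle_integral p.1 p.2
                          (fun l => inner w (resolvent l x) y).

Definition discrete_spectrum : Prop :=
  forall l, spectrum l ->
    exists P, riesz_projection [set l] P /\ finite_rank w P.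

Definition spectral_splitting (m : nat) (S : set C) (s : nat -> set C) : Prop :=
  [/\ discrete_spectrum,
      spectrum = S `|` \bigcup_(n in [set n | (m < n)%N]) s n,
      forall n, (m < n)%N -> S `&` s n = set0
    & trivIset [set n | (m < n)%N] s].

End Spectrum.

Section DifferentialOperator.
Context {R : realType}.
Local Notation C := R[i].
Local Notation mu := (@lebesgue_measure R).

Definition abs_continuous (w : R) (f : R -> C) : Prop :=
  forall e : R, 0 < e -> exists2 d : R, 0 < d &
    forall (n : nat) (a b : nat -> R),
      (forall i, (i < n)%N -> [/\ 0 <= a i, a i <= b i & b i <= w]) ->
      (forall i j, (i < n)%N -> (j < n)%N -> i <> j ->
         b i <= a j \/ b j <= a i) ->
      \sum_(i < n) (b i - a i) < d ->
      \sum_(i < n) cabs (f (b i) - f (a i)) < e.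

Definition has_cderiv (f : R -> C) (t : R) (l : C) : Prop :=
  is_derive t 1 (fun s => complex.Re (f s)) (complex.Re l) /\
  is_derive t 1 (fun s => complex.Im (f s)) (complex.Im l).

Definition ccontinuous (w : R) (f : R -> C) : Prop :=
  {within `[0, w], continuous (fun s => complex.Re (f s))} /\
  {within `[0, w], continuous (fun s => complex.Im (f s))}.

(* [Y 0] is in H^N[0,w] and [Y j] is its j-th derivative, j <= N.  At the
   endpoints the values [Y j 0], [Y j w] are fixed by continuity on [0,w] (hence
   are one-sided derivatives). *)
Definition sobolev_derivs (w : R) (N : nat) (Y : nat -> R -> C) : Prop :=
  [/\ forall j, (j < N)%N -> ccontinuous w (Y j),
      forall j (t : R), (j.+1 < N)%N -> t \in `]0, w[ -> has_cderiv (Y j) t (Y j.+1 t),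
      abs_continuous w (Y N.-1),
      {ae mu, forall t, t \in `]0, w[ -> has_cderiv (Y N.-1) t (Y N t)}
    & inL2 w (Y N)].

Inductive bcond := per | ap | dir.

Definition satisfies_bc (b : bcond) (k : nat) (w : R) (Y : nat -> R -> C) :=
  match b with
  | per => forall j, (j <= 2 * k - 1)%N -> Y j 0 = Y j w
  | ap => forall j, (j <= 2 * k - 1)%N -> Y j 0 = - Y j w
  | dir => forall i, (i <= k - 1)%N -> Y (2 * i)%N 0 = 0 /\ Y (2 * i)%N w = 0
  end.

Definition L_op (b : bcond) (k : nat) (w : R) (q : R -> C)
    (y f : R -> C) : Prop :=
  [/\ inL2 w y, inL2 w f &
      exists Y : nat -> R -> C,
        [/\ sobolev_derivs w (2 * k) Y, satisfies_bc b k w Y, l2eq w y (Y 0%N)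
          & l2eq w f (fun t => (-1) ^+ k * Y (2 * k)%N t - q t * Y 0%N t)]].

(* Only used for [per] and [ap].  Since [P0 b w 0] has rank [1 + theta b], the
   sum of the [P0 b w j], j <= m, has rank [2 * m + 1 + theta b]. *)
Definition theta (b : bcond) : nat := if b is ap then 1 else 0.

Definition lambda (b : bcond) (k : nat) (w : R) (n : nat) : R :=
  (pi * (2 * n + theta b)%:R / w) ^+ (2 * k).

Definition efun (b : bcond) (w : R) (n : int) (t : R) : C :=
  expi (- (pi * (2 * n + (theta b)%:Z)%:~R * t / w)).

Definition P0 (b : bcond) (w : R) (n : nat) (x : R -> C) : R -> C :=
  if (theta b == 0)%N && (n == 0)%N then proj1 w (efun b w 0) x
  else proj1 w (efun b w (- n%:Z - (theta b)%:Z)) x + proj1 w (efun b w n%:Z) x.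

Definition lambda_dir (k : nat) (w : R) (n : nat) : R :=
  (pi * n%:R / w) ^+ (2 * k).

Definition efun_dir (w : R) (n : nat) (t : R) : C :=
  (Num.sqrt 2 * sin (pi * n%:R * t / w))%:C.

Definition P0_dir (w : R) (n : nat) (x : R -> C) : R -> C :=
  proj1 w (efun_dir w n) x.

(* [lt n] = [l n] - (mean of q) + o(1) *)
Definition eigen_asymp (w : R) (q : R -> C) (l : nat -> R) (lt : nat -> C) :=
  (fun n => cabs (lt n - ((l n)%:C - mean w q))) @ \oo --> (0 : R).

End DifferentialOperator.

(* Main.v *)
(** The eigenvectors of the unperturbed operator form an orthonormal basis
    (completeness is proved by Chernoff's argument for pointwise convergence of
    Fourier series), in which [L_bc] becomes [Lam - Q] on sequences, with [Lam]
    diagonal and the columns of [Q] bounded in l^2 by [M].  For [m] large the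
    blocks up to [m] are merged into one, and the method of similar operators
    yields [X] with [(Lam - Q) U = U (Lam - B)], where [B] is the block diagonal
    part of [X] and [U = 1 + Gam X] divides the off-diagonal entries of [X] by
    the gaps of [Lam]: [X] solves [X = Q + Q (Gam X) - (Gam X) B] and is found by
    Picard iteration.  Hence the spectrum is the union of the spectra of the
    blocks of [Lam - B], and the Riesz projections are [U 1_J U^-1].  The
    difference of the projections is [[Gam X, 1_J] U^-1]; only gaps between
    blocks on both sides of [n] enter it, so that its Hilbert-Schmidt norm is of
    the order of the root of [sum_j max(n, j)^-(4k-2)], that is
    [n^-(2k - 3/2)]. *)
Require Import Defs.
From HB Require Import structures.
From mathcomp Require Import all_boot all_order all_algebra.
From mathcomp Require Import all_classical all_reals all_analysis.
From mathcomp Require Import measurable_realfun complex.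
From mathcomp Require Import ring lra zify.

Set Implicit Arguments.
Unset Strict Implicit.
Unset Printing Implicit Defensive.
Import Order.TTheory GRing.Theory Num.Theory.
Import numFieldNormedType.Exports.

Local Open Scope classical_set_scope.
Local Open Scope card_scope.
Local Open Scope complex_scope.
Local Open Scope ring_scope.

(** * Complex sequences *)

(** Since [q] is only in L_2, [Q] need not be bounded on l^2; it maps l^1 to l^2. Two summability
    facts compensate for this. The squares of [(1 + ev)^-1] are summable, so the domain of [Lam]
    lies in l^1. The squares of the inverse gaps are summable, so [Gam X] is Hilbert-Schmidt on l^2
    and has columns in l^1, and the product [Q (Gam X)] exists. Merging the blocks up to [m] makes
    the sum of squared inverse gaps small, for the Picard iteration, and makes the gaps exceed a
    multiple of the norm of [B], so that the blocks keep disjoint spectra. The bound for that norm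
    grows linearly in [m], the gaps like [m^(2k-1)], so both can be achieved. The intertwining
    relation only shows that [U] maps the domain into itself. That it maps onto the domain follows
    from one point [-t] at which [Lam - Q + t] is injective and [Lam - B + t] is onto. Contour
    integrals are computed without holomorphy: continuity of the resolvent, the resolvent identity
    and the orthogonality of exponentials on a circle leave an error that decays geometrically. *)

Section ComplexModulus.
Context {R : realType}.
Local Notation C := R[i].
Implicit Types (z y : C).

Lemma cabsE z : cabs z = Num.sqrt (complex.Re z ^+ 2 + complex.Im z ^+ 2).
Proof. by case: z. Qed.

Lemma normrC_cabs z : `|z| = (cabs z)%:C.
Proof. by rewrite normc_def cabsE. Qed.

Lemma cabs_ge0 z : 0 <= cabs z.
Proof. by rewrite cabsE sqrtr_ge0. Qed.

Lemma cabs_sqr z : cabs z ^+ 2 = complex.Re z ^+ 2 + complex.Im z ^+ 2.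
Proof. by rewrite cabsE sqr_sqrtr // addr_ge0 ?sqr_ge0. Qed.

Lemma cabs0 : cabs (0 : C) = 0.
Proof. exact: Normc.normc0. Qed.

Lemma cabs1 : cabs (1 : C) = 1.
Proof. exact: Normc.normc1. Qed.

Lemma cabsM z y : cabs (z * y) = cabs z * cabs y.
Proof. exact: Normc.normcM. Qed.

Lemma cabsV z : cabs z^-1 = (cabs z)^-1.
Proof. exact: Normc.normcV. Qed.

Lemma cabsX z n : cabs (z ^+ n) = cabs z ^+ n.
Proof. by elim: n => [|n IH]; rewrite ?expr0 ?cabs1 // !exprS cabsM IH. Qed.

Lemma cabsD z y : cabs (z + y) <= cabs z + cabs y.
Proof. by rewrite -lecR rmorphD /= -!normrC_cabs ler_normD. Qed.

Lemma cabsN z : cabs (- z) = cabs z.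
Proof. by rewrite !cabsE /=; case: z => a b /=; rewrite !sqrrN. Qed.

Lemma cabsB z y : cabs (z - y) <= cabs z + cabs y.
Proof. by rewrite (le_trans (cabsD _ _)) // cabsN. Qed.

Lemma cabsBC z y : cabs (z - y) = cabs (y - z).
Proof. by rewrite -cabsN opprB. Qed.

Lemma cabs_conj z : cabs z^* = cabs z.
Proof. by rewrite !cabsE; case: z => a b /=; rewrite sqrrN. Qed.

Lemma cabs_eq0 z : (cabs z == 0) = (z == 0).
Proof.
apply/eqP/eqP => [h|->]; last exact: cabs0.
by apply: Normc.eq0_normc.
Qed.

Lemma cabs_gt0 z : (0 < cabs z) = (z != 0).
Proof. by rewrite lt_neqAle cabs_ge0 andbT eq_sym cabs_eq0. Qed.

Lemma cabs_real (x : R) : cabs x%:C = `|x|.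
Proof. by rewrite cabsE /= expr0n addr0 sqrtr_sqr. Qed.

Lemma Re_le_cabs z : `|complex.Re z| <= cabs z.
Proof. by rewrite cabsE -sqrtr_sqr ler_wsqrtr // lerDl sqr_ge0. Qed.

Lemma Im_le_cabs z : `|complex.Im z| <= cabs z.
Proof. by rewrite cabsE -sqrtr_sqr ler_wsqrtr // lerDr sqr_ge0. Qed.

Lemma cabs_le_ReIm z : cabs z <= `|complex.Re z| + `|complex.Im z|.
Proof.
rewrite -(@ler_pXn2r _ 2) ?nnegrE ?cabs_ge0 ?addr_ge0 //.
rewrite cabs_sqr sqrrD !real_normK ?num_real // lerD2r lerDl.
by rewrite mulrn_wge0 // mulr_ge0.
Qed.

Lemma cabs_sum (I : Type) (r : seq I) (P : pred I) (F : I -> C) :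
  cabs (\sum_(i <- r | P i) F i) <= \sum_(i <- r | P i) cabs (F i).
Proof.
elim/big_ind2: _ => [|z a y b Hz Hy|//]; first by rewrite cabs0.
by rewrite (le_trans (cabsD _ _)) // lerD.
Qed.

Lemma cabs_sub_ge z y : cabs z - cabs y <= cabs (z - y).
Proof. by rewrite lerBlDr -{1}(subrK y z) cabsD. Qed.

Lemma eq_of_cabs_le z y : (forall e : R, 0 < e -> cabs (z - y) <= e) -> z = y.
Proof.
move=> h; apply/eqP; rewrite -subr_eq0 -cabs_eq0 eq_le cabs_ge0 andbT.
by apply/ler_addgt0Pr => e e0; rewrite add0r h.
Qed.

Lemma mulcJ_sqr z : z * z^* = ((cabs z) ^+ 2)%:C.
Proof. by rewrite cabs_sqr; case: z => a b; simpc; congr (_ +i* _); ring. Qed.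

End ComplexModulus.

Section ComplexLimits.
Context {R : realType}.
Local Notation C := R[i].
Implicit Types (u v : nat -> C) (l : C) (K : R).

Definition ccvg u l : Prop :=
  forall e : R, 0 < e -> exists N, forall n, (N <= n)%N -> cabs (u n - l) <= e.

Lemma ccvg_unique u l l' : ccvg u l -> ccvg u l' -> l = l'.
Proof.
move=> h h'; apply: eq_of_cabs_le => e e0.
have [N hN] := h _ (divr_gt0 e0 (ltr0Sn R 1)).
have [N' hN'] := h' _ (divr_gt0 e0 (ltr0Sn R 1)).
have {}hN := hN _ (leq_maxl N N'); have {}hN' := hN' _ (leq_maxr N N').
have -> : l - l' = (u (maxn N N') - l') - (u (maxn N N') - l) by ring.
rewrite (le_trans (cabsB _ _)) //; lra.
Qed.

Lemma ccvg_cst l : ccvg (fun=> l) l.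
Proof. by move=> e e0; exists 0%N => n _; rewrite subrr cabs0 ltW. Qed.

Lemma ccvgD u v l l' : ccvg u l -> ccvg v l' -> ccvg (fun n => u n + v n) (l + l').
Proof.
move=> h h' e e0.
have [N hN] := h _ (divr_gt0 e0 (ltr0Sn R 1)).
have [N' hN'] := h' _ (divr_gt0 e0 (ltr0Sn R 1)).
exists (maxn N N') => n; rewrite geq_max => /andP[/hN a /hN' b].
have -> : u n + v n - (l + l') = (u n - l) + (v n - l') by ring.
rewrite (le_trans (cabsD _ _)) //; lra.
Qed.

Lemma ccvgZ a u l : ccvg u l -> ccvg (fun n => a * u n) (a * l).
Proof.
move=> h e e0.
have a0 : 0 < cabs a + 1 by rewrite ltr_wpDl ?cabs_ge0.
have [N hN] := h _ (divr_gt0 e0 a0).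
exists N => n /hN; rewrite ler_pdivlMr // -mulrBr cabsM => hn.
rewrite (le_trans _ hn) // mulrC ler_wpM2l ?cabs_ge0 //; lra.
Qed.

Lemma ccvg_le u l K : ccvg u l -> (forall n, cabs (u n) <= K) -> cabs l <= K.
Proof.
move=> h hu; apply/ler_addgt0Pr => e e0; have [N hN] := h _ e0.
have -> : l = u N - (u N - l) by ring.
by rewrite (le_trans (cabsB _ _)) // lerD // hN.
Qed.

Lemma eq_ccvg u v l : (forall n, u n = v n) -> ccvg u l -> ccvg v l.
Proof. by move=> e h x /h[N hN]; exists N => n /hN; rewrite e. Qed.

Lemma ccvg_sum (I : Type) (r : seq I) (F : I -> nat -> C) (f : I -> C) :
  (forall i, ccvg (F i) (f i)) ->
  ccvg (fun n => \sum_(i <- r) F i n) (\sum_(i <- r) f i).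
Proof.
move=> h; elim: r => [|i r IH].
  by rewrite big_nil; apply: eq_ccvg (ccvg_cst 0) => n; rewrite big_nil.
rewrite big_cons; apply: eq_ccvg (ccvgD (h i) IH) => n.
by rewrite big_cons.
Qed.

Lemma ccvg_complete u :
  (forall e : R, 0 < e ->
     exists N, forall n m, (N <= n)%N -> (N <= m)%N -> cabs (u n - u m) <= e) ->
  exists l, ccvg u l.
Proof.
move=> h.
(* [f] will be the real or the imaginary part; both are 1-Lipschitz for the modulus, so they
   preserve Cauchy sequences. *)
have cv (f : C -> R) : (forall z y, `|f z - f y| <= cabs (z - y)) ->
    cvgn (fun n => f (u n)).
  move=> hf; apply/cauchy_cvgP/cauchy_ballP => e e0 /=.
  have [N hN] := h _ (divr_gt0 e0 (ltr0Sn R 1)).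
  exists (f @` (u @` [set n | (N <= n)%N]), f @` (u @` [set n | (N <= n)%N])).
    by split; exists N => // n Nn; exists (u n) => //; exists n.
  move=> [a b] /= [[_ [n Nn <-] <-] [_ [m Nm <-] <-]].
  apply: le_lt_trans (hf _ _) _; apply: le_lt_trans (hN _ _ Nn Nm) _; lra.
have cre : cvgn (fun n => complex.Re (u n)).
  apply: cv => z y; apply: le_trans (Re_le_cabs _).
  by case: z y => ? ? [].
have cim : cvgn (fun n => complex.Im (u n)).
  apply: cv => z y; apply: le_trans (Im_le_cabs _).
  by case: z y => ? ? [].
exists (lim ((fun n => complex.Re (u n)) @ \oo) +i* lim ((fun n => complex.Im (u n)) @ \oo)) => e e0.
have e2 : 0 < e / 2 by lra.
move/cvgrPdist_le : cre => /(_ _ e2)[N _ hN].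
move/cvgrPdist_le : cim => /(_ _ e2)[N' _ hN'].
exists (maxn N N') => n; rewrite geq_max => /andP[/hN a /hN' b].
rewrite cabsBC (le_trans (cabs_le_ReIm _)) //.
move: a b; case: (u n) => x y /= a b; lra.
Qed.

End ComplexLimits.

Section Sums.
Context {R : realType}.
Local Notation C := R[i].
Implicit Types (a b z y : nat -> C) (K L : R).

Definition l1le a K : Prop := forall n, \sum_(i < n) cabs (a i) <= K.

(** A bound in place of the norm, so that no value is assigned to a divergent sum; [0 <= K] is
    recorded because the sums only see [K ^+ 2]. *)
Definition l2le a K : Prop :=
  0 <= K /\ forall n, \sum_(i < n) cabs (a i) ^+ 2 <= K ^+ 2.

(** Total by a default value; it is the limit of the partial sums as soon as they converge, in
    particular under [l1le]. *)
Definition csum a : C := xget 0 [set s | ccvg (fun n => \sum_(i < n) a i) s].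

Lemma l1le_ge0 a K : l1le a K -> 0 <= K.
Proof. by move=> /(_ 0%N); rewrite big_ord0. Qed.

Lemma l1le_mono a K L : K <= L -> l1le a K -> l1le a L.
Proof. by move=> KL h n; apply: le_trans (h n) KL. Qed.

Lemma l1leW a b K : (forall i, cabs (b i) <= cabs (a i)) -> l1le a K -> l1le b K.
Proof. by move=> ab h n; apply: le_trans (h n); apply: ler_sum => i _. Qed.

Lemma l1leD a b K L : l1le a K -> l1le b L -> l1le (fun i => a i + b i) (K + L).
Proof.
move=> ha hb n; apply: le_trans (lerD (ha n) (hb n)).
by rewrite -big_split; apply: ler_sum => i _; exact: cabsD.
Qed.

Lemma l1leZ c a K : l1le a K -> l1le (fun i => c * a i) (cabs c * K).
Proof.
move=> h n; under eq_bigr do rewrite cabsM.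
by rewrite -mulr_sumr ler_wpM2l ?cabs_ge0.
Qed.

Lemma sum_tail_le (f : nat -> R) n m : (n <= m)%N ->
  \sum_(i < m) f i - \sum_(i < n) f i = \sum_(n <= i < m) f i.
Proof.
move=> nm; rewrite -!(big_mkord xpredT) (big_cat_nat (leq0n n) nm) /=.
by rewrite addrAC subrr add0r.
Qed.

Lemma csum_tail (f : nat -> C) n m : (n <= m)%N ->
  \sum_(i < m) f i - \sum_(i < n) f i = \sum_(n <= i < m) f i.
Proof.
move=> nm; rewrite -!(big_mkord xpredT) (big_cat_nat (leq0n n) nm) /=.
by rewrite addrAC subrr add0r.
Qed.

(** Otherwise every index is followed by a stretch of sum larger than [e], and sufficiently many
    such stretches exceed [K]. *)
Lemma real_bounded_cauchy (f : nat -> R) K : (forall i, 0 <= f i) ->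
  (forall n, \sum_(i < n) f i <= K) -> forall e : R, 0 < e ->
  exists N, forall n, (N <= n)%N -> \sum_(N <= i < n) f i <= e.
Proof.
move=> f0 fK e e0; apply/not_existsP => h.
have hs (j : nat) : exists N, j%:R * e <= \sum_(i < N) f i.
  elim: j => [|j [N hN]]; first by exists 0%N; rewrite big_ord0 mul0r.
  have /existsNP[n /not_implyP[Nn /negP]] := h N; rewrite -ltNge => hn.
  by exists n; rewrite -(subrK (\sum_(i < N) f i) (\sum_(i < n) f i))
    sum_tail_le // -natr1 mulrDl mul1r addrC lerD // ltW.
have /(_ e K e0) [|j hj] : forall e K : R, 0 < e -> 0 <= K -> exists j : nat, K < j%:R * e.
  move=> x y x0 y0; exists (Num.truncn (y / x)).+1.
  by rewrite -ltr_pdivrMr // truncnS_gt.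
  by have := fK 0%N; rewrite big_ord0.
by have [N hN] := hs j; have := lt_le_trans hj (le_trans hN (fK N)); rewrite ltxx.
Qed.

Lemma csumP a K : l1le a K -> ccvg (fun n => \sum_(i < n) a i) (csum a).
Proof.
move=> h; apply: (@xgetPex _ 0 [set s | ccvg (fun n => \sum_(i < n) a i) s]).
apply: ccvg_complete => e e0.
have [N hN] := real_bounded_cauchy (fun i => cabs_ge0 (a i)) h e0.
exists N => n m Nn Nm; wlog nm : n m Nn Nm / (n <= m)%N.
  by move=> H; case: (leqP n m) => [|/ltnW] /H; [|rewrite cabsBC]; apply.
rewrite cabsBC csum_tail // (le_trans (cabs_sum _ _ _)) //.
apply: le_trans (hN m Nm); rewrite (big_cat_nat Nn nm) /= lerDr.
by apply: sumr_ge0 => i _; exact: cabs_ge0.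
Qed.

Lemma csum_unique a s : ccvg (fun n => \sum_(i < n) a i) s -> csum a = s.
Proof.
move=> h; apply: (ccvg_unique _ h); have h' : [set s | ccvg (fun n => \sum_(i < n) a i) s] s by [].
exact: (xgetI 0 h').
Qed.

Lemma eq_csum a b : (forall i, a i = b i) -> csum a = csum b.
Proof. by move=> ab; congr csum; apply/funext. Qed.

Lemma csum_le a K : l1le a K -> cabs (csum a) <= K.
Proof.
move=> h; apply: ccvg_le (csumP h) _ => n.
exact: le_trans (cabs_sum _ _ _) (h n).
Qed.

Lemma csumD a b K L : l1le a K -> l1le b L ->
  csum (fun i => a i + b i) = csum a + csum b.
Proof.
move=> ha hb; apply: csum_unique; apply: eq_ccvg (ccvgD (csumP ha) (csumP hb)).
by move=> n; rewrite big_split.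
Qed.

Lemma csumZ c a K : l1le a K -> csum (fun i => c * a i) = c * csum a.
Proof.
move=> ha; apply: csum_unique; apply: eq_ccvg (ccvgZ c (csumP ha)).
by move=> n; rewrite mulr_sumr.
Qed.

Lemma csumB a b K L : l1le a K -> l1le b L ->
  csum (fun i => a i - b i) = csum a - csum b.
Proof.
move=> ha hb; under [in LHS]eq_csum do rewrite -mulN1r.
by rewrite (csumD ha (l1leZ (-1) hb)) (csumZ _ hb) mulN1r.
Qed.

Lemma l1le_fin n a : (forall i, (n <= i)%N -> a i = 0) ->
  l1le a (\sum_(i < n) cabs (a i)).
Proof.
move=> h m; case: (leqP m n) => [mn|/ltnW nm].
  rewrite -subr_ge0 (sum_tail_le (fun i => cabs (a i))) //.
  by apply: sumr_ge0 => i _; exact: cabs_ge0.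
rewrite -subr_le0 (sum_tail_le (fun i => cabs (a i))) //.
by rewrite big_nat big1 // => i /andP[ni _]; rewrite h ?cabs0.
Qed.

Lemma csum_fin n a : (forall i, (n <= i)%N -> a i = 0) ->
  csum a = \sum_(i < n) a i.
Proof.
move=> h; apply: csum_unique => e e0; exists n => m nm.
rewrite csum_tail // big_nat big1 ?cabs0 ?ltW // => i /andP[ni _].
exact: h.
Qed.

Lemma csum0 : csum (fun=> 0 : C) = 0.
Proof. by rewrite (@csum_fin 0) ?big_ord0. Qed.

Lemma l1le0 : l1le (fun=> 0 : C) 0.
Proof. by move=> n; rewrite big1 // => i _; rewrite cabs0. Qed.

Lemma csum_delta (f : nat -> C) j : csum (fun i => f i * (i == j)%:R) = f j.
Proof.
rewrite (@csum_fin j.+1); last by move=> i ij; rewrite gtn_eqF ?mulr0.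
rewrite (bigD1 ord_max) //= eqxx mulr1 big1 ?addr0 // => i.
by rewrite -val_eqE /= => /negPf ->; rewrite mulr0.
Qed.

Lemma csum_sum (n : nat) (F : 'I_n -> nat -> C) (K : 'I_n -> R) :
  (forall j, l1le (F j) (K j)) ->
  csum (fun i => \sum_(j < n) F j i) = \sum_(j < n) csum (F j).
Proof.
move=> h; apply: csum_unique.
apply: (@eq_ccvg _ (fun m => \sum_(j < n) \sum_(i < m) F j i)).
  by move=> m; rewrite exchange_big.
by apply: ccvg_sum => j; exact: csumP (h j).
Qed.

Lemma l1le_cut (n : nat) a K : l1le a K ->
  l1le (fun i => if (i < n)%N then a i else 0) K.
Proof. by apply: l1leW => i; case: ifP => // _; rewrite cabs0 cabs_ge0. Qed.

Lemma l1le_tail a K e : l1le a K -> 0 < e ->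
  exists n, l1le (fun i => if (i < n)%N then 0 else a i) e.
Proof.
move=> ha e0.
have [N hN] := real_bounded_cauchy (fun i => cabs_ge0 (a i)) ha e0.
exists N => m; case: (leqP N m) => Nm; last first.
  rewrite big1 ?ltW // => i _; by rewrite (ltn_trans (ltn_ord i) Nm) cabs0.
apply: le_trans (hN m Nm).
rewrite -(big_mkord xpredT (fun i => cabs (if (i < N)%N then 0 else a i))).
rewrite (big_cat_nat (leq0n N) Nm) /= big_nat big1 ?add0r => [|i /andP[_ ->]]; last exact: cabs0.
by rewrite big_nat [leRHS]big_nat; apply: ler_sum => i /andP[Ni _]; rewrite ltnNge Ni.
Qed.

Lemma real_CS n (x y : nat -> R) :
  (\sum_(i < n) x i * y i) ^+ 2 <=
  (\sum_(i < n) x i ^+ 2) * \sum_(i < n) y i ^+ 2.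
Proof.
have pos (f : nat -> R) m : 0 <= \sum_(i < m) f i ^+ 2.
  by apply: sumr_ge0 => i _; exact: sqr_ge0.
elim: n => [|n IH]; first by rewrite !big_ord0 expr0n mul0r.
rewrite !big_ord_recr /=; move: IH (pos x n) (pos y n).
set A := \sum_(i < n) x i ^+ 2; set B := \sum_(i < n) x i * y i.
set D := \sum_(i < n) y i ^+ 2; move: (x n) (y n) => s t h A0 D0.
(* Both sides are compared after squaring: [B ^+ 2 <= A * D] is the induction hypothesis, and the
   square of the right-hand side exceeds [4 * (A * D * (s * t) ^+ 2)] by a square. *)
have : (B * s * t *+ 2) <= A * t ^+ 2 + D * s ^+ 2; last by nra.
apply: le_trans (ler_norm _) _.
rewrite -(@ler_pXn2r _ 2) ?nnegrE ?normr_ge0 //; last first.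
  by rewrite addr_ge0 // mulr_ge0 ?sqr_ge0.
rewrite real_normK ?num_real //.
have h2 : B ^+ 2 * (s * t) ^+ 2 <= A * D * (s * t) ^+ 2 by rewrite ler_wpM2r ?sqr_ge0.
have := sqr_ge0 (A * t ^+ 2 - D * s ^+ 2).
have -> : (B * s * t *+ 2) ^+ 2 = 4 * (B ^+ 2 * (s * t) ^+ 2) by ring.
have -> : (A * t ^+ 2 + D * s ^+ 2) ^+ 2 =
  (A * t ^+ 2 - D * s ^+ 2) ^+ 2 + 4 * (A * D * (s * t) ^+ 2) by ring.
lra.
Qed.

Lemma real_CS_le n (x y : nat -> R) K L : 0 <= K -> 0 <= L ->
  \sum_(i < n) x i ^+ 2 <= K ^+ 2 -> \sum_(i < n) y i ^+ 2 <= L ^+ 2 ->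
  \sum_(i < n) x i * y i <= K * L.
Proof.
move=> K0 L0 hx hy; apply: le_trans (ler_norm _) _.
rewrite -(@ler_pXn2r _ 2) ?nnegrE ?mulr_ge0 // real_normK ?num_real //.
apply: le_trans (real_CS _ _ _) _; rewrite exprMn; apply: ler_pM => //.
  by apply: sumr_ge0 => i _; exact: sqr_ge0.
by apply: sumr_ge0 => i _; exact: sqr_ge0.
Qed.

Lemma l2le_ge0 a K : l2le a K -> 0 <= K.
Proof. by case. Qed.

Lemma l2le_mono a K L : K <= L -> l2le a K -> l2le a L.
Proof.
move=> KL [K0 h]; split=> [|n]; first exact: le_trans KL.
by apply: le_trans (h n) _; rewrite ler_pXn2r ?nnegrE // (le_trans K0).
Qed.

Lemma l2leW a b K : (forall i, cabs (b i) <= cabs (a i)) -> l2le a K -> l2le b K.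
Proof.
move=> ab [K0 h]; split=> // n; apply: le_trans (h n); apply: ler_sum => i _.
by rewrite ler_pXn2r ?nnegrE ?cabs_ge0.
Qed.

Lemma eq_l2le a b K : (forall i, a i = b i) -> l2le a K -> l2le b K.
Proof. by move=> ab; apply: l2leW => i; rewrite ab. Qed.

Lemma l2le0 K : 0 <= K -> l2le (fun=> 0) K.
Proof.
move=> K0; split=> // n; rewrite big1 ?sqr_ge0 // => i _.
by rewrite cabs0 expr0n.
Qed.

Lemma l2leZ c a K : l2le a K -> l2le (fun i => c * a i) (cabs c * K).
Proof.
move=> [K0 h]; split=> [|n]; first by rewrite mulr_ge0 ?cabs_ge0.
under eq_bigr do rewrite cabsM exprMn.
by rewrite -mulr_sumr exprMn ler_wpM2l ?sqr_ge0.
Qed.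

Lemma l2leN a K : l2le a K -> l2le (fun i => - a i) K.
Proof. by apply: l2leW => i; rewrite cabsN. Qed.

Lemma l2leD a b K L : l2le a K -> l2le b L -> l2le (fun i => a i + b i) (K + L).
Proof.
move=> [K0 ha] [L0 hb]; split=> [|n]; first exact: addr_ge0.
have := @real_CS_le n (cabs \o a) (cabs \o b) K L K0 L0 (ha n) (hb n) => /= hab.
apply: (@le_trans _ _ (\sum_(i < n) cabs (a i) ^+ 2 +
  2 * (\sum_(i < n) cabs (a i) * cabs (b i)) + \sum_(i < n) cabs (b i) ^+ 2)).
  rewrite mulr_sumr -!big_split /=; apply: ler_sum => i _.
  apply: (@le_trans _ _ ((cabs (a i) + cabs (b i)) ^+ 2)).
    by rewrite ler_pXn2r ?nnegrE ?cabs_ge0 ?addr_ge0 ?cabs_ge0 // cabsD.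
  by rewrite sqrrD; lra.
have := ha n; have := hb n; rewrite sqrrD; lra.
Qed.

Lemma l2leB a b K L : l2le a K -> l2le b L -> l2le (fun i => a i - b i) (K + L).
Proof. by move=> ha hb; exact: l2leD ha (l2leN hb). Qed.

Lemma l2le_pt a K i : l2le a K -> cabs (a i) <= K.
Proof.
move=> [K0 h]; rewrite -(@ler_pXn2r _ 2) ?nnegrE ?cabs_ge0 //.
apply: le_trans (h i.+1); rewrite big_ord_recr /= lerDr.
by apply: sumr_ge0 => j _; exact: sqr_ge0.
Qed.

Lemma l2le_sumP a K n : l2le a K -> \sum_(i < n) cabs (a i) ^+ 2 <= K ^+ 2.
Proof. by case. Qed.

Lemma l2le_cut n a K : l2le a K -> l2le (fun i => if (i < n)%N then a i else 0) K.
Proof. by apply: l2leW => i; case: ifP => // _; rewrite cabs0 cabs_ge0. Qed.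

Lemma l2le_supp n a K : 0 <= K -> (forall i, (n <= i)%N -> a i = 0) ->
  \sum_(i < n) cabs (a i) ^+ 2 <= K ^+ 2 -> l2le a K.
Proof.
move=> K0 an h; split=> // m.
have sub : \sum_(i < m) cabs (a i) ^+ 2 <= \sum_(i < n) cabs (a i) ^+ 2.
  case: (leqP m n) => [mn|/ltnW nm].
    rewrite -subr_ge0 (sum_tail_le (fun i => cabs (a i) ^+ 2)) //.
    by apply: sumr_ge0 => i _; exact: sqr_ge0.
  rewrite -subr_le0 (sum_tail_le (fun i => cabs (a i) ^+ 2)) //.
  by rewrite big_nat big1 // => i /andP[ni _]; rewrite an ?cabs0 ?expr0n.
exact: le_trans sub h.
Qed.

(** The factor [n] instead of its square root is good enough, since [d] is chosen after [n]. *)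
Lemma l2le_cut_small n a d : 0 <= d -> (forall i, (i < n)%N -> cabs (a i) <= d) ->
  l2le (fun i => if (i < n)%N then a i else 0) (n%:R * d).
Proof.
move=> d0 h; apply: (@l2le_supp n); first by rewrite mulr_ge0.
  by move=> i; rewrite leqNgt => /negPf ->.
apply: (@le_trans _ _ (\sum_(i < n) d ^+ 2)).
  apply: ler_sum => i _; rewrite ltn_ord.
  by rewrite ler_pXn2r ?nnegrE ?cabs_ge0 // h.
rewrite sumr_const card_ord exprMn -[X in X <= _]mulr_natl ler_wpM2r ?sqr_ge0 //.
by rewrite expr2 -natrM ler_nat; case: n {h} => // n; rewrite leq_pmulr.
Qed.

Lemma l2le_close a K : 0 <= K -> (forall e : R, 0 < e -> l2le a (K + e)) -> l2le a K.
Proof.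
move=> K0 h; split=> // n.
have [//|lt] := lerP (\sum_(i < n) cabs (a i) ^+ 2) (K ^+ 2).
set S := \sum_(i < n) _ in lt *.
have S0 : 0 <= S by apply: le_trans (ltW lt); exact: sqr_ge0.
have KS : K < Num.sqrt S.
  by rewrite -(@ltr_pXn2r _ 2) ?nnegrE ?sqrtr_ge0 // sqr_sqrtr.
have e0 : 0 < (Num.sqrt S - K) / 2 by lra.
have := l2le_sumP n (h _ e0); rewrite -/S -[leLHS](sqr_sqrtr S0).
have p : 0 <= K + (Num.sqrt S - K) / 2 by lra.
rewrite ler_pXn2r ?nnegrE ?sqrtr_ge0 //; lra.
Qed.

(** Fatou's lemma for sequences: on the first [n] coordinates the convergence is uniform, so there
    the limit differs from one of the [f m] by a vector of norm at most [e]. *)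
Lemma l2le_lim (f : nat -> nat -> C) g K : (forall m, l2le (f m) K) ->
  (forall i, ccvg (f^~ i) (g i)) -> l2le g K.
Proof.
move=> hf fg; have K0 := l2le_ge0 (hf 0%N).
apply: l2le_close => // e e0.
suff cut n : l2le (fun i => if (i < n)%N then g i else 0) (K + e).
  split=> [|n]; first by rewrite addr_ge0 // ltW.
  apply: le_trans (l2le_sumP n (cut n)).
  by rewrite le_eqVlt; apply/orP; left; apply/eqP; apply: eq_bigr => i _; rewrite ltn_ord.
have e1 : 0 < e / n.+1%:R by rewrite divr_gt0.
have [m hm] : exists m, forall i, (i < n)%N -> cabs (g i - f m i) <= e / n.+1%:R.
  suff /(_ n) [m hm] : forall j, exists m0, forall m i, (m0 <= m)%N -> (i < j)%N ->
      cabs (g i - f m i) <= e / n.+1%:R.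
    by exists m => i; exact: hm.
  elim=> [|j [m0 hm0]]; first by exists 0%N.
  have [m1 hm1] := fg j _ e1; exists (maxn m0 m1) => m i.
  rewrite geq_max => /andP[/hm0 h0 /hm1 h1]; rewrite ltnS leq_eqVlt.
  by case/orP => [/eqP ->|/h0 //]; rewrite cabsBC.
have h := l2leD (l2le_cut n (hf m)) (l2le_cut_small (ltW e1) hm).
apply: (@eq_l2le (fun i => (if (i < n)%N then f m i else 0) +
    (if (i < n)%N then g i - f m i else 0))).
  by move=> i; case: ifP => _; ring.
apply: l2le_mono h; rewrite lerD2l mulrA ler_pdivrMr // mulrC ler_pM2l //.
by rewrite ler_nat.
Qed.

Lemma l2_l1 a b K L : l2le a K -> l2le b L -> l1le (fun i => a i * b i) (K * L).
Proof.
move=> [K0 ha] [L0 hb] n; under eq_bigr do rewrite cabsM.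
exact: (@real_CS_le n (cabs \o a) (cabs \o b)).
Qed.

Lemma l2le_real (x : nat -> R) K : 0 <= K -> (forall n, \sum_(i < n) x i ^+ 2 <= K ^+ 2) ->
  l2le (fun i => (x i)%:C) K.
Proof.
move=> K0 h; split=> // n; apply: le_trans (h n).
by apply: ler_sum => i _; rewrite cabs_real real_normK ?num_real.
Qed.

Lemma l1_l2 a K : l1le a K -> l2le a K.
Proof.
move=> h; have K0 := l1le_ge0 h; split=> // n.
have hi i : cabs (a i) <= K.
  apply: le_trans (h i.+1); rewrite big_ord_recr /= lerDr.
  by apply: sumr_ge0 => j _; exact: cabs_ge0.
apply: (@le_trans _ _ (\sum_(i < n) K * cabs (a i))).
  by apply: ler_sum => i _; rewrite expr2 ler_wpM2r ?cabs_ge0.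
by rewrite -mulr_sumr expr2 ler_wpM2l.
Qed.

(** Minkowski's inequality for the series of vectors [z j * v j]: partial sums are bounded by the
    triangle inequality, and the limit is taken by [l2le_lim]. *)
Lemma l2le_csum (z : nat -> C) (v : nat -> nat -> C) (c : nat -> R) K :
  (forall j, l2le (v j) (c j)) ->
  l1le (fun j => z j * (c j)%:C) K ->
  l2le (fun i => csum (fun j => z j * v j i)) K.
Proof.
move=> hv hz.
have hzi i : l1le (fun j => z j * v j i) K.
  apply: l1leW hz => j; rewrite !cabsM ler_wpM2l ?cabs_ge0 //.
  by rewrite cabs_real (ger0_norm (l2le_ge0 (hv j))) l2le_pt.
apply: (@l2le_lim (fun m i => \sum_(j < m) z j * v j i)); last first.
  by move=> i; exact: csumP (hzi i).
move=> m; apply: l2le_mono (hz m) _.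
elim: m => [|m IH].
  rewrite big_ord0; apply: eq_l2le (l2le0 (lexx 0)) => i; by rewrite big_ord0.
rewrite big_ord_recr /=; apply: eq_l2le (l2leD IH _).
  by move=> i; rewrite big_ord_recr.
rewrite cabsM cabs_real (ger0_norm (l2le_ge0 (hv m))); exact: l2leZ.
Qed.

(** The least bound is the norm. It serves where an estimate of [N] by [a + q * N] with [q < 1] is
    to be absorbed, as in [apriori] and [res_lip]. *)
Lemma l2_min a K : l2le a K -> exists N, l2le a N /\ forall L, l2le a L -> N <= L.
Proof.
move=> hK; pose S := [set \sum_(i < n) cabs (a i) ^+ 2 | n in [set: nat]].
have S0 : S !=set0 by exists (\sum_(i < 0) cabs (a i) ^+ 2); exists 0%N.
have ub L : l2le a L -> ubound S (L ^+ 2) by move=> [_ h] _ [n _ <-].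
have hs : has_sup S by split=> //; exists (K ^+ 2); exact: ub.
have sup0 : 0 <= sup S.
  by apply: (sup_upper_bound hs); exists 0%N => //; rewrite big_ord0.
exists (Num.sqrt (sup S)); split.
  split=> [|n]; first exact: sqrtr_ge0.
  by rewrite sqr_sqrtr //; apply: (sup_upper_bound hs); exists n.
move=> L hL; rewrite -(@ler_pXn2r _ 2) ?nnegrE ?sqrtr_ge0 ?(l2le_ge0 hL) //.
by rewrite sqr_sqrtr //; apply: ge_sup => //; exact: ub.
Qed.

End Sums.

(** * The method of similar operators *)

Section Picard.
Context {R : realType} {T : Type}.
Local Notation C := R[i].
Variable bnd : (T -> C) -> R -> Prop.
Hypothesis bnd0 : forall K, 0 <= K -> bnd (fun=> 0) K.
Hypothesis bndD : forall f g K L, bnd f K -> bnd g L -> bnd (fun t => f t + g t) (K + L).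
Hypothesis bnd_pt : forall f K t, bnd f K -> cabs (f t) <= K.
Hypothesis bnd_mono : forall f K L, K <= L -> bnd f K -> bnd f L.
Hypothesis bnd_lim : forall (f : nat -> T -> C) g K, (forall m, bnd (f m) K) ->
  (forall t, ccvg (f^~ t) (g t)) -> bnd g K.

(** Banach's fixed point theorem with factor 1/2. The bounds [bnd] are abstract, with closure under
    pointwise limits in place of completeness, so that one lemma serves for matrices with bounded
    columns and for vectors in l^2. *)
Lemma picard (F : (T -> C) -> T -> C) (r : R) : 0 <= r ->
  (forall f, bnd f r -> bnd (F f) r) ->
  (forall f g d, bnd f r -> bnd g r -> bnd (fun t => f t - g t) d ->
     bnd (fun t => F f t - F g t) (d / 2)) ->
  exists f, bnd f r /\ forall t, F f t = f t.
Proof.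
move=> r0 Fr Fc; pose u n := iter n F (fun=> 0).
have ur n : bnd (u n) r by elim: n => [|n IH]; [exact: bnd0 | exact: Fr].
have us n : bnd (fun t => u n.+1 t - u n t) (r / 2 ^+ n).
  elim: n => [|n IH].
    rewrite expr0 divr1; have -> : (fun t => u 1%N t - u 0%N t) = u 1%N.
      by apply/funext => t /=; rewrite subr0.
    exact: ur.
  have := Fc _ _ _ (ur n.+1) (ur n) IH.
  by rewrite -mulrA -invfM -exprSr.
have ud k n : bnd (fun t => u (n + k)%N t - u n t) (2 * r / 2 ^+ n).
  (* The subtracted term lets the induction on [k] telescope; dropping it gives a bound uniform in
     [k]. *)
  suff : bnd (fun t => u (n + k)%N t - u n t) (2 * r / 2 ^+ n - 2 * r / 2 ^+ (n + k)).
    by apply: bnd_mono; rewrite gerBl divr_ge0 ?mulr_ge0 ?exprn_ge0.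
  elim: k => [|k IH].
    rewrite addn0 subrr; have -> : (fun t => u n t - u n t) = (fun=> 0).
      by apply/funext => t; rewrite subrr.
    exact: bnd0.
  have := bndD IH (us (n + k)%N); rewrite addnS.
  have -> : (fun t => u (n + k)%N t - u n t + (u (n + k).+1 t - u (n + k)%N t)) =
     (fun t => u (n + k).+1 t - u n t) by apply/funext => t; ring.
  apply: bnd_mono; rewrite exprS.
  set p := 2 ^+ (n + k); have p0 : p != 0 by rewrite expf_neq0.
  have q0 : 2 ^+ n != 0 :> R by rewrite expf_neq0.
  suff -> : 2 * r / 2 ^+ n - 2 * r / p + r / p = 2 * r / 2 ^+ n - 2 * r / (2 * p) by [].
  by field; rewrite p0 q0.
have small (e : R) : 0 < e -> exists n, 2 * r / 2 ^+ n <= e.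
  move=> e0; exists (Num.truncn (2 * r / e)).
  set n := Num.truncn _; have h : 2 * r / e <= 2 ^+ n.
    by apply: le_trans (ltW (truncnS_gt _)) _; rewrite -natrX ler_nat ltn_expl.
  by rewrite ler_pdivrMr ?exprn_gt0 // [leRHS]mulrC -ler_pdivrMr.
have uc t : exists l, ccvg (u^~ t) l.
  apply: ccvg_complete => e e0; have [N hN] := small (e / 2) (divr_gt0 e0 (ltr0Sn R 1)).
  exists N => n m /subnKC <- /subnKC <-.
  rewrite -(subrKA (u N t)) (le_trans (cabsD _ _)) // (splitr e) lerD //.
    exact: le_trans (bnd_pt t (ud _ _)) hN.
  by rewrite cabsBC; exact: le_trans (bnd_pt t (ud _ _)) hN.
have [f hf] := choice uc.
have fr : bnd f r := bnd_lim ur hf.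
have fu n : bnd (fun t => f t - u n t) (2 * r / 2 ^+ n).
  apply: (@bnd_lim (fun k t => u (n + k)%N t - u n t)) => // t e e0.
  have [N hN] := hf t _ e0; exists N => k Nk.
  have -> : u (n + k)%N t - u n t - (f t - u n t) = u (n + k)%N t - f t by ring.
  by apply: hN; rewrite (leq_trans Nk) // leq_addl.
exists f; split=> // t; apply: eq_of_cabs_le => e e0.
have [n hn] := small (e / 2) (divr_gt0 e0 (ltr0Sn R 1)).
have -> : F f t - f t = (F f t - u n.+1 t) - (f t - u n.+1 t) by ring.
rewrite (le_trans (cabsB _ _)) // (splitr e) lerD //.
  apply: le_trans (bnd_pt t (Fc _ _ _ fr (ur n) (fu n))) (le_trans _ hn).
  by rewrite ler_pdivrMr // ler_peMr ?ler1n // divr_ge0 ?mulr_ge0 ?exprn_ge0.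
apply: le_trans (bnd_pt t (fu n.+1)) (le_trans _ hn).
by rewrite ler_wpM2l ?mulr_ge0 // lef_pV2 ?posrE ?exprn_gt0 // ler_weXn2l ?ler1n.
Qed.

End Picard.

(** * Infinite matrices as operators on l^1 and l^2 *)

Section MatrixVector.
Context {R : realType}.
Local Notation C := R[i].
Implicit Types (X Y A : nat -> nat -> C) (z : nat -> C) (K L : R).

Lemma l1le_lim (f : nat -> nat -> C) g K : (forall m, l1le (f m) K) ->
  (forall i, ccvg (f^~ i) (g i)) -> l1le g K.
Proof.
move=> hf fg n; apply/ler_addgt0Pr => e e0.
have e1 : 0 < e / n.+1%:R by rewrite divr_gt0.
have [m hm] : exists m, forall i, (i < n)%N -> cabs (g i - f m i) <= e / n.+1%:R.
  suff /(_ n) [m hm] : forall j, exists m0, forall m i, (m0 <= m)%N -> (i < j)%N ->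
      cabs (g i - f m i) <= e / n.+1%:R.
    by exists m => i; exact: hm.
  elim=> [|j [m0 hm0]]; first by exists 0%N.
  have [m1 hm1] := fg j _ e1; exists (maxn m0 m1) => m i.
  rewrite geq_max => /andP[/hm0 h0 /hm1 h1]; rewrite ltnS leq_eqVlt.
  by case/orP => [/eqP ->|/h0 //]; rewrite cabsBC.
apply: (@le_trans _ _ (\sum_(i < n) (cabs (f m i) + e / n.+1%:R))).
  apply: ler_sum => i _; rewrite -[in leLHS](subrK (f m i) (g i)) addrC.
  by rewrite (le_trans (cabsD _ _)) // lerD // hm.
rewrite big_split /= lerD ?hf // sumr_const card_ord.
by rewrite -[leLHS]mulr_natl mulrCA ler_piMr ?ltW // ltr_pdivrMr // mul1r ltr_nat.
Qed.

Lemma l1le_csum z (v : nat -> nat -> C) L K : l1le z K -> (forall j, l1le (v j) L) ->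
  l1le (fun i => csum (fun j => z j * v j i)) (K * L).
Proof.
move=> hz hv; have L0 := l1le_ge0 (hv 0%N).
have hzi i : l1le (fun j => z j * v j i) (K * L).
  rewrite mulrC -(ger0_norm L0) -cabs_real; apply: l1leW (l1leZ L%:C hz) => j.
  rewrite !cabsM cabs_real (ger0_norm L0) mulrC ler_wpM2r ?cabs_ge0 //.
  apply: le_trans (hv j i.+1); rewrite big_ord_recr /= lerDr.
  by apply: sumr_ge0 => k _; exact: cabs_ge0.
apply: (@l1le_lim (fun m i => \sum_(j < m) z j * v j i)); last first.
  by move=> i; exact: csumP (hzi i).
move=> m; apply: (@l1le_mono _ _ ((\sum_(j < m) cabs (z j)) * L)).
  by rewrite ler_wpM2r.
elim: m => [|m IH].
  rewrite big_ord0 mul0r; apply: l1leW l1le0 => i; by rewrite big_ord0.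
rewrite big_ord_recr /= mulrDl; apply: l1leW (l1leD IH (l1leZ (z m) (hv m))) => i.
by rewrite big_ord_recr.
Qed.

Definition mv X z : nat -> C := fun i => csum (fun j => X i j * z j).

Definition mm X Y : nat -> nat -> C := fun i j => mv X (Y^~ j) i.

(** The bound of [X] as an operator from l^1 to l^2. It is what a potential in L_2 provides: column
    [j] of its matrix consists of the coefficients of [q * e j]. *)
Definition colb X K : Prop := forall j, l2le (X^~ j) K.

Lemma colb_ge0 X K : colb X K -> 0 <= K.
Proof. by move=> /(_ 0%N)/l2le_ge0. Qed.

Lemma colb_pt X K i j : colb X K -> cabs (X i j) <= K.
Proof. by move=> /(_ j)/l2le_pt. Qed.

Lemma row_l1 X z i K L : (forall j, cabs (X i j) <= K) -> l1le z L ->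
  l1le (fun j => X i j * z j) (K * L).
Proof.
move=> hX hz; have K0 : 0 <= K := le_trans (cabs_ge0 _) (hX 0%N).
rewrite -(ger0_norm K0) -cabs_real; apply: l1leW (l1leZ K%:C hz) => j.
by rewrite !cabsM cabs_real (ger0_norm K0) ler_wpM2r ?cabs_ge0.
Qed.

Lemma mv_l1 X z K L : colb X K -> l1le z L -> l2le (mv X z) (K * L).
Proof.
move=> hX hz; have K0 := colb_ge0 hX.
apply: (@eq_l2le _ (fun i => csum (fun j => z j * X i j))).
  by move=> i; apply: eq_csum => j; rewrite mulrC.
apply: (@l2le_csum _ z (fun j i => X i j) (fun=> K)) => //.
rewrite -(ger0_norm K0) -cabs_real; apply: l1leW (l1leZ K%:C hz) => j.
by rewrite !cabsM !cabs_real normr_id mulrC.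
Qed.

(** [c j] bounds the norm of column [j], so the hypothesis on [c] is a Hilbert-Schmidt bound;
    Cauchy-Schwarz over the columns makes the operator bounded on l^2. *)
Lemma mv_l2 X z (c : nat -> R) K L : (forall j, l2le (X^~ j) (c j)) ->
  (forall n, \sum_(j < n) c j ^+ 2 <= K ^+ 2) -> 0 <= K -> l2le z L ->
  l2le (mv X z) (K * L).
Proof.
move=> hX hc K0 hz.
apply: (@eq_l2le _ (fun i => csum (fun j => z j * X i j))).
  by move=> i; apply: eq_csum => j; rewrite mulrC.
apply: (@l2le_csum _ z (fun j i => X i j) c) => //.
by rewrite mulrC; apply: l2_l1 => //; exact: l2le_real.
Qed.

Lemma row_l2 X z i (c : nat -> R) K L : (forall j, l2le (X^~ j) (c j)) ->
  (forall n, \sum_(j < n) c j ^+ 2 <= K ^+ 2) -> 0 <= K -> l2le z L ->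
  l1le (fun j => X i j * z j) (K * L).
Proof.
move=> hX hc K0 hz; apply: l2_l1 hz; split=> // n; apply: le_trans (hc n).
apply: ler_sum => j _; rewrite ler_pXn2r ?nnegrE ?cabs_ge0 ?(l2le_ge0 (hX j)) //.
exact: l2le_pt (hX j).
Qed.

Lemma mvD X z y i K L : l1le (fun j => X i j * z j) K -> l1le (fun j => X i j * y j) L ->
  mv X (fun j => z j + y j) i = mv X z i + mv X y i.
Proof.
by move=> h h'; rewrite -(csumD h h'); apply: eq_csum => j; rewrite mulrDr.
Qed.

Lemma mvB X z y i K L : l1le (fun j => X i j * z j) K -> l1le (fun j => X i j * y j) L ->
  mv X (fun j => z j - y j) i = mv X z i - mv X y i.
Proof.
by move=> h h'; rewrite -(csumB h h'); apply: eq_csum => j; rewrite mulrBr.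
Qed.

Lemma mvZ X z c i K : l1le (fun j => X i j * z j) K ->
  mv X (fun j => c * z j) i = c * mv X z i.
Proof. by move=> h; rewrite -(csumZ c h); apply: eq_csum => j; rewrite mulrCA. Qed.

Lemma mvBl X Y z i K L : l1le (fun j => X i j * z j) K -> l1le (fun j => Y i j * z j) L ->
  mv (fun i j => X i j - Y i j) z i = mv X z i - mv Y z i.
Proof.
by move=> h h'; rewrite -(csumB h h'); apply: eq_csum => j; rewrite mulrBl.
Qed.

Lemma mvDl X Y z i K L : l1le (fun j => X i j * z j) K -> l1le (fun j => Y i j * z j) L ->
  mv (fun i j => X i j + Y i j) z i = mv X z i + mv Y z i.
Proof.
by move=> h h'; rewrite -(csumD h h'); apply: eq_csum => j; rewrite mulrDl.
Qed.

Lemma l1le_mv Y z K L : (forall j, l1le (Y^~ j) L) -> l1le z K -> l1le (mv Y z) (K * L).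
Proof.
move=> hY hz; apply: l1leW (l1le_csum hz hY) => i.
by rewrite /mv; under eq_csum do rewrite mulrC.
Qed.

Lemma l1_pt (a : nat -> C) K i : l1le a K -> cabs (a i) <= K.
Proof.
move=> h; apply: le_trans (h i.+1); rewrite big_ord_recr /= lerDr.
by apply: sumr_ge0 => k _; exact: cabs_ge0.
Qed.

(* The identity holds for finite sections of [z] by linearity; both sides are
   continuous in [z] for the l^1 norm. *)
Lemma mv_mv A Y z i K L c : (forall l, cabs (A i l) <= K) ->
  (forall j, l1le (Y^~ j) L) -> l1le z c -> mv A (mv Y z) i = mv (mm A Y) z i.
Proof.
move=> hA hY hz.
have K0 : 0 <= K := le_trans (cabs_ge0 _) (hA 0%N).
have L0 := l1le_ge0 (hY 0%N).
have hYr k l : cabs (Y k l) <= L := l1_pt k (hY l).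
have hAYr l : cabs (mm A Y i l) <= K * L by apply: csum_le; exact: row_l1.
have bd (y : nat -> C) e : l1le y e ->
    cabs (mv A (mv Y y) i) <= K * (e * L) /\ cabs (mv (mm A Y) y i) <= K * (e * L).
  move=> hy; split.
    by apply: csum_le; apply: row_l1 => //; exact: l1le_mv.
  apply: csum_le; rewrite [e * L]mulrC mulrA; exact: row_l1.
have fin n (y : nat -> C) : (forall j, (n <= j)%N -> y j = 0) ->
    mv A (mv Y y) i = mv (mm A Y) y i.
  move=> hy; rewrite [RHS]/mv [RHS](@csum_fin _ n); last by move=> j /hy ->; rewrite mulr0.
  have -> : mv Y y = fun k => \sum_(j < n) Y k j * y j.
    by apply/funext => k; rewrite /mv (@csum_fin _ n) // => j /hy ->; rewrite mulr0.
  rewrite /mv; under eq_csum do rewrite mulr_sumr.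
  rewrite (@csum_sum _ _ _ (fun j : 'I_n => cabs (y j) * (K * L))).
    apply: eq_bigr => j _; rewrite mulrC -(csumZ _ (row_l1 hA (hY j))).
    by apply: eq_csum => k; rewrite mulrA mulrC.
  move=> j; apply: l1leW (l1leZ (y j) (row_l1 hA (hY j))) => k.
  by rewrite mulrA mulrC.
apply: eq_of_cabs_le => e e0.
have e1 : 0 < e / (2 * (K * L) + 1).
  by rewrite divr_gt0 // ltr_wpDl // !mulr_ge0.
have [n hn] := l1le_tail hz e1.
have hn' := l1le_cut n hz.
have zE : z = fun j => (if (j < n)%N then z j else 0) + (if (j < n)%N then 0 else z j).
  by apply/funext => j; case: ifP; rewrite ?addr0 ?add0r.
have -> : mv A (mv Y z) i - mv (mm A Y) z i =
    mv A (mv Y (fun j => if (j < n)%N then 0 else z j)) i -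
    mv (mm A Y) (fun j => if (j < n)%N then 0 else z j) i.
  have -> : mv Y z = fun k => mv Y (fun j => if (j < n)%N then z j else 0) k +
      mv Y (fun j => if (j < n)%N then 0 else z j) k.
    apply/funext => k; rewrite {1}zE.
    by apply: mvD; (apply: row_l1; [move=> l; exact: hYr | eassumption]).
  rewrite [in X in _ - X]zE.
  rewrite (mvD (row_l1 hAYr hn') (row_l1 hAYr hn)).
  rewrite (mvD (row_l1 hA (l1le_mv hY hn')) (row_l1 hA (l1le_mv hY hn))).
  rewrite (fin n (fun j => if (j < n)%N then z j else 0)); first by ring.
  by move=> j; rewrite leqNgt => /negPf ->.
have [b1 b2] := bd _ _ hn.
rewrite (le_trans (cabsB _ _)) // (le_trans (lerD b1 b2)) //.
have -> : forall d : R, K * (d * L) + K * (d * L) = d * (2 * (K * L)) by move=> d; ring.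
rewrite -mulrAC ler_pdivrMr; last by rewrite ltr_wpDl // !mulr_ge0.
by rewrite ler_pM2l // lerDl.
Qed.

End MatrixVector.

Section Perturbation.
Context {R : realType}.
Local Notation C := R[i].

(** The maximal domain of the diagonal operator; in coordinates it is the domain of [L_bc] as well,
    see [L_op_coef] and [L_op_of_coef]. *)
Definition dom (ev : nat -> R) (z : nat -> C) : Prop :=
  (exists K, l2le z K) /\ exists K, l2le (fun i => (ev i)%:C * z i) K.

Definition pert (ev : nat -> R) (B : nat -> nat -> C) (z : nat -> C) : nat -> C :=
  fun i => (ev i)%:C * z i - mv B z i.

End Perturbation.

(** * The equation for [X] and the transformation [U] *)

Section Similarity.
Context {R : realType}.
Local Notation C := R[i].
(** [bl] gives the block of an index, [G j] is a lower bound for the gaps between [ev j] and the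
    other blocks, and [eps] bounds the l^2 norm of the inverse gaps. *)
Variables (ev : nat -> R) (Q : nat -> nat -> C) (bl : nat -> nat) (G : nat -> R).
Variables (M eps kap : R).
Hypothesis colQ : colb Q M.
Hypothesis G_gt0 : forall j, 0 < G j.
Hypothesis gap : forall i j, bl i <> bl j -> G j <= `|ev i - ev j|.
Hypothesis eps_ge0 : 0 <= eps.
Hypothesis sumG : forall n, \sum_(i < n) (G i)^-1 ^+ 2 <= eps ^+ 2.
(** The factor 10 makes the Picard map of [simeq_exists] contract by 1/2: its terms vary by at most
    [5 * (M * eps)] times the distance of the arguments. *)
Hypothesis small : 10 * (M * eps) <= 1.
Hypothesis ev_ge0 : forall i, 0 <= ev i.
Hypothesis kap_ge0 : 0 <= kap.
Hypothesis sum_ev : forall n, \sum_(i < n) (1 + ev i)^-1 ^+ 2 <= kap ^+ 2.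
Variable Nb : nat.
Hypothesis bl_fin : forall b, exists n, forall i, bl i = b -> (n <= i < n + Nb)%N.

Implicit Types (X Y : nat -> nat -> C) (z x y : nat -> C) (K L : R).

Let M_ge0 : 0 <= M := colb_ge0 colQ.

Let smallK K : 0 <= K -> 10 * (M * eps * K) <= K.
Proof. by move=> K0; rewrite mulrA ler_piMl. Qed.

(** The solution [Y] of [Lam Y - Y Lam = X - dgp X] without entries inside the blocks, see
    [gam_comm]. *)
Definition gam X i j : C :=
  if bl i == bl j then 0 else X i j / (ev i - ev j)%:C.

Definition dgp X i j : C := if bl i == bl j then X i j else 0.

(** The gap is symmetric in the two blocks, so an entry may be charged to its column, as here, or to
    its row, as in [gam_entl]. The former gives square summable column norms, hence boundedness on
    l^2; the latter gives columns in l^1, to which [Q] applies. *)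
Lemma gam_ent X i j : cabs (gam X i j) <= cabs (X i j) / G j.
Proof.
rewrite /gam; case: eqP => [_|/gap g].
  by rewrite cabs0 divr_ge0 ?cabs_ge0 // ltW.
rewrite cabsM cabsV cabs_real ler_wpM2l ?cabs_ge0 // lef_pV2 ?posrE //.
exact: lt_le_trans (G_gt0 _) g.
Qed.

Lemma gam_entl X i j : cabs (gam X i j) <= cabs (X i j) / G i.
Proof.
rewrite /gam; case: eqP => [_|/nesym/gap g].
  by rewrite cabs0 divr_ge0 ?cabs_ge0 // ltW.
rewrite cabsM cabsV cabs_real ler_wpM2l ?cabs_ge0 // distrC lef_pV2 ?posrE //.
exact: lt_le_trans (G_gt0 _) g.
Qed.

Lemma gam_col X K j : colb X K -> l2le (gam X ^~ j) (K / G j).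
Proof.
move=> hX; rewrite mulrC -[(G j)^-1]ger0_norm ?invr_ge0 ?(ltW (G_gt0 _)) //.
rewrite -cabs_real; apply: l2leW (l2leZ (G j)^-1%:C (hX j)) => i.
rewrite cabsM cabs_real ger0_norm ?invr_ge0 ?(ltW (G_gt0 _)) // mulrC.
exact: gam_ent.
Qed.

Lemma gam_l1 X K j : colb X K -> l1le (gam X ^~ j) (K * eps).
Proof.
move=> hX; apply: l1leW (l2_l1 (hX j) (l2le_real (x := fun i => (G i)^-1) eps_ge0 sumG)) => i.
rewrite cabsM cabs_real ger0_norm ?invr_ge0 ?(ltW (G_gt0 _)) //.
exact: gam_entl.
Qed.

Lemma sumKG K n : \sum_(j < n) (K / G j) ^+ 2 <= (K * eps) ^+ 2.
Proof.
under eq_bigr do rewrite exprMn.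
by rewrite -mulr_sumr exprMn ler_wpM2l ?sqr_ge0.
Qed.

Lemma gam_mv X K z L : colb X K -> l2le z L -> l2le (mv (gam X) z) (K * eps * L).
Proof.
move=> hX hz; apply: (mv_l2 (fun j => gam_col j hX) (sumKG K)) => //.
by rewrite mulr_ge0 // (colb_ge0 hX).
Qed.

Lemma gam_row X K z L i : colb X K -> l2le z L ->
  l1le (fun j => gam X i j * z j) (K * eps * L).
Proof.
move=> hX hz; apply: (row_l2 i (fun j => gam_col j hX) (sumKG K)) => //.
by rewrite mulr_ge0 // (colb_ge0 hX).
Qed.

Lemma dgp_colb X K : colb X K -> colb (dgp X) K.
Proof.
move=> hX j; apply: l2leW (hX j) => i.
by rewrite /dgp; case: ifP => // _; rewrite cabs0 cabs_ge0.
Qed.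

Lemma gamB X Y i j : gam (fun i j => X i j - Y i j) i j = gam X i j - gam Y i j.
Proof. by rewrite /gam; case: ifP => _; rewrite ?subrr // mulrBl. Qed.

Lemma dgpB X Y i j : dgp (fun i j => X i j - Y i j) i j = dgp X i j - dgp Y i j.
Proof. by rewrite /dgp; case: ifP => _; rewrite ?subrr. Qed.

Definition simeq X : nat -> nat -> C := fun i j =>
  Q i j + mm Q (gam X) i j - mm (gam X) (dgp X) i j.

Lemma simeq_exists : exists X, colb X (2 * M) /\ forall i j, simeq X i j = X i j.
Proof.
pose un (f : nat * nat -> C) : nat -> nat -> C := fun i j => f (i, j).
have [||||||||f [fb fE]] := @picard R _ (fun f K => colb (un f) K) _ _ _ _ _
    (fun f p => simeq (un f) p.1 p.2) (2 * M).
by move=> K K0 j; exact: l2le0.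
by move=> f g K L hf hg j; exact: l2leD (hf j) (hg j).
by move=> f K [i j] hf; exact: (colb_pt i j hf).
by move=> f K L KL hf j; exact: l2le_mono KL (hf j).
move=> f g K hf fg j; apply: (@l2le_lim _ (fun m i => f m (i, j))) => [m|i].
    exact: hf m j.
  exact: fg.
by rewrite mulr_ge0.
move=> f hf j; rewrite /un /=.
  have h := l2leB (l2leD (colQ j) (mv_l1 colQ (gam_l1 j hf)))
     (gam_mv hf (dgp_colb hf j)).
  (* The terms bound [Q], [Q (Gam X)] and [(Gam X) (dgp X)]; by [small] the last two amount to at
     most 6/10 of [M]. *)
  have le : M + M * (2 * M * eps) + 2 * M * eps * (2 * M) <= 2 * M.
    by have := smallK M_ge0; move: M_ge0 => m0; lra.
  exact: (l2le_mono le h).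
move=> f g d hf hg hd j; rewrite /un /=.
  (* The product of [gam] and [dgp] is bilinear: its difference is [gam (f - g)] times [dgp f] plus
     [gam g] times [dgp (f - g)]. *)
  have h := l2leB (l2leB (mv_l1 colQ (gam_l1 j hd))
     (gam_mv hd (dgp_colb hf j))) (gam_mv hg (dgp_colb hd j)).
  have d0 := colb_ge0 hd.
  apply: (@eq_l2le _ _ _ _ _ (l2le_mono _ h)); last by have := smallK d0; lra.
  move=> i; rewrite /simeq /mm.
  have -> : gam (un (fun t => f t - g t)) = fun i j => gam (un f) i j - gam (un g) i j.
    by apply/funext => a; apply/funext => b; rewrite -gamB.
  have -> : dgp (un (fun t => f t - g t)) = fun i j => dgp (un f) i j - dgp (un g) i j.
    by apply/funext => a; apply/funext => b; rewrite -dgpB.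
  have hQ a : cabs (Q i a) <= M by exact: colb_pt.
  rewrite (mvB (row_l1 hQ (gam_l1 j hf)) (row_l1 hQ (gam_l1 j hg))).
  rewrite (mvBl (gam_row i hf (dgp_colb hf j)) (gam_row i hg (dgp_colb hf j))).
  rewrite (mvB (gam_row i hg (dgp_colb hf j)) (gam_row i hg (dgp_colb hg j))).
  rewrite /un; ring.
by exists (un f); split=> // i j; rewrite (fE (i, j)).
Qed.


Section FixedPoint.
Variable X : nat -> nat -> C.
Hypothesis colX : colb X (2 * M).
Hypothesis eqX : forall i j, simeq X i j = X i j.

Local Notation dom := (dom ev).
Local Notation opL := (pert ev Q).
Local Notation opA := (pert ev (dgp X)).

Definition opU z : nat -> C := fun i => z i + mv (gam X) z i.

(** Cauchy-Schwarz against [(1 + ev i)^-1]. This embedding is what makes [Q] applicable to vectors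
    of the domain. *)
Lemma l1le_dom K L z : l2le z K -> l2le (fun i => (ev i)%:C * z i) L ->
  l1le z (kap * (K + L)).
Proof.
move=> hz hez; have h := l2leD hz hez.
have h1 := l2le_real (x := fun i => (1 + ev i)^-1) kap_ge0 sum_ev.
apply: l1leW (l2_l1 h1 h) => i.
have -> : z i + (ev i)%:C * z i = (1 + ev i)%:C * z i by rewrite rmorphD rmorph1 mulrDl mul1r.
by rewrite mulrA -rmorphM /= mulVf ?mul1r // lt0r_neq0 // ltr_pwDl.
Qed.

Lemma dom_l1 z : dom z -> exists K, l1le z K.
Proof. by move=> [[K hK] [L hL]]; exists (kap * (K + L)); exact: l1le_dom. Qed.

Lemma domD z y : dom z -> dom y -> dom (fun i => z i + y i).
Proof.
move=> [[K hK] [L hL]] [[K' hK'] [L' hL']]; split.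
  by exists (K + K'); exact: l2leD.
exists (L + L'); apply: eq_l2le (l2leD hL hL') => i; by rewrite mulrDr.
Qed.

Lemma domZ c z : dom z -> dom (fun i => c * z i).
Proof.
move=> [[K hK] [L hL]]; split; first by exists (cabs c * K); exact: l2leZ.
exists (cabs c * L); apply: eq_l2le (l2leZ c hL) => i; by rewrite mulrCA.
Qed.

Lemma dom_supp n z : (forall i, (n <= i)%N -> z i = 0) -> dom z.
Proof.
move=> h; split; first by eexists; apply: l1_l2 (l1le_fin h).
by eexists; apply: l1_l2 (@l1le_fin _ n _ _) => i /h ->; rewrite mulr0.
Qed.

(** This makes [opU] an isomorphism of l^2, bounded by 2 together with its inverse. *)
Lemma gam_half z K : l2le z K -> l2le (mv (gam X) z) (K / 2).
Proof.
move=> hz; have K0 := l2le_ge0 hz; apply: l2le_mono (gam_mv colX hz).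
by have := smallK K0; lra.
Qed.

Lemma gam_rowX z K i : l2le z K -> l1le (fun j => gam X i j * z j) K.
Proof.
move=> hz; have K0 := l2le_ge0 hz; apply: l1le_mono (gam_row i colX hz).
by have := smallK K0; lra.
Qed.

Lemma opU_l2 z K : l2le z K -> l2le (opU z) (2 * K).
Proof.
move=> hz; have K0 := l2le_ge0 hz.
by apply: l2le_mono (l2leD hz (gam_half hz)); lra.
Qed.

Lemma opUD z y K L : l2le z K -> l2le y L -> opU (fun i => z i + y i) = fun i => opU z i + opU y i.
Proof.
move=> hz hy; apply/funext => i; rewrite /opU (mvD (gam_rowX i hz) (gam_rowX i hy)).
ring.
Qed.

Lemma opUZ c z K : l2le z K -> opU (fun i => c * z i) = fun i => c * opU z i.
Proof. by move=> hz; apply/funext => i; rewrite /opU (mvZ c (gam_rowX i hz)) mulrDr. Qed.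

(** Any bound [L'] of [z] improves to [K + L' / 2], because [z] is [opU z] minus a vector of at most
    half the size; iteration starting from [L] leaves [2 * K]. *)
Lemma opU_inj z K L : l2le z L -> l2le (opU z) K -> l2le z (2 * K).
Proof.
move=> hz hU; have K0 := l2le_ge0 hU; have L0 := l2le_ge0 hz.
have step L' : l2le z L' -> l2le z (K + L' / 2).
  move=> h; apply: eq_l2le (l2leB hU (gam_half h)) => i.
  by rewrite /opU addrK.
have it n : l2le z (2 * K + L / 2 ^+ n).
  elim: n => [|n IH]; first by apply: l2le_mono hz; rewrite expr0; lra.
  apply: l2le_mono (step _ IH); rewrite exprS invfM.
  rewrite le_eqVlt; apply/orP; left; apply/eqP; field.
  by rewrite expf_neq0.
apply: l2le_close; first lra.
move=> e e0; apply: l2le_mono (it (Num.truncn (L / e))); rewrite lerD2l.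
rewrite ler_pdivrMr ?exprn_gt0 // [leRHS]mulrC -ler_pdivrMr //.
by apply: le_trans (ltW (truncnS_gt _)) _; rewrite -natrX ler_nat ltn_expl.
Qed.

Lemma opU_surj x K : l2le x K -> exists z, l2le z (2 * K) /\ opU z = x.
Proof.
move=> hx; have K0 := l2le_ge0 hx.
have [||||||||f [fb fE]] := @picard R nat (fun f K => l2le f K) _ _ _ _ _
    (fun z i => x i - mv (gam X) z i) (2 * K).
by move=> L L0; exact: l2le0.
by move=> f g L L' hf hg; exact: l2leD.
by move=> f L i; exact: l2le_pt.
by move=> f L L' LL' hf; exact: l2le_mono hf.
by move=> f g L hf fg; exact: l2le_lim hf fg.
by rewrite mulr_ge0.
by move=> f hf; apply: l2le_mono (l2leB hx (gam_half hf)); lra.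
move=> f g d hf hg hd; apply: eq_l2le (l2leN (gam_half hd)) => i.
by rewrite (mvB (gam_rowX i hf) (gam_rowX i hg)); ring.
by exists f; split=> //; apply/funext => i; rewrite /opU -{1}fE subrK.
Qed.

Lemma dgp_row z K i : l1le z K -> l1le (fun j => dgp X i j * z j) (2 * M * K).
Proof. by move=> hz; apply: row_l1 => // j; exact: colb_pt (dgp_colb colX). Qed.

Lemma Q_row z K i : l1le z K -> l1le (fun j => Q i j * z j) (M * K).
Proof. by move=> hz; apply: row_l1 => // j; exact: colb_pt. Qed.

Lemma gap_neq i j : bl i <> bl j -> (ev i - ev j)%:C != 0 :> C.
Proof.
move=> /gap g; rewrite -cabs_eq0 cabs_real gt_eqF //.
exact: lt_le_trans (G_gt0 j) g.
Qed.

Lemma gam_comm i j : (ev i)%:C * gam X i j - gam X i j * (ev j)%:C = X i j - dgp X i j.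
Proof.
rewrite /gam /dgp; case: eqP => [_|h]; first by rewrite mulr0 mul0r !subrr.
rewrite subr0 mulrC -mulrBr -rmorphB /=.
by rewrite divfK // gap_neq.
Qed.

(** [gam_comm] applied to a vector. The entries of [X] and [dgp X] are merely bounded along rows
    here, so that [z] in l^1 is what makes their series converge. *)
Lemma mv_gam_comm z K L i : l2le z K -> l2le (fun j => (ev j)%:C * z j) L ->
  (ev i)%:C * mv (gam X) z i =
   mv (gam X) (fun j => (ev j)%:C * z j) i + mv X z i - mv (dgp X) z i.
Proof.
move=> hz hez; have h1 := l1le_dom hz hez.
rewrite -(csumZ _ (gam_rowX i hz)).
have hX : l1le (fun j => X i j * z j) (2 * M * (kap * (K + L))).
  by apply: row_l1 => // j; exact: colb_pt.
rewrite /mv -(csumD (gam_rowX i hez) hX).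
rewrite -(csumB (l1leD (gam_rowX i hez) hX) (dgp_row i h1)).
apply: eq_csum => j; have := gam_comm i j => e.
rewrite mulrA; have -> : (ev i)%:C * gam X i j = gam X i j * (ev j)%:C + (X i j - dgp X i j).
  by rewrite -e; ring.
ring.
Qed.

(** Rows and columns of [dgp X] have at most [Nb] nonzero entries, each of modulus at most [2 * M];
    by Schur's test this is a bound of its norm on l^2. *)
Definition bB : R := Nb%:R * (2 * M).

Lemma bB_ge0 : 0 <= bB.
Proof. by rewrite mulr_ge0 // mulr_ge0. Qed.

Lemma l1le_interval (a : nat -> C) n L : 0 <= L ->
  (forall i, a i != 0 -> (n <= i < n + Nb)%N) -> (forall i, cabs (a i) <= L) ->
  l1le a (Nb%:R * L).
Proof.
move=> L0 ha aL; apply: (l1le_mono _ (@l1le_fin _ (n + Nb)%N _ _)); last first.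
  move=> i ni; apply/eqP; apply: contraT => /ha /andP[_]; by rewrite ltnNge ni.
rewrite -(big_mkord xpredT (fun i => cabs (a i))).
rewrite (big_cat_nat (leq0n n) (leq_addr _ _)) /=.
rewrite big_nat big1 ?add0r; last first.
  move=> i /andP[_ ni]; apply/eqP; rewrite cabs_eq0; apply: contraT => /ha /andP[].
  by rewrite leqNgt ni.
apply: (@le_trans _ _ (\sum_(n <= i < n + Nb) L)); first exact: ler_sum.
by rewrite sumr_const_nat addKn mulr_natl.
Qed.

Lemma dgp_neq0 i j : dgp X i j != 0 -> bl i = bl j.
Proof. by rewrite /dgp; case: (bl i =P bl j) => // _; rewrite eqxx. Qed.

Lemma dgp_l1 j : l1le (dgp X ^~ j) bB.
Proof.
have [n hn] := bl_fin (bl j); apply: (@l1le_interval _ n); first by rewrite mulr_ge0.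
  by move=> i /dgp_neq0/hn.
by move=> i; exact: colb_pt (dgp_colb colX).
Qed.

Lemma dgp_rowl1 i : l1le (dgp X i) bB.
Proof.
have [n hn] := bl_fin (bl i); apply: (@l1le_interval _ n); first by rewrite mulr_ge0.
  by move=> j /dgp_neq0/esym/hn.
by move=> j; exact: colb_pt (dgp_colb colX).
Qed.

Lemma dgp_rowfin i : exists J, forall j, (J <= j)%N -> dgp X i j = 0.
Proof.
have [n hn] := bl_fin (bl i); exists (n + Nb)%N => j nj.
apply/eqP; apply: contraT => /dgp_neq0/esym/hn /andP[_]; by rewrite ltnNge nj.
Qed.

Lemma mv_gam_dgp z K i : l1le z K ->
  mv (gam X) (mv (dgp X) z) i = mv (mm (gam X) (dgp X)) z i.
Proof.
move=> hz; apply: (mv_mv _ dgp_l1 hz) => l.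
exact: (l1_pt i (gam_l1 l colX)).
Qed.

(* Schur test: rows and columns of the block diagonal part are bounded by [bB]
   in l^1. *)
Lemma mv_dgp z K : l2le z K -> l2le (mv (dgp X) z) (bB * K).
Proof.
move=> hz; have K0 := l2le_ge0 hz; have b0 := bB_ge0.
split=> [|n]; first by rewrite mulr_ge0.
have [J hJ] : exists J, forall i j, (i < n)%N -> (J <= j)%N -> dgp X i j = 0.
  elim: n => [|n [J hJ]]; first by exists 0%N.
  have [J' hJ'] := dgp_rowfin n; exists (maxn J J') => i j.
  rewrite ltnS leq_eqVlt geq_max => /orP[/eqP ->|ni] /andP[Jj J'j]; first exact: hJ'.
  exact: hJ.
apply: (@le_trans _ _ (\sum_(i < n) bB * \sum_(j < J) cabs (dgp X i j) * cabs (z j) ^+ 2)).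
  apply: ler_sum => i _; rewrite /mv (@csum_fin _ J); last first.
    by move=> j Jj; rewrite hJ ?mul0r.
  (* The modulus of each matrix entry is distributed as two square roots, one of them attached to
     the coordinate of [z]. *)
  have := real_CS J (fun j => Num.sqrt (cabs (dgp X i j)))
    (fun j => Num.sqrt (cabs (dgp X i j)) * cabs (z j)).
  under eq_bigr do rewrite mulrA -expr2 sqr_sqrtr ?cabs_ge0 //.
  under [X in _ <= X * _ -> _]eq_bigr do rewrite sqr_sqrtr ?cabs_ge0 //.
  under [X in _ <= _ * X -> _]eq_bigr do rewrite exprMn sqr_sqrtr ?cabs_ge0 //.
  move=> h; apply: le_trans (le_trans _ h) _.
    rewrite ler_pXn2r ?nnegrE ?cabs_ge0 ?sumr_ge0 //; last first.
      by move=> j _; rewrite mulr_ge0 ?cabs_ge0.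
    apply: le_trans (cabs_sum _ _ _) _; apply: ler_sum => j _; by rewrite cabsM.
  apply: ler_wpM2r (dgp_rowl1 i J); apply: sumr_ge0 => j _.
  by rewrite mulr_ge0 ?cabs_ge0 ?sqr_ge0.
rewrite -mulr_sumr exchange_big /=.
apply: (@le_trans _ _ (bB * \sum_(j < J) bB * cabs (z j) ^+ 2)).
  rewrite ler_wpM2l //; apply: ler_sum => j _; rewrite -mulr_suml.
  by apply: ler_wpM2r (dgp_l1 j n); exact: sqr_ge0.
rewrite -[X in bB * X]mulr_sumr mulrA -expr2 [leRHS](exprMn _ bB) ler_wpM2l ?sqr_ge0 //.
exact: l2le_sumP.
Qed.


Lemma mv_dgp_l2 z K : l1le z K -> l2le (mv (dgp X) z) (2 * M * K).
Proof. by move=> hz; exact: mv_l1 (dgp_colb colX) hz. Qed.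


(** Moving [Lam] past [Gam X] produces [X z - B z], and the equation for [X] turns [X z] into
    [Q (U z) - Gam X (B z)]. The terms [Q (U z)] cancel and [U (Lam z - B z)] remains. The image is
    in the domain because [X] and [B] map l^1 to l^2. *)
Lemma intertwine z : dom z -> dom (opU z) /\ opL (opU z) = opU (opA z).
Proof.
move=> [[K hK] [L hL]]; have h1 := l1le_dom hK hL.
have hQ := mv_l1 colQ h1; have hB := mv_dgp_l2 h1; have hX := mv_l1 colX h1.
have evU : (fun i => (ev i)%:C * opU z i) = fun i => (ev i)%:C * z i +
    (mv (gam X) (fun j => (ev j)%:C * z j) i + mv X z i - mv (dgp X) z i).
  by apply/funext => i; rewrite mulrDr (mv_gam_comm i hK hL).
split.
  split; first by exists (2 * K); exact: opU_l2.
  eexists; rewrite evU; exact: l2leD hL (l2leB (l2leD (gam_half hL) hX) hB).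
apply/funext => i; rewrite /pert.
have -> : (ev i)%:C * opU z i = (ev i)%:C * z i +
    (mv (gam X) (fun j => (ev j)%:C * z j) i + mv X z i - mv (dgp X) z i).
  by rewrite -[LHS]/((fun i => (ev i)%:C * opU z i) i) evU.
have gl j := gam_l1 j colX.
have -> : mv Q (opU z) i = mv Q z i + mv Q (mv (gam X) z) i.
  by rewrite (mvD (Q_row i h1) (Q_row i (l1le_mv gl h1))).
have XE : mv X z i = mv Q z i + mv Q (mv (gam X) z) i - mv (gam X) (mv (dgp X) z) i.
  have Qb l : cabs (Q i l) <= M by exact: colb_pt.
  have Qg j : cabs (mm Q (gam X) i j) <= M * (2 * M * eps).
    by apply: csum_le; exact: row_l1.
  have gd j : cabs (mm (gam X) (dgp X) i j) <= 2 * M * eps * (2 * M).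
    by apply: csum_le; exact: gam_row colX (dgp_colb colX j).
  rewrite (mv_mv (i := i) Qb gl h1) (mv_gam_dgp i h1).
  have -> : mv X z i = mv (simeq X) z i by apply: eq_csum => j; rewrite eqX.
  rewrite -(mvDl (row_l1 Qb h1) (row_l1 Qg h1)).
  rewrite -(mvBl (K := M * (kap * (K + L)) + M * (2 * M * eps) * (kap * (K + L))) _
    (row_l1 gd h1)) //.
  apply: (l1leW _ (l1leD (row_l1 Qb h1) (row_l1 Qg h1))) => j.
  by rewrite mulrDl.
rewrite /opU /pert XE (mvB (gam_rowX i hL) (gam_rowX i hB)); ring.
Qed.

Hypothesis inj0 : exists2 t : R, 0 < t & (forall z, dom z ->
  (forall i, opL z i = - t%:C * z i) -> forall i, z i = 0) /\
  (forall x K, l2le x K -> exists z, dom z /\ forall i, - t%:C * z i - opA z i = x i).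

(** The vector [(- t - (Lam - Q)) v] is pulled back by [U], and the equation for [Lam - B] is solved
    there at [- t]. By [intertwine], [U] of the solution satisfies the same equation as [v], so it
    is [v] by injectivity. *)
Lemma opU_dom_surj v : dom v -> exists z, dom z /\ v = opU z.
Proof.
move=> dv; case: inj0 => t t0 [inj surj].
have [[K hK] [L hL]] := dv; have h1 := l1le_dom hK hL.
have hx := l2leB (l2leZ (- t%:C) hK) (l2leB hL (mv_l1 colQ h1)).
have [x' [hx' xE]] := opU_surj hx.
have [z [dz zE]] := surj _ _ hx'.
have [dUz UE] := intertwine dz.
exists z; split=> //.
have [[K' hK'] [L' hL']] := dz; have hz1 := l1le_dom hK' hL'.
have hA := l2leB hL' (mv_dgp_l2 hz1).
have dif i : opL v i - opL (opU z) i = - t%:C * (v i - opU z i).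
  rewrite UE mulrBr.
  have -> : opU (opA z) i = - t%:C * opU z i - opU x' i.
    have -> : x' = fun j => - t%:C * z j - opA z j by apply/funext => j; rewrite zE.
    rewrite (opUD (l2leZ (- t%:C) hK') (l2leN hA)) (opUZ _ hK').
    have -> : (fun i0 : nat => - opA z i0) = fun i0 => (-1) * opA z i0.
      by apply/funext => j; rewrite mulN1r.
    rewrite (opUZ _ hA); ring.
  rewrite xE /pert; ring.
have dN : dom (fun i => v i - opU z i).
  have := domD dv (domZ (-1) dUz).
  by congr dom; apply/funext => i; rewrite mulN1r.
have [[K1 hK1] [L1 hL1]] := dUz; have hU1 := l1le_dom hK1 hL1.
apply/funext => i; apply/eqP; rewrite -subr_eq0; apply/eqP.
apply: (inj (fun i => v i - opU z i) dN) => j.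
rewrite -dif /pert (mvB (Q_row j h1) (Q_row j hU1)); ring.
Qed.

End FixedPoint.
End Similarity.

(** * Complex integrals *)

Section ComplexIntegral.
Context {R : realType}.
Local Notation C := R[i].
Local Notation mu := (@lebesgue_measure R).
Variable D : set R.
Hypothesis mD : @measurable _ (measurableTypeR R) D.
Implicit Types (f g : R -> C).

Definition cintegrable f : Prop :=
  mu.-integrable D (fun t => (complex.Re (f t))%:E) /\
  mu.-integrable D (fun t => (complex.Im (f t))%:E).

Definition cmeasurable f : Prop :=
  measurable_fun D (fun t => complex.Re (f t)) /\
  measurable_fun D (fun t => complex.Im (f t)).

Lemma eq_cintegrable f g : (forall t, D t -> f t = g t) -> cintegrable f -> cintegrable g.
Proof.
move=> e [h1 h2]; split.
  by apply: (eq_integrable mD _ _ _ h1) => // t /set_mem Dt; rewrite e.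
by apply: (eq_integrable mD _ _ _ h2) => // t /set_mem Dt; rewrite e.
Qed.

Lemma eq_cintegral f g : (forall t, D t -> f t = g t) -> cintegral D f = cintegral D g.
Proof.
move=> e; rewrite /cintegral; congr (_ +i* _); apply: eq_Rintegral => t /set_mem Dt.
  by rewrite e.
by rewrite e.
Qed.

Lemma cintegrableD f g : cintegrable f -> cintegrable g -> cintegrable (fun t => f t + g t).
Proof.
move=> [f1 f2] [g1 g2]; split.
  apply: (eq_integrable mD _ _ _ (integrableD mD f1 g1)) => // t _ /=.
  by rewrite -EFinD; case: (f t); case: (g t).
apply: (eq_integrable mD _ _ _ (integrableD mD f2 g2)) => // t _ /=.
by rewrite -EFinD; case: (f t); case: (g t).
Qed.

Lemma cintegralD f g : cintegrable f -> cintegrable g ->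
  cintegral D (fun t => f t + g t) = cintegral D f + cintegral D g.
Proof.
move=> [f1 f2] [g1 g2]; rewrite /cintegral.
rewrite -[RHS]/((_ + _) +i* (_ + _)) -!RintegralD //; congr (_ +i* _).
  by apply: eq_Rintegral => t _; case: (f t); case: (g t).
by apply: eq_Rintegral => t _; case: (f t); case: (g t).
Qed.

Let re_scale (c z : C) : complex.Re (c * z) =
  complex.Re c * complex.Re z - complex.Im c * complex.Im z.
Proof. by case: c; case: z. Qed.

Let im_scale (c z : C) : complex.Im (c * z) =
  complex.Re c * complex.Im z + complex.Im c * complex.Re z.
Proof. by case: c; case: z. Qed.

Lemma cintegrableZ c f : cintegrable f -> cintegrable (fun t => c * f t).
Proof.
move=> [f1 f2]; split.
  apply: (eq_integrable mD _ _ _ (integrableB mD (integrableZl mD (complex.Re c) f1)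
    (integrableZl mD (complex.Im c) f2))) => // t _ /=.
  by rewrite -!EFinM -EFinB re_scale.
apply: (eq_integrable mD _ _ _ (integrableD mD (integrableZl mD (complex.Re c) f2)
    (integrableZl mD (complex.Im c) f1))) => // t _ /=.
by rewrite -!EFinM -EFinD im_scale.
Qed.

Lemma cintegralZ c f : cintegrable f ->
  cintegral D (fun t => c * f t) = c * cintegral D f.
Proof.
move=> [f1 f2]; rewrite /cintegral.
have Z (a : R) (h : R -> R) : mu.-integrable D (EFin \o h) ->
    mu.-integrable D (EFin \o (fun t => a * h t)).
  by move=> hh; apply: (eq_integrable mD _ _ _ (integrableZl mD a hh)) => // t _ /=; rewrite EFinM.
have -> : c * (\int[mu]_(t in D) complex.Re (f t) +i* \int[mu]_(t in D) complex.Im (f t)) =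
  (complex.Re c * \int[mu]_(t in D) complex.Re (f t) - complex.Im c * \int[mu]_(t in D) complex.Im (f t)) +i*
  (complex.Re c * \int[mu]_(t in D) complex.Im (f t) + complex.Im c * \int[mu]_(t in D) complex.Re (f t)).
  by case: c.
rewrite -!RintegralZl // -RintegralB //; [|exact: Z|exact: Z].
rewrite -RintegralD //; [|exact: Z|exact: Z]; congr (_ +i* _).
  by apply: eq_Rintegral => t _; rewrite re_scale.
by apply: eq_Rintegral => t _; rewrite im_scale.
Qed.

Lemma cintegralB f g : cintegrable f -> cintegrable g ->
  cintegral D (fun t => f t - g t) = cintegral D f - cintegral D g.
Proof.
move=> hf hg; rewrite -[- cintegral D g]mulN1r -cintegralZ // -cintegralD //.
  by apply: eq_cintegral => t _; rewrite mulN1r.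
exact: cintegrableZ.
Qed.

Lemma cintegral0 : cintegral D (fun=> 0 : C) = 0.
Proof. by rewrite /cintegral /= /Rintegral !integral0. Qed.

Lemma cintegrable0 : cintegrable (fun=> 0 : C).
Proof. by split; exact: integrable0. Qed.

Lemma cintegrable_sum (I : Type) (r : seq I) (F : I -> R -> C) :
  (forall i, cintegrable (F i)) -> cintegrable (fun t => \sum_(i <- r) F i t).
Proof.
move=> h; elim: r => [|i r IH].
  by apply: eq_cintegrable cintegrable0 => t _; rewrite big_nil.
by apply: eq_cintegrable (cintegrableD (h i) IH) => t _; rewrite big_cons.
Qed.

Lemma cintegral_sum (I : Type) (r : seq I) (F : I -> R -> C) :
  (forall i, cintegrable (F i)) ->
  cintegral D (fun t => \sum_(i <- r) F i t) = \sum_(i <- r) cintegral D (F i).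
Proof.
move=> h; elim: r => [|i r IH].
  by rewrite big_nil -[RHS]cintegral0; apply: eq_cintegral => t _; rewrite big_nil.
rewrite big_cons -IH -cintegralD //; last exact: cintegrable_sum.
by apply: eq_cintegral => t _; rewrite big_cons.
Qed.

Lemma cintegral_conj f : cintegrable f ->
  cintegral D (fun t => (f t)^*) = (cintegral D f)^*.
Proof.
move=> [f1 f2]; rewrite /cintegral /=; congr (_ +i* _).
  by apply: eq_Rintegral => t _; case: (f t).
rewrite -[RHS]mulN1r -RintegralZl //; apply: eq_Rintegral => t _.
by case: (f t) => a b /=; rewrite mulN1r.
Qed.

Lemma cintegrable_meas f : cintegrable f -> cmeasurable f.
Proof.
by move=> [/integrableP[f1 _] /integrableP[f2 _]]; split; apply/measurable_EFinP.
Qed.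

Lemma cabs_measurable f : cmeasurable f -> measurable_fun D (fun t => cabs (f t)).
Proof.
move=> [f1 f2].
rewrite (_ : (fun t => cabs (f t)) = (@Num.sqrt R) \o
   (fun t => complex.Re (f t) ^+ 2 + complex.Im (f t) ^+ 2)); last first.
  by apply/funext => t /=; rewrite cabsE.
apply: measurableT_comp; last first.
  by apply: measurable_funD; exact: measurable_funX.
apply: continuous_measurable_fun; exact: sqrt_continuous.
Qed.

Lemma cabs_integrable f : cintegrable f -> mu.-integrable D (fun t => (cabs (f t))%:E).
Proof.
move=> hf; have [f1 f2] := hf.
apply: (le_integrable mD _ _ (integrableD mD (integrable_abse f1) (integrable_abse f2))).
  by apply/measurable_EFinP; exact: cabs_measurable (cintegrable_meas hf).
move=> t Dt; rewrite -[leRHS]/((`| `|complex.Re (f t)| + `|complex.Im (f t)| |)%:E).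
rewrite -[leLHS]/((`|cabs (f t)|)%:E) lee_fin.
by rewrite [leRHS]ger0_norm ?addr_ge0 // ger0_norm ?cabs_ge0 // cabs_le_ReIm.
Qed.

Lemma le_cintegrable f (g : R -> R) : cmeasurable f ->
  mu.-integrable D (fun t => (g t)%:E) ->
  (forall t, D t -> cabs (f t) <= g t) -> cintegrable f.
Proof.
move=> [f1 f2] ig fg; split.
  apply: (le_integrable mD _ _ ig); first exact/measurable_EFinP.
  move=> t Dt /=; rewrite lee_fin (le_trans (Re_le_cabs _)) //.
  by rewrite (le_trans (fg _ Dt)) // ler_norm.
apply: (le_integrable mD _ _ ig); first exact/measurable_EFinP.
move=> t Dt /=; rewrite lee_fin (le_trans (Im_le_cabs _)) //.
by rewrite (le_trans (fg _ Dt)) // ler_norm.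
Qed.

(** After multiplication by the conjugate of the integral [J] the value is [cabs J ^+ 2], so only a
    real part remains to be estimated. *)
Lemma cabs_cintegral_le f : cintegrable f ->
  cabs (cintegral D f) <= \int[mu]_(t in D) cabs (f t).
Proof.
move=> hf; set J := cintegral D f.
have [J0|Jn0] := eqVneq J 0.
  by rewrite J0 cabs0; apply: Rintegral_ge0 => t _; exact: cabs_ge0.
have Jp : 0 < cabs J by rewrite cabs_gt0.
rewrite -(ler_pM2l Jp) -expr2.
have -> : cabs J ^+ 2 = complex.Re (cintegral D (fun t => J^* * f t)).
  by rewrite cintegralZ // -/J mulrC mulcJ_sqr.
rewrite -RintegralZl //; last exact: cabs_integrable.
have [h1 _] := cintegrableZ (J^*) hf.
move: (cabs J) (cabs_conj J) => c cJ.
rewrite /cintegral [leLHS]/=.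
apply: le_Rintegral => //.
  apply: (eq_integrable mD _ _ _ (integrableZl mD c (cabs_integrable hf))) => // t _ /=.
move=> t _; rewrite (le_trans (ler_norm _)) // (le_trans (Re_le_cabs _)) //.
by rewrite cabsM cJ.
Qed.

End ComplexIntegral.

(** * Continuous complex functions and exponentials *)

Section ContinuousComplex.
Context {R : realType}.
Local Notation C := R[i].
Local Notation mu := (@lebesgue_measure R).
Implicit Types (f g : R -> C).

Definition ccont f : Prop := forall t (e : R), 0 < e ->
  exists2 d : R, 0 < d & forall s, `|s - t| < d -> cabs (f s - f t) <= e.

Lemma ccont_real f (p : C -> R) : (forall z y, `|p z - p y| <= cabs (z - y)) ->
  ccont f -> continuous (fun t => p (f t)).
Proof.
move=> hp hf t; apply/cvgrPdist_le => e e0; have [d d0 hd] := hf t e e0.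
apply/nbhs_ballP; exists d => //= s; rewrite /ball /= => hs.
by rewrite (le_trans (hp _ _)) // cabsBC hd // distrC.
Qed.

Lemma ccont_Re f : ccont f -> continuous (fun t => complex.Re (f t)).
Proof.
apply: ccont_real => z y; apply: le_trans (Re_le_cabs _).
by case: z y => ? ? [].
Qed.

Lemma ccont_Im f : ccont f -> continuous (fun t => complex.Im (f t)).
Proof.
apply: ccont_real => z y; apply: le_trans (Im_le_cabs _).
by case: z y => ? ? [].
Qed.

Lemma ccont_ReIm f : continuous (fun t => complex.Re (f t)) ->
  continuous (fun t => complex.Im (f t)) -> ccont f.
Proof.
move=> h1 h2 t e e0; have e2 : 0 < e / 2 by lra.
have /cvgrPdist_le/(_ _ e2)/nbhs_ballP [d1 d10 hd1] := h1 t.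
have /cvgrPdist_le/(_ _ e2)/nbhs_ballP [d2 d20 hd2] := h2 t.
exists (Num.min d1 d2); first by rewrite lt_min; apply/andP.
move=> s; rewrite lt_min => /andP[s1 s2].
have a : `|complex.Re (f t) - complex.Re (f s)| <= e / 2 by apply: hd1; rewrite /ball /= distrC.
have b : `|complex.Im (f t) - complex.Im (f s)| <= e / 2 by apply: hd2; rewrite /ball /= distrC.
rewrite cabsBC (le_trans (cabs_le_ReIm _)) //.
move: a b; case: (f t) => x y; case: (f s) => u v /= a b; lra.
Qed.

Lemma ccont_cst c : ccont (fun=> c).
Proof. by move=> t e e0; exists 1 => // s _; rewrite subrr cabs0 ltW. Qed.

Lemma ccontD f g : ccont f -> ccont g -> ccont (fun t => f t + g t).
Proof.
move=> hf hg t e e0; have e2 : 0 < e / 2 by lra.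
have [d1 d10 h1] := hf t _ e2; have [d2 d20 h2] := hg t _ e2.
exists (Num.min d1 d2); first by rewrite lt_min; apply/andP.
move=> s; rewrite lt_min => /andP[/h1 s1 /h2 s2].
have -> : f s + g s - (f t + g t) = (f s - f t) + (g s - g t) by ring.
rewrite (le_trans (cabsD _ _)) //; lra.
Qed.

Lemma ccontM f g : ccont f -> ccont g -> ccont (fun t => f t * g t).
Proof.
move=> hf hg t e e0.
set K := cabs (f t) + cabs (g t) + 1.
have K0 : 0 < K by rewrite ltr_wpDl // addr_ge0 ?cabs_ge0.
have e2 : 0 < Num.min 1 (e / (2 * K)) by rewrite lt_min ltr01 divr_gt0 // mulr_gt0.
have [d1 d10 h1] := hf t _ e2; have [d2 d20 h2] := hg t _ e2.
exists (Num.min d1 d2); first by rewrite lt_min; apply/andP.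
move=> s; rewrite lt_min => /andP[/h1 s1 /h2 s2].
have -> : f s * g s - f t * g t = (f s - f t) * g s + f t * (g s - g t) by ring.
rewrite (le_trans (cabsD _ _)) // !cabsM (splitr e).
have gs : cabs (g s) <= K.
  have : cabs (g s) <= cabs (g t) + 1.
    rewrite -[g s](subrK (g t)) (le_trans (cabsD _ _)) // addrC lerD2l.
    by apply: le_trans s2 _; rewrite ge_min lexx.
  have := cabs_ge0 (f t); rewrite /K; lra.
have ft : cabs (f t) <= K by rewrite /K; have := cabs_ge0 (g t); lra.
have eK : e / 2 = e / (2 * K) * K by field; rewrite gt_eqF.
apply: lerD; rewrite eK.
  apply: ler_pM; rewrite ?cabs_ge0 //; apply: le_trans s1 _.
  by rewrite ge_min lexx orbT.
rewrite mulrC; apply: ler_pM; rewrite ?cabs_ge0 //; apply: le_trans s2 _.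
by rewrite ge_min lexx orbT.
Qed.

Lemma ccontX f n : ccont f -> ccont (fun t => f t ^+ n).
Proof.
move=> hf; elim: n => [|n IH]; first exact: ccont_cst.
have := ccontM hf IH; congr ccont; apply/funext => t; by rewrite exprS.
Qed.

Lemma ccont_expi (a : R) : ccont (fun s => expi (a * s)).
Proof.
apply: ccont_ReIm => /= t.
  apply: continuous_comp; first exact: mulrl_continuous.
  exact: continuous_cos.
apply: continuous_comp; first exact: mulrl_continuous.
exact: continuous_sin.
Qed.

Lemma ccont_integrable f (a b : R) : ccont f -> cintegrable `[a, b] f.
Proof.
move=> hf; split.
  apply: continuous_compact_integrable; first exact: segment_compact.
  exact/continuous_subspaceT/ccont_Re.
apply: continuous_compact_integrable; first exact: segment_compact.
exact/continuous_subspaceT/ccont_Im.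
Qed.

Lemma cintegral_bound f (a b K : R) : a <= b -> ccont f ->
  (forall t, cabs (f t) <= K) -> cabs (cintegral `[a, b] f) <= K * (b - a).
Proof.
move=> ab hf hK; apply: le_trans (cabs_cintegral_le _ _) _ => //.
  exact: ccont_integrable.
have -> : K * (b - a) = \int[mu]_(t in `[a, b]) K.
  rewrite Rintegral_cst //; congr (_ * _).
  have e := @lebesgue_measure_itv R `[a, b]; symmetry.
  etransitivity; first exact: (f_equal (@fine R) e).
  rewrite /= lte_fin; case: ltP => // ba; have -> : a = b by lra.
  by rewrite subrr.
apply: le_Rintegral => //.
  exact/cabs_integrable/ccont_integrable.
by apply: continuous_compact_integrable;
   [exact: segment_compact | apply: continuous_subspaceT => t; exact: cvg_cst].
Qed.

Lemma expiD (s t : R) : expi (s + t) = expi s * expi t.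
Proof. by rewrite /expi cosD sinD; simpc; congr (_ +i* _); ring. Qed.

Lemma expi0 : expi 0 = 1 :> C.
Proof. by rewrite /expi cos0 sin0. Qed.

Lemma cabs_expi s : cabs (expi s : C) = 1.
Proof. by rewrite cabsE /= cos2Dsin2 sqrtr1. Qed.

Lemma expi_neq0 s : expi s != 0 :> C.
Proof. by rewrite -cabs_eq0 cabs_expi oner_eq0. Qed.

Lemma expiN (s : R) : expi (- s) = (expi s)^* :> C.
Proof. by rewrite /expi cosN sinN. Qed.

Lemma expiX (s : R) n : expi s ^+ n = expi (n%:R * s) :> C.
Proof.
elim: n => [|n IH]; first by rewrite mul0r expi0.
by rewrite exprS IH -expiD -natr1 mulrDl mul1r addrC.
Qed.

Lemma expi_inv (s : R) : (expi s)^-1 = expi (- s) :> C.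
Proof.
by apply: (mulfI (expi_neq0 s)); rewrite divff ?expi_neq0 // -expiD subrr expi0.
Qed.

Lemma expi_2pi : expi (2 * pi) = 1 :> C.
Proof. by rewrite /expi mulr_natl cos2pi sin2pi. Qed.

(** [0 -i* a^-1] is the inverse of [i a], as for the usual antiderivative. Orthogonality on circles
    and orthonormality of the basis both rest on this formula. *)
Lemma cintegral_expi (a b : R) : 0 < b -> a != 0 ->
  cintegral `[0, b] (fun s => expi (a * s)) =
  (expi (a * b) - 1) * (0 -i* a^-1).
Proof.
move=> b0 a0.
have dcos (F f : R -> R) : (forall x : R, is_derive x (1 : R) F (f x)) -> continuous f ->
    \int[mu]_(t in `[0, b]) f t = F b - F 0.
  move=> hF hf; rewrite /Rintegral (@continuous_FTC2 _ f F) //.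
  - exact: continuous_subspaceT.
  - split.
    + by move=> x _; case: (hF x).
    + by apply: cvg_at_right_filter; apply: differentiable_continuous; apply/derivable1_diffP; case: (hF 0).
    + by apply: cvg_at_left_filter; apply: differentiable_continuous; apply/derivable1_diffP; case: (hF b).
  - by move=> x _; rewrite derive1E; have [_ ->] := hF x.
rewrite /cintegral /=.
rewrite (_ : \int[mu]_(t in `[0, b]) cos (a * t) =
  a^-1 * sin (a * b) - a^-1 * sin (a * 0)); last first.
  apply: (dcos (fun x => a^-1 * sin (a * x)) (fun x => cos (a * x))).
    by move=> x; apply: is_derive_eq; rewrite /GRing.scale /=; field.
  by move=> t; apply: continuous_comp; [exact: mulrl_continuous|exact: continuous_cos].
rewrite (_ : \int[mu]_(t in `[0, b]) sin (a * t) =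
  - (a^-1 * cos (a * b)) - - (a^-1 * cos (a * 0))); last first.
  apply: (dcos (fun x => - (a^-1 * cos (a * x))) (fun x => sin (a * x))).
    by move=> x; apply: is_derive_eq; rewrite /GRing.scale /=; field.
  by move=> t; apply: continuous_comp; [exact: mulrl_continuous|exact: continuous_sin].
rewrite /expi mulr0 sin0 cos0 /=; simpc; congr (_ +i* _); ring.
Qed.

End ContinuousComplex.

(** * The block diagonal operator *)

Section BlockResolvent.
Context {R : realType}.
Local Notation C := R[i].
Variables (ev : nat -> R) (B : nat -> nat -> C) (bl : nat -> nat) (b : R).
Hypothesis ev_ge0 : forall i, 0 <= ev i.
Hypothesis ev_large : forall K : R, exists n, forall i, (n <= i)%N -> K <= ev i.
Hypothesis b_ge0 : 0 <= b.
Hypothesis B_bl : forall i j, bl i <> bl j -> B i j = 0.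
Hypothesis B_row : forall i, exists J, forall j, (J <= j)%N -> B i j = 0.
Hypothesis B_bnd : forall z K, l2le z K -> l2le (mv B z) (b * K).

Local Notation dom := (dom ev).
Local Notation A := (pert ev B).
Implicit Types (z x y : nat -> C) (K L : R) (l : C) (I : pred nat).

(** A union of blocks; restriction to such a set commutes with [A], see [pert_restr]. *)
Definition blockset I : Prop := forall i j, bl i = bl j -> I i = I j.

Definition restr I z : nat -> C := fun i => if I i then z i else 0.

Definition supp I z : Prop := forall i, ~~ I i -> z i = 0.

Lemma restr_supp I z : supp I (restr I z).
Proof. by move=> i /negPf h; rewrite /restr h. Qed.

Lemma supp_restr I z : supp I z -> restr I z = z.
Proof. by move=> h; apply/funext => i; rewrite /restr; case: ifPn => // /h ->. Qed.

Lemma restr_l2 I z K : l2le z K -> l2le (restr I z) K.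
Proof. by apply: l2leW => i; rewrite /restr; case: ifP; rewrite // cabs0 cabs_ge0. Qed.

(** Rows of [B] are finite, so that [A] is defined and linear on arbitrary sequences. *)
Lemma B_sum i z : exists K, l1le (fun j => B i j * z j) K.
Proof.
have [J hJ] := B_row i; eexists; apply: (@l1le_fin _ J) => j /hJ ->.
by rewrite mul0r.
Qed.

Lemma mvBD z y : mv B (fun i => z i + y i) = fun i => mv B z i + mv B y i.
Proof.
apply/funext => i; have [K hK] := B_sum i z; have [L hL] := B_sum i y.
exact: mvD hK hL.
Qed.

Lemma mvBZ c z : mv B (fun i => c * z i) = fun i => c * mv B z i.
Proof. by apply/funext => i; have [K hK] := B_sum i z; exact: mvZ hK. Qed.

Lemma pertD z y i : A (fun i => z i + y i) i = A z i + A y i.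
Proof. by rewrite /pert mvBD; ring. Qed.

Lemma pertZ c z i : A (fun i => c * z i) i = c * A z i.
Proof. by rewrite /pert mvBZ; ring. Qed.

Lemma mv_restr I z : blockset I -> mv B (restr I z) = restr I (mv B z).
Proof.
move=> hI; apply/funext => i; rewrite /restr /mv; case: ifPn => Ii.
  apply: eq_csum => j; case: ifPn => // Ij; rewrite B_bl ?mul0r // => e.
  by move: Ij; rewrite -(hI _ _ e) Ii.
rewrite (_ : (fun j => _) = fun=> 0) ?csum0 //; apply/funext => j.
case: ifPn => [Ij|_]; last by rewrite mulr0.
by rewrite B_bl ?mul0r // => e; move: Ii; rewrite (hI _ _ e) Ij.
Qed.

Lemma pert_restr I z : blockset I -> A (restr I z) = restr I (A z).
Proof.
move=> hI; apply/funext => i; rewrite /pert mv_restr // /restr.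
by case: ifP => _ //; rewrite mulr0 subr0.
Qed.

Lemma dom_restr I z : dom z -> dom (restr I z).
Proof.
move=> [[K hK] [L hL]]; split; first by exists K; exact: restr_l2.
exists L; apply: eq_l2le (restr_l2 I hL) => i; rewrite /restr.
by case: ifP => _; rewrite ?mulr0.
Qed.

(** Solving for the diagonal term gives [(b + d) * N <= K + b * N] for the norm [N] of [z], and
    [b * N] is absorbed. *)
Lemma apriori I l d z K L : (forall i, I i -> b + d <= cabs (l - (ev i)%:C)) ->
  0 < d -> supp I z -> l2le z L -> l2le (fun i => l * z i - A z i) K ->
  l2le z (K / d).
Proof.
move=> far d0 sz hz hK; have [N [hN Nmin]] := l2_min hz.
have K0 := l2le_ge0 hK; have N0 := l2le_ge0 hN.
have b0 := b_ge0; have bd0 : 0 < b + d by lra.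
have h := l2leB hK (B_bnd hN).
suff : l2le z ((K + b * N) / (b + d)).
  move=> /Nmin; rewrite ler_pdivlMr // => hh; apply: l2le_mono hN.
  rewrite ler_pdivlMr //; lra.
rewrite mulrC -[(b + d)^-1]ger0_norm ?invr_ge0 ?(ltW bd0) // -cabs_real.
apply: l2leW (l2leZ (b + d)^-1%:C h) => i.
have [Ii|/sz ->] := boolP (I i); last by rewrite cabs0 cabs_ge0.
have -> : l * z i - A z i - mv B z i = (l - (ev i)%:C) * z i by rewrite /pert; ring.
rewrite !cabsM cabs_real ger0_norm ?invr_ge0 ?(ltW bd0) // mulrA.
rewrite ler_peMl ?cabs_ge0 // mulrC ler_pdivlMr // mul1r; exact: far.
Qed.

Lemma dom_of_eq l z x K L : l2le z K -> l2le x L ->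
  (forall i, l * z i - A z i = x i) -> dom z.
Proof.
move=> hz hx e; split; first by exists K.
eexists; apply: (eq_l2le _ (l2leB (l2leD (l2leZ l hz) (B_bnd hz)) hx)) => i.
by rewrite -e /pert; ring.
Qed.

(** A fixed point of [z = (x - B z) / (l - ev)] on [I]; at distance [2 * b + 1] from the diagonal
    the map contracts by a factor below 1/2 and preserves the ball of radius [K]. *)
Lemma far_solve I l x K : blockset I ->
  (forall i, I i -> 2 * b + 1 <= cabs (l - (ev i)%:C)) ->
  supp I x -> l2le x K ->
  exists z, [/\ dom z, supp I z, l2le z K & forall i, l * z i - A z i = x i].
Proof.
move=> hI far sx hx; have K0 := l2le_ge0 hx.
have b0 := b_ge0; have c0 : 0 < 2 * b + 1 by lra.
pose F z i := if I i then (x i - mv B z i) / (l - (ev i)%:C) else 0.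
have dv (y : nat -> C) L : l2le y L ->
    l2le (fun i => if I i then y i / (l - (ev i)%:C) else 0) (L / (2 * b + 1)).
  move=> hy; rewrite mulrC -[(2 * b + 1)^-1]ger0_norm ?invr_ge0 ?(ltW c0) //.
  rewrite -cabs_real; apply: l2leW (l2leZ (2 * b + 1)^-1%:C hy) => i.
  case: ifPn => [/far h|_]; last by rewrite cabs0 cabs_ge0.
  rewrite !cabsM cabsV cabs_real ger0_norm ?invr_ge0 ?(ltW c0) // mulrC.
  by rewrite ler_wpM2r ?cabs_ge0 // lef_pV2 ?posrE // (lt_le_trans c0).
have [||||||||z [zb zE]] := @picard R nat (fun f K => l2le f K) _ _ _ _ _ F K.
by move=> L L0; exact: l2le0.
by move=> f g L L' hf hg; exact: l2leD.
by move=> f L i; exact: l2le_pt.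
by move=> f L L' LL' hf; exact: l2le_mono hf.
by move=> f g L hf fg; exact: l2le_lim hf fg.
by [].
move=> f hf; apply: l2le_mono (dv _ _ (l2leB hx (B_bnd hf))).
by rewrite ler_pdivrMr //; nra.
move=> f g d hf hg hd; have d0 := l2le_ge0 hd.
  apply: (@eq_l2le _ _ _ _ _ (l2le_mono _ (dv _ _ (l2leN (B_bnd hd))))).
    move=> i; rewrite /F.
    have -> : (fun t => f t - g t) = fun t => f t + (-1) * g t.
      by apply/funext => t; rewrite mulN1r.
    rewrite mvBD mvBZ; case: ifP => _; last by rewrite subrr.
    by rewrite -mulrBl; congr (_ / _); ring.
  by rewrite ler_pdivrMr //; nra.
have sz : supp I z by move=> i /negPf h; rewrite -zE /F h.
have e i : l * z i - A z i = x i.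
  rewrite /pert; have [Ii|nI] := boolP (I i); last first.
    rewrite sz // sx // -(supp_restr sz) mv_restr // /restr (negPf nI); ring.
  have l0 : l - (ev i)%:C != 0.
    by rewrite -cabs_eq0 gt_eqF // (lt_le_trans c0) // far.
  rewrite -[x i](subrK (mv B z i)) -[x i - _](divfK l0).
  have -> : (x i - mv B z i) / (l - (ev i)%:C) = z i by rewrite -[RHS]zE /F Ii.
  ring.
by exists z; split=> //; exact: dom_of_eq zb hx e.
Qed.

Definition evb n l : Prop := exists z,
  [/\ exists i, z i != 0, supp (fun i => bl i == n) z & forall i, A z i = l * z i].

Section FiniteBlocks.
Variables (c d : nat).
Let D : 'M[C]_d := \matrix_(i, j)
  ((if i == j then (ev (c + i))%:C else 0) - B (c + i) (c + j)).

(** Extension by zero from the segment of [d] indices starting at [c]. *)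
Definition ext (v : 'I_d -> C) : nat -> C := fun i =>
  if (c <= i < c + d)%N =P true is ReflectT h then
    (if insub (i - c)%N is Some k then v k else 0) else 0.

Lemma ext_in v (k : 'I_d) : ext v (c + k) = v k.
Proof.
rewrite /ext; case: eqP => [h|]; last by rewrite leq_addr ltn_add2l ltn_ord.
by rewrite addKn valK.
Qed.

Lemma ext_supp v : supp (fun i => (c <= i < c + d)%N) (ext v).
Proof. by move=> i; rewrite /ext; case: eqP => // ->. Qed.

Lemma sum_supp z : supp (fun i => (c <= i < c + d)%N) z -> forall i,
  mv B z i = \sum_(k < d) B i (c + k) * z (c + k)%N.
Proof.
move=> sz i; rewrite /mv (@csum_fin _ (c + d)); last first.
  by move=> j cj; rewrite sz ?mulr0 // [X in _ && X]ltnNge cj andbF.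
rewrite -(big_mkord xpredT (fun j => B i j * z j)).
rewrite (big_cat_nat (leq0n c) (leq_addr _ _)) /= big_nat big1 ?add0r.
  by rewrite -{1}[c]add0n big_addn addKn big_mkord; apply: eq_bigr => k _; rewrite addnC.
by move=> j /andP[_ jc]; rewrite sz ?mulr0 // leqNgt jc.
Qed.

Lemma pert_mx z (k : 'I_d) : supp (fun i => (c <= i < c + d)%N) z ->
  A z (c + k)%N = (D *m (\col_j z (c + j)%N)) k 0.
Proof.
move=> sz; rewrite /pert sum_supp // !mxE.
under [RHS]eq_bigr do rewrite !mxE mulrBl.
rewrite big_split /= sumrN; congr (_ - _).
rewrite (bigD1 k) //= eqxx big1 ?addr0 // => j.
by rewrite eq_sym => /negPf ->; rewrite mul0r.
Qed.

Hypothesis seg : blockset (fun i => (c <= i < c + d)%N).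

Lemma pert_seg_supp z : supp (fun i => (c <= i < c + d)%N) z ->
  supp (fun i => (c <= i < c + d)%N) (A z).
Proof.
by move=> sz; rewrite -(supp_restr sz) pert_restr //; exact: restr_supp.
Qed.

Lemma seg_eq z y : supp (fun i => (c <= i < c + d)%N) z ->
  supp (fun i => (c <= i < c + d)%N) y ->
  (forall k : 'I_d, z (c + k)%N = y (c + k)%N) -> z = y.
Proof.
move=> sz sy h; apply/funext => i; have [hi|nh] := boolP (c <= i < c + d)%N; last first.
  by rewrite sz // sy.
have lt : (i - c < d)%N by lia.
by have /= := h (Ordinal lt); rewrite subnKC; [|lia].
Qed.

(** [eigenvalue] is about row vectors, hence the transpose. Extension by zero preserves eigenvectors
    because the segment is a union of blocks. *)
Lemma eig_seg l : eigenvalue D^T l <-> exists z,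
  [/\ exists i, z i != 0, supp (fun i => (c <= i < c + d)%N) z
    & forall i, A z i = l * z i].
Proof.
split.
  move=> /eigenvalueP [v hv v0]; exists (ext (fun k => v 0 k)).
  have sx := ext_supp (fun k => v 0 k); split=> //.
    have /rV0Pn [k hk] := v0; by exists (c + k)%N; rewrite ext_in.
  suff -> : A (ext (fun k => v 0 k)) = fun i => l * ext (fun k => v 0 k) i by [].
  apply: seg_eq; first exact: pert_seg_supp.
    by move=> i /sx ->; rewrite mulr0.
  move=> k; rewrite pert_mx // ext_in.
  have -> : (\col_j ext (fun k => v 0 k) (c + j)%N) = v^T.
    by apply/colP => j; rewrite !mxE ext_in.
  move: hv => /(congr1 trmx); rewrite trmx_mul trmxK => ->.
  by rewrite linearZ !mxE.
move=> [z [[i zi] sz zE]]; apply/eigenvalueP; exists (\row_j z (c + j)%N).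
  apply/rowP => k; rewrite !mxE -zE pert_mx // !mxE.
  by apply: eq_bigr => j _; rewrite !mxE mulrC.
apply: contra_neq zi => /rowP h.
suff -> : z = fun=> 0 by [].
by apply: seg_eq => // k; have := h k; rewrite !mxE.
Qed.

(** The characteristic polynomial splits over [C]. The length of the list, with multiplicities, is
    the source of the number of eigenvalues in each block. *)
Lemma eig_roots : exists rs : seq C, size rs = d /\ forall l,
  (exists z, [/\ exists i, z i != 0, supp (fun i => (c <= i < c + d)%N) z
    & forall i, A z i = l * z i]) <-> l \in rs.
Proof.
have [rs hrs] := closed_field_poly_normal (char_poly D^T).
exists rs; split=> [|l].
  have := size_char_poly D^T; rewrite hrs size_scale ?lead_coef_eq0 ?monic_neq0 ?char_poly_monic //.
  by rewrite size_prod_XsubC => -[].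
rewrite -eig_seg eigenvalue_root_char hrs rootZ ?root_prod_XsubC //.
by rewrite lead_coef_eq0 monic_neq0 ?char_poly_monic.
Qed.

(** A finite matrix without kernel is invertible. The constant is crude: [S] sums the moduli of all
    entries of the inverse, and [c + d] comes from [l2le_cut_small]. *)
Lemma seg_solve l : (forall z, supp (fun i => (c <= i < c + d)%N) z ->
    (forall i, A z i = l * z i) -> forall i, z i = 0) ->
  exists2 Ml, 0 <= Ml & forall x K, supp (fun i => (c <= i < c + d)%N) x -> l2le x K ->
   exists z, [/\ supp (fun i => (c <= i < c + d)%N) z, l2le z (Ml * K)
     & forall i, l * z i - A z i = x i].
Proof.
move=> inj; pose E := l%:M - D.
have Eu : E \in unitmx.
  rewrite unitmxE unitfE -det_tr; apply/negP => /det0P [v v0 hv].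
  have : eigenvalue D^T l.
    apply/eigenvalueP; exists v => //.
    have : v *m E^T = 0 by [].
    rewrite /E linearB /= tr_scalar_mx mulmxBr mul_mx_scalar => /eqP.
    by rewrite subr_eq0 => /eqP <-.
  move=> /eig_seg [z [[i zi] sz zE]]; move: zi.
  by rewrite (inj z sz zE) eqxx.
pose S := \sum_(k < d) \sum_(j < d) cabs (invmx E k j).
have S0 : 0 <= S by do 2! [apply: sumr_ge0 => ? _]; exact: cabs_ge0.
exists ((c + d)%:R * S); first by rewrite mulr_ge0.
move=> x K sx hx; have K0 := l2le_ge0 hx.
pose u : 'cV[C]_d := invmx E *m \col_j x (c + j)%N.
have su := ext_supp (fun k => u k 0).
exists (ext (fun k => u k 0)); split=> //; last first.
  move=> i; move: i; suff : (fun i => l * ext (fun k => u k 0) i - A (ext (fun k => u k 0)) i) = x.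
    by move=> h i; rewrite -h.
  apply: seg_eq => //.
    by move=> i hi; rewrite su // mulr0 (pert_seg_supp su) // subrr.
  move=> k; rewrite pert_mx // ext_in.
  have -> : (\col_j ext (fun k => u k 0) (c + j)%N) = u.
    by apply/colP => j; rewrite mxE ext_in.
  have : (E *m u) k 0 = x (c + k)%N by rewrite /u mulKVmx // mxE.
  by rewrite /E mulmxBl mul_scalar_mx !mxE => <-.
have small i : cabs (ext (fun k => u k 0) i) <= S * K.
  have [hi|/su ->] := boolP (c <= i < c + d)%N; last by rewrite cabs0 mulr_ge0.
  have lt : (i - c < d)%N by lia.
  have -> : i = (c + Ordinal lt)%N by rewrite /= subnKC //; lia.
  rewrite ext_in mxE (le_trans (cabs_sum _ _ _)) // mulr_suml.
  rewrite [leRHS](bigD1 (Ordinal lt)) //= mulr_suml ler_wpDr //.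
    by apply: sumr_ge0 => j _; rewrite mulr_ge0 // sumr_ge0 // => ? _; exact: cabs_ge0.
  apply: ler_sum => j _; rewrite cabsM mxE ler_wpM2l ?cabs_ge0 //.
  exact: l2le_pt hx.
have := @l2le_cut_small _ (c + d) (ext (fun k => u k 0)) (S * K).
rewrite -mulrA; move=> h; apply: eq_l2le (h _ _); first last.
- by move=> i _; exact: small.
- by rewrite mulr_ge0.
- move=> i; case: ifPn => // ni; rewrite su //; apply: contra ni => /andP[]//.
Qed.

End FiniteBlocks.

Hypothesis blocks : forall n, exists c d, forall i, (bl i == n) = (c <= i < c + d)%N.
Hypothesis cuts : forall n, exists2 a, (n <= a)%N & blockset (fun i => (i < a)%N).

Lemma blockset_bl n : blockset (fun i => bl i == n).
Proof. by move=> i j ->. Qed.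

Lemma blocksetC I : blockset I -> blockset (fun i => ~~ I i).
Proof. by move=> h i j /h ->. Qed.

Lemma far_index l K : exists2 a, blockset (fun i => (i < a)%N) &
  forall i, ~~ (i < a)%N -> K <= cabs (l - (ev i)%:C).
Proof.
have [n hn] := ev_large (K + cabs l); have [a na ha] := cuts n.
exists a => // i; rewrite -leqNgt => ai.
have := cabs_sub_ge (ev i)%:C l; rewrite cabsBC cabs_real ger0_norm //.
have := hn i (leq_trans na ai); lra.
Qed.

(** The resolvent set of [A] with an explicit bound of the inverse, for use in estimates that are
    uniform in the right-hand side. *)
Definition reg l Ml : Prop := [/\ 0 <= Ml,
  forall x K, l2le x K -> exists z, dom z /\ forall i, l * z i - A z i = x i
  & forall z K, dom z -> l2le (fun i => l * z i - A z i) K -> l2le z (Ml * K)].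

(** Some block meets [z], and restriction to it commutes with [A]. *)
Lemma kernel_evb l z : (exists i, z i != 0) -> (forall i, A z i = l * z i) ->
  exists n, evb n l.
Proof.
move=> [i zi] h; exists (bl i), (restr (fun j => bl j == bl i) z); split.
- by exists i; rewrite /restr eqxx.
- exact: restr_supp.
- move=> j; rewrite pert_restr; last exact: blockset_bl.
  by rewrite /restr; case: ifP => _; rewrite ?h ?mulr0.
Qed.

(** Beyond a cut the diagonal is far from [l] and [far_solve] applies; below it a finite matrix
    without kernel remains. The two solutions add up because [A] respects the cut. *)
Lemma reg_of l : (forall n, ~ evb n l) -> exists Ml, reg l Ml.
Proof.
move=> nev.
have inj z : (forall i, A z i = l * z i) -> forall i, z i = 0.
  move=> h i; apply/eqP; apply: contraT => zi.
  by have [n] := kernel_evb (ex_intro _ i zi) h; move/(nev n).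
have [a ca far] := far_index l (2 * b + 1).
have ca' : blockset (fun i => (0 <= i < 0 + a)%N) by [].
have [Mn Mn0 near] := seg_solve ca' (fun z _ h => inj z h).
have b0 := b_ge0.
have sol x K : l2le x K -> exists z, [/\ dom z, l2le z ((Mn + 1) * K)
    & forall i, l * z i - A z i = x i].
  move=> hx; have K0 := l2le_ge0 hx.
  have [z1 [s1 h1 e1]] := near _ _ (@restr_supp (fun i => (0 <= i < 0 + a)%N) x)
     (@restr_l2 (fun i => (0 <= i < 0 + a)%N) _ _ hx).
  have [z2 [d2 s2 h2 e2]] := far_solve (blocksetC ca) far
     (@restr_supp (fun i => ~~ (i < a)%N) x) (@restr_l2 (fun i => ~~ (i < a)%N) _ _ hx).
  have e i : l * (z1 i + z2 i) - A (fun i => z1 i + z2 i) i = x i.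
    rewrite pertD; have := e1 i; have := e2 i.
    rewrite /restr /= add0n => a2 a1.
    transitivity ((l * z1 i - A z1 i) + (l * z2 i - A z2 i)); first by ring.
    by rewrite a1 a2; case: ifP; rewrite ?addr0 ?add0r.
  have hz := l2leD h1 h2.
  exists (fun i => z1 i + z2 i); split=> //; first exact: dom_of_eq hz hx e.
  by apply: l2le_mono hz; rewrite mulrDl mul1r.
exists (Mn + 1); split; first by rewrite addr_ge0.
  by move=> x K /sol [z [dz _ e]]; exists z.
move=> z K dz hK; have [y [dy hy ey]] := sol _ _ hK.
suff -> : z = y by [].
apply/funext => i; apply/eqP; rewrite -subr_eq0; apply/eqP.
have -> : z i - y i = (fun i => z i + -1 * y i) i by rewrite mulN1r.
apply: (inj (fun i => z i + -1 * y i)) => j; rewrite pertD pertZ.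
have := ey j => {}ey; apply/eqP; rewrite eq_sym -subr_eq0; apply/eqP.
transitivity ((l * z j - A z j) - (l * y j - A y j)); first by ring.
by rewrite ey subrr.
Qed.

(** An eigenvector solves the homogeneous equation; if the whole diagonal of its block were at
    distance [b + d] from [l], [apriori] would make it vanish. *)
Lemma evb_near n l d : evb n l -> 0 < d ->
  exists2 i, bl i = n & cabs (l - (ev i)%:C) < b + d.
Proof.
move=> [z [[j zj] sz ez]] d0; apply: contrapT => hn.
have far i : bl i == n -> b + d <= cabs (l - (ev i)%:C).
  by move=> /eqP e; rewrite leNgt; apply/negP => lt; apply: hn; exists i.
have [c [e cd]] := blocks n.
have fz i' : (c + e <= i')%N -> z i' = 0.
  by move=> ci; apply: sz; rewrite cd negb_and -leqNgt ci orbT.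
have h0 : l2le (fun i => l * z i - A z i) 0.
  by apply: eq_l2le (l2le0 (lexx 0)) => i; rewrite ez subrr.
have := apriori far d0 sz (l1_l2 (l1le_fin fz)) h0.
rewrite mul0r => /(l2le_pt j).
by rewrite le_eqVlt ltNge cabs_ge0 orbF cabs_eq0 (negPf zj).
Qed.

Definition res l x : nat -> C :=
  xget (fun=> 0) [set z | dom z /\ forall i, l * z i - A z i = x i].

Section Resolvent.
Variables (l : C) (Ml : R).
Hypothesis hreg : reg l Ml.

Lemma res_uniq z y : dom z -> dom y ->
  (forall i, l * z i - A z i = l * y i - A y i) -> z = y.
Proof.
move=> [[K hK] [L hL]] [[K' hK'] [L' hL']] e; have [_ _ h] := hreg.
have d : dom (fun i => z i + -1 * y i).
  split; first by exists (K + cabs (-1) * K'); exact: l2leD hK (l2leZ _ hK').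
  exists (L + cabs (-1) * L'); apply: eq_l2le (l2leD hL (l2leZ (-1) hL')) => i; ring.
have h0 : l2le (fun i => l * (z i + -1 * y i) - A (fun i => z i + -1 * y i) i) 0.
  apply: eq_l2le (l2le0 (lexx 0)) => i; rewrite pertD pertZ.
  transitivity ((l * z i - A z i) - (l * y i - A y i)); last by ring.
  by rewrite e subrr.
apply/funext => i; have := l2le_pt i (h _ _ d h0).
rewrite mulr0 le_eqVlt ltNge cabs_ge0 orbF cabs_eq0 mulN1r subr_eq0.
by move/eqP.
Qed.

Lemma resP x K : l2le x K -> [/\ dom (res l x), forall i, l * res l x i - A (res l x) i = x i
  & l2le (res l x) (Ml * K)].
Proof.
move=> hx; have [_ /(_ _ _ hx) hz h] := hreg.
have [] := @xgetPex _ (fun=> 0) [set z | dom z /\ forall i, l * z i - A z i = x i] hz.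
rewrite -/(res l x) => dz ez; split=> //; apply: h => //.
by apply: eq_l2le hx => i; rewrite ez.
Qed.

Lemma res_eq x K z : l2le x K -> dom z -> (forall i, l * z i - A z i = x i) -> res l x = z.
Proof.
move=> hx dz ez; have [dr er _] := resP hx.
by apply: res_uniq => // i; rewrite er ez.
Qed.

Lemma res_supp I x K : blockset I -> l2le x K -> supp I x -> supp I (res l x).
Proof.
move=> hI hx sx; have [dr er _] := resP hx.
rewrite (res_eq (z := restr I (res l x)) hx); first exact: restr_supp.
  exact: dom_restr.
move=> i; rewrite pert_restr // /restr; case: ifPn => [_|/sx ->]; first exact: er.
by rewrite mulr0 subrr.
Qed.

Lemma resD x y K L : l2le x K -> l2le y L ->
  res l (fun i => x i + y i) = fun i => res l x i + res l y i.
Proof.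
move=> hx hy; have [[[K1 h1] [K2 h2]] ex _] := resP hx.
have [[[K1' h1'] [K2' h2']] ey _] := resP hy.
apply: (res_eq (l2leD hx hy)).
  split; first by exists (K1 + K1'); exact: l2leD.
  exists (K2 + K2'); apply: eq_l2le (l2leD h2 h2') => i; ring.
by move=> i; rewrite pertD -ex -ey; ring.
Qed.

Lemma resZ c x K : l2le x K -> res l (fun i => c * x i) = fun i => c * res l x i.
Proof.
move=> hx; have [[[K1 h1] [K2 h2]] ex _] := resP hx.
apply: (res_eq (l2leZ c hx)).
  split; first by exists (cabs c * K1); exact: l2leZ.
  exists (cabs c * K2); apply: eq_l2le (l2leZ c h2) => i; ring.
by move=> i; rewrite pertZ -ex; ring.
Qed.

(** The identity [(l - A)^-1 (A - c) = (l - c) (l - A)^-1 - 1]. Under a contour integral it trades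
    powers of [l - c] for powers of [A - c], which takes the place of holomorphy. *)
Lemma res_shift c x K L : dom x -> l2le x K -> l2le (fun i => A x i - c * x i) L ->
  res l (fun i => A x i - c * x i) = fun i => (l - c) * res l x i - x i.
Proof.
move=> dx hx hs; have [[[K1 h1] [K2 h2]] ex _] := resP hx.
have [[K3 h3] [K4 h4]] := dx.
apply: (res_eq hs).
  split; first by eexists; exact: l2leB (l2leZ (l - c) h1) h3.
  eexists; apply: eq_l2le (l2leB (l2leZ (l - c) h2) h4) => i; ring.
move=> i; have -> : (fun i => (l - c) * res l x i - x i) =
    fun i => (l - c) * res l x i + -1 * x i by apply/funext => j; ring.
rewrite pertD !pertZ; have := ex i => e.
transitivity ((l - c) * (l * res l x i - A (res l x) i) - l * x i + A x i).
  ring.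
by rewrite e; ring.
Qed.

End Resolvent.

(** [Ml'] does not enter the bound: the norm of [res l' x] is first estimated by [2 * (Ml * K)], by
    absorption. Continuity along a circle thus requires no uniform bound of the resolvent. *)
Lemma res_lip l Ml l' Ml' x K : reg l Ml -> reg l' Ml' -> l2le x K ->
  Ml * cabs (l - l') <= 2^-1 ->
  l2le (fun i => res l x i - res l' x i) (Ml * (cabs (l' - l) * (2 * (Ml * K)))).
Proof.
move=> h h' hx small; have [d e hr] := resP h hx; have [d' e' hr'] := resP h' hx.
have [Ml0 _ hb] := h; have K0 := l2le_ge0 hx.
have dd : dom (fun i => res l x i + -1 * res l' x i).
  have [[K1 h1] [K2 h2]] := d; have [[K3 h3] [K4 h4]] := d'.
  split; first by eexists; exact: l2leD h1 (l2leZ (-1) h3).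
  eexists; apply: eq_l2le (l2leD h2 (l2leZ (-1) h4)) => i; ring.
have key L : l2le (res l' x) L ->
    l2le (fun i => res l x i + -1 * res l' x i) (Ml * (cabs (l' - l) * L)).
  move=> hL; apply: hb => //; apply: eq_l2le (l2leZ (l' - l) hL) => i.
  rewrite pertD pertZ; have e1 := e i; have e2 := e' i.
  transitivity ((l * res l x i - A (res l x) i) - (l' * res l' x i - A (res l' x) i)
    + (l' - l) * res l' x i); last by ring.
  by rewrite e1 e2 subrr add0r.
have [N [hN Nmin]] := l2_min hr'; have N0 := l2le_ge0 hN.
have : N <= Ml * K + Ml * (cabs (l' - l) * N).
  apply: Nmin; apply: eq_l2le (l2leB hr (key _ hN)) => i; ring.
have := small; rewrite cabsBC => s hh.
have hN2 : N <= 2 * (Ml * K).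
  have := ler_wpM2r N0 s; lra.
apply: eq_l2le (key _ (l2le_mono hN2 hN)) => i; ring.
Qed.

(** * Contour integrals of the resolvent of the block diagonal operator *)

Section Contour.
(** [Psi] is a bounded linear functional on l^2, so that all integrals are integrals of scalar
    functions. *)
Variables (c : C) (r : R) (Psi : (nat -> C) -> C) (CP : R).
Hypothesis r_gt0 : 0 < r.
Hypothesis circ : forall l, cabs (l - c) = r -> exists Ml, reg l Ml.
Hypothesis CP_ge0 : 0 <= CP.
Hypothesis PsiD : forall z y K L, l2le z K -> l2le y L ->
  Psi (fun i => z i + y i) = Psi z + Psi y.
Hypothesis PsiZ : forall a z K, l2le z K -> Psi (fun i => a * z i) = a * Psi z.
Hypothesis Psi_le : forall z K, l2le z K -> cabs (Psi z) <= CP * K.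

Let p (s : R) : C := c + r%:C * expi s.
Let wt (s : R) : C := (0 +i* 1) * r%:C * expi s.

Let pE s : cabs (p s - c) = r.
Proof. by rewrite /p addrC addKr cabsM cabs_expi mulr1 cabs_real gtr0_norm. Qed.

Let preg s : exists Ml, reg (p s) Ml.
Proof. exact/circ/pE. Qed.

Let p_cont : ccont p.
Proof.
apply: ccontD; first exact: ccont_cst.
apply: ccontM; first exact: ccont_cst.
have := @ccont_expi R 1; congr ccont; apply/funext => s; by rewrite mul1r.
Qed.

Let wt_cont : ccont wt.
Proof.
apply: ccontM; first exact: ccont_cst.
have := @ccont_expi R 1; congr ccont; apply/funext => s; by rewrite mul1r.
Qed.

Definition phi x (s : R) : C := Psi (res (p s) x).

Lemma PsiB z y K L : l2le z K -> l2le y L -> Psi (fun i => z i - y i) = Psi z - Psi y.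
Proof.
move=> hz hy; rewrite -mulN1r -(PsiZ _ hy) -(PsiD hz (l2leZ (-1) hy)).
by congr Psi; apply/funext => i; rewrite mulN1r.
Qed.

Lemma phi_cont x K : l2le x K -> ccont (phi x).
Proof.
move=> hx s e e0; have [Ml h] := preg s; have [Ml0 _ _] := h; have K0 := l2le_ge0 hx.
(* The first summand serves the final estimate, the second the smallness condition of [res_lip], and
   1 makes [D] positive. *)
pose D := CP * (Ml * (2 * (Ml * K))) + 2 * Ml + 1.
have q0 : 0 <= CP * (Ml * (2 * (Ml * K))) by rewrite !mulr_ge0.
have D0 : 0 < D by rewrite /D; lra.
have f0 : 0 < Num.min e 1 / D by rewrite divr_gt0 // lt_min e0 ltr01.
have [d d0 hd] := p_cont s f0; exists d => // t /hd.
rewrite ler_pdivlMr // le_min => /andP[h1 h2].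
have [Ml' h'] := preg t; have cc := cabs_ge0 (p t - p s).
have sm : Ml * cabs (p s - p t) <= 2^-1.
  rewrite cabsBC; have : cabs (p t - p s) * (2 * Ml) <= cabs (p t - p s) * D.
    by rewrite ler_wpM2l // /D; lra.
  lra.
have [_ _ b1] := resP h hx; have [_ _ b2] := resP h' hx.
rewrite /phi cabsBC -(PsiB b1 b2).
apply: le_trans (Psi_le (res_lip h h' hx sm)) _.
apply: le_trans h1.
have -> : CP * (Ml * (cabs (p t - p s) * (2 * (Ml * K)))) =
  cabs (p t - p s) * (CP * (Ml * (2 * (Ml * K)))) by ring.
by rewrite ler_wpM2l // /D; lra.
Qed.

Lemma circle_phi x : circle_integral c r (fun l => Psi (res l x)) =
  cintegral `[0, 2 * pi] (fun s => phi x s * wt s).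
Proof. by []. Qed.

Lemma phi_shift x s K : dom x -> l2le x K ->
  phi (fun i => A x i - c * x i) s = r%:C * expi s * phi x s - Psi x.
Proof.
move=> dx hx; have [Ml h] := preg s; have [_ [L hL]] := dx.
have hs := l2leB (l2leB hL (B_bnd hx)) (l2leZ c hx).
have [_ _ b1] := resP h hx.
rewrite /phi (res_shift h dx hx hs) (PsiB (l2leZ _ b1) hx) (PsiZ _ b1).
by congr (_ * _ - _); rewrite /p addrC addKr.
Qed.

(* [J n m x] is the contour integral of [(l - c)^(n - m) <(l - A)^-1 x>]. *)
Let J (n m : nat) x := cintegral `[0, 2 * pi]
  (fun s => (r%:C * expi s) ^+ n * (r%:C * expi s) ^- m * (phi x s * wt s)).

Let rexp_neq0 s : r%:C * expi s != 0 :> C.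
Proof. by rewrite mulf_neq0 ?expi_neq0 // -cabs_eq0 cabs_real normr_eq0 gt_eqF. Qed.

Let kern_cont (n m : nat) : ccont (fun s : R => (r%:C * expi s : C) ^+ n * (r%:C * expi s) ^- m).
Proof.
apply: ccontM.
  apply: ccontX; apply: ccontM; first exact: ccont_cst.
  have := @ccont_expi R 1; congr ccont; apply/funext => s; by rewrite mul1r.
have -> : (fun s : R => (r%:C * expi s : C) ^- m) =
    fun s => (r%:C ^- m) * expi (- m%:R * s).
  apply/funext => s; rewrite exprMn expiX invfM expi_inv mulNr.
  by [].
apply: ccontM; first exact: ccont_cst.
exact: ccont_expi.
Qed.

(** With [l - c = r * expi s] this is the integral of [(l - c)^(n - m)] around the circle, which
    only sees the exponent -1. *)
Let kern_int (n m : nat) :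
  cintegral `[0, 2 * pi] (fun s : R => (r%:C * expi s) ^+ n * (r%:C * expi s) ^- m * wt s) =
  if n.+1 == m then 2 * pi *i else 0.
Proof.
have -> : (fun s : R => (r%:C * expi s) ^+ n * (r%:C * expi s) ^- m * wt s) =
    fun s => (r%:C ^+ n * r%:C ^- m * (0 +i* 1) * r%:C) * expi ((n.+1%:R - m%:R) * s).
  apply/funext => s; rewrite /wt !exprMn !expiX invfM expi_inv.
  have -> : expi ((n.+1%:R - m%:R) * s) = expi (n%:R * s) * expi (- (m%:R * s)) * expi s :> C.
    by rewrite -!expiD; congr expi; rewrite -natr1; ring.
  ring.
rewrite cintegralZ //; last by apply: ccont_integrable; exact: ccont_expi.
case: eqP => [<-|nm].
  rewrite subrr exprS; have r0 : r%:C != 0 :> C by rewrite -cabs_eq0 cabs_real normr_eq0 gt_eqF.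
  have -> : (fun s : R => expi (0 * s)) = fun=> 1 :> C by apply/funext => s; rewrite mul0r expi0.
  rewrite /cintegral /= Rintegral_cst // mul1r /Rintegral integral0.
  have e := @lebesgue_measure_itv R `[0, 2 * pi].
  have -> : fine (lebesgue_measure (`[0, 2 * pi]%classic : set R)) = 2 * pi.
    etransitivity; first exact: (f_equal (@fine R) e).
    by rewrite /= lte_fin mulr_gt0 ?pi_gt0 //= subr0.
  have -> : r%:C ^+ n * (r%:C * r%:C ^+ n)^-1 * (0 +i* 1) * r%:C = (0 +i* 1) :> C.
    by field; rewrite r0 expf_neq0.
  by simpc.
have nm0 : n.+1%:R - m%:R != 0 :> R by rewrite subr_eq0 eqr_nat; apply/eqP.
rewrite cintegral_expi //; last by rewrite mulr_gt0 ?pi_gt0.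
have -> : expi ((n.+1%:R - m%:R) * (2 * pi)) = 1 :> C.
  by rewrite mulrBl expiD -expi_inv -!(expiX (2 * pi)) expi_2pi !expr1n invr1 mulr1.
by rewrite subrr mul0r mulr0.
Qed.

Let J_le n m x K : l2le x K -> forall D, (forall s, cabs (phi x s) <= D) ->
  cabs (J n m x) <= r ^+ n * r ^- m * (D * r) * (2 * pi).
Proof.
move=> hx D hD; rewrite -[X in _ * X](subr0 (2 * pi)).
apply: cintegral_bound; first by rewrite mulr_ge0 ?pi_ge0.
  apply: ccontM; first exact: kern_cont.
  by apply: ccontM wt_cont; exact: phi_cont hx.
move=> s; rewrite !cabsM cabsV !cabsX !cabsM !cabs_expi !mulr1 cabs_real gtr0_norm //.
have -> : cabs (0 +i* 1 : C) = 1 by rewrite cabsE /= expr0n expr1n add0r sqrtr1.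
by rewrite mul1r ler_wpM2l ?mulr_ge0 ?invr_ge0 ?exprn_ge0 ?(ltW r_gt0) // ler_wpM2r // ltW.
Qed.

(** [phi_shift] under the integral; by [kern_int] the subtracted term survives only when [n - m] is
    -1. *)
Let J_shift n m x K : dom x -> l2le x K ->
  J n m (fun i => A x i - c * x i) = J n.+1 m x -
    (if n.+1 == m then 2 * pi *i else 0) * Psi x.
Proof.
move=> dx hx; rewrite -kern_int mulrC -cintegralZ //; last first.
  by apply: ccont_integrable; apply: ccontM wt_cont; exact: kern_cont.
rewrite /J -cintegralB //; first last.
- apply: cintegrableZ => //.
  by apply: ccont_integrable; apply: ccontM wt_cont; exact: kern_cont.
- apply: ccont_integrable; apply: ccontM; first exact: kern_cont.
  by apply: ccontM wt_cont; exact: phi_cont hx.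
apply: eq_cintegral => s _; rewrite (phi_shift s dx hx) exprS; ring.
Qed.

Let J_cancel n m x : J n.+1 m.+1 x = J n m x.
Proof.
apply: eq_cintegral => s _; rewrite !exprS invfM; move: (rexp_neq0 s).
by move: (r%:C * expi s) => u u0; field; rewrite u0 expf_neq0.
Qed.

Let geom0 (a : C) (q D : R) : 0 <= q -> q < 1 -> 0 <= D ->
  (forall n : nat, cabs a <= D * q ^+ n) -> a = 0.
Proof.
move=> q0 q1 D0 h; rewrite -[a]subr0; apply: eq_of_cabs_le => e e0; rewrite !subr0.
have qn : `|q| < 1 by rewrite ger0_norm.
have /cvgrPdist_le/(_ (e / (D + 1))) := cvg_expr qn.
move=> [|N _ hN]; first by rewrite divr_gt0 // ltr_wpDl.
have := hN N (leqnn N); rewrite /= sub0r normrN ger0_norm ?exprn_ge0 // => hq.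
apply: le_trans (h N) _; apply: (@le_trans _ _ (D * (e / (D + 1)))).
  by rewrite ler_wpM2l.
rewrite mulrCA ler_piMr ?ltW // ltr_pdivrMr ?ltr_wpDl //; lra.
Qed.

Variable I : pred nat.
Hypothesis hI : blockset I.

(** When [c] is far from the diagonal on [I], [x] can be divided by [A - c] repeatedly. After [n]
    divisions the integral is [J n 0 y] with [y] of size [K / (r + b + 1) ^+ n], whereas the kernel
    has size [r ^+ n]; letting [n] grow gives 0. *)
Lemma contour_outside x K d : 0 < d ->
  (forall i, I i -> r + 2 * b + 1 + d <= cabs (c - (ev i)%:C)) ->
  supp I x -> l2le x K -> circle_integral c r (fun l => Psi (res l x)) = 0.
Proof.
move=> d0 far sx hx; have b0 := b_ge0; have K0 := l2le_ge0 hx.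
rewrite circle_phi.
have phib y L : supp I y -> l2le y L -> forall s, cabs (phi y s) <= CP * (L / (b + 1)).
  move=> sy hy s; apply: Psi_le; have [Ml h] := preg s.
  have [[[N hN] _] e _] := resP h hy.
  apply: (apriori (I := I) (l := p s) (L := N)) => //.
  - move=> i /far; have := cabs_sub_ge (c - (ev i)%:C) (c - p s).
    rewrite [cabs (c - p s)]cabsBC pE => h1 h2.
    have -> : p s - (ev i)%:C = c - (ev i)%:C - (c - p s) by ring.
    lra.
  - lra.
  - exact: (res_supp h hI hy sy).
  - by apply: eq_l2le hy => i; rewrite e.
have step (n : nat) : exists y, [/\ supp I y, l2le y (K / (r + b + 1) ^+ n) &
    cintegral `[0, 2 * pi] (fun s => phi x s * wt s) = J n 0 y].
  elim: n => [|n [y [sy hy e]]].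
    exists x; rewrite expr0 divr1; split=> //; apply: eq_cintegral => s _.
    by rewrite !expr0 invr1 !mul1r.
  have far' i : I i -> 2 * b + 1 <= cabs (c - (ev i)%:C).
    by move=> /far; have := r_gt0; lra.
  have [z0 [dz sz hz ez]] := far_solve hI far' sy hy.
  (* [far_solve] inverts [c - A], whence the sign. *)
  pose z := fun i => -1 * z0 i.
  have hzl : l2le z (K / (r + b + 1) ^+ n).
    by apply: l2leW hz => i; rewrite /z mulN1r cabsN.
  have szz : supp I z by move=> i /sz; rewrite /z => ->; rewrite mulr0.
  have dzz : dom z.
    have [_ [L hL]] := dz; split; first by eexists; exact: hzl.
    exists L; apply: l2leW hL => i; by rewrite /z mulN1r mulrN cabsN.
  have yE : y = fun i => A z i - c * z i.
    by apply/funext => i; rewrite -ez /z pertZ; ring.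
  exists z; split=> //; last first.
    by rewrite e yE (J_shift _ _ dzz hzl) /= mul0r subr0.
  rewrite exprS invfM mulrCA mulrC.
  apply: (apriori (I := I) (l := c) (d := r + b + 1) _ _ szz hzl) => //.
  - move=> i /far; lra.
  - have := r_gt0; lra.
  - by apply: l2leW hy => i; rewrite yE cabsBC.
have rb0 : 0 < r + b + 1 by have := r_gt0; lra.
apply: (@geom0 _ (r / (r + b + 1)) (CP * (K / (b + 1)) * r * (2 * pi))).
- by rewrite divr_ge0 ?(ltW r_gt0) // ltW.
- by rewrite ltr_pdivrMr // mul1r; lra.
- have b1 : 0 <= b + 1 by lra.
  by rewrite !mulr_ge0 ?invr_ge0 ?pi_ge0 ?(ltW r_gt0).
move=> n; have [y [sy hy ->]] := step n.
apply: le_trans (J_le n 0 hy (phib _ _ sy hy)) _.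
rewrite expr0 invr1 mulr1 expr_div_n le_eqVlt; apply/orP; left; apply/eqP; field.
by rewrite expf_neq0 ?gt_eqF //; lra.
Qed.

(** Here [x] is multiplied by [A - c]. The first step produces the residue [2 * pi *i * Psi x]; the
    remainder [J 0 n.+1 y] has a vector of size [K * (rho + b) ^+ n.+1] against a kernel of size
    [r ^- n.+1]. Finite support keeps all iterates in the domain. *)
Lemma contour_inside x K (rho : R) n0 : 0 <= rho -> rho + b < r ->
  (forall i, I i -> cabs (c - (ev i)%:C) <= rho) ->
  (forall i, I i -> (i < n0)%N) ->
  supp I x -> l2le x K ->
  circle_integral c r (fun l => Psi (res l x)) = 2 * pi *i * Psi x.
Proof.
move=> rho0 rhor near fin sx hx; have b0 := b_ge0; have K0 := l2le_ge0 hx.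
rewrite circle_phi; set d := r - rho - b.
have d0 : 0 < d by rewrite /d; lra.
have phib y L : supp I y -> l2le y L -> forall s, cabs (phi y s) <= CP * (L / d).
  move=> sy hy s; apply: Psi_le; have [Ml h] := preg s.
  have [[[N hN] _] e _] := resP h hy.
  apply: (apriori (I := I) (l := p s) (L := N)) => //; first last.
  - by apply: eq_l2le hy => i; rewrite e.
  - exact: (res_supp h hI hy sy).
  - move=> i /near; have := cabs_sub_ge (p s - c) ((ev i)%:C - c).
    rewrite [cabs ((ev i)%:C - c)]cabsBC pE => h1 h2.
    have -> : p s - (ev i)%:C = p s - c - ((ev i)%:C - c) by ring.
    rewrite /d; lra.
have sdom y : supp I y -> dom y.
  move=> sy; have fz i : (n0 <= i)%N -> y i = 0.
    by move=> ni; apply: sy; apply/negP => /fin; rewrite ltnNge ni.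
  split; first by eexists; apply: l1_l2 (l1le_fin fz).
  by eexists; apply: l1_l2 (@l1le_fin _ n0 _ _) => j /fz ->; rewrite mulr0.
have step (n : nat) : exists y, [/\ supp I y, l2le y (K * (rho + b) ^+ n.+1) &
    cintegral `[0, 2 * pi] (fun s => phi x s * wt s) = 2 * pi *i * Psi x + J 0 n.+1 y].
  have shift y L : supp I y -> l2le y L ->
      supp I (fun i => A y i - c * y i) /\ l2le (fun i => A y i - c * y i) (L * (rho + b)).
    move=> sy hy; split.
      move=> i ni; rewrite sy // mulr0 subr0 -(supp_restr sy) pert_restr //.
      exact: restr_supp.
    have h : l2le (fun i => ((ev i)%:C - c) * y i) (L * rho).
      have := l2leZ rho%:C hy; rewrite cabs_real ger0_norm // mulrC.
      apply: l2leW => i; rewrite !cabsM cabs_real [`|rho|]ger0_norm //.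
      have [/near Ii|/sy ->] := boolP (I i); last by rewrite cabs0 !mulr0.
      by rewrite ler_wpM2r ?cabs_ge0 // cabsBC.
    have := l2leB h (B_bnd hy); rewrite mulrDr [b * L]mulrC.
    by apply: eq_l2le => i; rewrite /pert; ring.
  elim: n => [|n [y [sy hy e]]].
    have [s1 h1] := shift _ _ sx hx; exists (fun i => A x i - c * x i); split=> //.
    rewrite (J_shift 0 1 (sdom _ sx) hx) eqxx J_cancel.
    rewrite addrC subrK; apply: eq_cintegral => s _.
    by rewrite !expr0 invr1 !mul1r.
  have [s1 h1] := shift _ _ sy hy; exists (fun i => A y i - c * y i); split=> //.
    by rewrite exprSr mulrA.
  by rewrite e (J_shift 0 n.+2 (sdom _ sy) hy) /= mul0r subr0 J_cancel.
apply/eqP; rewrite -subr_eq0; apply/eqP.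
have r0 := r_gt0.
apply: (@geom0 _ ((rho + b) / r) (CP * (K * ((rho + b) / r) / d) * r * (2 * pi))).
- by rewrite divr_ge0 ?addr_ge0 // ltW.
- by rewrite ltr_pdivrMr // mul1r.
- by rewrite !mulr_ge0 ?divr_ge0 ?pi_ge0 ?addr_ge0 ?invr_ge0 ?(ltW r_gt0) ?(ltW d0).
move=> n; have [y [sy hy ->]] := step n; rewrite addrC addKr.
apply: le_trans (J_le 0 n.+1 hy (phib _ _ sy hy)) _.
rewrite expr0 mul1r expr_div_n !exprS.
rewrite le_eqVlt; apply/orP; left; apply/eqP; field.
by rewrite expf_neq0 ?gt_eqF.
Qed.

End Contour.

End BlockResolvent.

(** * The space [L_2] *)

Section L2Space.
Context {R : realType}.
Local Notation C := R[i].
Local Notation mu := (@lebesgue_measure R).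
Variable w : R.
Hypothesis w_gt0 : 0 < w.
Local Notation D := (`[0, w]%classic : set R).
Implicit Types (f g x y : R -> C).

Let mD : @measurable _ (measurableTypeR R) D.
Proof. exact: measurable_itv. Qed.

Lemma conj_real (a : R) : (a%:C)^* = a%:C :> C.
Proof. exact: conjc_real. Qed.

Lemma aeS (P Q : R -> Prop) : (forall t, P t -> Q t) ->
  {ae mu, forall t, P t} -> {ae mu, forall t, Q t}.
Proof. by move=> h; apply: filterS h; exact: (ae_filter_ringOfSetsType mu). Qed.

Lemma aeS2 (P1 P2 Q : R -> Prop) : (forall t, P1 t -> P2 t -> Q t) ->
  {ae mu, forall t, P1 t} -> {ae mu, forall t, P2 t} -> {ae mu, forall t, Q t}.
Proof. by move=> h; apply: filterS2 h; exact: (ae_filter_ringOfSetsType mu). Qed.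

Lemma lebesgue_itv0 : fine (mu D) = w.
Proof.
have e := @lebesgue_measure_itv R `[0, w].
etransitivity; first exact: (f_equal (@fine R) e).
by rewrite /= lte_fin w_gt0 /= subr0.
Qed.

Lemma integrable_cst_itv (K : R) : mu.-integrable D (fun=> K%:E).
Proof.
apply: continuous_compact_integrable; first exact: segment_compact.
by apply: continuous_subspaceT => t; exact: cvg_cst.
Qed.

Lemma cmeasurableD f g : cmeasurable D f -> cmeasurable D g ->
  cmeasurable D (fun t => f t + g t).
Proof.
move=> [f1 f2] [g1 g2]; split.
  apply: (eq_measurable_fun _ _ (measurable_funD f1 g1)) => t _ /=.
  by case: (f t); case: (g t).
apply: (eq_measurable_fun _ _ (measurable_funD f2 g2)) => t _ /=.
by case: (f t); case: (g t).
Qed.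

Lemma cmeasurableM f g : cmeasurable D f -> cmeasurable D g ->
  cmeasurable D (fun t => f t * g t).
Proof.
move=> [f1 f2] [g1 g2]; split.
  apply: (eq_measurable_fun _ _ (measurable_funB (measurable_funM f1 g1) (measurable_funM f2 g2))) => t _ /=.
  by case: (f t); case: (g t).
apply: (eq_measurable_fun _ _ (measurable_funD (measurable_funM f1 g2) (measurable_funM f2 g1))) => t _ /=.
by case: (f t); case: (g t).
Qed.

Lemma cmeasurable_cst c : cmeasurable D (fun=> c).
Proof. by split; exact: measurable_cst. Qed.

Lemma cmeasurable_conj f : cmeasurable D f -> cmeasurable D (fun t => (f t)^*).
Proof.
move=> [f1 f2]; split.
  by apply: (eq_measurable_fun _ _ f1) => t _; case: (f t).
have -> : (fun t => complex.Im (f t)^*) = \- (fun t => complex.Im (f t)).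
  by apply/funext => t /=; case: (f t).
exact: measurable_funN.
Qed.

Lemma cmeasurable_lim (F : nat -> R -> C) f : (forall n, cmeasurable D (F n)) ->
  (forall t, D t -> ccvg (F^~ t) (f t)) -> cmeasurable D f.
Proof.
have aux (p : C -> R) : (forall z y : C, `|p z - p y| <= cabs (z - y)) ->
    (forall n, measurable_fun D (fun t => p (F n t))) ->
    (forall t, D t -> ccvg (F^~ t) (f t)) -> measurable_fun D (fun t => p (f t)).
  move=> hp mF cF; apply: (measurable_fun_cvg mF) => t Dt.
  apply/cvgrPdist_le => e e0; have [N hN] := cF t Dt e e0.
  exists N => // n Nn /=; apply: le_trans (hp _ _) _; rewrite cabsBC; exact: hN.
move=> mF cF; split.
  apply: aux cF => [z y|n]; last by case: (mF n).
  by apply: le_trans (Re_le_cabs _); case: z y => ? ? [].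
apply: aux cF => [z y|n]; last by case: (mF n).
by apply: le_trans (Im_le_cabs _); case: z y => ? ? [].
Qed.

Lemma ccont_cmeasurable f : ccont f -> cmeasurable D f.
Proof.
by move=> hf; apply: cintegrable_meas; exact: ccont_integrable.
Qed.

Definition sq_integrable f := mu.-integrable D (fun t => ((cabs (f t)) ^+ 2)%:E).

(** Trades finiteness of an extended norm for integrability of the square, the form in which closure
    properties are proved. *)
Lemma inL2P f : inL2 w f <-> cmeasurable D f /\ sq_integrable f.
Proof.
have key : measurable_fun D (fun t => ((cabs (f t)) ^+ 2)%:E) ->
    (l2norm w f < +oo)%E <-> sq_integrable f.
  move=> mf; rewrite /l2norm /sq_integrable.
  have nn : (\int[mu]_(t in D) `|((cabs (f t)) ^+ 2)%:E| =
      \int[mu]_(t in D) ((cabs (f t)) ^+ 2)%:E)%E.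
    by apply: eq_integral => t _; rewrite gee0_abs // lee_fin sqr_ge0.
  have p0 : (0 <= \int[mu]_(t in D) ((cabs (f t)) ^+ 2)%:E)%E.
    by apply: integral_ge0 => t _; rewrite lee_fin sqr_ge0.
  split=> [h|/integrableP[_]].
    apply/integrableP; split => //; rewrite nn.
    case: (\int[mu]_(t in D) _)%E h p0 => [r| |] //= h p0.
      by rewrite ltry.
    by move: h; rewrite mulry gtr0_sg ?invr_gt0 // mul1e.
  rewrite nn; case: (\int[mu]_(t in D) _)%E p0 => [r| |] //= _ _.
  by rewrite ltry.
split=> [[m1 m2 h]|[[m1 m2] h]].
  split=> //; apply/key => //; apply/measurable_EFinP/measurable_funX.
  exact: cabs_measurable.
split=> //; apply/key => //; apply/measurable_EFinP/measurable_funX.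
exact: cabs_measurable.
Qed.

Lemma inL2_meas f : inL2 w f -> cmeasurable D f.
Proof. by move=> /inL2P[]. Qed.

(** The squared norm as a real number, with the same normalisation as [inner]. *)
Definition n2 f : R := w^-1 * \int[mu]_(t in D) cabs (f t) ^+ 2.

Lemma n2_ge0 f : 0 <= n2 f.
Proof.
by rewrite /n2 mulr_ge0 ?invr_ge0 ?(ltW w_gt0) // Rintegral_ge0 // => t _; exact: sqr_ge0.
Qed.

Lemma l2norm_n2 f : inL2 w f -> l2norm w f = (Num.sqrt (n2 f))%:E.
Proof.
move=> /inL2P[_ h]; rewrite /l2norm /n2 /Rintegral.
have /integrable_fin_num := h => /(_ mD) /fineK {1}<-.
by rewrite -EFinM.
Qed.

Lemma bounded_inL2 f K : cmeasurable D f -> (forall t, D t -> cabs (f t) <= K) -> inL2 w f.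
Proof.
move=> mf hK; apply/inL2P; split=> //.
apply: (le_integrable mD _ _ (integrable_cst_itv (K ^+ 2))).
  by apply/measurable_EFinP/measurable_funX; exact: cabs_measurable.
move=> t Dt; rewrite /= lee_fin !ger0_norm ?sqr_ge0 //.
by rewrite ler_pXn2r ?nnegrE ?cabs_ge0 ?(le_trans (cabs_ge0 _) (hK _ Dt)) // hK.
Qed.

Lemma inL2_mulb f g K : inL2 w f -> cmeasurable D g -> (forall t, D t -> cabs (g t) <= K) ->
  inL2 w (fun t => f t * g t).
Proof.
have K0 : (forall t, D t -> cabs (g t) <= K) -> 0 <= K.
  move=> h; apply: le_trans (cabs_ge0 _) (h 0 _).
  by rewrite /= in_itv /= lexx ltW.
move=> /inL2P[mf hf] mg hK; have {}K0 := K0 hK.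
apply/inL2P; split; first exact: cmeasurableM.
apply: (le_integrable mD _ _ (integrableZl mD (K ^+ 2) hf)).
  by apply/measurable_EFinP/measurable_funX; apply: cabs_measurable; exact: cmeasurableM.
move=> t Dt; rewrite -EFinM /= lee_fin !ger0_norm ?mulr_ge0 ?sqr_ge0 ?cabs_ge0 //.
rewrite cabsM exprMn mulrC ler_wpM2r ?sqr_ge0 //.
by rewrite ler_pXn2r ?nnegrE ?cabs_ge0 // hK.
Qed.

Lemma inL2D f g : inL2 w f -> inL2 w g -> inL2 w (fun t => f t + g t).
Proof.
move=> /inL2P[mf hf] /inL2P[mg hg]; apply/inL2P; split; first exact: cmeasurableD.
apply: (le_integrable mD _ _ (integrableZl mD 2 (integrableD mD hf hg))).
  by apply/measurable_EFinP/measurable_funX; apply: cabs_measurable; exact: cmeasurableD.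
move=> t Dt; rewrite -EFinD -EFinM /= lee_fin !ger0_norm ?mulr_ge0 ?addr_ge0 ?sqr_ge0 ?cabs_ge0 //.
apply: (@le_trans _ _ ((cabs (f t) + cabs (g t)) ^+ 2)).
  have c0 := cabs_ge0 (f t + g t); have f0 := cabs_ge0 (f t); have g0 := cabs_ge0 (g t).
  by rewrite ler_pXn2r ?nnegrE ?addr_ge0 // cabsD.
have := sqr_ge0 (cabs (f t) - cabs (g t)); rewrite !expr2; lra.
Qed.

Lemma inL2Z c f : inL2 w f -> inL2 w (fun t => c * f t).
Proof.
move=> hf; have := inL2_mulb (g := fun=> c) hf (cmeasurable_cst c) (fun t _ => lexx (cabs c)).
by congr inL2; apply/funext => t; rewrite mulrC.
Qed.

Lemma inL2B f g : inL2 w f -> inL2 w g -> inL2 w (fun t => f t - g t).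
Proof.
move=> hf hg; have := inL2D hf (inL2Z (-1) hg).
by congr inL2; apply/funext => t; rewrite mulN1r.
Qed.

Lemma inL2_conj f : inL2 w f -> inL2 w (fun t => (f t)^*).
Proof.
move=> /inL2P[mf hf]; apply/inL2P; split; first exact: cmeasurable_conj.
by apply: (eq_integrable mD _ _ _ hf) => t _; rewrite cabs_conj.
Qed.

Lemma inL2_0 : inL2 w (fun=> 0).
Proof. by apply: (@bounded_inL2 _ 0 (cmeasurable_cst 0)) => t _; rewrite cabs0. Qed.

Lemma inL2_sum n (F : nat -> R -> C) : (forall i, inL2 w (F i)) ->
  inL2 w (fun t => \sum_(i < n) F i t).
Proof.
move=> h; elim: n => [|n IH].
  by have := inL2_0; congr inL2; apply/funext => t; rewrite big_ord0.
by have := inL2D IH (h n); congr inL2; apply/funext => t; rewrite big_ord_recr.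
Qed.

Lemma L2_mul f g : inL2 w f -> inL2 w g -> cintegrable D (fun t => f t * (g t)^*).
Proof.
move=> /inL2P[mf hf] /inL2P[mg hg].
apply: (le_cintegrable (g := fun t => 1 * (cabs (f t) ^+ 2 + cabs (g t) ^+ 2)) mD).
- by apply: cmeasurableM => //; exact: cmeasurable_conj.
- by apply: (eq_integrable mD _ _ _ (integrableD mD hf hg)) => t _; rewrite mul1r EFinD.
- move=> t _; rewrite cabsM cabs_conj.
  have := sqr_ge0 (cabs (f t) - cabs (g t)); have := sqr_ge0 (cabs (f t) + cabs (g t)).
  rewrite !expr2; lra.
Qed.

Lemma L2_cintegrable f : inL2 w f -> cintegrable D f.
Proof.
move=> hf; have h1 : inL2 w (fun=> 1).
  by apply: (@bounded_inL2 _ 1 (cmeasurable_cst 1)) => t _; rewrite cabs1.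
by apply: (eq_cintegrable mD _ (L2_mul hf h1)) => t _; rewrite rmorph1 mulr1.
Qed.

Lemma eq_inner f g y : (forall t, f t = g t) -> inner w f y = inner w g y.
Proof. by move=> /funext ->. Qed.

Lemma innerDl f g y : inL2 w f -> inL2 w g -> inL2 w y ->
  inner w (fun t => f t + g t) y = inner w f y + inner w g y.
Proof.
move=> hf hg hy; rewrite /inner -mulrDr -(cintegralD mD (L2_mul hf hy) (L2_mul hg hy)).
by congr (_ * _); apply: eq_cintegral => t _; rewrite mulrDl.
Qed.

Lemma innerZl c f y : inL2 w f -> inL2 w y ->
  inner w (fun t => c * f t) y = c * inner w f y.
Proof.
move=> hf hy; rewrite /inner mulrCA -(cintegralZ mD c (L2_mul hf hy)).
by congr (_ * _); apply: eq_cintegral => t _; rewrite mulrA.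
Qed.

Lemma innerBl f g y : inL2 w f -> inL2 w g -> inL2 w y ->
  inner w (fun t => f t - g t) y = inner w f y - inner w g y.
Proof.
move=> hf hg hy; rewrite -mulN1r -innerZl // -innerDl //; last exact: inL2Z.
by apply: eq_inner => t; rewrite mulN1r.
Qed.

Lemma inner_conj f y : inL2 w f -> inL2 w y -> inner w y f = (inner w f y)^*.
Proof.
move=> hf hy; rewrite /inner rmorphM /= -(cintegral_conj mD (L2_mul hf hy)).
rewrite conj_real; congr (_ * _).
by apply: eq_cintegral => t _; rewrite rmorphM /= conjCK mulrC.
Qed.

Lemma innerDr f g y : inL2 w f -> inL2 w g -> inL2 w y ->
  inner w y (fun t => f t + g t) = inner w y f + inner w y g.
Proof.
move=> hf hg hy; rewrite inner_conj ?innerDl ?rmorphD //=; last exact: inL2D.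
by rewrite -!inner_conj.
Qed.

Lemma innerBr f g y : inL2 w f -> inL2 w g -> inL2 w y ->
  inner w y (fun t => f t - g t) = inner w y f - inner w y g.
Proof.
move=> hf hg hy; rewrite inner_conj ?innerBl ?rmorphB //=; last exact: inL2B.
by rewrite -!inner_conj.
Qed.

Lemma inner_suml n (F : nat -> R -> C) y : (forall i, inL2 w (F i)) -> inL2 w y ->
  inner w (fun t => \sum_(i < n) F i t) y = \sum_(i < n) inner w (F i) y.
Proof.
move=> hF hy; elim: n => [|n IH].
  rewrite big_ord0 /inner (eq_cintegral (g := fun=> 0)) ?cintegral0 ?mulr0 // => t _.
  by rewrite big_ord0 mul0r.
rewrite big_ord_recr /= -IH -innerDl //; last exact: inL2_sum.
by apply: eq_inner => t; rewrite big_ord_recr.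
Qed.

Lemma inner_mul_conj q f g : inner w (fun t => q t * f t) g =
  inner w f (fun t => (q t)^* * g t).
Proof.
congr (_ * _); apply: eq_cintegral => t _.
by rewrite rmorphM /= conjCK mulrA [f t * _]mulrC.
Qed.

Lemma inner_n2 f : inL2 w f -> inner w f f = (n2 f)%:C.
Proof.
move=> hf; rewrite /inner /cintegral /n2.
have -> : \int[mu]_(t in D) complex.Im (f t * (f t)^*) = 0.
  transitivity (\int[mu]_(t in D) (0 : R)); last by rewrite /Rintegral integral0.
  by apply: eq_Rintegral => t _; rewrite mulcJ_sqr.
have -> : \int[mu]_(t in D) complex.Re (f t * (f t)^*) = \int[mu]_(t in D) cabs (f t) ^+ 2.
  by apply: eq_Rintegral => t _; rewrite mulcJ_sqr.
by simpc.
Qed.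

Lemma l2eq_cintegral f g : cmeasurable D f -> cmeasurable D g ->
  l2eq w f g -> cintegral D f = cintegral D g.
Proof.
move=> [f1 f2] [g1 g2] fg; rewrite /cintegral /Rintegral; congr (fine _ +i* fine _).
  apply: ae_eq_integral => //; [exact/measurable_EFinP|exact/measurable_EFinP|].
  by apply: aeS fg => t h Dt; rewrite h.
apply: ae_eq_integral => //; [exact/measurable_EFinP|exact/measurable_EFinP|].
by apply: aeS fg => t h Dt; rewrite h.
Qed.

Lemma l2eq_inner f g y : inL2 w f -> inL2 w g -> inL2 w y -> l2eq w f g ->
  inner w f y = inner w g y.
Proof.
move=> /inL2_meas hf /inL2_meas hg /inL2_meas hy fg; congr (_ * _).
apply: l2eq_cintegral; [apply: cmeasurableM => //; exact: cmeasurable_conj ..|].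
by apply: aeS fg => t h Dt; rewrite h.
Qed.

Lemma l2eq_n2 f g : inL2 w f -> inL2 w g -> l2eq w f g -> n2 f = n2 g.
Proof.
move=> /inL2_meas hf /inL2_meas hg fg; congr (_ * fine _).
apply: ae_eq_integral => //.
- by apply/measurable_EFinP/measurable_funX; exact: cabs_measurable.
- by apply/measurable_EFinP/measurable_funX; exact: cabs_measurable.
- by apply: aeS fg => t h Dt; rewrite h.
Qed.

Lemma l2eq_refl f : l2eq w f f.
Proof. exact: aeW. Qed.

(** * Orthonormal systems: coefficients and synthesis *)

Section Orthonormal.
Variable e : nat -> R -> C.
Hypothesis e_L2 : forall i, inL2 w (e i).
Hypothesis e_on : forall i j, inner w (e i) (e j) = (i == j)%:R.

Lemma lincomb_L2 n (a : nat -> C) : inL2 w (fun t => \sum_(i < n) a i * e i t).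
Proof. exact: (@inL2_sum n (fun i t => a i * e i t) (fun i => inL2Z (a i) (e_L2 i))). Qed.

Let term_L2 (a : nat -> C) i : inL2 w (fun t => a i * e i t).
Proof. exact: inL2Z. Qed.

Lemma inner_lincomb n (a : nat -> C) j :
  inner w (fun t => \sum_(i < n) a i * e i t) (e j) = if (j < n)%N then a j else 0.
Proof.
rewrite (@inner_suml n (fun i t => a i * e i t) _ (term_L2 a)) //.
under eq_bigr do rewrite innerZl // e_on.
case: ifPn => jn.
  rewrite (bigD1 (Ordinal jn)) //= eqxx mulr1 big1 ?addr0 // => i.
  by rewrite -val_eqE /= => /negPf ->; rewrite mulr0.
rewrite big1 // => i _; case: eqP => [ij|_]; last by rewrite mulr0.
by move: jn; rewrite -ij ltn_ord.
Qed.

Lemma inner_lincomb_r n (a : nat -> C) x : inL2 w x ->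
  inner w x (fun t => \sum_(i < n) a i * e i t) = \sum_(i < n) (a i)^* * inner w x (e i).
Proof.
move=> hx; rewrite inner_conj //; last exact: lincomb_L2.
rewrite (@inner_suml n (fun i t => a i * e i t) _ (term_L2 a)) //.
rewrite rmorph_sum /=; apply: eq_bigr => i _.
by rewrite innerZl // rmorphM /= -inner_conj.
Qed.

Lemma n2_lincomb n (a : nat -> C) :
  n2 (fun t => \sum_(i < n) a i * e i t) = \sum_(i < n) cabs (a i) ^+ 2.
Proof.
have h := lincomb_L2 n a.
apply: (@complexI R); rewrite -inner_n2 // inner_lincomb_r // rmorph_sum /=.
by apply: eq_bigr => i _; rewrite inner_lincomb ltn_ord mulrC mulcJ_sqr.
Qed.

Lemma bessel x : inL2 w x -> l2le (fun i => inner w x (e i)) (Num.sqrt (n2 x)).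
Proof.
move=> hx; split=> [|n]; first exact: sqrtr_ge0.
rewrite sqr_sqrtr ?n2_ge0 //; set a := fun i => inner w x (e i).
pose s t := \sum_(i < n) a i * e i t.
have hs : inL2 w s := lincomb_L2 n a.
have hxs : inL2 w (fun t => x t - s t) by exact: inL2B.
rewrite -subr_ge0; apply: le_trans (n2_ge0 (fun t => x t - s t)) _.
suff -> : n2 (fun t => x t - s t) = n2 x - \sum_(i < n) cabs (a i) ^+ 2 by [].
apply: (@complexI R); rewrite -inner_n2 // innerBl //.
have -> : inner w s (fun t => x t - s t) = 0.
  rewrite inner_conj // innerBl // !inner_lincomb_r //.
  under [X in _ - X]eq_bigr do rewrite inner_lincomb ltn_ord.
  by rewrite subrr rmorph0.
rewrite subr0 innerBr // inner_n2 // inner_lincomb_r // [RHS]rmorphB rmorph_sum.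
by congr (_ - _); apply: eq_bigr => i _; rewrite mulrC mulcJ_sqr.
Qed.

(** Testing [psi] on the combination with coefficients conjugate to [psi (e i)] bounds the partial
    sum [S] by [K] times its root. This controls a functional along an arbitrary orthonormal basis,
    as [hs_norm] demands. *)
Lemma bessel_functional (psi : (R -> C) -> C) K : 0 <= K ->
  (forall n (a : nat -> C), psi (fun t => \sum_(i < n) a i * e i t) =
     \sum_(i < n) a i * psi (e i)) ->
  (forall x, inL2 w x -> cabs (psi x) <= K * Num.sqrt (n2 x)) ->
  l2le (fun i => psi (e i)) K.
Proof.
move=> K0 lin bd; split=> // n.
pose a i := (psi (e i))^*.
have h := lincomb_L2 n a.
have := bd _ h; rewrite lin n2_lincomb.
have -> : \sum_(i < n) a i * psi (e i) = (\sum_(i < n) cabs (psi (e i)) ^+ 2)%:C.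
  by rewrite rmorph_sum; apply: eq_bigr => i _; rewrite mulrC mulcJ_sqr.
have -> : \sum_(i < n) cabs (a i) ^+ 2 = \sum_(i < n) cabs (psi (e i)) ^+ 2.
  by apply: eq_bigr => i _; rewrite cabs_conj.
set S := \sum_(i < n) _; have S0 : 0 <= S by apply: sumr_ge0 => i _; exact: sqr_ge0.
rewrite cabs_real ger0_norm // -{1}(sqr_sqrtr S0) expr2.
have [s0|sn0] := eqVneq (Num.sqrt S) 0 => [_|].
  by rewrite -(sqr_sqrtr S0) s0 expr0n sqr_ge0.
rewrite ler_pM2r; last by rewrite lt_neqAle eq_sym sn0 sqrtr_ge0.
by rewrite -(ler_pXn2r (n := 2)) ?nnegrE ?sqrtr_ge0 // sqr_sqrtr.
Qed.

Variable E : R.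
Hypothesis e_bnd : forall i t, cabs (e i t) <= E.
Implicit Types (z : nat -> C).

Let E_ge0 : 0 <= E := le_trans (cabs_ge0 _) (e_bnd 0 0).

(** A pointwise sum, uniformly convergent for [z] in l^1 because the basis is uniformly bounded.
    Since the domain lies in l^1, no limit in L_2 has to be taken. *)
Definition synth z : R -> C := fun t => csum (fun i => z i * e i t).

Lemma synth_l1 z K t : l1le z K -> l1le (fun i => z i * e i t) (K * E).
Proof.
move=> hz; rewrite mulrC -(ger0_norm E_ge0) -cabs_real.
apply: l1leW (l1leZ E%:C hz) => i; rewrite !cabsM cabs_real ger0_norm // mulrC.
by rewrite ler_wpM2r ?cabs_ge0.
Qed.

Lemma synth_bnd z K t : l1le z K -> cabs (synth z t) <= K * E.
Proof. by move=> hz; apply: csum_le; exact: synth_l1. Qed.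

Lemma synth_meas z K : l1le z K -> cmeasurable D (synth z).
Proof.
move=> hz; apply: (cmeasurable_lim (F := fun n t => \sum_(i < n) z i * e i t)).
  by move=> n; apply: inL2_meas; exact: lincomb_L2.
by move=> t _; apply: csumP (synth_l1 t hz).
Qed.

Lemma synth_L2 z K : l1le z K -> inL2 w (synth z).
Proof.
by move=> hz; apply: (bounded_inL2 (synth_meas hz)) => t _; exact: synth_bnd hz.
Qed.

Lemma inner_bnd f y L : inL2 w f -> inL2 w y -> (forall t, cabs (f t) <= L) ->
  cabs (inner w f y) <= L * (w^-1 * \int[mu]_(t in D) cabs (y t)).
Proof.
move=> hf hy hL; rewrite /inner cabsM cabs_real ger0_norm ?invr_ge0 ?(ltW w_gt0) //.
rewrite mulrCA ler_wpM2l ?invr_ge0 ?(ltW w_gt0) //.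
have hfy := L2_mul hf hy; have iy := cabs_integrable mD (L2_cintegrable hy).
apply: le_trans (cabs_cintegral_le mD hfy) _.
rewrite -RintegralZl //; apply: le_Rintegral => //.
- exact: cabs_integrable.
- by apply: (eq_integrable mD _ _ _ (integrableZl mD L iy)) => t _; rewrite -EFinM.
- by move=> t _; rewrite cabsM cabs_conj ler_wpM2r ?cabs_ge0.
Qed.

Lemma inner_l1 z K y : l1le z K -> inL2 w y ->
  exists L, l1le (fun i => z i * inner w (e i) y) L.
Proof.
move=> hz hy; set L := E * (w^-1 * \int[mu]_(t in D) cabs (y t)).
have L0 : 0 <= L := le_trans (cabs_ge0 _) (inner_bnd (e_L2 0) hy (e_bnd 0)).
exists (L * K); rewrite -{1}(ger0_norm L0) -cabs_real.
apply: l1leW (l1leZ L%:C hz) => i; rewrite cabsM [leRHS]cabsM cabs_real ger0_norm // mulrC.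
by rewrite ler_wpM2r ?cabs_ge0 // inner_bnd.
Qed.

(** Partial sums converge uniformly, which suffices against the integrable function [y]. *)
Lemma inner_synth z K y : l1le z K -> inL2 w y ->
  inner w (synth z) y = csum (fun i => z i * inner w (e i) y).
Proof.
move=> hz hy; have [L hL] := inner_l1 hz hy.
symmetry; apply: csum_unique => d d0.
set V := E * (w^-1 * \int[mu]_(t in D) cabs (y t)).
have V0 : 0 <= V := le_trans (cabs_ge0 _) (inner_bnd (e_L2 0) hy (e_bnd 0)).
have d1 : 0 < d / (V + 1) by rewrite divr_gt0 // ltr_wpDl.
have [N hN] := real_bounded_cauchy (fun i => cabs_ge0 (z i)) hz d1.
exists N => n Nn.
have <- : inner w (fun t => \sum_(i < n) z i * e i t) y = \sum_(i < n) z i * inner w (e i) y.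
  rewrite (@inner_suml n (fun i t => z i * e i t) _ (term_L2 z)) //.
  by apply: eq_bigr => i _; rewrite innerZl.
rewrite cabsBC -innerBl //; [|exact: synth_L2 hz|exact: lincomb_L2].
have tl : l1le (fun i => if (i < n)%N then 0 else z i) (d / (V + 1)).
  move=> m; case: (leqP n m) => nm; last first.
    by rewrite big1 ?ltW // => i _; rewrite (ltn_trans (ltn_ord i) nm) cabs0.
  apply: le_trans (hN m (leq_trans Nn nm)).
  rewrite -(big_mkord xpredT (fun i => cabs (if (i < n)%N then 0 else z i))).
  rewrite (big_cat_nat (leq0n n) nm) /= big_nat big1 ?add0r => [|i /andP[_ ->]]; last exact: cabs0.
  rewrite [leRHS](big_cat_nat Nn nm) /= ler_wpDl ?sumr_ge0 // => [i _|]; first exact: cabs_ge0.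
  by rewrite big_nat [leRHS]big_nat; apply: ler_sum => i /andP[Ni _]; rewrite ltnNge Ni.
have sm t : cabs (synth z t - \sum_(i < n) z i * e i t) <= d / (V + 1) * E.
  have -> : \sum_(i < n) z i * e i t = csum (fun i => (if (i < n)%N then z i else 0) * e i t).
    rewrite (@csum_fin _ n); first by apply: eq_bigr => i _; rewrite ltn_ord.
    by move=> i; rewrite leqNgt => /negPf ->; rewrite mul0r.
  rewrite -(csumB (synth_l1 t hz) (synth_l1 t (l1le_cut n hz))).
  apply: le_trans (synth_bnd t tl); rewrite /synth.
  rewrite (eq_csum (b := fun i => (if (i < n)%N then 0 else z i) * e i t)) //.
  by move=> i; case: ifP => _; rewrite ?mul0r ?subrr ?subr0.
have hB := inL2B (synth_L2 hz) (lincomb_L2 n z).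
apply: le_trans (inner_bnd hB hy sm) _.
have -> : d / (V + 1) * E * (w^-1 * \int[mu]_(t in D) cabs (y t)) = d * V / (V + 1).
  by rewrite /V; ring.
by rewrite ler_pdivrMr ?ltr_wpDl // ler_pM2l // lerDl.
Qed.

Lemma coef_synth z K j : l1le z K -> inner w (synth z) (e j) = z j.
Proof.
move=> hz; rewrite (inner_synth hz (e_L2 j)).
by under eq_csum do rewrite e_on; exact: csum_delta.
Qed.

Lemma n2_synth z K L : l1le z K -> l2le z L -> n2 (synth z) <= L ^+ 2.
Proof.
move=> hz h2; have h := synth_L2 hz; have := inner_n2 h.
rewrite (inner_synth hz h) => e1.
have : cabs (csum (fun i => z i * inner w (e i) (synth z))) <= L * L.
  apply: csum_le; apply: l2_l1 => //; apply: l2leW h2 => i.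
  by rewrite inner_conj // cabs_conj (coef_synth i hz).
by rewrite e1 cabs_real ger0_norm ?n2_ge0.
Qed.

Lemma synthD z (y : nat -> C) K L t : l1le z K -> l1le y L ->
  synth (fun i => z i + y i) t = synth z t + synth y t.
Proof.
move=> hz hy; rewrite -(csumD (synth_l1 t hz) (synth_l1 t hy)).
by apply: eq_csum => i; rewrite mulrDl.
Qed.

Lemma synthZ c z K t : l1le z K -> synth (fun i => c * z i) t = c * synth z t.
Proof.
by move=> hz; rewrite -(csumZ c (synth_l1 t hz)); apply: eq_csum => i; rewrite mulrA.
Qed.

Section Potential.
Variable q : R -> C.
Hypothesis hq : inL2 w q.

Definition potmx i j : C := inner w (fun t => q t * e j t) (e i).

Lemma q_e_L2 j : inL2 w (fun t => q t * e j t).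
Proof. exact: (inL2_mulb hq (inL2_meas (e_L2 j)) (fun t _ => e_bnd j t)). Qed.

Lemma n2_q_e j : n2 (fun t => q t * e j t) <= E ^+ 2 * n2 q.
Proof.
have /inL2P[_ h1] := hq; have /inL2P[_ h2] := q_e_L2 j.
rewrite /n2 mulrCA ler_wpM2l ?invr_ge0 ?(ltW w_gt0) // -RintegralZl //.
apply: le_Rintegral => //.
  by apply: (eq_integrable mD _ _ _ (integrableZl mD (E ^+ 2) h1)) => t _; rewrite -EFinM.
move=> t _; rewrite cabsM exprMn mulrC ler_wpM2r ?sqr_ge0 //.
by rewrite ler_pXn2r ?nnegrE ?cabs_ge0.
Qed.

Lemma potmx_col : colb potmx (E * Num.sqrt (n2 q)).
Proof.
move=> j; apply: l2le_mono (bessel (q_e_L2 j)).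
rewrite -(@ler_pXn2r _ 2) ?nnegrE ?sqrtr_ge0 ?mulr_ge0 ?sqrtr_ge0 //.
by rewrite exprMn !sqr_sqrtr ?n2_ge0 // n2_q_e.
Qed.

(** [q] is moved to the other factor, so that the series alone is integrated term by term, against
    an L_2 function. *)
Lemma coef_q_synth z K i : l1le z K ->
  inner w (fun t => q t * synth z t) (e i) = mv potmx z i.
Proof.
move=> hz; rewrite inner_mul_conj (inner_synth hz).
  by apply: eq_csum => j; rewrite -inner_mul_conj mulrC.
have h := inL2_mulb (inL2_conj hq) (inL2_meas (e_L2 i)) (fun t _ => e_bnd i t).
exact: h.
Qed.

End Potential.

End Orthonormal.
End L2Space.

(** * Absolutely continuous functions *)

Section AbsoluteContinuity.
Context {R : realType}.
Local Notation mu := (@lebesgue_measure R).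
Implicit Types (f g F G : R -> R) (w x y : R).

Definition rac w f : Prop :=
  forall e : R, 0 < e -> exists2 d : R, 0 < d &
    forall (n : nat) (a b : nat -> R),
      (forall i, (i < n)%N -> [/\ 0 <= a i, a i <= b i & b i <= w]) ->
      (forall i j, (i < n)%N -> (j < n)%N -> i <> j ->
         b i <= a j \/ b j <= a i) ->
      \sum_(i < n) (b i - a i) < d ->
      \sum_(i < n) `|f (b i) - f (a i)| < e.

Lemma mu_itv_oc x y : x <= y -> mu (`]x, y]%classic : set R) = (y - x)%:E.
Proof.
move=> xy; have e := @lebesgue_measure_itv R `]x, y].
rewrite /= lte_fin in e; apply: etrans e _.
case: ltP => // yx; have -> : x = y by lra.
by rewrite subrr.
Qed.

Lemma mu_itv_cc x y : x <= y -> mu (`[x, y]%classic : set R) = (y - x)%:E.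
Proof.
move=> xy; have e := @lebesgue_measure_itv R `[x, y].
rewrite /= lte_fin in e; apply: etrans e _.
case: ltP => // yx; have -> : x = y by lra.
by rewrite subrr.
Qed.

Section CousinArgument.
Variables (w e : R) (f : R -> R) (O : set R).
Hypotheses (w_ge0 : 0 <= w) (e_gt0 : 0 < e) (openO : open O).
Hypothesis gauge : forall t, 0 <= t <= w -> O t \/
  exists2 d : R, 0 < d & forall s, 0 <= s <= w -> `|s - t| < d -> `|f s - f t| <= e * `|s - t|.

Let Mo x : R := fine (mu (O `&` `[0, x])).

Let mO : @measurable _ (measurableTypeR R) O.
Proof. exact: open_measurable. Qed.

Let mOx x : @measurable _ (measurableTypeR R) (O `&` `[0, x]).
Proof. by apply: measurableI => //; exact: measurable_itv. Qed.

Let fin_Mo x : 0 <= x -> mu (O `&` `[0, x]) = (Mo x)%:E.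
Proof.
move=> x0; rewrite fineK // ge0_fin_numE //.
apply: (@le_lt_trans _ _ (mu (`[0, x]%classic : set R))).
  by apply: le_measure; rewrite ?inE //; exact: measurable_itv.
by rewrite mu_itv_cc // ltry.
Qed.

Let Mo_add x y : 0 <= x -> x <= y -> `]x, y] `<=` O -> Mo x + (y - x) <= Mo y.
Proof.
move=> x0 xy xyO; have y0 := le_trans x0 xy.
have mxy : @measurable _ (measurableTypeR R) `]x, y] by exact: measurable_itv.
rewrite -lee_fin EFinD -!fin_Mo // -mu_itv_oc //.
rewrite -measureU //; last first.
  apply/seteqP; split=> // t [[_]] /=; rewrite !in_itv /= => /andP[_ tx] /andP[xt _].
  by move: (lt_le_trans xt tx); rewrite ltxx.
apply: le_measure; rewrite ?inE //; first exact: measurableU.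
move=> t [[Ot] | txy].
  by rewrite /= !in_itv /= => /andP[-> tx]; split=> //; exact: le_trans xy.
split; first exact: xyO.
by move: txy; rewrite /= !in_itv /= => /andP[xt ->]; rewrite (ltW (le_lt_trans x0 xt)).
Qed.

Let Mo_mono x y : 0 <= x -> x <= y -> Mo x <= Mo y.
Proof.
move=> x0 xy; have y0 := le_trans x0 xy; rewrite -lee_fin -!fin_Mo //.
apply: le_measure; rewrite ?inE // => t [Ot].
by rewrite /= !in_itv /= => /andP[-> tx]; split=> //; exact: le_trans xy.
Qed.

(** Bookkeeping of the increments of [f] up to [x]: those at points of small slope amount to
    [e * x], the others lie on intervals charged to the measure of [O], to which absolute continuity
    will apply. *)
Let good x : Prop := exists (n : nat) (a b : nat -> R),
  [/\ forall i, (i < n)%N -> [/\ 0 <= a i, a i <= b i & b i <= x],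
      forall i j, (i < n)%N -> (j < n)%N -> i <> j -> b i <= a j \/ b j <= a i,
      \sum_(i < n) (b i - a i) <= Mo x &
      `|f x - f 0| <= e * x + \sum_(i < n) `|f (b i) - f (a i)|].

(** Near a point [t] of [O] the whole interval from [x] to [y] joins the list. Otherwise the slopes
    on the two sides of [t] add [e * (y - x)], because [t] lies between [x] and [y]. *)
Let good_step x y t d : 0 <= x -> x <= t -> t <= y -> y <= w -> good x ->
  ball t d `<=` O \/ (forall s, 0 <= s <= w -> `|s - t| < d -> `|f s - f t| <= e * `|s - t|) ->
  t - d < x -> y < t + d -> good y.
Proof.
move=> x0 xt ty yw [n [a [b [h1 h2 h3 h4]]]] [bO|der] dx dy; last first.
  exists n, a, b; split=> //.
  - by move=> i /h1 [? ? bx]; split=> //; rewrite (le_trans bx) // (le_trans xt).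
  - by apply: le_trans h3 _; apply: Mo_mono => //; exact: le_trans ty.
  - have a1 : `|f y - f t| <= e * `|y - t|.
      apply: der; first by apply/andP; split=> //; rewrite (le_trans x0) // (le_trans xt).
      by rewrite ger0_norm; lra.
    have a2 : `|f x - f t| <= e * `|x - t|.
      apply: der; first by apply/andP; split=> //; lra.
      by rewrite ler0_norm; lra.
    have -> : f y - f 0 = (f y - f t) - (f x - f t) + (f x - f 0) by ring.
    apply: le_trans (ler_normD _ _) _; apply: le_trans (lerD (ler_normB _ _) h4) _.
    move: a1 a2; rewrite [`|y - t|]ger0_norm ?subr_ge0 // [`|x - t|]ler0_norm ?subr_le0 // => a1 a2.
    have := lerD a1 a2; lra.
have xy : x <= y by exact: le_trans ty.
exists n.+1, (fun i => if (i < n)%N then a i else x), (fun i => if (i < n)%N then b i else y).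
split.
- move=> i _; case: ifP => [/h1 [? ? bx]|_]; split=> //; exact: le_trans xy.
- move=> i j; rewrite !ltnS => ni nj ij.
  case: (ltnP i n) => hi; case: (ltnP j n) => hj; first exact: h2.
  + by left; case: (h1 _ hi).
  + by right; case: (h1 _ hj).
  + case: ij; have -> : i = n by apply/eqP; rewrite eqn_leq ni hi.
    by apply/eqP; rewrite eqn_leq nj hj.
- rewrite big_ord_recr /= ltnn.
  apply: le_trans (Mo_add x0 xy _); last first.
    move=> s; rewrite /= in_itv /= => /andP[xs sy]; apply: bO.
    by rewrite /ball /= ltr_distlC; apply/andP; split; lra.
  rewrite lerD2r; apply: le_trans h3; rewrite le_eqVlt; apply/orP; left; apply/eqP.
  by apply: eq_bigr => i _; rewrite ltn_ord.
- rewrite big_ord_recr /= ltnn.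
  have -> : \sum_(i < n) `|f (if (i < n)%N then b i else y) - f (if (i < n)%N then a i else x)| =
      \sum_(i < n) `|f (b i) - f (a i)|.
    by apply: eq_bigr => i _; rewrite ltn_ord.
  have -> : f y - f 0 = (f y - f x) + (f x - f 0) by ring.
  apply: le_trans (ler_normD _ _) _; have := h4; have := ler_wpM2l (ltW e_gt0) xy; lra.
Qed.

(* Cousin's lemma, by following the supremum of the good points. *)
Lemma cousin_bound : good w.
Proof.
have good0 : good 0.
  exists 0%N, (fun=> 0), (fun=> 0); split=> //; first by rewrite big_ord0 fine_ge0.
  by rewrite subrr normr0 mulr0 big_ord0 addr0.
pose A := [set x | 0 <= x <= w /\ good x].
have A0 : A 0 by split; rewrite ?lexx.
have hA : has_sup A by split; [exists 0 | exists w => x [/andP[]]].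
set s := sup A.
have s0 : 0 <= s by apply: sup_upper_bound hA _ A0.
have sw : s <= w by apply: ge_sup; [exists 0 | move=> x [/andP[]]].
have [d d0 dP] : exists2 d, 0 < d & ball s d `<=` O \/
    (forall u, 0 <= u <= w -> `|u - s| < d -> `|f u - f s| <= e * `|u - s|).
  have [Os|[d d0 hd]] := gauge (introT andP (conj s0 sw)); last by exists d => //; right.
  have := openO; rewrite openE => /(_ _ Os) /nbhs_ballP [d d0 hd].
  by exists d => //; left.
have [x [/andP[x0 xw] gx] dx] := sup_adherent d0 hA; rewrite -/s in dx.
have xs : x <= s by apply: sup_upper_bound hA _ _; split=> //; rewrite x0.
have gs : good s by apply: (good_step x0 xs (lexx s) sw gx dP dx); rewrite ltrDl.
have [<-//|ns] := eqVneq s w.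
have sltw : s < w by rewrite lt_neqAle ns.
pose y := Num.min w (s + d / 2).
have sy : s < y by rewrite lt_min sltw ltrDl divr_gt0.
have yd : y < s + d by rewrite gt_min; apply/orP; right; lra.
have yw : y <= w by rewrite ge_min lexx.
have gy : good y by apply: (good_step x0 xs (ltW sy) yw gx dP dx yd).
have : y <= s by apply: sup_upper_bound hA _ _; split=> //; rewrite yw (le_trans s0 (ltW sy)).
by rewrite leNgt sy.
Qed.

End CousinArgument.

(** The exceptional null set is covered by an open set whose measure is below the [d] of absolute
    continuity for [e / (w + 1)]; elsewhere slopes are at most [e / (w + 1)]. The bound of
    [cousin_bound] then adds up to [e]. The endpoints join the null set because the derivative is
    only known inside. *)
Lemma rac_const w f : 0 < w -> rac w f ->
  {ae mu, forall t, t \in `]0, w[ -> is_derive t (1 : R) f 0} -> f w = f 0.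
Proof.
move=> w0 hf [N [mN N0 hN]]; apply/eqP; rewrite -subr_eq0 -normr_eq0 eq_le normr_ge0 andbT.
apply/ler_addgt0Pr => e e0; rewrite add0r.
have w1 : 0 < w + 1 by lra.
have e1 : 0 < e / (w + 1) by rewrite divr_gt0.
have [d d0 hd] := hf _ e1.
have mN' : @measurable _ (measurableTypeR R) (N `|` [set 0; w]).
  by apply: measurableU => //; apply: measurableU; exact: measurable_set1.
have N'0 : mu (N `|` [set 0; w]) = 0%E.
  have m1 x : @measurable _ (measurableTypeR R) [set x] by exact: measurable_set1.
  have z0 : mu [set 0; w] = 0%E.
    by apply: etrans (measureU0 _ _ _) _ => //; exact: lebesgue_measure_set1.
  by apply: etrans (measureU0 _ _ _) _ => //; exact: measurableU.
have [||U [oU NU Ud]] := @lebesgue_regularity_outer R (N `|` [set 0; w]) d mN' => //.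
  exact: (eq_ind_r (fun z : \bar R => (z < +oo)%E) (ltry 0) N'0).
have mU : @measurable _ (measurableTypeR R) U by exact: open_measurable.
have muU : (mu U < d%:E)%E.
  have -> : U = (U `\` (N `|` [set 0; w])) `|` (N `|` [set 0; w]).
    apply/seteqP; split=> t; last by move=> [[] |/NU].
    by move=> Ut; have [h|h] := pselect ((N `|` [set 0; w]) t); [right|left].
  rewrite measureU0 //; exact: measurableD.
have muUoo : (mu U < +oo)%E by exact: lt_trans muU (ltry d).
have [||||n [a [b [h1 h2 h3 h4]]]] := @cousin_bound w (e / (w + 1)) f U.
- exact: ltW.
- by [].
- by [].
- move=> t /andP[t0 tw]; have [Ut|nUt] := pselect (U t); [by left|right].
  have t0' : t != 0 by apply: contra_notN nUt => /eqP ->; apply: NU; right; left.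
  have tw' : t != w by apply: contra_notN nUt => /eqP ->; apply: NU; right; right.
  have tin : t \in `]0, w[ by rewrite in_itv /= !lt_neqAle t0 tw eq_sym t0' tw'.
  have dt : is_derive t (1 : R) f 0.
    apply: contrapT => nd; apply: nUt; apply: NU; left; apply: hN => /= h.
    exact/nd/h.
  have [df d'] := dt.
  have /cvgrPdist_le/(_ _ e1) := df.
  rewrite -/('D_1 f t) d' => /nbhs_ballP [r r0 hr].
  exists r => // s _ sr; have [->|st] := eqVneq s t; first by rewrite !subrr normr0 mulr0.
  have st0 : s - t != 0 by rewrite subr_eq0.
  have /= := hr (s - t); rewrite /ball /= sub0r normrN => /(_ sr st0).
  rewrite sub0r normrN /GRing.scale /= mulr1 subrK normrM normfV.
  by rewrite mulrC ler_pdivrMr // normr_gt0.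
apply: le_trans h4 _.
have : \sum_(i < n) `|f (b i) - f (a i)| < e / (w + 1).
  apply: hd => //; rewrite -lte_fin; apply: le_lt_trans muU.
  apply: (@le_trans _ _ (mu (U `&` `[0, w]))).
    rewrite -lee_fin in h3; apply: le_trans h3 _; rewrite fineK //.
    rewrite ge0_fin_numE //; apply: (@le_lt_trans _ _ (mu U)) => //.
    by apply: le_measure; rewrite ?inE //; apply: measurableI => //; exact: measurable_itv.
  by apply: le_measure; rewrite ?inE //; apply: measurableI => //; exact: measurable_itv.
have : e / (w + 1) * w + e / (w + 1) = e by field; rewrite gt_eqF.
lra.
Qed.

Lemma rac_le w x f : x <= w -> rac w f -> rac x f.
Proof.
move=> xw hf e /hf [d d0 hd]; exists d => // n a b h; apply: hd => i /h [? ? bx].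
by split=> //; exact: le_trans xw.
Qed.

Lemma eq_rac w f g : (forall t, 0 <= t <= w -> f t = g t) -> rac w f -> rac w g.
Proof.
move=> fg hf e /hf [d d0 hd]; exists d => // n a b h1 h2 h3.
rewrite (eq_bigr (fun i : 'I_n => `|f (b i) - f (a i)|)); first exact: hd.
move=> i _; have [a0 ab bw] := h1 i (ltn_ord i).
by rewrite !fg // ?a0 ?(le_trans ab) // bw (le_trans a0).
Qed.

Lemma racD w f g : rac w f -> rac w g -> rac w (fun t => f t + g t).
Proof.
move=> hf hg e e0; have e2 : 0 < e / 2 by lra.
have [d1 d10 h1] := hf _ e2; have [d2 d20 h2] := hg _ e2.
exists (Num.min d1 d2); first by rewrite lt_min d10.
move=> n a b ha hb; rewrite lt_min => /andP[s1 s2].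
have {}h1 := h1 n a b ha hb s1; have {}h2 := h2 n a b ha hb s2.
rewrite (splitr e); apply: le_lt_trans (ltrD h1 h2); rewrite -big_split /=.
apply: ler_sum => i _; have -> : f (b i) + g (b i) - (f (a i) + g (a i)) =
  (f (b i) - f (a i)) + (g (b i) - g (a i)) by ring.
exact: ler_normD.
Qed.

Lemma racZ w c f : rac w f -> rac w (fun t => c * f t).
Proof.
move=> hf e e0; have c0 : 0 < `|c| + 1 by rewrite ltr_wpDl.
have [d d0 hd] := hf _ (divr_gt0 e0 c0); exists d => // n a b h1 h2 h3.
have := hd n a b h1 h2 h3; rewrite ltr_pdivlMr //; apply: le_lt_trans.
rewrite mulr_suml; apply: ler_sum => i _.
by rewrite -mulrBr normrM mulrC ler_wpM2l // lerDl.
Qed.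

Lemma racM w f g K : rac w f -> rac w g ->
  (forall t, 0 <= t <= w -> `|f t| <= K) -> (forall t, 0 <= t <= w -> `|g t| <= K) ->
  rac w (fun t => f t * g t).
Proof.
move=> hf hg fK gK e e0; have k0 : 0 < `|K| + 1 by rewrite ltr_wpDl.
have e2 : 0 < e / (2 * (`|K| + 1)) by rewrite divr_gt0 // mulr_gt0.
have [d1 d10 h1] := hf _ e2; have [d2 d20 h2] := hg _ e2.
exists (Num.min d1 d2); first by rewrite lt_min d10.
move=> n a b ha hb; rewrite lt_min => /andP[s1 s2].
have {}h1 := h1 n a b ha hb s1; have {}h2 := h2 n a b ha hb s2.
have : (\sum_(i < n) `|f (b i) - f (a i)| + \sum_(i < n) `|g (b i) - g (a i)|) * (`|K| + 1) < e.
  rewrite -ltr_pdivlMr //; apply: lt_le_trans (ltrD h1 h2) _.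
  rewrite le_eqVlt; apply/orP; left; apply/eqP; field; by rewrite gt_eqF.
apply: le_lt_trans; rewrite -big_split /= mulr_suml; apply: ler_sum => i _.
have [a0 ab bw] := ha i (ltn_ord i).
have -> : f (b i) * g (b i) - f (a i) * g (a i) =
  (f (b i) - f (a i)) * g (b i) + f (a i) * (g (b i) - g (a i)) by ring.
have hK : K <= `|K| + 1 by rewrite (le_trans (ler_norm K)) // lerDl.
apply: le_trans (ler_normD _ _) _; rewrite !normrM mulrDl; apply: lerD.
  by rewrite ler_wpM2l // (le_trans _ hK) // gK // bw (le_trans a0).
by rewrite mulrC ler_wpM2l // (le_trans _ hK) // fK // a0 (le_trans ab).
Qed.

(** Absolute continuity of the Lebesgue integral, on the union of the given intervals; half-open
    ones stay disjoint when endpoints are shared. *)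
Lemma rac_int w g : 0 < w -> mu.-integrable (`[0, w]%classic : set R) (EFin \o g) ->
  rac w (fun x => \int[mu]_(t in `[0, x]) g t).
Proof.
move=> w0 ig e e0.
have mD : @measurable _ (measurableTypeR R) `[0, w] by exact: measurable_itv.
have igD : mu.-integrable setT (EFin \o (g \_ `[0, w])).
  by rewrite -restrict_EFin; apply/integrable_restrict => //; rewrite setTI.
have [d [d0 hd]] := integral_normr_continuous igD e0.
exists d => // n a b h1 h2 h3.
pose A (i : nat) := (`]a i, b i]%classic : set R).
have mA i : @measurable _ (measurableTypeR R) (A i) by exact: measurable_itv.
pose U := \big[setU/set0]_(i < n) A i.
have mU : @measurable _ (measurableTypeR R) U by exact: bigsetU_measurable.
have tA : trivIset [set: 'I_n] (fun i => A i).
  apply/trivIsetP => i j _ _ ij; apply/seteqP; split=> // t [] /=.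
  rewrite /A /= !in_itv /= => /andP[ai tb] /andP[aj tb'].
  have ij' : (i : nat) <> j by apply/eqP; rewrite val_eqE.
  by have [] := h2 i j (ltn_ord i) (ltn_ord j) ij' => h; lra.
have muU : (mu U < d%:E)%E.
  rewrite /U measure_semi_additive_ord //.
  rewrite (eq_bigr (fun i : 'I_n => (b i - a i)%:E)); last first.
    by move=> i _; apply: mu_itv_oc; case: (h1 i (ltn_ord i)).
  by rewrite sumEFin lte_fin.
have := hd U mU muU; apply: le_lt_trans.
have iU : mu.-integrable U (EFin \o (fun t => `|(g \_ `[0, w]) t|)).
  by apply: (@integrableS _ _ _ _ setT) => //; exact: (integrable_norm igD).
have -> : \int[mu]_(t in U) `|(g \_ `[0, w]) t| = \sum_(i < n) \int[mu]_(t in A i) `|g t|.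
  rewrite /Rintegral /U.
  have := @ge0_integral_bigsetU _ _ R mu 'I_n (fun i => A i)
    (fun t => (`|(g \_ `[0, w]) t|)%:E) (enum 'I_n).
  rewrite !big_enum /= => -> //; last first.
  - by apply: measurable_funTS; case/integrableP : (integrable_norm igD).
  - by apply: (@sub_trivIset _ _ [set` enum 'I_n] [set: 'I_n]) => //; exact: subsetT.
  - exact: enum_uniq.
  rewrite -sum_fine.
    apply: eq_bigr => i _; congr fine; apply: eq_integral => t /set_mem /=.
    rewrite /A /= in_itv /= => /andP[at_ tb]; rewrite patchE mem_set //= in_itv /=.
    by have [a0 _ bw] := h1 i (ltn_ord i); apply/andP; split; lra.
  move=> i _; apply: integrable_fin_num => //.
  by apply: (@integrableS _ _ _ _ setT) => //; exact: (integrable_norm igD).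
apply: ler_sum => i _; have [a0 ab bw] := h1 i (ltn_ord i).
have isub x y : 0 <= x -> y <= w -> mu.-integrable (`[x, y]%classic : set R) (EFin \o g).
  move=> x0 yw; have mxy : @measurable _ (measurableTypeR R) `[x, y] by exact: measurable_itv.
  by apply: (integrableS mD mxy _ ig); apply: subset_itv; rewrite bnd_simp.
have i0 := isub 0 (b i) (lexx 0) bw.
rewrite Rintegral_itvB ?bnd_simp //.
apply: le_normr_Rintegral => //.
have mab : @measurable _ (measurableTypeR R) `[a i, b i] by exact: measurable_itv.
by apply: (integrableS mab (mA i) _ (isub _ _ a0 bw)); exact: subset_itv_oc_cc.
Qed.


Lemma is_derive_eqoo w F G t l : t \in `]0, w[ -> (forall s, 0 <= s <= w -> F s = G s) ->
  is_derive t (1 : R) F l -> is_derive t (1 : R) G l.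
Proof.
move=> tw FG; apply: near_eq_is_derive.
have := near_in_itvoo tw; apply: filterS => s; rewrite in_itv /= => /andP[s0 sw].
by rewrite FG // !ltW.
Qed.

(** Says that [F] is an indefinite integral of [f], in a form that is easily closed under sums and
    products; [acd_ftc] recovers the integral. *)
Definition acd w F f : Prop :=
  [/\ rac w F, {ae mu, forall t, t \in `]0, w[ -> is_derive t (1 : R) F (f t)}
    & mu.-integrable (`[0, w]%classic : set R) (EFin \o f)].

Section Acd.
Variable w : R.
Hypothesis w_gt0 : 0 < w.
Let D : set R := `[0, w]%classic.
Let mD : @measurable _ (measurableTypeR R) D.
Proof. exact: measurable_itv. Qed.

Lemma eq_acd F G f : (forall t, 0 <= t <= w -> F t = G t) -> acd w F f -> acd w G f.
Proof.
move=> FG [h1 h2 h3]; split=> //; first exact: eq_rac h1.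
by apply: aeS h2 => t h tw; apply: is_derive_eqoo tw FG (h tw).
Qed.

(** Lebesgue's differentiation theorem, for [g] extended by zero to the line. *)
Lemma acd_int g : mu.-integrable D (EFin \o g) ->
  acd w (fun x => \int[mu]_(t in `[0, x]) g t) g.
Proof.
move=> ig; split=> //; first exact: rac_int.
have igD : mu.-integrable setT (EFin \o (g \_ D)).
  by rewrite -restrict_EFin; apply/integrable_restrict => //; rewrite setTI.
have ii (A : set R) : @measurable _ (measurableTypeR R) A -> mu.-integrable A (EFin \o (g \_ D)).
  by move=> mA; apply: (@integrableS _ _ _ _ setT).
have loc : locally_integrable [set: R] (g \_ D).
  by apply: open_integrable_locally => //; exact: openT.
have := @FTC1 R (g \_ D) (BLeft 0) (fun y => ii _ (measurable_itv _)) loc.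
apply: aeS => t ht tw; have [t0 t1] : 0 < t /\ t < w by move: tw; rewrite in_itv => /andP.
have [h1 h2] : derivable (fun x => \int[mu]_(u in `[0, x]) (g \_ D) u) t 1 /\
    (fun x => \int[mu]_(u in `[0, x]) (g \_ D) u)^`()%classic t = (g \_ D) t.
  by apply: ht; rewrite (@lte_fin R).
apply: (@is_derive_eqoo w (fun x => \int[mu]_(t in `[0, x]) (g \_ D) t)) => //.
  move=> s /andP[s0 sw]; apply: eq_Rintegral => u /set_mem /=; rewrite in_itv /= => /andP[u0 us].
  by rewrite patchE mem_set //= /D /= in_itv /= u0 (le_trans us).
have -> : g t = (g \_ D) t by rewrite patchE mem_set // /D /= in_itv /= !ltW.
by apply: (DeriveDef h1); rewrite -h2 derive1E.
Qed.

Lemma acdD F f G g : acd w F f -> acd w G g ->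
  acd w (fun t => F t + G t) (fun t => f t + g t).
Proof.
move=> [F1 F2 F3] [G1 G2 G3]; split; first exact: racD.
- by apply: aeS2 F2 G2 => t hF hG tw; apply: is_deriveD; [exact: hF|exact: hG].
- exact: (integrableD mD F3 G3).
Qed.

Lemma acdZ c F f : acd w F f -> acd w (fun t => c * F t) (fun t => c * f t).
Proof.
move=> [F1 F2 F3]; split; first exact: racZ.
- by apply: aeS F2 => t hF tw; apply: is_deriveZ; exact: hF.
- exact: (integrableZl mD _ F3).
Qed.

(** [rac_const] applied to [F] minus the integral of [f], whose derivative vanishes almost
    everywhere. *)
Lemma acd_ftc F f x : acd w F f -> 0 <= x <= w -> F x = F 0 + \int[mu]_(t in `[0, x]) f t.
Proof.
move=> hF /andP[]; rewrite le_eqVlt => /orP[/eqP <- _|x0 xw].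
  by rewrite set_itv1 Rintegral_set1 addr0.
have [H1 H2 H3] := acdD hF (acdZ (-1) (acd_int (let: And3 _ _ h := hF in h))).
have := rac_const x0 (rac_le xw H1) _.
rewrite set_itv1 Rintegral_set1 mulr0 addr0 mulN1r => <-; first by rewrite subrK.
apply: aeS H2 => t ht; rewrite in_itv /= => /andP[t0 tx].
have := ht _; rewrite in_itv /= t0 (lt_le_trans tx xw) => /(_ isT).
by rewrite mulN1r subrr.
Qed.

Lemma acd_cont F f : acd w F f -> {within D, continuous F}.
Proof.
move=> hF; have [_ _ ig] := hF.
apply: (@subspace_eq_continuous _ _ _ (fun x => F 0 + \int[mu]_(t in `[0, x]) f t)).
  by move=> x; rewrite inE /D /= in_itv /= => xw; apply/esym; exact: acd_ftc.
have := @parameterized_integral_continuous R 0 w f (ltW w_gt0) ig.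
move=> hc x; apply: cvgD; [exact: cvg_cst|exact: hc].
Qed.

Lemma within_bounded F : {within D, continuous F} ->
  exists K, forall t, 0 <= t <= w -> `|F t| <= K.
Proof.
move=> cF.
have [c1 _ h1] := @EVT_max R F 0 w (ltW w_gt0) cF.
have [c2 _ h2] := @EVT_min R F 0 w (ltW w_gt0) cF.
exists (Num.max (F c1) (- F c2)) => t tw; have tD : t \in `[0, w] by rewrite in_itv.
by rewrite ler_norml le_max (h1 _ tD) lerNl le_max lerN2 (h2 _ tD) orbT.
Qed.

Lemma within_integrable F : {within D, continuous F} -> mu.-integrable D (EFin \o F).
Proof. by move=> cF; apply: continuous_compact_integrable => //; exact: segment_compact. Qed.

Lemma integrable_mulc F g : {within D, continuous F} -> mu.-integrable D (EFin \o g) ->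
  mu.-integrable D (EFin \o (fun t => F t * g t)).
Proof.
move=> cF ig; have [K hK] := within_bounded cF.
have mF : measurable_fun D F by exact: subspace_continuous_measurable_fun.
have mg : measurable_fun D g by case/integrableP : ig => /measurable_EFinP.
have ik := integrableZl mD K (integrable_norm ig).
apply: (le_integrable mD _ _ ik).
  by apply/measurable_EFinP; exact: measurable_funM.
move=> t Dt /=; rewrite lee_fin !normrM normr_id.
apply: ler_wpM2r => //; apply: le_trans (ler_norm _); apply: hK.
by move: Dt; rewrite /D /= in_itv.
Qed.

Lemma acdM F f G g : acd w F f -> acd w G g ->
  acd w (fun t => F t * G t) (fun t => F t * g t + G t * f t).
Proof.
move=> hF hG; have [F1 F2 F3] := hF; have [G1 G2 G3] := hG.
have cF := acd_cont hF; have cG := acd_cont hG.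
have [K hK] := within_bounded cF; have [L hL] := within_bounded cG.
split.
- apply: (@racM w F G (Num.max K L)) => // t tw; rewrite le_max.
    by rewrite hK.
  by rewrite hL // orbT.
- by apply: aeS2 F2 G2 => t a b tw; apply: is_deriveM; [exact: a|exact: b].
- exact: (integrableD mD (integrable_mulc cF G3) (integrable_mulc cG F3)).
Qed.

Lemma acd_C1 F f : {within D, continuous F} -> {within D, continuous f} ->
  (forall t, t \in `]0, w[ -> is_derive t (1 : R) F (f t)) -> acd w F f.
Proof.
move=> cF cf dF; have ig := within_integrable cf.
apply: (@eq_acd (fun x => F 0 + \int[mu]_(t in `[0, x]) f t)).
  move=> x /andP[]; rewrite le_eqVlt => /orP[/eqP <- _|x0 xw].
    by rewrite set_itv1 Rintegral_set1 addr0.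
  have sub : `[0, x] `<=` D by apply: subset_itv; rewrite bnd_simp.
  have cfx := continuous_subspaceW sub cf; have cFx := continuous_subspaceW sub cF.
  have dx t : t \in `]0, x[ -> is_derive t (1 : R) F (f t).
    by rewrite in_itv /= => /andP[t0 tx]; apply: dF; rewrite in_itv /= t0 (lt_le_trans tx xw).
  have /= e := @continuous_FTC2 R f F 0 x x0 cfx _ _.
  have dF' : derivable_oo_LRcontinuous F 0 x.
    have /(continuous_within_itvP _ x0) [_ h2 h3] := cFx.
    by split=> // t /dx [].
  have dF2 : {in `]0, x[, F^`()%classic =1 f} by move=> t /dx [_ <-]; rewrite derive1E.
  by rewrite /Rintegral (e dF' dF2) /= addrCA subrr addr0.
have : acd w (fun x => F 0 + \int[mu]_(t in `[0, x]) f t) (fun t => 0 + f t).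
  apply: acdD (acd_int ig); split.
  - move=> e e0; exists 1 => // n a b _ _ _; rewrite big1 // => i _.
    by rewrite subrr normr0.
  - by apply: aeW => t _; exact: is_derive_cst.
  - by apply: within_integrable => ?; exact: cvg_cst.
move=> [h1 h2 h3]; split=> //.
by apply: aeS h2 => t h tw; have := h tw; rewrite add0r.
Qed.

End Acd.
End AbsoluteContinuity.

(** * Complex indefinite integrals and Green's formula *)

Section ComplexAC.
Context {R : realType}.
Local Notation C := R[i].
Local Notation mu := (@lebesgue_measure R).
Variable w : R.
Hypothesis w_gt0 : 0 < w.
Local Notation D := (`[0, w]%classic : set R).
Implicit Types (F G f g e d : R -> C).

Let mD : @measurable _ (measurableTypeR R) D.
Proof. exact: measurable_itv. Qed.

Definition cacd F f : Prop :=
  acd w (fun t => complex.Re (F t)) (fun t => complex.Re (f t)) /\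
  acd w (fun t => complex.Im (F t)) (fun t => complex.Im (f t)).

Let Re_D (z y : C) : complex.Re (z + y) = complex.Re z + complex.Re y.
Proof. by case: z; case: y. Qed.

Let Im_D (z y : C) : complex.Im (z + y) = complex.Im z + complex.Im y.
Proof. by case: z; case: y. Qed.

Let Re_M (z y : C) :
  complex.Re (z * y) = complex.Re z * complex.Re y + (-1) * (complex.Im z * complex.Im y).
Proof. by case: z => a b; case: y => a' b' /=; ring. Qed.

Let Im_M (z y : C) :
  complex.Im (z * y) = complex.Re z * complex.Im y + complex.Im z * complex.Re y.
Proof. by case: z => a b; case: y => a' b' /=; ring. Qed.

Let acd_ext (F F' f f' : R -> R) : (forall t, F t = F' t) -> (forall t, f t = f' t) ->
  acd w F f -> acd w F' f'.
Proof. by move=> /funext -> /funext ->. Qed.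

Lemma cacd_ext F F' f f' : (forall t, F t = F' t) -> (forall t, f t = f' t) ->
  cacd F f -> cacd F' f'.
Proof. by move=> /funext -> /funext ->. Qed.

Lemma cacdD F f G g : cacd F f -> cacd G g -> cacd (fun t => F t + G t) (fun t => f t + g t).
Proof.
move=> [F1 F2] [G1 G2]; split.
  by apply: acd_ext (acdD F1 G1) => t; rewrite Re_D.
by apply: acd_ext (acdD F2 G2) => t; rewrite Im_D.
Qed.

Lemma cacdM F f G g : cacd F f -> cacd G g ->
  cacd (fun t => F t * G t) (fun t => F t * g t + G t * f t).
Proof.
move=> [F1 F2] [G1 G2]; split.
  apply: acd_ext (acdD (acdM w_gt0 F1 G1) (acdZ (-1) (acdM w_gt0 F2 G2))) => t.
    by rewrite Re_M.
  by rewrite Re_D !Re_M; ring.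
apply: acd_ext (acdD (acdM w_gt0 F1 G2) (acdM w_gt0 F2 G1)) => t.
  by rewrite Im_M.
by rewrite Im_D !Im_M; ring.
Qed.

Lemma cacd_conj F f : cacd F f -> cacd (fun t => (F t)^*) (fun t => (f t)^*).
Proof.
move=> [F1 F2]; split.
  by apply: acd_ext F1 => t; [case: (F t)|case: (f t)].
by apply: acd_ext (acdZ (-1) F2) => t; [case: (F t)|case: (f t)] => a b /=; rewrite mulN1r.
Qed.

Lemma cacd_int g : cintegrable D g -> cacd (fun x => cintegral `[0, x] g) g.
Proof. by move=> [h1 h2]; split; exact: acd_int. Qed.

Lemma cacd_integrable F f : cacd F f -> cintegrable D f.
Proof. by move=> [[_ _ h1] [_ _ h2]]. Qed.

Lemma cacd_ftc F f : cacd F f -> F w = F 0 + cintegral D f.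
Proof.
have ww : 0 <= w <= w by rewrite lexx ltW.
move=> [h1 h2]; have := acd_ftc w_gt0 h1 ww; have := acd_ftc w_gt0 h2 ww.
rewrite /cintegral; case: (F w) => a b; case: (F 0) => a' b' /= -> ->.
by rewrite /GRing.add.
Qed.

Lemma cacd_ccont F f : cacd F f -> ccontinuous w F.
Proof. by move=> [h1 h2]; split; [exact: acd_cont h1|exact: acd_cont h2]. Qed.

Lemma ccontinuous_integrable F : ccontinuous w F -> cintegrable D F.
Proof. by move=> [h1 h2]; split; exact: within_integrable. Qed.

Lemma ccontinuous_bounded F : ccontinuous w F -> exists K, forall t, 0 <= t <= w -> cabs (F t) <= K.
Proof.
move=> [h1 h2]; have [K hK] := within_bounded w_gt0 h1; have [L hL] := within_bounded w_gt0 h2.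
exists (K + L) => t tw; apply: le_trans (cabs_le_ReIm _) _.
by rewrite lerD // ?hK ?hL.
Qed.

Lemma ccontinuous_L2 F : ccontinuous w F -> inL2 w F.
Proof.
move=> cF; have [K hK] := ccontinuous_bounded cF.
apply: (@bounded_inL2 _ w w_gt0 F K).
  by apply: (cintegrable_meas (f := F)); exact: ccontinuous_integrable.
by move=> t; rewrite /= in_itv /=; exact: hK.
Qed.

Lemma cacd_L2 F f : cacd F f -> inL2 w F.
Proof. by move=> /cacd_ccont /ccontinuous_L2. Qed.

Lemma cintegrable_mulc F g : ccontinuous w F -> cintegrable D g ->
  cintegrable D (fun t => F t * g t).
Proof.
move=> [F1 F2] [g1 g2]; split.
  have a := integrable_mulc w_gt0 F1 g1; have b := integrable_mulc w_gt0 F2 g2.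
  apply: (eq_integrable mD _ _ _ (integrableB mD a b)) => t _ /=.
  by rewrite -EFinB Re_M mulN1r.
have a := integrable_mulc w_gt0 F1 g2; have b := integrable_mulc w_gt0 F2 g1.
by apply: (eq_integrable mD _ _ _ (integrableD mD a b)) => t _ /=; rewrite -EFinD Im_M.
Qed.

Lemma cacd_C1 F f : ccontinuous w F -> ccontinuous w f ->
  (forall t, t \in `]0, w[ -> has_cderiv F t (f t)) -> cacd F f.
Proof.
move=> [F1 F2] [f1 f2] dF.
by split; apply: acd_C1 => // t /dF [].
Qed.

Lemma cderiv_ccontinuous F f : (forall t, has_cderiv F t (f t)) -> ccontinuous w F.
Proof.
have h (G g : R -> R) : (forall t : R, is_derive t (1 : R) G (g t)) -> {within D, continuous G}.
  move=> dG; apply: continuous_subspaceT => t; apply: differentiable_continuous.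
  by apply/derivable1_diffP; case: (dG t).
move=> dF; split; [apply: (h _ (fun t => complex.Re (f t)))|apply: (h _ (fun t => complex.Im (f t)))];
by move=> t; case: (dF t).
Qed.

Lemma cacd_smooth F f g : (forall t, has_cderiv F t (f t)) -> (forall t, has_cderiv f t (g t)) ->
  cacd F f.
Proof.
by move=> dF df; apply: cacd_C1 (cderiv_ccontinuous dF) (cderiv_ccontinuous df) _ => t _.
Qed.

Lemma cint_cderiv g t : ccontinuous w g -> t \in `]0, w[ ->
  has_cderiv (fun x => cintegral `[0, x] g) t (g t).
Proof.
move=> [h1 h2]; rewrite in_itv /= => /andP[t0 tw].
have h (G : R -> R) : {within D, continuous G} ->
    is_derive t (1 : R) (fun x => \int[mu]_(s in `[0, x]) G s) (G t).
  move=> cG; have iG := within_integrable cG.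
  have [c1 _ _] := (continuous_within_itvP _ w_gt0).1 cG.
  have ct : {for t, continuous G} by apply: c1; rewrite in_itv /= t0.
  have [a b] := @continuous_FTC1_closed R G 0 t w tw iG t0 ct.
  by apply: (DeriveDef a); rewrite -b derive1E.
by split; exact: h.
Qed.

(** The derivative of [Y1] times the conjugate of [e], minus that of [Y] times the conjugate of [d];
    the two products of [Y1] with the conjugate of [d] cancel. *)
Lemma green Y Y1 F e d e2 : cacd Y Y1 -> cacd Y1 F -> cacd e d -> cacd d e2 ->
  cintegral D (fun t => F t * (e t)^*) - cintegral D (fun t => Y t * (e2 t)^*) =
  (Y1 w * (e w)^* - Y w * (d w)^*) - (Y1 0 * (e 0)^* - Y 0 * (d 0)^*).
Proof.
move=> hY hF /cacd_conj he /cacd_conj hd.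
have cY := cacd_ccont hY; have ce := cacd_ccont he.
have i1 := cintegrable_mulc ce (cacd_integrable hF).
have i2 := cintegrable_mulc cY (cacd_integrable hd).
have N1 : cacd (fun=> -1) (fun=> 0).
  by apply: (@cacd_smooth _ (fun=> 0) (fun=> 0)) => t; split; exact: is_derive_cst.
have h := cacdD (cacdM hF he) (cacdM N1 (cacdM hY hd)).
have := cacd_ftc h; rewrite !mulN1r => ->; rewrite [RHS]addrAC subrr add0r -cintegralB //.
  by apply: eq_cintegral => t _; ring.
by apply: (eq_cintegrable mD _ i1) => t _; rewrite mulrC.
Qed.

(** The second-order conditions on a function and its derivative. Each [bc] consists of [k] copies,
    one for each even derivative, so that the unperturbed operator is the [k]-th power of the one
    for [- y''] and can be treated two derivatives at a time. *)
Definition bc2 (b : bcond) (U V : R -> C) : Prop :=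
  match b with
  | per => U 0 = U w /\ V 0 = V w
  | ap => U 0 = - U w /\ V 0 = - V w
  | dir => U 0 = 0 /\ U w = 0
  end.

Lemma satisfies_bc2 b k (Y : nat -> R -> C) : (0 < k)%N ->
  satisfies_bc b k w Y <-> forall i, (i < k)%N -> bc2 b (Y (2 * i)%N) (Y (2 * i).+1).
Proof.
move=> k0; case: b => /=; split=> h.
- by move=> i ik; split; apply: h; lia.
- move=> j jk; have := odd_double_half j; rewrite -mul2n; set i := j./2 => ji.
  have ik : (i < k)%N by lia.
  by have [h1 h2] := h i ik; rewrite -ji; case: (odd j).
- by move=> i ik; split; apply: h; lia.
- move=> j jk; have := odd_double_half j; rewrite -mul2n; set i := j./2 => ji.
  have ik : (i < k)%N by lia.
  by have [h1 h2] := h i ik; rewrite -ji; case: (odd j).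
- by move=> i ik; apply: h; lia.
- by move=> i ik; apply: h; lia.
Qed.

Lemma bc2_green b U V e d : bc2 b U V -> bc2 b e d ->
  (V w * (e w)^* - U w * (d w)^*) - (V 0 * (e 0)^* - U 0 * (d 0)^*) = 0.
Proof.
case: b => /= -[-> hV] [-> hd]; rewrite ?hV ?hd ?rmorphN /= ?rmorph0; ring.
Qed.

End ComplexAC.

(** * The unperturbed basis *)

Section Basis.
Context {R : realType}.
Local Notation C := R[i].
Local Notation mu := (@lebesgue_measure R).
Variable w : R.
Hypothesis w_gt0 : 0 < w.
Local Notation D := (`[0, w]%classic : set R).
Implicit Types (F G f g e d U V : R -> C) (b : bcond) (i j n : nat) (t : R).

Let mD : @measurable _ (measurableTypeR R) D.
Proof. exact: measurable_itv. Qed.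

(* The basis is indexed by nat so that the range of [P0 b w 0 + ... + P0 b w n]
   is spanned by an initial segment. *)
Definition zidx b i : int :=
  match b with
  | per => if odd i then - (uphalf i)%:Z else (uphalf i)%:Z
  | _ => if odd i then (i./2)%:Z else - (i./2)%:Z - 1
  end.

Definition blk b i : nat :=
  match b with per => uphalf i | ap => i./2 | dir => i.+1 end.

(** A signed frequency; only even powers of it enter the eigenvalues. *)
Definition frq b i : R :=
  if b is dir then pi * i.+1%:R / w
  else pi * (2 * zidx b i + (theta b)%:Z)%:~R / w.

Definition bas b i : R -> C :=
  if b is dir then efun_dir w i.+1 else efun b w (zidx b i).

Definition dbas b i t : C :=
  if b is dir then (Num.sqrt 2 * (frq b i * cos (frq b i * t)))%:C
  else (0 -i* frq b i) * expi (- (frq b i) * t).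

Lemma basE b i t : bas b i t =
  if b is dir then (Num.sqrt 2 * sin (frq b i * t))%:C else expi (- (frq b i) * t).
Proof. by case: b; rewrite /= /efun_dir /efun ?mulNr mulrAC. Qed.

Lemma bas_cderiv b i t : has_cderiv (bas b i) t (dbas b i t).
Proof.
rewrite (_ : bas b i = fun s => if b is dir then (Num.sqrt 2 * sin (frq b i * s))%:C
  else expi (- (frq b i) * s)); last by apply/funext => s; exact: basE.
rewrite /dbas; set a := frq b i; case: b @a => a; split=> /=;
  by apply: is_derive_eq; rewrite /GRing.scale /=; ring.
Qed.

Lemma dbas_cderiv b i t : has_cderiv (dbas b i) t (- ((frq b i) ^+ 2)%:C * bas b i t).
Proof.
rewrite basE /dbas; set a := frq b i; case: b @a => a; split=> /=;
  by apply: is_derive_eq; rewrite /GRing.scale /=; ring.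
Qed.

Lemma bas_cacd b i : cacd w (bas b i) (dbas b i).
Proof. exact: (cacd_smooth w_gt0 (bas_cderiv b i) (dbas_cderiv b i)). Qed.

Lemma dbas_cacd b i : cacd w (dbas b i) (fun t => - ((frq b i) ^+ 2)%:C * bas b i t).
Proof.
apply: (cacd_smooth w_gt0 (dbas_cderiv b i)
  (g := fun t => - ((frq b i) ^+ 2)%:C * dbas b i t)) => t.
have [h1 h2] := bas_cderiv b i t; split.
  have -> : (fun s => complex.Re (- ((frq b i) ^+ 2)%:C * bas b i s)) =
     (fun s => - (frq b i) ^+ 2 * complex.Re (bas b i s)).
    by apply/funext => s; case: (bas b i s) => x y /=; ring.
  have -> : complex.Re (- ((frq b i) ^+ 2)%:C * dbas b i t) = - (frq b i) ^+ 2 * complex.Re (dbas b i t).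
    by case: (dbas b i t) => x y /=; ring.
  exact: is_deriveZ.
have -> : (fun s => complex.Im (- ((frq b i) ^+ 2)%:C * bas b i s)) =
   (fun s => - (frq b i) ^+ 2 * complex.Im (bas b i s)).
  by apply/funext => s; case: (bas b i s) => x y /=; ring.
have -> : complex.Im (- ((frq b i) ^+ 2)%:C * dbas b i t) = - (frq b i) ^+ 2 * complex.Im (dbas b i t).
  by case: (dbas b i t) => x y /=; ring.
exact: is_deriveZ.
Qed.

Lemma realC_eq0 (a : R) : (a%:C == 0 :> C) = (a == 0).
Proof. by rewrite eq_complex /= eqxx andbT. Qed.

Lemma bas_L2 b i : inL2 w (bas b i).
Proof. by apply: (cacd_L2 w_gt0 (f := dbas b i)); exact: bas_cacd. Qed.

Lemma cabs_bas b i t : cabs (bas b i t) <= 2.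
Proof.
rewrite basE; case: b; rewrite ?cabs_expi ?ler1n // cabs_real normrM.
have s2 : `|Num.sqrt 2 : R| <= 2.
  rewrite ger0_norm ?sqrtr_ge0 // -(@ler_pXn2r _ 2) ?nnegrE ?sqrtr_ge0 //.
  by rewrite sqr_sqrtr //; lra.
rewrite -[leRHS]mulr1 ler_pM // ler_norml.
by rewrite sin_geN1 sin_le1.
Qed.

Lemma expi_intpi (z : int) : expi (pi * (2 * z)%:~R) = 1 :> C.
Proof.
have h (n : nat) : expi (pi * (2 * n%:Z)%:~R) = 1 :> C.
  have -> : pi * (2 * n%:Z)%:~R = n%:R * (2 * pi) :> R.
    by rewrite intrM -[(n%:Z)%:~R]/(n%:R : R); ring.
  by rewrite -expiX expi_2pi expr1n.
case: z => n; first exact: h.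
have -> : pi * (2 * Negz n)%:~R = - (pi * (2 * n.+1%:Z)%:~R) :> R.
  have -> : 2 * Negz n = - (2 * n.+1%:Z) by lia.
  by rewrite mulrNz mulrN.
by rewrite expiN h rmorph1.
Qed.

Lemma sin_natpi (n : nat) : sin (pi * n%:R) = 0 :> R.
Proof.
elim: n => [|n IH]; first by rewrite mulr0 sin0.
by rewrite -natr1 mulrDr mulr1 sinD IH sinpi mulr0 mul0r addr0.
Qed.

Lemma Rintegral_cos (n : nat) : (0 < n)%N ->
  \int[mu]_(t in D) cos (pi * n%:R / w * t) = 0.
Proof.
move=> n0; have a0 : pi * n%:R / w != 0 :> R.
  by rewrite !mulf_neq0 ?invr_neq0 ?gt_eqF ?pi_gt0 ?ltr0n.
have := cintegral_expi w_gt0 a0.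
rewrite -(mulrA _ w^-1 w) mulVf ?gt_eqF // mulr1.
by rewrite /cintegral /expi sin_natpi /=; simpc => -[-> _].
Qed.

Lemma bas_on_exp b i j : b <> dir -> inner w (bas b i) (bas b j) = (i == j)%:R.
Proof.
move=> bd; have e : forall t : R, bas b i t * (bas b j t)^* = expi ((frq b j - frq b i) * t).
  by move=> t; rewrite !basE; case: b bd => // _; rewrite -expiN -expiD; congr expi; ring.
rewrite /inner (eq_cintegral (fun t _ => e t)).
have w0 : w != 0 by rewrite gt_eqF.
have fE k : frq b k = pi * (2 * zidx b k + (theta b)%:Z)%:~R / w by case: b bd {e}.
have [->|ij] := eqVneq i j.
  rewrite (eq_cintegral (g := fun=> 1)); last by move=> t _; rewrite subrr mul0r expi0.
  rewrite /cintegral /= !Rintegral_cst //= lebesgue_itv0 // mul1r mul0r.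
  by rewrite -[w +i* 0]/(w%:C) -rmorphM /= mulVf.
have zij : zidx b j - zidx b i != 0.
  rewrite subr_eq0; apply: contra_neq ij; rewrite /zidx.
  have oi := odd_double_half i; have oj := odd_double_half j.
  have ui := uphalf_half i; have uj := uphalf_half j.
  case: b bd {e fE} => // _; move: oi oj ui uj; case: (odd i) => /=; case: (odd j) => /=; lia.
have f0 : frq b j - frq b i = pi * (2 * (zidx b j - zidx b i))%:~R / w.
  by rewrite !fE -mulrBl -mulrBr -intrB; congr (_ * (_)%:~R / _); ring.
rewrite cintegral_expi // f0; last first.
  have zij0 : (2 * (zidx b j - zidx b i))%:~R != 0 :> R by rewrite intr_eq0 mulf_neq0.
  by rewrite !mulf_neq0 ?invr_neq0 // gt_eqF ?pi_gt0.
by rewrite divfK // expi_intpi subrr mul0r mulr0.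
Qed.

Lemma bas_on b i j : inner w (bas b i) (bas b j) = (i == j)%:R.
Proof.
have [->|bd] : b = dir \/ b <> dir by case: b; [right|right|left].
  pose m := `|i - j|%N.
  have e : forall t : R, bas dir i t * (bas dir j t)^* =
      (cos (pi * m%:R / w * t) - cos (pi * (i.+1 + j.+1)%:R / w * t))%:C.
    move=> t; rewrite !basE conj_real -rmorphM; congr (_%:C).
    have s2 : Num.sqrt 2 * Num.sqrt 2 = 2 :> R by rewrite -expr2 sqr_sqrtr.
    rewrite mulrACA s2.
    have -> : cos (pi * m%:R / w * t) = cos (frq dir i * t - frq dir j * t).
      have [ij|ji] := leqP i j.
        rewrite -cosN; congr cos; rewrite /m distnEr // natrB //= -!natr1; ring.
      rewrite /m distnEl ?(ltnW ji) // natrB ?(ltnW ji) //=; congr cos.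
      by rewrite -!natr1; ring.
    have -> : pi * (i.+1 + j.+1)%:R / w * t = frq dir i * t + frq dir j * t.
      by rewrite /= natrD; ring.
    by rewrite cosB cosD; ring.
  have ic n : mu.-integrable D (EFin \o (fun t => cos (pi * n%:R / w * t))).
    apply: within_integrable; apply: continuous_subspaceT => t.
    by apply: continuous_comp; [exact: mulrl_continuous|exact: continuous_cos].
  rewrite /inner (eq_cintegral (fun t _ => e t)) /cintegral /= /Rintegral integral0 -/(Rintegral _ _ _).
  rewrite RintegralB // (@Rintegral_cos (i.+1 + j.+1)) // subr0 -rmorphM /=.
  have [ij|ij] := eqVneq i j.
    rewrite /m ij distnn mulr0 mul0r; under eq_Rintegral do rewrite mul0r cos0.
    by rewrite Rintegral_cst //= lebesgue_itv0 // mul1r mulVf ?gt_eqF.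
  rewrite Rintegral_cos ?mulr0 // /m lt0n distn_eq0 //.
exact: bas_on_exp.
Qed.

Lemma bas_bc b i : bc2 w b (bas b i) (dbas b i).
Proof.
have w0 : w != 0 by rewrite gt_eqF.
have [->|bd] : b = dir \/ b <> dir by case: b; [right|right|left].
  by rewrite /bc2 !basE mulr0 sin0 mulr0 /= divfK // sin_natpi mulr0.
have fE k : frq b k * w = pi * (2 * zidx b k + (theta b)%:Z)%:~R.
  by case: b bd => // _; rewrite /= divfK.
have e0 : bas b i 0 = 1 by rewrite basE; case: b bd {fE} => // _; rewrite mulr0 expi0.
have d0 : dbas b i 0 = (0 -i* frq b i) by rewrite /dbas; case: b bd {fE e0} => // _; rewrite mulr0 expi0 mulr1.
have ew : bas b i w = (-1) ^+ theta b.
  rewrite basE; case: b bd fE {e0 d0} => // _ fE; rewrite mulNr fE expiN intrD mulrDr expiD expi_intpi mul1r /=.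
    by rewrite mulr0 expi0 expr0 rmorph1.
  by rewrite mulr1 expr1 /expi cospi sinpi; simpc.
have dw : dbas b i w = (0 -i* frq b i) * (-1) ^+ theta b.
  by rewrite -ew basE /dbas; case: b bd {fE e0 d0 ew}.
rewrite /bc2 e0 d0 ew dw; case: b bd {fE e0 d0 ew dw} => // _ /=.
  by rewrite expr0 mulr1.
by rewrite expr1 mulrN1 !opprK.
Qed.

(** The zero mode of the periodic problem is the one coefficient that cannot be recovered from the
    second derivative. *)
Lemma frq_eq0 b i : frq b i = 0 -> b = per /\ i = 0%N.
Proof.
have w0 : w^-1 != 0 by rewrite invr_neq0 // gt_eqF.
have p0 : pi != 0 :> R by rewrite gt_eqF // pi_gt0.
have [->|bd] : b = dir \/ b <> dir by case: b; [right|right|left].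
  by move=> /eqP; rewrite /= !mulf_eq0 (negbTE w0) (negbTE p0) pnatr_eq0.
have fE : frq b i = pi * (2 * zidx b i + (theta b)%:Z)%:~R / w by case: b bd.
move=> /eqP; rewrite fE !mulf_eq0 (negbTE w0) (negbTE p0) orbF /= intr_eq0 => /eqP.
have oi := odd_double_half i; have ui := uphalf_half i.
move=> z0; suff : b = per /\ uphalf i = 0%N by move=> [-> u0]; split=> //; lia.
move: z0; case: b bd {fE} => // _; rewrite /zidx; move: oi ui; case: (odd i) => /= oi ui z0;
  by [split=> //; lia|exfalso; lia].
Qed.

(** Two integrations by parts; the boundary terms cancel since [U] and the basis function satisfy
    the same conditions. *)
Lemma coef_green b U V F i : cacd w U V -> cacd w V F -> inL2 w F -> bc2 w b U V ->
  inner w F (bas b i) = - ((frq b i) ^+ 2)%:C * inner w U (bas b i).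
Proof.
move=> hU hV hF hbc.
have := green w_gt0 hU hV (bas_cacd b i) (dbas_cacd b i).
rewrite (bc2_green hbc (bas_bc b i)) => /eqP; rewrite subr_eq0 => /eqP.
rewrite /inner => ->; rewrite mulrCA; congr (_ * _).
rewrite -(cintegralZ mD _ (L2_mul w_gt0 (cacd_L2 w_gt0 hU) (bas_L2 b i))).
apply: eq_cintegral => t _; rewrite rmorphM rmorphN /= conj_real; ring.
Qed.

Lemma affine_cacd (a c : C) : cacd w (fun t => a + c * t%:C) (fun=> c).
Proof.
apply: (cacd_smooth w_gt0 (g := fun=> 0)) => t; last by split; exact: is_derive_cst.
split.
  have -> : (fun s : R => complex.Re (a + c * s%:C)) = (fun s => complex.Re a + complex.Re c * s).
    by apply/funext => s; case: a => ? ?; case: c => ? ? /=; ring.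
  by apply: is_derive_eq; rewrite /GRing.scale /=; ring.
have -> : (fun s : R => complex.Im (a + c * s%:C)) = (fun s => complex.Im a + complex.Im c * s).
  by apply/funext => s; case: a => ? ?; case: c => ? ? /=; ring.
by apply: is_derive_eq; rewrite /GRing.scale /=; ring.
Qed.

Lemma frq_per0 : frq per 0 = 0.
Proof. by rewrite /frq /= mulr0 mul0r. Qed.

Lemma bas_per0 t : bas per 0 t = 1.
Proof. by rewrite basE frq_per0 oppr0 mul0r expi0. Qed.

(** [F] is integrated twice, and an affine function [a + c t] is added to meet the boundary
    conditions. The coefficients are then forced by [coef_green], except at a zero frequency, where
    the free constant of the periodic problem is used. *)
Lemma bvp b F (z : nat -> C) : inL2 w F ->
  (forall i, inner w F (bas b i) = - ((frq b i) ^+ 2)%:C * z i) ->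
  exists U V, [/\ cacd w U V, cacd w V F,
    forall t, t \in `]0, w[ -> has_cderiv U t (V t), bc2 w b U V &
    forall i, inner w U (bas b i) = z i].
Proof.
move=> hF hz; have iF := L2_cintegrable w_gt0 hF.
pose V0 x := cintegral `[0, x] F; have aV0 : cacd w V0 F := cacd_int w_gt0 iF.
have cV0 := cacd_ccont w_gt0 aV0; have iV0 := ccontinuous_integrable cV0.
pose U0 x := cintegral `[0, x] V0; have aU0 : cacd w U0 V0 := cacd_int w_gt0 iV0.
have z00 f : cintegral `[0, 0] f = 0 by rewrite /cintegral set_itv1 !Rintegral_set1.
have V00 : V0 0 = 0 by exact: z00.
have U00 : U0 0 = 0 by exact: z00.
have wC : (w%:C : C) != 0 by rewrite realC_eq0 gt_eqF.
pose U a c t := U0 t + (a + c * t%:C); pose V (c : C) t := V0 t + c.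
have aU a c : cacd w (U a c) (V c) by exact: cacdD aU0 (affine_cacd a c).
have aV c : cacd w (V c) F.
  apply: (cacd_ext _ _ (cacdD aV0 (affine_cacd c 0))) => t; first by rewrite mul0r addr0.
  by rewrite addr0.
have dU a c t : t \in `]0, w[ -> has_cderiv (U a c) t (V c t).
  move=> tw; have [h1 h2] := cint_cderiv w_gt0 cV0 tw.
  have [[_ _ _] _] := affine_cacd a c; split.
    have -> : (fun s => complex.Re (U a c s)) = (fun s => complex.Re (U0 s) + (complex.Re a + complex.Re c * s)).
      by apply/funext => s; rewrite /U; case: (U0 s) => ? ?; case: a => ? ?; case: c => ? ? /=; ring.
    have -> : complex.Re (V c t) = complex.Re (V0 t) + (0 + complex.Re c * 1).
      by rewrite /V; case: (V0 t) => ? ?; case: c => ? ? /=; ring.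
    by apply: is_deriveD.
  have -> : (fun s => complex.Im (U a c s)) = (fun s => complex.Im (U0 s) + (complex.Im a + complex.Im c * s)).
    by apply/funext => s; rewrite /U; case: (U0 s) => ? ?; case: a => ? ?; case: c => ? ? /=; ring.
  have -> : complex.Im (V c t) = complex.Im (V0 t) + (0 + complex.Im c * 1).
    by rewrite /V; case: (V0 t) => ? ?; case: c => ? ? /=; ring.
  by apply: is_deriveD.
have U_0 a c : U a c 0 = a by rewrite /U U00 mulr0 add0r addr0.
have U_w a c : U a c w = U0 w + a + c * w%:C by rewrite /U addrA.
have V_0 c : V c 0 = c by rewrite /V V00 add0r.
have [a [c [hbc hper]]] : exists a c, bc2 w b (U a c) (V c) /\
    (b = per -> inner w (U a c) (bas b 0) = z 0%N).
  case: b hz => hz.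
  - pose c := - (U0 w / w%:C).
    (* The solvability condition: [F] is orthogonal to the constant function [bas per 0], so its
       integral is periodic. *)
    have Vw : V0 w = 0.
      have := hz 0%N; rewrite frq_per0 expr0n oppr0 mul0r /inner => /eqP; rewrite mulf_eq0 realC_eq0 invr_eq0 gt_eqF // orFb.
      by move=> /eqP <-; apply: eq_cintegral => t _; rewrite bas_per0 rmorph1 mulr1.
    have cw : c * w%:C = - U0 w by rewrite /c mulNr divfK.
    have h1 : inner w (bas per 0) (bas per 0) = 1 by rewrite bas_on.
    pose a := z 0%N - inner w (U 0 c) (bas per 0).
    exists a, c; split; first by rewrite /= U_0 U_w cw V_0 /V Vw; split; ring.
    move=> _; rewrite (@eq_inner _ _ _ (fun t => U 0 c t + a * bas per 0 t)); last first.
      by move=> t; rewrite bas_per0 /U; ring.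
    have b0 := bas_L2 per 0.
    rewrite innerDl ?innerZl ?h1 //; first by rewrite /a; ring.
      exact: cacd_L2 w_gt0 _ _ (aU _ _).
    exact: inL2Z.
  (* For [ap] the condition on [V] determines [c], and then the one on [U] determines [a]. *)
  - pose c := - (V0 w / 2); pose a := - ((U0 w + c * w%:C) / 2).
    exists a, c; split=> //; rewrite /= U_0 U_w V_0 /V.
    by split; rewrite /a /c; field.
  - exists 0, (- (U0 w / w%:C)); split=> //; rewrite /= U_0 U_w; split=> //.
    by rewrite addr0 mulNr divfK // subrr.
exists (U a c), (V c); split=> // [t tw|i]; first exact: dU.
have [f0|f0] := eqVneq (frq b i) 0.
  by have [bp ->] := frq_eq0 f0; exact: hper.
have := coef_green i (aU a c) (aV c) hF hbc; rewrite hz => /mulfI ->//.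
by rewrite oppr_eq0 realC_eq0 expf_neq0.
Qed.

End Basis.

(** * Completeness of the basis *)

Section RealQuotients.
Context {R : realType}.
Implicit Types (f : R -> R) (w t l : R).

Lemma derive_lin f t l : is_derive t (1 : R) f l -> forall e : R, 0 < e ->
  exists2 r : R, 0 < r & forall s, `|s - t| < r -> `|f s - f t - l * (s - t)| <= e * `|s - t|.
Proof.
move=> [df d'] e e0; have /cvgrPdist_le/(_ _ e0) := df.
rewrite -/('D_1 f t) d' => /nbhs_ballP [r r0 hr].
exists r => // s sr; have [->|st] := eqVneq s t; first by rewrite !subrr mulr0 normr0 subrr normr0 mulr0.
have st0 : s - t != 0 by rewrite subr_eq0.
have /= := hr (s - t); rewrite /ball /= sub0r normrN => /(_ sr st0).
rewrite /GRing.scale /= mulr1 subrK distrC => h.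
have -> : f s - f t - l * (s - t) = ((s - t)^-1 * (f s - f t) - l) * (s - t) by field.
by rewrite normrM ler_wpM2r.
Qed.

Lemma zero_deriv w f t l : (forall s, s \in `]0, w[ -> f s = 0) -> t \in `]0, w[ ->
  is_derive t (1 : R) f l -> l = 0.
Proof.
move=> f0 tw df; have : is_derive t (1 : R) (fun=> 0 : R) l.
  by apply: near_eq_is_derive df; have := near_in_itvoo tw; apply: filterS => s /f0.
by move=> [_ <-]; rewrite derive_cst.
Qed.

(** Differentiability handles [s] near [t]; elsewhere [f] is bounded and the distance to [t] is
    bounded below. *)
Lemma lin_upper w f t l K : (forall s, 0 <= s <= w -> `|f s| <= K) ->
  is_derive t (1 : R) f l -> f t = 0 ->
  exists L, forall s, 0 <= s <= w -> `|f s| <= L * `|s - t|.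
Proof.
move=> fK df ft; have [r r0 hr] := derive_lin df ltr01.
exists (Num.max (`|l| + 1) (K / r)) => s sw.
have [sr|rs] := ltP `|s - t| r.
  apply: le_trans (_ : (`|l| + 1) * `|s - t| <= _); last by rewrite ler_wpM2r // le_max lexx.
  have -> : f s = (f s - f t - l * (s - t)) + l * (s - t) by rewrite ft; ring.
  apply: le_trans (ler_normD _ _) _; rewrite normrM; have := hr s sr; lra.
apply: le_trans (_ : K / r * `|s - t| <= _); last by rewrite ler_wpM2r // le_max lexx orbT.
have K0 : 0 <= K by apply: le_trans (fK s sw).
apply: le_trans (fK s sw) _; rewrite -mulrA ler_peMr // mulrC ler_pdivlMr //; lra.
Qed.

(** Near [t] the nonzero derivative dominates; on the two remaining compact intervals the modulus of
    [f] has a positive minimum. Together with [lin_upper] this bounds the quotient in [divide]. *)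
Lemma lin_lower w f t l : 0 < w -> t \in `]0, w[ -> {within `[0, w], continuous f} ->
  (forall s, 0 <= s <= w -> s != t -> f s != 0) ->
  is_derive t (1 : R) f l -> l != 0 -> f t = 0 ->
  exists2 m, 0 < m & forall s, 0 <= s <= w -> m * `|s - t| <= `|f s|.
Proof.
move=> w0; rewrite in_itv /= => /andP[t0 tw] cf f0 df l0 ft.
have l2 : 0 < `|l| / 2 by rewrite divr_gt0 // normr_gt0.
have [r r0 hr] := derive_lin df l2.
have far a b : a <= b -> 0 <= a -> b <= w -> (forall s, a <= s <= b -> s != t) ->
    exists2 m, 0 < m & forall s, a <= s <= b -> m * `|s - t| <= `|f s|.
  move=> ab a0 bw nt.
  have sub : `[a, b] `<=` `[0, w] by apply: subset_itv; rewrite bnd_simp.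
  have cn : {within `[a, b], continuous (fun s => `|f s|)}.
    have := continuous_subspaceW sub cf; move=> h x.
    exact: (@cvg_norm _ _ _ _ _ _ _ (h x)).
  have [c cab hc] := EVT_min ab cn.
  have fc : 0 < `|f c|.
    move: cab; rewrite in_itv /= => /andP[ac cb]; rewrite normr_gt0 f0 //.
      by rewrite (le_trans a0) // (le_trans cb).
    by apply: nt; rewrite ac.
  exists (`|f c| / w); first by rewrite divr_gt0.
  move=> s /andP[as_ sb]; apply: le_trans (hc s _); last by rewrite in_itv /= as_.
  rewrite -mulrA ler_piMr // mulrC ler_pdivrMr // mul1r ler_norml; lra.
pose r1 := Num.min (r / 2) (Num.min (t / 2) ((w - t) / 2)).
have r1r : r1 <= r / 2 by rewrite ge_min lexx.
have r1t : r1 <= t / 2 by rewrite !ge_min lexx orbT.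
have r1w : r1 <= (w - t) / 2 by rewrite !ge_min lexx !orbT.
have r10 : 0 < r1 by rewrite !lt_min; apply/andP; split; [|apply/andP; split]; lra.
have [||||m1 m10 h1] := far 0 (t - r1); [lra|by []|lra| |].
  by move=> s /andP[_ h]; rewrite lt_eqF //; lra.
have [||||m2 m20 h2] := far (t + r1) w; [lra|lra|by []| |].
  by move=> s /andP[h _]; rewrite gt_eqF //; lra.
exists (Num.min (`|l| / 2) (Num.min m1 m2)); first by rewrite !lt_min l2 m10.
move=> s /andP[s0 sw].
have mn (m : R) : Num.min (`|l| / 2) (Num.min m1 m2) <= m -> m * `|s - t| <= `|f s| ->
    Num.min (`|l| / 2) (Num.min m1 m2) * `|s - t| <= `|f s|.
  by move=> hm; apply: le_trans; rewrite ler_wpM2r.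
have [sl|sl] := leP s (t - r1).
  by apply: (mn m1); rewrite ?ge_min ?lexx ?orbT // h1 // s0.
have [sg|sg] := leP (t + r1) s.
  by apply: (mn m2); rewrite ?ge_min ?lexx ?orbT // h2 // sg.
apply: (mn (`|l| / 2)); first by rewrite ge_min lexx.
have := hr s; rewrite ft subr0 => /(_ _).
have sr : `|s - t| < r by rewrite ltr_norml; apply/andP; split; lra.
move=> /(_ sr) h; have := ler_normB (f s) (f s - l * (s - t)).
have -> : f s - (f s - l * (s - t)) = l * (s - t) by ring.
rewrite normrM; lra.
Qed.

End RealQuotients.

Section Completeness.
Context {R : realType}.
Local Notation C := R[i].
Local Notation mu := (@lebesgue_measure R).
Variable w : R.
Hypothesis w_gt0 : 0 < w.
Local Notation D := (`[0, w]%classic : set R).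
Implicit Types (F G f g e d U V h : R -> C) (b : bcond) (i j n : nat) (t : R).

Let mD : @measurable _ (measurableTypeR R) D.
Proof. exact: measurable_itv. Qed.

Lemma const_mod_zero (a : nat -> C) K : (forall n, cabs (a n.+1) = cabs (a n)) ->
  l2le a K -> a 0%N = 0.
Proof.
move=> ha [K0 hK]; have hc n : cabs (a n) = cabs (a 0%N) by elim: n => // n; rewrite ha.
apply/eqP; apply: contraT; rewrite -cabs_gt0 => a0; set x := cabs (a 0%N) in hc a0.
have x2 : 0 < x ^+ 2 by rewrite exprn_gt0.
pose n := (Num.truncn (K ^+ 2 / x ^+ 2)).+1.
have := hK n; under eq_bigr do rewrite hc.
rewrite sumr_const card_ord -mulr_natl leNgt => /negP []; rewrite -ltr_pdivrMr //.
exact: truncnS_gt.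
Qed.

Lemma cmeasurableV f : cmeasurable D f -> cmeasurable D (fun t => (f t)^-1).
Proof.
move=> mf; have mc := cabs_measurable mf.
have mr : measurable_fun D (fun t => (cabs (f t) ^+ 2)^-1).
  apply: (eq_measurable_fun (fun t => (cabs (f t) ^+ 2) `^ (-1))).
    by move=> t _; rewrite powR_inv1 // sqr_ge0.
  exact: (measurableT_comp (measurable_powR (-1)) (measurable_funX 2 mc)).
have mrc : cmeasurable D (fun t => ((cabs (f t) ^+ 2)^-1)%:C).
  by split=> //=; exact: measurable_cst.
have [h1 h2] := cmeasurableM (cmeasurable_conj mf) mrc.
have e t : (f t)^-1 = (f t)^* * ((cabs (f t) ^+ 2)^-1)%:C.
  rewrite fmorphV /= -mulcJ_sqr; have [->|f0] := eqVneq (f t) 0.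
    by rewrite invr0 mul0r invr0 mulr0.
  rewrite invfM mulrCA mulfV ?mulr1 // -cabs_eq0 cabs_conj cabs_eq0 //.
split.
  by apply: (eq_measurable_fun _ _ h1) => t _; rewrite e.
by apply: (eq_measurable_fun _ _ h2) => t _; rewrite e.
Qed.

Section Division.
Variables (U V e de Dc : R -> C) (t0 m : R).
Hypotheses (cU : ccontinuous w U) (dU : has_cderiv U t0 (V t0)).
Hypotheses (ce : ccontinuous w e) (d_e : has_cderiv e t0 (de t0)) (et0 : e t0 != 0).
Hypotheses (cD : cmeasurable D Dc) (m_gt0 : 0 < m).
Hypothesis Dc_ge : forall s, 0 <= s <= w -> m * `|s - t0| <= cabs (Dc s).

Let c : C := U t0 / e t0.
Let G t := U t - c * e t.

(** Chernoff's quotient: [U - c * e] vanishes at [t0] at least linearly and [Dc] at most linearly,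
    so their quotient is bounded, hence in L_2. *)
Lemma divide : exists h, inL2 w h /\ forall t, 0 <= t <= w -> U t = c * e t + Dc t * h t.
Proof.
have LU := ccontinuous_L2 w_gt0 cU; have Le := ccontinuous_L2 w_gt0 ce.
have LG : inL2 w G by apply: inL2B => //; exact: inL2Z.
have [K1 hK1] := ccontinuous_bounded w_gt0 cU; have [K2 hK2] := ccontinuous_bounded w_gt0 ce.
have GK s : 0 <= s <= w -> cabs (G s) <= K1 + cabs c * K2.
  move=> sw; apply: le_trans (cabsB _ _) _; rewrite cabsM lerD ?hK1 //.
  by rewrite ler_wpM2l ?cabs_ge0 ?hK2.
have Gt0 : G t0 = 0 by rewrite /G /c divfK // subrr.
have [L hL] : exists L, forall s, 0 <= s <= w -> cabs (G s) <= L * `|s - t0|.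
  have [u1 u2] := dU; have [v1 v2] := d_e.
  have ReG : is_derive t0 (1 : R) (fun s => complex.Re (G s)) (complex.Re (V t0 - c * de t0)).
    have -> : (fun s => complex.Re (G s)) = (fun s => complex.Re (U s) -
        (complex.Re c * complex.Re (e s) - complex.Im c * complex.Im (e s))).
      by apply/funext => s; rewrite /G; case: (U s) => ? ?; case: c => ? ?; case: (e s).
    have -> : complex.Re (V t0 - c * de t0) = complex.Re (V t0) -
        (complex.Re c * complex.Re (de t0) - complex.Im c * complex.Im (de t0)).
      by case: (V t0) => ? ?; case: c => ? ?; case: (de t0).
    by apply: is_deriveB; apply: is_deriveB; exact: is_deriveZ.
  have ImG : is_derive t0 (1 : R) (fun s => complex.Im (G s)) (complex.Im (V t0 - c * de t0)).
    have -> : (fun s => complex.Im (G s)) = (fun s => complex.Im (U s) -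
        (complex.Re c * complex.Im (e s) + complex.Im c * complex.Re (e s))).
      by apply/funext => s; rewrite /G; case: (U s) => ? ?; case: c => ? ?; case: (e s).
    have -> : complex.Im (V t0 - c * de t0) = complex.Im (V t0) -
        (complex.Re c * complex.Im (de t0) + complex.Im c * complex.Re (de t0)).
      by case: (V t0) => ? ?; case: c => ? ?; case: (de t0).
    by apply: is_deriveB; apply: is_deriveD; exact: is_deriveZ.
  have [||L1 h1] := lin_upper (w := w) (K := K1 + cabs c * K2) _ ReG.
  - by move=> s sw; apply: le_trans (Re_le_cabs _) (GK s sw).
  - by rewrite Gt0.
  have [||L2 h2] := lin_upper (w := w) (K := K1 + cabs c * K2) _ ImG.
  - by move=> s sw; apply: le_trans (Im_le_cabs _) (GK s sw).
  - by rewrite Gt0.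
  exists (L1 + L2) => s sw; apply: le_trans (cabs_le_ReIm _) _.
  by rewrite mulrDl lerD ?h1 ?h2.
exists (fun t => G t * (Dc t)^-1); split.
  apply: (@bounded_inL2 _ w w_gt0 _ (`|L| / m)).
    by apply: cmeasurableM; [exact: inL2_meas LG|exact: cmeasurableV].
  move=> t; rewrite /= in_itv /= => tw; rewrite cabsM cabsV.
  have [->|tt0] := eqVneq t t0; first by rewrite Gt0 cabs0 mul0r divr_ge0 // ltW.
  have a0 : 0 < m * `|t - t0| by rewrite mulr_gt0 // normr_gt0 subr_eq0.
  have d0 := lt_le_trans a0 (Dc_ge tw); rewrite ler_pdivrMr //.
  apply: le_trans (hL t tw) _; apply: le_trans (_ : `|L| * `|t - t0| <= _).
    by rewrite ler_wpM2r // ler_norm.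
  rewrite -mulrA ler_wpM2l // mulrC ler_pdivlMr // mulrC; exact: Dc_ge.
move=> t tw; have [t_eq|tt0] := eqVneq t t0.
  by rewrite t_eq Gt0 mul0r mulr0 addr0 /c divfK.
have a0 : 0 < m * `|t - t0| by rewrite mulr_gt0 // normr_gt0 subr_eq0.
have d0 := lt_le_trans a0 (Dc_ge tw); rewrite mulrCA mulfV ?mulr1 -?cabs_gt0 //.
by rewrite /G addrC subrK.
Qed.

End Division.

Section Vanishing.
Variables (b : bcond) (U V : R -> C).
Hypotheses (aU : cacd w U V) (dU : forall t, t \in `]0, w[ -> has_cderiv U t (V t)).
Hypothesis cU0 : forall i, inner w U (bas w b i) = 0.

(** Multiplication by the conjugate of [psi] lowers [zidx] by one. [posi] and [negi] enumerate the
    basis elements of nonnegative and of negative [zidx]. *)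
Let psi t : C := expi (- (2 * pi / w) * t).

Let posi n := if b is per then n.*2 else n.*2.+1.
Let negi n := if b is per then n.*2.+1 else n.*2.

Let bas_shift i j : b <> dir -> zidx b i = zidx b j + 1 ->
  forall t, (psi t)^* * bas w b i t = bas w b j t.
Proof.
move=> bd zij t; have z1 : (zidx b i)%:~R = (zidx b j)%:~R + 1 :> R by rewrite zij intrD.
rewrite !basE; case: b bd z1 {zij} => // _ z1;
rewrite /psi -expiN -expiD; congr expi; rewrite /frq !intrD !intrM z1;
by field; rewrite gt_eqF.
Qed.

Let bessel_sub (s : nat -> nat) h : injective s -> inL2 w h ->
  l2le (fun n => inner w h (bas w b (s n))) (Num.sqrt (n2 w h)).
Proof.
move=> si hh; apply: (bessel w_gt0 (e := fun n => bas w b (s n))) => // [i|i j].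
  exact: bas_L2.
by rewrite bas_on // (inj_eq si).
Qed.

(* Chernoff's proof of pointwise convergence, for the value at [t0]. *)
Lemma vanish_exp t0 : b <> dir -> t0 \in `]0, w[ -> U t0 = 0.
Proof.
move=> bd t0w; have := t0w; rewrite in_itv /= => /andP[t00 t0w'].
have zpos n : zidx b (posi n) = n%:Z.
  by rewrite /zidx /posi; case: b bd => // _; rewrite /= odd_double ?uphalf_double ?doubleK /= ?doubleK.
have zneg n : zidx b (negi n) = - n%:Z - 1.
  rewrite /zidx /negi; case: b bd => // _; rewrite /= odd_double /= ?doubleK //; lia.
have ipos : injective posi.
  by move=> x y; rewrite /posi; case: b => e; lia.
have ineg : injective negi.
  by move=> x y; rewrite /negi; case: b => e; lia.
pose e := bas w b (posi 0).
have [m m0 hm] : exists2 m, 0 < m & forall s, 0 <= s <= w -> m * `|s - t0| <= cabs (psi s - psi t0).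
  (* A real function with the modulus of [psi s - psi t0], so that [lin_lower] applies; its argument
     stays strictly between [- pi] and [pi], so it vanishes at [t0] only. *)
  pose f s : R := 2 * sin (pi / w * (s - t0)).
  have key s : cabs (psi s - psi t0) = `|f s|.
    apply/eqP; rewrite -(@eqrXn2 _ 2) ?cabs_ge0 // cabs_sqr real_normK ?num_real // /f /psi /expi /=.
    set x := - (2 * pi / w) * s; set y := - (2 * pi / w) * t0.
    have -> : pi / w * (s - t0) = (y - x) / 2 by rewrite /x /y; field; rewrite gt_eqF.
    have e1 : cos (y - x) = 1 - 2 * sin ((y - x) / 2) ^+ 2.
      have {1}-> : y - x = (y - x) / 2 + (y - x) / 2 by rewrite -splitr.
      by rewrite cosD; have := cos2Dsin2 ((y - x) / 2); rewrite !expr2; lra.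
    have := cos2Dsin2 x; have := cos2Dsin2 y; move: e1; rewrite cosB => e1 hy hx.
    apply/eqP; have -> : (2 * sin ((y - x) / 2)) ^+ 2 = 2 * (2 * sin ((y - x) / 2) ^+ 2) by ring.
    have -> : 2 * sin ((y - x) / 2) ^+ 2 = 1 - (cos y * cos x + sin y * sin x) by lra.
    have -> : (cos x - cos y) ^+ 2 + (sin x - sin y) ^+ 2 =
      (cos x ^+ 2 + sin x ^+ 2) + (cos y ^+ 2 + sin y ^+ 2) - 2 * (cos y * cos x + sin y * sin x) by ring.
    by rewrite hx hy; ring.
  have [|||||m m0 hm] := @lin_lower R w f t0 (2 * (pi / w)) w_gt0 t0w.
  - apply: continuous_subspaceT => s; apply: cvgM; first exact: cvg_cst.
    apply: continuous_comp; last exact: continuous_sin.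
    by apply: cvgM; [exact: cvg_cst|apply: cvgB; [exact: cvg_id|exact: cvg_cst]].
  - move=> s /andP[s0 sw] st; rewrite mulf_neq0 //.
    have pw : 0 < pi / w :> R by rewrite divr_gt0 // pi_gt0.
    have lt_pi (x : R) : 0 < x -> x < w -> sin (pi / w * x) != 0.
      move=> x0 xw; rewrite gt_eqF // sin_gt0_pi // mulr_gt0 //=.
      by rewrite -[ltRHS](divfK (lt0r_neq0 w_gt0)) ltr_pM2l.
    have [h|h] : s < t0 \/ t0 < s by move: st; rewrite neq_lt => /orP[]; [left|right].
      by rewrite -oppr_eq0 -sinN -mulrN opprB lt_pi //; lra.
    by rewrite lt_pi //; lra.
  - by apply: is_derive_eq; rewrite /GRing.scale /= subrr mulr0 cos0; ring.
  - by rewrite mulf_neq0 // gt_eqF // divr_gt0 // pi_gt0.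
  - by rewrite /f subrr mulr0 sin0 mulr0.
  by exists m => // s sw; rewrite key hm.
have ce := cacd_ccont w_gt0 (bas_cacd w_gt0 b (posi 0)).
have en0 : e t0 != 0 by rewrite /e basE; case: b bd => // _; exact: expi_neq0.
have cpsi : cmeasurable D (fun t => psi t - psi t0).
  by apply: ccont_cmeasurable => //; apply: ccontD; [exact: ccont_expi|exact: ccont_cst].
have mpsi : cmeasurable D psi by apply: ccont_cmeasurable => //; exact: ccont_expi.
have [h [hL hU]] := divide (cacd_ccont w_gt0 aU) (dU t0w) ce (bas_cderiv w b (posi 0) t0) en0 cpsi m0 hm.
set c := U t0 / _ in hU.
pose hh i := inner w h (bas w b i).
have LU := cacd_L2 w_gt0 aU.
have Lph : inL2 w (fun t => psi t * h t).
  under eq_fun do rewrite mulrC.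
  by apply: (@inL2_mulb _ w w_gt0 _ _ 1) => // t _; rewrite cabs_expi.
(* All coefficients of [U = c * e + (psi - psi t0) * h] vanish; this is a first-order recurrence for
   those of [h], inhomogeneous at [posi 0] only. *)
have rec i j : zidx b i = zidx b j + 1 -> hh j = psi t0 * hh i - c * (posi 0 == i)%:R.
  move=> zij; have Lb := bas_L2 w_gt0 b i.
  have := cU0 i; rewrite -(bas_on w_gt0 b) -innerZl //; last exact: bas_L2.
  have -> : inner w U (bas w b i) =
     inner w (fun t => c * e t + (psi t * h t - psi t0 * h t)) (bas w b i).
    congr (_ * _); apply: eq_cintegral => t; rewrite /= in_itv /= => tw.
    by rewrite hU // mulrBl.
  rewrite innerDl //; [|exact/inL2Z/bas_L2|exact/inL2B/inL2Z].
  rewrite innerBl ?(innerZl _ _ hL) //; last exact: inL2Z.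
  have -> : inner w (fun t => psi t * h t) (bas w b i) = hh j.
    rewrite inner_mul_conj; apply: (congr1 (inner w h)).
    by apply/funext => t; exact: bas_shift.
  rewrite -/(hh i) -/(hh j) -/e => /eqP.
  rewrite addr_eq0 => /eqP ->; ring.
have absr i j : zidx b i = zidx b j + 1 -> posi 0 != i -> cabs (hh i) = cabs (hh j).
  by move=> /rec -> /negbTE ->; rewrite mulr0 subr0 cabsM cabs_expi mul1r.
(* Along each half-line of integers the moduli are constant, and they are square summable by Bessel,
   so they are 0; the inhomogeneous step then forces [c = 0]. *)
have p0 : hh (posi 0) = 0.
  apply: (const_mod_zero (a := fun n => hh (posi n))) (bessel_sub ipos hL) => n.
  apply: absr; first by rewrite !zpos; lia.
  by rewrite (inj_eq ipos).
have q0 : hh (negi 0) = 0.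
  apply: (const_mod_zero (a := fun n => hh (negi n))) (bessel_sub ineg hL) => n.
  apply/esym/absr; first by rewrite !zneg; lia.
  by apply/eqP => e1; have := zpos 0%N; rewrite e1 zneg; lia.
have zz : zidx b (posi 0) = zidx b (negi 0) + 1 by rewrite zpos zneg.
have := rec _ _ zz; rewrite p0 q0 eqxx mulr0 mulr1 sub0r.
move=> /esym/eqP; rewrite oppr_eq0 => /eqP c0.
by have := hU t0; rewrite c0 mul0r add0r subrr mul0r; apply; rewrite !ltW.
Qed.

(** For sines the multiplier is [2 * cos (pi / w * t)], which shifts the index in both directions,
    so the recurrence has order two. The divisor vanishes at [t0] only, as [cos] is injective on
    [[0, pi]]. *)
Lemma vanish_dir t0 : b = dir -> t0 \in `]0, w[ -> U t0 = 0.
Proof.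
move=> bd t0w; have := t0w; rewrite in_itv /= => /andP[t00 t0w'].
have pw : 0 < pi / w :> R by rewrite divr_gt0 // pi_gt0.
pose e := bas w dir; pose f s : R := 2 * cos (pi / w * s) - 2 * cos (pi / w * t0).
have st0 : 0 < sin (pi / w * t0).
  by rewrite sin_gt0_pi // mulr_gt0 //= -[ltRHS](divfK (lt0r_neq0 w_gt0)) ltr_pM2l.
have cf : continuous f.
  move=> s; apply: cvgB; last exact: cvg_cst.
  apply: cvgM; first exact: cvg_cst.
  by apply: continuous_comp; [exact: mulrl_continuous|exact: continuous_cos].
have [m m0 hm] : exists2 m, 0 < m & forall s, 0 <= s <= w -> m * `|s - t0| <= cabs (f s)%:C.
  have [|||||m m0 hm] := @lin_lower R w f t0 (- 2 * (pi / w) * sin (pi / w * t0)) w_gt0 t0w.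
  - exact: continuous_subspaceT.
  - move=> s /andP[s0 sw]; apply: contra_neq => /eqP.
    rewrite /f -mulrBr mulf_eq0 pnatr_eq0 /= subr_eq0 => /eqP /cos_inj.
    have inp x : 0 <= x -> x <= w -> pi / w * x \in `[0, pi].
      move=> x0 xw; rewrite in_itv /= mulr_ge0 ?(ltW pw) //=.
      by rewrite -[leRHS](divfK (lt0r_neq0 w_gt0)) ler_pM2l.
    by move=> /(_ (inp _ s0 sw) (inp _ (ltW t00) (ltW t0w'))) /mulfI; apply; rewrite gt_eqF.
  - by apply: is_derive_eq; rewrite /GRing.scale /=; ring.
  - by apply: mulf_neq0; [apply: mulf_neq0; [rewrite oppr_eq0 pnatr_eq0|rewrite gt_eqF]|rewrite gt_eqF].
  - by rewrite /f subrr.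
  by exists m => // s sw; rewrite cabs_real hm.
have ce := cacd_ccont w_gt0 (bas_cacd w_gt0 dir 0).
have sq2 : Num.sqrt 2 != 0 :> R by rewrite gt_eqF // sqrtr_gt0.
have fq : frq w dir 0 = pi / w by rewrite /frq mulr1.
have en0 : e 0%N t0 != 0 by rewrite /e basE fq realC_eq0 mulf_neq0 // gt_eqF.
have mcos : cmeasurable D (fun t => (2 * cos (pi / w * t))%:C).
  apply: ccont_cmeasurable => //; apply: ccont_ReIm => /=; last by move=> ?; exact: cvg_cst.
  move=> s; apply: cvgM; first exact: cvg_cst.
  by apply: continuous_comp; [exact: mulrl_continuous|exact: continuous_cos].
have mf : cmeasurable D (fun t => (f t)%:C).
  by apply: ccont_cmeasurable => //; apply: ccont_ReIm => //= ?; exact: cvg_cst.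
have [h [hL hU]] := divide (cacd_ccont w_gt0 aU) (dU t0w) ce (bas_cderiv w dir 0 t0) en0 mf m0 hm.
set c := U t0 / _ in hU.
pose hh i := inner w h (e i).
pose z : C := expi (pi / w * t0).
have zE : (2 * cos (pi / w * t0))%:C = z + z^* by rewrite /z /expi; simpc; congr (_ +i* _); ring.
have zz : z * z^* = 1 by rewrite mulcJ_sqr cabs_expi expr1n.
have LU := cacd_L2 w_gt0 aU.
have Lph : inL2 w (fun t => (2 * cos (pi / w * t))%:C * h t).
  under eq_fun do rewrite mulrC.
  apply: (@inL2_mulb _ w w_gt0 _ _ 2) => // t _.
  rewrite cabs_real normrM ger0_norm // ler_piMr // ler_norml.
  by rewrite cos_geN1 cos_le1.
have rec i : hh i.+1 + (if i is j.+1 then hh j else 0) - (z + z^*) * hh i + c * (0%N == i)%:R = 0.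
  have Lb := bas_L2 w_gt0 dir i.
  rewrite -(bas_on w_gt0 dir) -innerZl //; last exact: bas_L2.
  have := cU0 i; rewrite bd => cUi; rewrite -[RHS]cUi.
  transitivity (inner w (fun t => c * e 0%N t + ((2 * cos (pi / w * t))%:C * h t - (z + z^*) * h t)) (e i)); last first.
    congr (_ * _); apply: eq_cintegral => t; rewrite /= in_itv /= => tw.
    by rewrite hU // -zE -mulrBl -rmorphB.
  rewrite innerDl //; [|exact/inL2Z/bas_L2|exact/inL2B/inL2Z].
  rewrite innerBl ?(innerZl _ _ hL) //; last exact: inL2Z.
  rewrite addrC -/(hh i); congr (_ + (_ - _)).
  rewrite inner_mul_conj; have ee : forall t, ((2 * cos (pi / w * t))%:C)^* * e i t =
      e i.+1 t + (if i is j.+1 then e j t else 0).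
    move=> t; rewrite conj_real /e; case: i {Lb cUi} => [|j]; rewrite !basE -?rmorphD -?rmorphM /= ?addr0; congr (_%:C).
      rewrite /frq mulr1; have -> : pi * 2 / w * t = pi / w * t + pi / w * t by ring.
      by rewrite sinD; ring.
    have -> : frq w dir j.+2 * t = frq w dir j.+1 * t + pi / w * t by rewrite /frq -!natr1; ring.
    have -> : frq w dir j * t = frq w dir j.+1 * t - pi / w * t by rewrite /frq -!natr1; ring.
    by rewrite sinD sinB; ring.
  rewrite (_ : (fun t => _) = (fun t => e i.+1 t + (if i is j.+1 then e j t else 0))); last exact/funext.
  case: i {Lb ee cUi} => [|j]; last by rewrite innerDr //; exact: bas_L2.
  by rewrite addr0; apply: (congr1 (inner w h)); apply/funext => t; rewrite addr0.
have hh2 : l2le hh (Num.sqrt (n2 w h)).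
  by apply: (bessel w_gt0 (e := e)) => // [i|i j]; [exact: bas_L2|exact: bas_on].
(* The recurrence has characteristic roots z, z^*, both of modulus 1. *)
have gen (x y : C) : x + y = z + z^* -> cabs y = 1 -> x * y = 1 -> hh 1%N = x * hh 0%N.
  move=> xy y1 xy1; apply/eqP; rewrite -subr_eq0; apply/eqP.
  (* This combination is multiplied by the other root [y] at each step. *)
  apply: (const_mod_zero (a := fun n => hh n.+1 - x * hh n) (K := Num.sqrt (n2 w h) + cabs x * Num.sqrt (n2 w h))).
    move=> n; have -> : hh n.+2 - x * hh n.+1 = y * (hh n.+1 - x * hh n).
      have := rec n.+1; rewrite /= mulr0 addr0 => /eqP; rewrite subr_eq0 => /eqP.
      rewrite -xy => e1; have -> : hh n.+2 = (x + y) * hh n.+1 - hh n by rewrite -e1; ring.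
      by rewrite -[hh n in LHS]mul1r -xy1; ring.
    by rewrite cabsM y1 mul1r.
  apply: l2leB; last exact: l2leZ.
  have [k0 hk] := hh2; split=> [|n]; [exact: k0|apply: le_trans (hk n.+1)].
  by rewrite big_ord_recl /= lerDr sqr_ge0.
have g1 := gen z z^* erefl _ zz; have g2 := gen z^* z (addrC _ _) _ _.
have zc : cabs z = 1 by exact: cabs_expi.
have {}g1 : hh 1%N = z * hh 0%N by apply: g1; rewrite cabs_conj.
have {}g2 : hh 1%N = z^* * hh 0%N by apply: g2; rewrite // mulrC.
have h0 : hh 0%N = 0.
  apply/eqP; have : (z - z^*) * hh 0%N = 0 by rewrite mulrBl -g1 -g2 subrr.
  move=> /eqP; rewrite mulf_eq0 => /orP[|//]; rewrite /z /expi; simpc.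
  by rewrite eq_complex /= => /andP[_]; rewrite -mulr2n mulrn_eq0 /= (gt_eqF st0).
have h1 : hh 1%N = 0 by rewrite g1 h0 mulr0.
have := rec 0%N; rewrite h1 h0 mulr0 addr0 subr0 add0r mulr1 => c0.
by have := hU t0; rewrite c0 mul0r add0r /f subrr mul0r; apply; rewrite !ltW.
Qed.

End Vanishing.

(** Chernoff's argument is pointwise and needs a derivative, so it is applied to the solution [U] of
    [U'' = F] with all coefficients 0. Since [U] vanishes on the open interval, so does [V], and [F]
    vanishes almost everywhere. *)
Lemma bas_complete b F : inL2 w F -> (forall i, inner w F (bas w b i) = 0) -> l2eq w F (fun=> 0).
Proof.
move=> hF F0; have [|U [V [aU aV dU _ cU]]] := bvp (z := fun=> 0) w_gt0 hF (b := b).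
  by move=> i; rewrite F0 mulr0.
have U0 t : t \in `]0, w[ -> U t = 0.
  have [bd|bd] : b = dir \/ b <> dir by case: b {F0 aU aV dU cU}; [right|right|left].
    exact: (vanish_dir aU dU cU bd).
  exact: (vanish_exp aU dU cU bd).
have V0 t : t \in `]0, w[ -> V t = 0.
  move=> tw; have [d1 d2] := dU t tw.
  have h1 : complex.Re (V t) = 0 by apply: zero_deriv tw d1 => s /U0 ->.
  have h2 : complex.Im (V t) = 0 by apply: zero_deriv tw d2 => s /U0 ->.
  by move: h1 h2; case: (V t) => a c /= -> ->.
have [[_ r1 _] [_ r2 _]] := aV.
have n0 : {ae mu, forall t, t <> 0 /\ t <> w}.
  exists [set 0; w]; split.
  - by apply: measurableU; exact: measurable_set1.
  - have m1 x : @measurable _ (measurableTypeR R) [set x] by exact: measurable_set1.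
    by apply: etrans (measureU0 _ _ _) _ => //; exact: lebesgue_measure_set1.
  - by move=> t /= /not_andP[] /contrapT ->; [left|right].
apply: aeS2 n0 _; last first.
  apply: aeS2 r1 r2; move=> t a1 a2; exact: (conj a1 a2).
move=> t [t0 tw] /= [a1 a2]; rewrite in_itv /= => /andP[t1 t2].
have tin : t \in `]0, w[ by rewrite in_itv /= !lt_neqAle t1 t2 !andbT; apply/andP; split; apply/eqP => // /esym.
have h1 : complex.Re (F t) = 0 by apply: zero_deriv tin (a1 tin) => s /V0 ->.
have h2 : complex.Im (F t) = 0 by apply: zero_deriv tin (a2 tin) => s /V0 ->.
by move: h1 h2; case: (F t) => a c /= -> ->.
Qed.

End Completeness.

(** * The differential operator in coordinates *)

Section Operator.
Context {R : realType}.
Local Notation C := R[i].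
Local Notation mu := (@lebesgue_measure R).
Variables (w : R) (b : bcond) (k : nat) (q : R -> C).
Hypotheses (w_gt0 : 0 < w) (k_gt0 : (0 < k)%N) (hq : inL2 w q).
Local Notation D := (`[0, w]%classic : set R).
Implicit Types (F G f g y U V h : R -> C) (i j n : nat) (t : R).

Let e := bas w b.
Let e_L2 i : inL2 w (e i). Proof. exact: bas_L2. Qed.
Let e_on i j : inner w (e i) (e j) = (i == j)%:R. Proof. exact: bas_on. Qed.
Let e_bnd i t : cabs (e i t) <= 2. Proof. exact: cabs_bas. Qed.

Definition evl i : R := frq w b i ^+ (2 * k).
Definition qmx : nat -> nat -> C := potmx w e q.
Definition fcoef y i : C := inner w y (e i).

Hypothesis l1dom : forall z, dom evl z -> exists K, l1le z K.

Lemma l2eq_fcoef f g : inL2 w f -> inL2 w g -> (forall i, fcoef f i = fcoef g i) -> l2eq w f g.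
Proof.
move=> hf hg fg; have := @bas_complete R w w_gt0 b (fun t => f t - g t) (inL2B w_gt0 hf hg).
have h0 i : inner w (fun t => f t - g t) (bas w b i) = 0.
  have Lb := e_L2 i; have h1 := fg i; rewrite /fcoef /e in h1.
  by rewrite innerBl // h1 subrr.
by move=> /(_ h0); apply: aeS => t h tw; apply/eqP; rewrite -subr_eq0 h.
Qed.

Lemma cacd_cderiv F f t : cacd w F f -> ccontinuous w f -> t \in `]0, w[ -> has_cderiv F t (f t).
Proof.
move=> [h1 h2] cf tw; have [d1 d2] := cint_cderiv w_gt0 cf tw.
have key (G g : R -> R) : acd w G g ->
    is_derive t (1 : R) (fun x => \int[mu]_(s in `[0, x]) g s) (g t) -> is_derive t (1 : R) G (g t).
  move=> hG dG; apply: (@is_derive_eqoo _ w (fun x => G 0 + \int[mu]_(s in `[0, x]) g s)) => //.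
    by move=> s sw; apply/esym; exact: (acd_ftc w_gt0 hG).
  by rewrite -[g t]add0r; apply: is_deriveD.
by split; [exact: key _ _ h1 d1|exact: key _ _ h2 d2].
Qed.

Lemma abs_continuous_rac F : abs_continuous w F <->
  rac w (fun t => complex.Re (F t)) /\ rac w (fun t => complex.Im (F t)).
Proof.
have ReB (z y : C) : complex.Re (z - y) = complex.Re z - complex.Re y by case: z; case: y.
have ImB (z y : C) : complex.Im (z - y) = complex.Im z - complex.Im y by case: z; case: y.
split=> [h|[h1 h2]].
  split=> r r0; have [d d0 hd] := h r r0; exists d => // n a c u1 u2 u3;
  apply: le_lt_trans (hd n a c u1 u2 u3); apply: ler_sum => i _.
    by rewrite -ReB Re_le_cabs.
  by rewrite -ImB Im_le_cabs.
move=> r r0; have r2 : 0 < r / 2 by rewrite divr_gt0.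
have [d1 d10 hd1] := h1 _ r2; have [d2 d20 hd2] := h2 _ r2.
exists (Num.min d1 d2); first by rewrite lt_min d10.
move=> n a c u1 u2; rewrite lt_min => /andP[s1 s2].
have v1 := hd1 n a c u1 u2 s1; have v2 := hd2 n a c u1 u2 s2.
rewrite (splitr r); apply: le_lt_trans (ltrD v1 v2); rewrite -big_split /=.
by apply: ler_sum => i _; apply: le_trans (cabs_le_ReIm _) _; rewrite ReB ImB.
Qed.

Lemma sobolev_cacd N (Y : nat -> R -> C) : (0 < N)%N -> sobolev_derivs w N Y <->
  [/\ forall j, (j < N)%N -> cacd w (Y j) (Y j.+1),
      forall j t, (j.+1 < N)%N -> t \in `]0, w[ -> has_cderiv (Y j) t (Y j.+1 t)
    & inL2 w (Y N)].
Proof.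
move=> N0; split=> [[h1 h2 /abs_continuous_rac [h3 h3'] h4 h5]|[h1 h2 h3]].
  split=> // j jN; have [jN'|Nj] := ltnP j.+1 N.
    by apply: cacd_C1 => //; [exact: h1|exact: h1|move=> t; exact: h2].
  have jE : j = N.-1 by lia.
  have [i1 i2] := L2_cintegrable w_gt0 h5.
  rewrite jE prednK //; split; split=> //; apply: aeS h4 => t h tw; by have [] := h tw.
have hl : cacd w (Y N.-1) (Y N) by rewrite -{2}(prednK N0); apply: h1; rewrite ltn_predL.
have [[r1 a1 _] [r2 a2 _]] := hl.
split=> //.
- by move=> j /h1 /cacd_ccont; apply.
- by apply/abs_continuous_rac.
- by apply: aeS2 a1 a2 => t u v tw; split; [exact: u|exact: v].
Qed.

Lemma evlE i : ((evl i)%:C : C) = (-1) ^+ k * (- ((frq w b i) ^+ 2)%:C) ^+ k.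
Proof.
rewrite -exprMn mulN1r opprK -rmorphXn -exprM; congr (_%:C).
Qed.

Lemma fcoefZ c f i : inL2 w f -> fcoef (fun t => c * f t) i = c * fcoef f i.
Proof. by move=> hf; rewrite /fcoef innerZl //; exact: e_L2. Qed.

Lemma fcoefD f g i : inL2 w f -> inL2 w g -> fcoef (fun t => f t + g t) i = fcoef f i + fcoef g i.
Proof. by move=> hf hg; rewrite /fcoef innerDl //; exact: e_L2. Qed.

Lemma l2eq_fcoefE f g i : inL2 w f -> inL2 w g -> l2eq w f g -> fcoef f i = fcoef g i.
Proof. by move=> hf hg; exact: (l2eq_inner w_gt0 hf hg (e_L2 i)). Qed.

Lemma fcoef_l2 f : inL2 w f -> l2le (fcoef f) (Num.sqrt (n2 w f)).
Proof. by move=> hf; exact: (bessel w_gt0 e_L2 e_on hf). Qed.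

Lemma fcoef_synth z K i : l1le z K -> fcoef (synth e z) i = z i.
Proof. by move=> hz; exact: (coef_synth w_gt0 e_L2 e_on e_bnd i hz). Qed.

Lemma q_synth_L2 z K : l1le z K -> inL2 w (fun t => q t * synth e z t).
Proof.
move=> hz; have mz := synth_meas w_gt0 e_L2 e_bnd hz.
exact: (inL2_mulb w_gt0 hq mz (fun t _ => synth_bnd e_bnd t hz)).
Qed.

(** Green's formula is applied [k] times to pairs of derivatives. The product with [q] is computed
    on the series of [y], whose coefficients are in l^1 by [l1dom]. *)
Lemma L_op_coef y f : L_op b k w q y f ->
  [/\ inL2 w y, inL2 w f, dom evl (fcoef y) & forall i, fcoef f i = pert evl qmx (fcoef y) i].
Proof.
move=> [hy hf [Y [/sobolev_cacd hS /satisfies_bc2 hb yY fY]]].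
have k2 : (0 < 2 * k)%N by rewrite muln_gt0.
have [a1 a2 a3] := hS k2; have {}hb := hb w_gt0 k_gt0.
have LY j : (j <= 2 * k)%N -> inL2 w (Y j).
  rewrite leq_eqVlt => /orP[/eqP -> //|/a1]; exact: cacd_L2.
have cf i j : (j <= k)%N -> fcoef (Y (2 * j)%N) i = (- ((frq w b i) ^+ 2)%:C) ^+ j * fcoef (Y 0%N) i.
  elim: j => [|j IH] jk; first by rewrite muln0 expr0 mul1r.
  rewrite exprS -mulrA -IH; last exact: ltnW.
  have -> : (2 * j.+1)%N = (2 * j).+2 by lia.
  rewrite /fcoef /e (coef_green (b := b) (V := Y (2 * j).+1) w_gt0 i (a1 (2 * j)%N _)) //; first last.
  - exact: hb.
  - by apply: LY; lia.
  - by apply: a1; lia.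
  - by lia.
have yY' i : fcoef y i = fcoef (Y 0%N) i by apply: l2eq_fcoefE => //; exact: LY.
have top i : fcoef (fun t => (-1) ^+ k * Y (2 * k)%N t) i = (evl i)%:C * fcoef y i.
  rewrite fcoefZ; last exact: LY.
  by rewrite cf // evlE yY' mulrA.
have dy : dom evl (fcoef y).
  split; first by exists (Num.sqrt (n2 w y)); exact: fcoef_l2.
  exists (Num.sqrt (n2 w (fun t => (-1) ^+ k * Y (2 * k)%N t))).
  by apply: eq_l2le top _; apply: fcoef_l2; apply: inL2Z => //; exact: LY.
have [K hK] := l1dom dy; have Ls := synth_L2 w_gt0 e_L2 e_bnd hK.
have Ys : l2eq w (Y 0%N) (synth e (fcoef y)).
  apply: l2eq_fcoef => // [|i]; first exact: LY.
  by rewrite -yY' (fcoef_synth i hK).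
split=> // i; rewrite /pert -top -(coef_q_synth w_gt0 e_L2 e_bnd hq i hK).
have L1 : inL2 w (fun t => (-1) ^+ k * Y (2 * k)%N t) by apply: inL2Z => //; exact: LY.
have L2 := q_synth_L2 hK.
rewrite -[inner _ _ (e i)]/(fcoef _ i).
have <- : fcoef (fun t => (-1) ^+ k * Y (2 * k)%N t - q t * synth e (fcoef y) t) i =
   fcoef (fun t => (-1) ^+ k * Y (2 * k)%N t) i - fcoef (fun t => q t * synth e (fcoef y) t) i.
  by rewrite /fcoef innerBl //; exact: e_L2.
apply: l2eq_fcoefE => //; first exact: inL2B.
by apply: aeS2 fY Ys => t h1 h2 tw; rewrite h1 // h2.
Qed.

(** Each step solves a second-order problem on top of the previous solution; the two new functions
    go in front and shift all indices by two. *)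
Lemma bvp_chain n G (z : nat -> C) : inL2 w G ->
  (forall i, fcoef G i = (- ((frq w b i) ^+ 2)%:C) ^+ n * z i) ->
  exists Y : nat -> R -> C,
    [/\ Y (2 * n)%N = G,
      forall j, (j < 2 * n)%N -> cacd w (Y j) (Y j.+1),
      forall j t, (j.+1 < 2 * n)%N -> t \in `]0, w[ -> has_cderiv (Y j) t (Y j.+1 t),
      forall i, (i < n)%N -> bc2 w b (Y (2 * i)%N) (Y (2 * i).+1)
    & forall i, fcoef (Y 0%N) i = z i].
Proof.
elim: n z => [|n IH] z hG hz.
  by exists (fun=> G); split=> // i; rewrite hz expr0 mul1r.
have [|Y [Y1 Y2 Y3 Y4 Y5]] := IH (fun i => - ((frq w b i) ^+ 2)%:C * z i) hG.
  by move=> i; rewrite hz exprSr mulrA.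
have LY : inL2 w (Y 0%N).
  have [n0|n0] := posnP n; first by move: Y1; rewrite n0 => ->.
  by apply: (cacd_L2 w_gt0 (f := Y 1%N)); apply: Y2; lia.
have [U [V [u1 u2 u3 u4 u5]]] := bvp w_gt0 LY Y5.
pose Z j := if j is j'.+1 then if j' is j''.+1 then Y j'' else V else U.
exists Z; split.
- by have -> : (2 * n.+1)%N = (2 * n).+2 by lia.
- case=> [|[|j]] //= jn; apply: Y2; lia.
- case=> [|[|j]] t //= jn tw; [exact: u3| |by apply: Y3 => //; lia].
  apply: cacd_cderiv tw => //; apply: (cacd_ccont w_gt0 (f := Y 1%N)); apply: Y2; lia.
- case=> [|i] // ni; have -> : (2 * i.+1)%N = (2 * i).+2 by lia.
  exact: Y4.
- exact: u5.
Qed.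

(** The equation dictates the highest derivative [G], from which [bvp_chain] builds the others. With
    [L_op_coef] this identifies [L_bc] with [Lam - Q], domains included. *)
Lemma L_op_of_coef y f : inL2 w y -> inL2 w f -> dom evl (fcoef y) ->
  (forall i, fcoef f i = pert evl qmx (fcoef y) i) -> L_op b k w q y f.
Proof.
move=> hy hf dy hfy; have [K hK] := l1dom dy.
have Ls := synth_L2 w_gt0 e_L2 e_bnd hK; have Lq := q_synth_L2 hK.
pose G t := (-1) ^+ k * (f t + q t * synth e (fcoef y) t).
have LG : inL2 w G by apply: inL2Z => //; exact: inL2D.
have [|Y [Y1 Y2 Y3 Y4 Y5]] := @bvp_chain k G (fcoef y) LG.
  move=> i; rewrite fcoefZ; last exact: inL2D.
  rewrite fcoefD // [fcoef (fun t => _ * _) i](coef_q_synth w_gt0 e_L2 e_bnd hq i hK) hfy /pert subrK evlE.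
  by rewrite !mulrA -expr2 sqrr_sign mul1r.
have k2 : (0 < 2 * k)%N by rewrite muln_gt0.
have LY : inL2 w (Y 0%N) by apply: (cacd_L2 w_gt0); exact: Y2.
have yY : l2eq w y (Y 0%N) by apply: l2eq_fcoef.
split=> //; exists Y; split=> //.
- by apply/sobolev_cacd => //; split=> //; rewrite Y1.
- exact/satisfies_bc2.
- have sY : l2eq w (synth e (fcoef y)) (Y 0%N).
    by apply: l2eq_fcoef => // i; rewrite Y5 (fcoef_synth i hK).
  apply: aeS sY => t h tw; rewrite Y1 /G mulrA -expr2 sqrr_sign mul1r.
  by rewrite -h // addrK.
Qed.

End Operator.

(** * Gaps of the unperturbed spectrum *)

Section Numerics.
Context {R : realType}.
Implicit Types (n i j : nat) (w : R) (b : bcond).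

Lemma natX_le (a c r : nat) : (a <= c)%N -> (a%:R : R) ^+ r <= c%:R ^+ r.
Proof. by move=> ac; rewrite lerXn2r ?nnegrE ?ler0n // ler_nat. Qed.

Lemma pow_gap (a c r : nat) : (c < a)%N -> (a%:R : R) ^+ r <= a%:R ^+ r.+1 - c%:R ^+ r.+1.
Proof.
move=> ca; have h : (c%:R : R) ^+ r.+1 <= c%:R * a%:R ^+ r.
  by rewrite exprS ler_wpM2l // natX_le // ltnW.
have h1 : (c%:R : R) + 1 <= a%:R by rewrite natr1 ler_nat.
have a0 : 0 <= (a%:R : R) ^+ r by exact: exprn_ge0.
rewrite [X in _ <= X - _]exprS; have := ler_wpM2r a0 h1; rewrite mulrDl mul1r; lra.
Qed.

Lemma inv_gap (n r : nat) : (0 < n)%N ->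
  (n.+1%:R ^+ r.+2)^-1 <= (n%:R ^+ r.+1)^-1 - (n.+1%:R ^+ r.+1)^-1 :> R.
Proof.
move=> n0; have x0 : 0 < n%:R ^+ r.+1 :> R by rewrite exprn_gt0 // ltr0n.
have y0 : 0 < n.+1%:R ^+ r.+1 :> R by rewrite exprn_gt0 // ltr0n.
have y1 : 0 < n.+1%:R :> R by rewrite ltr0n.
have xy : n%:R ^+ r.+1 <= n.+1%:R ^+ r.+1 :> R by rewrite ler_pXn2r ?nnegrE // ler_nat.
have h := @pow_gap n.+1 n r (ltnSn n).
rewrite -subr_ge0; set x := n%:R ^+ r.+1 in x0 xy h *; set y := n.+1%:R ^+ r.+1 in y0 xy h *.
have yE : y = n.+1%:R * n.+1%:R ^+ r by rewrite /y exprS.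
have -> : (n.+1%:R ^+ r.+2)^-1 = (n.+1%:R * y)^-1 :> R by rewrite exprS.
have -> : x^-1 - y^-1 - (n.+1%:R * y)^-1 = (n.+1%:R * (y - x) - x) / (n.+1%:R * x * y).
  by field; rewrite !gt_eqF.
apply: divr_ge0; last by rewrite !mulr_ge0 // ltW.
have := ler_wpM2l (ltW y1) h; rewrite -yE; lra.
Qed.

(** The [n + 1] terms with [l <= n] contribute at most [2 / n%:R ^+ r.+1]; by [inv_gap] the others
    telescope to at most half of that. *)
Lemma tail_pow (n r L : nat) : (0 < n)%N ->
  \sum_(l < L) ((maxn n l)%:R ^+ r.+2)^-1 <= 3 / n%:R ^+ r.+1 :> R.
Proof.
move=> n0; have n0' : 0 < n%:R :> R by rewrite ltr0n.
have n1 : 1 <= n%:R :> R by rewrite ler1n.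
have x0 : 0 < n%:R ^+ r.+1 :> R by exact: exprn_gt0.
have small l : (l <= n.+1)%N -> \sum_(i < l) ((maxn n i)%:R ^+ r.+2)^-1 <= 2 / n%:R ^+ r.+1 :> R.
  move=> ln; rewrite (eq_bigr (fun=> (n%:R ^+ r.+2)^-1)); last first.
    by move=> i _; rewrite (maxn_idPl _) // -ltnS (leq_trans (ltn_ord i)).
  rewrite sumr_const card_ord -[_ *+ l]mulr_natl [_ ^+ r.+2]exprS invfM mulrA ler_wpM2r ?invr_ge0 ?(ltW x0) //.
  rewrite ler_pdivrMr //; apply: (@le_trans _ _ n.+1%:R); first by rewrite ler_nat.
  rewrite -natr1; lra.
have big d : \sum_(i < n.+1 + d) ((maxn n i)%:R ^+ r.+2)^-1 <=
    2 / n%:R ^+ r.+1 + ((n%:R ^+ r.+1)^-1 - ((n + d)%:R ^+ r.+1)^-1) :> R.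
  elim: d => [|d IH]; first by rewrite !addn0 subrr addr0 small.
  rewrite addnS big_ord_recr /= (maxn_idPr _); last by rewrite addSn leqW // leq_addr.
  have := @inv_gap (n + d) r; rewrite addn_gt0 n0 => /(_ isT); rewrite addnS addSn; lra.
have [Ln|nL] := leqP L n.+1.
  apply: le_trans (small _ Ln) _; rewrite ler_wpM2r ?invr_ge0 ?(ltW x0) //; lra.
rewrite -(subnKC (ltnW nL)); apply: le_trans (big _) _.
have : 0 <= ((n + (L - n.+1))%:R ^+ r.+1)^-1 :> R by rewrite invr_ge0 exprn_ge0.
lra.
Qed.

(** Two indices share each value of [j./2], which doubles the constant. As [i./2 <= blk b i], this
    sum dominates the one for every boundary condition. *)
Lemma tail_half (n r J : nat) : (0 < n)%N ->
  \sum_(j < J) ((maxn n j./2)%:R ^+ r.+2)^-1 <= 6 / n%:R ^+ r.+1 :> R.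
Proof.
move=> n0; have e L : \sum_(j < L.*2) ((maxn n j./2)%:R ^+ r.+2)^-1 =
    2 * \sum_(l < L) ((maxn n l)%:R ^+ r.+2)^-1 :> R.
  elim: L => [|L IH]; first by rewrite !big_ord0 mulr0.
  rewrite doubleS !big_ord_recr /= IH uphalf_double doubleK; ring.
apply: (@le_trans _ _ (\sum_(j < J.*2) ((maxn n j./2)%:R ^+ r.+2)^-1)).
  rewrite -!(big_mkord xpredT (fun j => ((maxn n j./2)%:R ^+ r.+2)^-1)).
  have JJ : (J <= J.*2)%N by rewrite -addnn leq_addr.
  rewrite [leRHS](big_cat_nat (leq0n J) JJ) /= lerDl; apply: sumr_ge0 => i _.
  by rewrite invr_ge0 exprn_ge0.
rewrite e; have := @tail_pow n r J n0; lra.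
Qed.

Lemma half_blk b i : (i./2 <= blk b i)%N.
Proof. by case: b => /=; lia. Qed.

Lemma tail_blk b (n r J : nat) : (0 < n)%N ->
  \sum_(j < J) ((maxn n (blk b j))%:R ^+ r.+2)^-1 <= 6 / n%:R ^+ r.+1 :> R.
Proof.
move=> n0; apply: le_trans (tail_half r J n0); apply: ler_sum => j _.
have m0 x : (0 < maxn n x)%N by rewrite leq_max n0.
rewrite lef_pV2 ?posrE ?exprn_gt0 ?ltr0n // ler_pXn2r ?nnegrE // ler_nat.
by rewrite geq_max leq_maxl leq_max half_blk orbT.
Qed.

(* [lam b k w n] is the common eigenvalue of the block [n] of the unperturbed
   operator, and [Nn b n] the number of basis elements in the blocks up to n. *)
Definition sv b n : nat := match b with per => 2 * n | ap => 2 * n + 1 | dir => n end.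

Definition lam b k w n : R := (pi * (sv b n)%:R / w) ^+ (2 * k).

Definition Nn b n : nat := match b with per => 2 * n + 1 | ap => 2 * n + 2 | dir => n end.

Lemma sv_ge b n : (n <= sv b n)%N.
Proof. by case: b => /=; lia. Qed.

Lemma sv_mono b n n' : (n < n')%N -> (sv b n < sv b n')%N.
Proof. by case: b => /=; lia. Qed.

Lemma blk_le b i n : (blk b i <= n)%N = (i < Nn b n)%N.
Proof. by case: b => /=; apply/idP/idP; lia. Qed.

Lemma Nn_mono b n n' : (n <= n')%N -> (Nn b n <= Nn b n')%N.
Proof. by case: b => /=; lia. Qed.

Lemma lam_lambda b k w n : b <> dir -> lambda b k w n = lam b k w n.
Proof. by case: b => // _; rewrite /lambda /lam /= ?addn0. Qed.

Lemma lam_lambda_dir k w n : lambda_dir k w n = lam dir k w n.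
Proof. by []. Qed.

(** Indices with the same [blk] have frequencies of equal modulus, [pi * (sv b n)%:R / w], so [Lam]
    is scalar on each unmerged block. *)
Lemma evl_lam w b k i : evl w b k i = lam b k w (blk b i).
Proof.
rewrite /evl /lam; have [->//|bd] : b = dir \/ b <> dir by case: b; [right|right|left].
have -> : frq w b i = pi * (2 * zidx b i + (theta b)%:Z)%:~R / w by case: b bd.
rewrite !exprM !expr2 !mulrA; congr (_ ^+ k).
suff : ((2 * zidx b i + (theta b)%:Z)%:~R : R) ^+ 2 = ((sv b (blk b i))%:R) ^+ 2.
  rewrite !expr2 => e; have -> (x : R) : pi * x / w * pi * x / w = pi * pi * w^-1 * w^-1 * (x * x) by ring.
  by rewrite e; ring.
have [->|->] : 2 * zidx b i + (theta b)%:Z = (sv b (blk b i))%:Z \/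
    2 * zidx b i + (theta b)%:Z = - (sv b (blk b i))%:Z.
  by case: b bd => // _; rewrite /zidx /= ; case: (odd i); lia.
  by [].
by rewrite mulrNz sqrrN.
Qed.

Section Gaps.
Variables (w : R) (k : nat).
Hypotheses (w_gt0 : 0 < w) (hk : (1 < k)%N).

Definition kap0 : R := (pi / w) ^+ (2 * k).

Lemma kap0_gt0 : 0 < kap0.
Proof. by rewrite exprn_gt0 // divr_gt0 // pi_gt0. Qed.

Lemma lamE b n : lam b k w n = kap0 * (sv b n)%:R ^+ (2 * k).
Proof. by rewrite /lam mulrAC exprMn. Qed.

Lemma lam_ge0 b n : 0 <= lam b k w n.
Proof. by rewrite lamE mulr_ge0 ?(ltW kap0_gt0) ?exprn_ge0. Qed.


Lemma lam_step b n n' : (n < n')%N ->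
  kap0 * n'%:R ^+ (2 * k - 1) <= lam b k w n' - lam b k w n.
Proof.
move=> nn; rewrite !lamE -mulrBr ler_wpM2l ?(ltW kap0_gt0) //.
have -> : (2 * k)%N = (2 * k - 1).+1 by lia.
rewrite subn1 /=; apply: le_trans (pow_gap _ (sv_mono b nn)).
by rewrite natX_le // sv_ge.
Qed.

Lemma lam_gap b n n' : n <> n' ->
  kap0 * (maxn n n')%:R ^+ (2 * k - 1) <= `|lam b k w n - lam b k w n'|.
Proof.
move=> nn; have [h|h|//] := ltngtP n n'.
  by rewrite distrC; apply: le_trans (lam_step b h) (ler_norm _).
by apply: le_trans (lam_step b h) (ler_norm _).
Qed.

Lemma lam_mono b n n' : (n <= n')%N -> lam b k w n <= lam b k w n'.
Proof.
rewrite leq_eqVlt => /orP[/eqP -> //|h]; have := lam_step b h.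
have : 0 <= kap0 * n'%:R ^+ (2 * k - 1) by rewrite mulr_ge0 ?(ltW kap0_gt0) ?exprn_ge0.
lra.
Qed.

Lemma evl_lower b : exists2 c, 0 < c & forall i, c * (maxn 1 i./2)%:R ^+ (2 * k) <= 1 + evl w b k i.
Proof.
have k0 := kap0_gt0; exists (Num.min 1 kap0); first by rewrite lt_min ltr01.
move=> i; rewrite evl_lam lamE.
have [h|h] := leqP i./2 1.
  rewrite expr1n mulr1; apply: (@le_trans _ _ 1); first by rewrite ge_min lexx.
  by rewrite lerDl mulr_ge0 ?(ltW k0) ?exprn_ge0.
apply: (@le_trans _ _ (kap0 * (sv b (blk b i))%:R ^+ (2 * k))).
  have min0 : 0 <= Num.min 1 kap0 by rewrite le_min ler01 ltW.
  apply: ler_pM => //; first by rewrite ge_min lexx orbT.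
  by rewrite natX_le // (leq_trans (half_blk b i)) // sv_ge.
by rewrite lerDr.
Qed.

Lemma evl_ge0 b i : 0 <= evl w b k i.
Proof. by rewrite evl_lam lam_ge0. Qed.

Lemma evl_inv_sum b : exists2 c, 0 < c & forall J, \sum_(i < J) (1 + evl w b k i)^-1 <= c.
Proof.
have [c c0 hc] := evl_lower b; exists (c^-1 * 6); first by rewrite mulr_gt0 ?invr_gt0.
move=> J; apply: (@le_trans _ _ (\sum_(i < J) c^-1 * ((maxn 1 i./2)%:R ^+ (2 * k))^-1)).
  apply: ler_sum => i _; rewrite -invfM lef_pV2 ?posrE //.
    by rewrite ltr_pwDl // evl_ge0.
  by rewrite mulr_gt0 // exprn_gt0 // ltr0n leq_max.
rewrite -mulr_sumr ler_wpM2l ?invr_ge0 ?(ltW c0) //.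
have -> : (2 * k)%N = (2 * k - 2).+2 by lia.
by apply: le_trans (tail_half _ J (ltnSn 0)) _; rewrite expr1n divr1.
Qed.

Lemma evl_sq_sum b : exists2 c, 0 <= c & forall J, \sum_(i < J) (1 + evl w b k i)^-1 ^+ 2 <= c ^+ 2.
Proof.
have [c c0 hc] := evl_inv_sum b; exists (c + 1); first by rewrite addr_ge0 // ltW.
move=> J; apply: (@le_trans _ _ c).
  apply: le_trans (hc J); apply: ler_sum => i _; rewrite expr2 ler_piMr //.
    by rewrite invr_ge0 addr_ge0 // evl_ge0.
  by rewrite invf_le1 ?lerDl ?evl_ge0 // ltr_pwDl // evl_ge0.
rewrite expr2; nra.
Qed.

(** Bounds the l^2 norm of the inverse gaps seen from block [n]: squares of
    [kap0 * max(n, j)^(2k-1)] have inverses summing to order [n^-(4k-3)], with the constant 6 of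
    [tail_blk]. *)
Definition tailc n : R := Num.sqrt (6 / n%:R ^+ (4 * k - 3)) / kap0.

Lemma tailc_ge0 n : 0 <= tailc n.
Proof. by rewrite divr_ge0 ?sqrtr_ge0 // ltW // kap0_gt0. Qed.

Lemma tailc_small (r : R) : 0 < r -> exists N, forall n, (N <= n)%N -> tailc n <= r.
Proof.
move=> r0; have s0 : 0 < r * kap0 by rewrite mulr_gt0 // kap0_gt0.
have s2 : 0 < (r * kap0) ^+ 2 by rewrite exprn_gt0.
exists (Num.truncn (6 / (r * kap0) ^+ 2)).+1 => n Nn.
have n1 : 6 / (r * kap0) ^+ 2 <= n%:R.
  by apply: le_trans (ltW (truncnS_gt _)) _; rewrite ler_nat.
have n0 : (0 < n)%N by exact: leq_trans Nn.
rewrite /tailc ler_pdivrMr ?kap0_gt0 // -(@ler_pXn2r _ 2) ?nnegrE ?sqrtr_ge0 ?(ltW s0) //.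
have np : 0 < n%:R ^+ (4 * k - 3) :> R by rewrite exprn_gt0 // ltr0n.
rewrite sqr_sqrtr ?divr_ge0 ?(ltW np) // ler_pdivrMr // mulrC -ler_pdivrMr //.
apply: le_trans n1 _; rewrite -natrX ler_nat.
by have := leq_pexp2l n0 (_ : (1 <= 4 * k - 3)%N); rewrite expn1; apply; lia.
Qed.

End Gaps.

(** Row bounds are suprema over finite sections; for finitely many rows a single section length
    approximates all of them. *)
Lemma l2_rows (f : nat -> nat -> R[i]) (S : R) : 0 <= S ->
  (forall I J, \sum_(i < I) \sum_(j < J) cabs (f i j) ^+ 2 <= S ^+ 2) ->
  exists r : nat -> R, (forall i, l2le (f i) (r i)) /\ forall I, \sum_(i < I) r i ^+ 2 <= S ^+ 2.
Proof.
move=> S0 hS; pose A i := [set \sum_(j < J) cabs (f i j) ^+ 2 | J in [set: nat]].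
have row i J : \sum_(j < J) cabs (f i j) ^+ 2 <= S ^+ 2.
  apply: le_trans (hS i.+1 J); rewrite big_ord_recr /= lerDr.
  by apply: sumr_ge0 => a _; apply: sumr_ge0 => j _; exact: sqr_ge0.
have hA i : has_sup (A i).
  by split; [exists (\sum_(j < 0) cabs (f i j) ^+ 2); exists 0%N|exists (S ^+ 2) => _ [J _ <-]; exact: row].
have ub i J : \sum_(j < J) cabs (f i j) ^+ 2 <= sup (A i).
  by apply: sup_upper_bound (hA i) _ _; exists J.
have s0 i : 0 <= sup (A i) by apply: le_trans (ub i 0%N); rewrite big_ord0.
exists (fun i => Num.sqrt (sup (A i))); split.
  by move=> i; split=> [|J]; rewrite ?sqrtr_ge0 // sqr_sqrtr.
move=> I; under eq_bigr do rewrite sqr_sqrtr //.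
apply/ler_addgt0Pr => e e0; have e1 : 0 < e / I.+1%:R by rewrite divr_gt0 // ltr0n.
have [J hJ] : exists J, forall i, (i < I)%N -> sup (A i) <= \sum_(j < J) cabs (f i j) ^+ 2 + e / I.+1%:R.
  elim: {1}I => [|n [J hJ]]; first by exists 0%N.
  have [_ [J' _ <-] h] := sup_adherent e1 (hA n).
  have mono i (a c : nat) : (a <= c)%N -> \sum_(j < a) cabs (f i j) ^+ 2 <= \sum_(j < c) cabs (f i j) ^+ 2.
    move=> ac; rewrite -!(big_mkord xpredT (fun j => cabs (f i j) ^+ 2)).
    by rewrite [leRHS](big_cat_nat (leq0n a) ac) /= lerDl; apply: sumr_ge0 => j _; exact: sqr_ge0.
  exists (maxn J J') => i; rewrite ltnS leq_eqVlt => /orP[/eqP ->|/hJ hi].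
    rewrite -lerBlDr; apply: le_trans (ltW h) _; exact: mono (leq_maxr J J').
  by apply: le_trans hi _; rewrite lerD2r; exact: mono (leq_maxl J J').
apply: (@le_trans _ _ (\sum_(i < I) (\sum_(j < J) cabs (f i j) ^+ 2 + e / I.+1%:R))).
  by apply: ler_sum => i _; exact: hJ.
rewrite big_split /=; apply: lerD; first exact: hS.
rewrite sumr_const card_ord -[_ *+ I]mulr_natl mulrCA ler_piMr ?(ltW e0) //.
by rewrite ler_pdivrMr ?ltr0n // mul1r ler_nat.
Qed.

End Numerics.

(** * Similarity for the differential operator *)

Section Model.
Context {R : realType}.
Local Notation C := R[i].
Variables (b : bcond) (k m : nat) (w : R) (q : R -> C).
Hypotheses (hk : (1 < k)%N) (w_gt0 : 0 < w) (hq : inL2 w q) (m_gt0 : (0 < m)%N).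
Implicit Types (x y f : R -> C) (z v : nat -> C) (i j n : nat) (l : C).

Local Notation ev := (evl w b k).
Local Notation Q := (qmx w b q).
Local Notation p := (2 * k - 1)%N.
Local Notation k0 := (kap0 w k).

(** The factor 2 is the uniform bound [cabs_bas] of the basis. *)
Definition potnorm : R := 2 * Num.sqrt (n2 w q).
Local Notation M := potnorm.

(* All blocks up to m are merged into one. *)
Definition bl i : nat := maxn m (blk b i).
Definition Gap j : R := k0 * (bl j)%:R ^+ p.
Local Notation tailc := (tailc w k).
(** The merged block has [Nn b m] indices, every other one at most two. *)
Definition Nb : nat := Nn b m + 2.
Local Notation bb := (bB M Nb).

(** [small] is the contraction condition with [eps = tailc m]; [sep] makes the gaps exceed the norm
    bound [bb] of [B] by enough to draw separating circles. *)
Hypothesis small : 10 * (M * tailc m) <= 1.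
Hypothesis sep : 10 * (bb + 1) <= k0 * (m.+1)%:R ^+ p.

Let k00 : 0 < k0. Proof. exact: kap0_gt0. Qed.

Let ev_nonneg i : 0 <= ev i. Proof. exact: evl_ge0. Qed.

Lemma bl_gt0 i : (0 < bl i)%N.
Proof. by rewrite leq_max m_gt0. Qed.

Lemma colQ : colb Q M.
Proof. exact: (potmx_col w_gt0 (bas_L2 w_gt0 b) (bas_on w_gt0 b) (cabs_bas w b) hq). Qed.

Lemma Gap_gt0 j : 0 < Gap j.
Proof. by rewrite mulr_gt0 // exprn_gt0 // ltr0n bl_gt0. Qed.

(** Sharper than [gap_Gap] in that the larger block counts, as the commutator estimate [cmt_le]
    requires. *)
Lemma gap_max i j : bl i <> bl j -> k0 * (maxn (bl i) (bl j))%:R ^+ p <= `|ev i - ev j|.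
Proof.
move=> h; have bij : blk b i <> blk b j by move=> e; apply: h; rewrite /bl e.
rewrite !evl_lam; apply: le_trans (lam_gap w_gt0 hk b bij).
by rewrite ler_wpM2l ?(ltW k00) // natX_le //; move: h; rewrite /bl; lia.
Qed.

Lemma gap_Gap i j : bl i <> bl j -> Gap j <= `|ev i - ev j|.
Proof.
move=> h; apply: le_trans (gap_max h).
by rewrite ler_wpM2l ?(ltW k00) // natX_le // leq_maxr.
Qed.

Let tailc_ge0 n : 0 <= tailc n. Proof. exact: tailc_ge0. Qed.

Lemma sum_tail n J : (0 < n)%N ->
  \sum_(j < J) ((k0 * (maxn n (blk b j))%:R ^+ p)^-1) ^+ 2 <= tailc n ^+ 2.
Proof.
move=> n0; have n0' : 0 < n%:R :> R by rewrite ltr0n.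
rewrite /tailc exprMn sqr_sqrtr; last by rewrite divr_ge0 // exprn_ge0 // ltW.
have e (x : R) : ((k0 * x ^+ p)^-1) ^+ 2 = (k0^-1) ^+ 2 * (x ^+ (2 * p))^-1.
  by rewrite invfM exprMn; congr (_ * _); rewrite exprVn -exprM mulnC.
under eq_bigr do rewrite e.
rewrite -mulr_sumr [leRHS]mulrC ler_wpM2l ?sqr_ge0 //.
have -> : (2 * p)%N = (4 * k - 4).+2 by lia.
have -> : (4 * k - 3)%N = (4 * k - 4).+1 by lia.
exact: tail_blk.
Qed.

Lemma sumG n : \sum_(i < n) (Gap i)^-1 ^+ 2 <= tailc m ^+ 2.
Proof. exact: sum_tail. Qed.

Lemma l1dom z : dom ev z -> exists K, l1le z K.
Proof.
have [c c0 hc] := evl_sq_sum w_gt0 hk b.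
exact: (dom_l1 ev_nonneg c0 hc).
Qed.

Lemma cutE i n : (m <= n)%N -> (i < Nn b n)%N = (bl i <= n)%N.
Proof. by move=> mn; rewrite -blk_le geq_max mn. Qed.

Lemma blocks n : exists c d, forall i, (bl i == n) = (c <= i < c + d)%N.
Proof.
have [nm|mn|->] := ltngtP n m.
- exists 0%N, 0%N => i; rewrite addn0 ltn0 andbF; apply/eqP; rewrite /bl; lia.
- exists (Nn b n.-1), (Nn b n - Nn b n.-1)%N => i.
  rewrite subnKC ?Nn_mono ?leq_pred // cutE ?(ltnW mn) // leqNgt cutE; last by lia.
  by rewrite -ltnNge; apply/eqP/andP; lia.
- exists 0%N, (Nn b m) => i; rewrite /= add0n cutE //; apply/eqP/idP; rewrite /bl; lia.
Qed.

Lemma block_small n : (m < n)%N -> exists c d, (d <= 2)%N /\ forall i, (bl i == n) = (c <= i < c + d)%N.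
Proof.
move=> mn; exists (Nn b n.-1), (Nn b n - Nn b n.-1)%N; split; first by case: b => /=; lia.
move=> i; rewrite subnKC ?Nn_mono ?leq_pred // cutE ?(ltnW mn) // leqNgt cutE; last by lia.
by rewrite -ltnNge; apply/eqP/andP; lia.
Qed.

Lemma bl_fin n : exists c, forall i, bl i = n -> (c <= i < c + Nb)%N.
Proof.
have [nm|mn|->] := ltngtP n m.
- by exists 0%N => i; rewrite /bl; lia.
- have [c [d [d2 h]]] := block_small mn; exists c => i /eqP; rewrite h /Nb; lia.
- by exists 0%N => i e; rewrite /Nb add0n; have := cutE i (leqnn m); rewrite e leqnn; lia.
Qed.

Lemma ev_large (K : R) : exists n, forall i, (n <= i)%N -> K <= ev i.
Proof.
exists (2 * (Num.truncn (K / k0)).+1)%N => i hi; rewrite evl_lam (lamE w k).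
have Ki : K / k0 <= (i./2)%:R.
  apply: le_trans (ltW (truncnS_gt _)) _; rewrite ler_nat.
  by move: hi; set tr := Num.truncn _; move: tr => tr hi; lia.
rewrite mulrC -ler_pdivrMr //; apply: le_trans Ki _.
have h0 : (0 < i./2)%N by lia.
apply: (@le_trans _ _ ((i./2)%:R ^+ (2 * k))); last first.
  by rewrite natX_le // (leq_trans (half_blk b i)) // sv_ge.
by rewrite -natrX ler_nat; have := leq_pexp2l h0 (_ : (1 <= 2 * k)%N); rewrite expn1; apply; lia.
Qed.

Section Similar.
Variable X : nat -> nat -> C.
Hypothesis colX : colb X (2 * M).
Hypothesis eqX : forall i j, simeq ev Q bl X i j = X i j.

Local Notation U := (opU ev bl X).
Local Notation B := (dgp bl X).
Local Notation A := (pert ev B).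

Lemma B_bl i j : bl i <> bl j -> B i j = 0.
Proof. by rewrite /dgp => /eqP/negPf ->. Qed.

Lemma B_row i : exists J, forall j, (J <= j)%N -> B i j = 0.
Proof. exact: (dgp_rowfin bl_fin X). Qed.

Lemma bb_ge0 : 0 <= bb.
Proof. exact: (bB_ge0 colQ). Qed.

Lemma B_bnd z K : l2le z K -> l2le (mv B z) (bb * K).
Proof. exact: (mv_dgp colQ bl_fin colX). Qed.

Lemma cuts n : exists2 a, (n <= a)%N & blockset bl (fun i => (i < a)%N).
Proof.
exists (Nn b (maxn m n)); first by case: b => /=; lia.
by move=> i j e; rewrite !cutE ?leq_maxl // e.
Qed.

Lemma block_set n : blockset bl (fun i => bl i == n).
Proof. by move=> i j ->. Qed.

Lemma eigen_empty n l : (n < m)%N -> ~ evb ev B bl n l.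
Proof.
move=> nm [z [[i zi] sz _]]; move: zi; rewrite sz ?eqxx //.
by apply/eqP; rewrite /bl; lia.
Qed.

(** For [Lam - Q] the argument is in l^1: a vector of the kernel satisfies [z = (t + Lam)^-1 Q z],
    and for large [t] the right-hand side has at most half the l^1 norm. For [Lam - B] it is enough
    that [- t] is farther than [bb] from the diagonal. *)
Lemma injective_at : exists2 t : R, 0 < t &
  (forall z, dom ev z -> (forall i, pert ev Q z i = - t%:C * z i) -> forall i, z i = 0) /\
  (forall z K, l2le z K -> exists y : nat -> C, dom ev y /\ forall i, - t%:C * y i - A y i = z i).
Proof.
have [c c0 hc] := evl_inv_sum w_gt0 hk b; have M0 := colb_ge0 colQ; have b0 := bb_ge0.
have ev0 := ev_nonneg.
(* [4 * M ^+ 2 * c] yields [M * s <= 1 / 2], and [1 + bb] the distance to the diagonal. *)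
pose t := 1 + bb + 4 * M ^+ 2 * c.
have mc : 0 <= 4 * M ^+ 2 * c by rewrite !mulr_ge0 ?sqr_ge0 // ltW.
have t1 : 1 <= t by rewrite /t; lra.
have t0 : 0 < t by lra.
exists t => //; split.
  move=> z dz hz; have [K hK] := l1dom dz.
  pose s := Num.sqrt (c / t); have s0 : 0 <= s by exact: sqrtr_ge0.
  have ct0 : 0 <= c / t by rewrite divr_ge0 // ltW.
  have hs J : \sum_(i < J) ((t + ev i)^-1) ^+ 2 <= s ^+ 2.
    rewrite sqr_sqrtr //; apply: (@le_trans _ _ (\sum_(i < J) t^-1 * (1 + ev i)^-1)); last first.
      by rewrite -mulr_sumr mulrC ler_wpM2r // invr_ge0 ltW.
    apply: ler_sum => i _; have e0 := ev0 i; rewrite expr2 -!invfM lef_pV2 ?posrE; [|by rewrite mulr_gt0; lra ..].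
    by apply: ler_pM; lra.
  have Ms : M * s <= 2^-1.
    rewrite -(@ler_pXn2r _ 2) ?nnegrE ?mulr_ge0 ?invr_ge0 // exprMn sqr_sqrtr // mulrA.
    rewrite ler_pdivrMr //; have : 4 * M ^+ 2 * c <= t by rewrite /t; lra.
    rewrite exprVn; have -> : (2 : R) ^- 2 = 4^-1 by congr (_^-1); rewrite expr2; ring.
    lra.
  have zE i : z i = ((t + ev i)^-1)%:C * mv Q z i.
    have := hz i; rewrite /pert => /eqP; rewrite subr_eq addrC -subr_eq => /eqP <-.
    have te : (t + ev i)%:C != 0 :> C by rewrite realC_eq0 gt_eqF //; have := ev0 i; lra.
    rewrite mulNr opprK -mulrDl -rmorphD /= [ev i + t]addrC.
    by rewrite mulrA -rmorphM /= mulVf ?mul1r //; move: te; rewrite realC_eq0.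
  have half L : l1le z L -> l1le z (L / 2).
    move=> hL; have L0 := l1le_ge0 hL.
    have h := l2_l1 (l2le_real (x := fun i => (t + ev i)^-1) s0 hs) (mv_l1 colQ hL).
    have {}h : l1le z (s * (M * L)) by apply: l1leW h => i; rewrite {1}zE.
    by apply: l1le_mono h; rewrite mulrA [s * M]mulrC [L / 2]mulrC ler_wpM2r.
  have it n : l1le z (K / 2 ^+ n).
    elim: n => [|n IH]; first by rewrite expr0 divr1.
    by apply: l1le_mono (half _ IH); rewrite exprSr invfM mulrA.
  move=> i; apply: eq_of_cabs_le => e e0; rewrite subr0.
  have h := it (Num.truncn (K / e)); apply: le_trans (_ : K / 2 ^+ Num.truncn (K / e) <= _).
    apply: le_trans (h i.+1); rewrite big_ord_recr /= lerDr.
    by apply: sumr_ge0 => j _; exact: cabs_ge0.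
  rewrite ler_pdivrMr ?exprn_gt0 // [leRHS]mulrC -ler_pdivrMr //.
  by apply: le_trans (ltW (truncnS_gt _)) _; rewrite -natrX ler_nat ltn_expl.
have nev n : ~ evb ev B bl n (- t%:C).
  move=> hl; have [i _] := evb_near bb_ge0 B_bnd blocks hl ltr01.
  have -> : - t%:C - (ev i)%:C = - (t + ev i)%:C :> C by rewrite -opprD -rmorphD.
  rewrite cabsN cabs_real ger0_norm; last by have := ev0 i; lra.
  by have := ev0 i; rewrite /t; lra.
have [Ml [_ h _]] := reg_of ev0 ev_large bb_ge0 B_bl B_row B_bnd cuts nev.
by move=> z K hz; have [y [dy hy]] := h _ _ hz; exists y.
Qed.

Lemma U_dom_surj v : dom ev v -> exists z, dom ev z /\ v = U z.
Proof.
have [c c0 hc] := evl_sq_sum w_gt0 hk b.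
exact: (opU_dom_surj colQ Gap_gt0 gap_Gap (tailc_ge0 m) sumG small ev_nonneg c0 hc bl_fin colX eqX injective_at).
Qed.

Lemma U_intertwine z : dom ev z -> dom ev (U z) /\ pert ev Q (U z) = U (A z).
Proof.
have [c c0 hc] := evl_sq_sum w_gt0 hk b.
exact: (intertwine colQ Gap_gt0 gap_Gap (tailc_ge0 m) sumG small ev_nonneg c0 hc bl_fin colX eqX).
Qed.

Lemma U_l2 z K : l2le z K -> l2le (U z) (2 * K).
Proof. exact: (opU_l2 Gap_gt0 gap_Gap (tailc_ge0 m) sumG small colX). Qed.

Lemma UD z v K L : l2le z K -> l2le v L -> U (fun i => z i + v i) = fun i => U z i + U v i.
Proof. exact: (opUD Gap_gt0 gap_Gap (tailc_ge0 m) sumG small colX). Qed.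

Lemma UZ (c : C) z K : l2le z K -> U (fun i => c * z i) = fun i => c * U z i.
Proof. exact: (opUZ Gap_gt0 gap_Gap (tailc_ge0 m) sumG small colX). Qed.

Lemma UB z v K L : l2le z K -> l2le v L -> U (fun i => z i - v i) = fun i => U z i - U v i.
Proof.
move=> hz hv; have -> : (fun i => z i - v i) = fun i => z i + (-1) * v i.
  by apply/funext => i; rewrite mulN1r.
by rewrite (UD hz (l2leZ (-1) hv)) (UZ (-1) hv); apply/funext => i; rewrite mulN1r.
Qed.

Lemma U_bnd z K L : l2le z L -> l2le (U z) K -> l2le z (2 * K).
Proof. exact: (opU_inj Gap_gt0 gap_Gap (tailc_ge0 m) sumG small colX). Qed.

Lemma U_inj z v K L : l2le z K -> l2le v L -> U z = U v -> z = v.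
Proof.
move=> hz hv e; have h := l2leB hz hv.
have h0 : l2le (U (fun i => z i - v i)) 0.
  by rewrite (UB hz hv) e; apply: eq_l2le (l2le0 (lexx 0)) => i; rewrite subrr.
apply/funext => i; apply/eqP; rewrite -subr_eq0 -cabs_eq0 eq_le cabs_ge0 andbT.
by have := l2le_pt i (U_bnd h h0); rewrite mulr0.
Qed.

Definition Uinv v : nat -> C := xget (fun=> 0) [set z | (exists K, l2le z K) /\ U z = v].

Lemma UinvP v K : l2le v K -> l2le (Uinv v) (2 * K) /\ U (Uinv v) = v.
Proof.
move=> hv; have [z [hz zE]] := opU_surj Gap_gt0 gap_Gap (tailc_ge0 m) sumG small colX hv.
have : [set z | (exists K, l2le z K) /\ U z = v] (Uinv v).
  by apply: xgetPex; exists z; split=> //; eexists; exact: hz.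
move=> [[L hL] e]; split=> //; apply: U_bnd hL _; by rewrite e.
Qed.

Lemma Uinv_eq z K : l2le z K -> Uinv (U z) = z.
Proof. by move=> hz; have [h e] := UinvP (U_l2 hz); exact: U_inj h hz e. Qed.

Lemma UinvD v z K L : l2le v K -> l2le z L ->
  Uinv (fun i => v i + z i) = fun i => Uinv v i + Uinv z i.
Proof.
move=> hv hz; have [h1 e1] := UinvP hv; have [h2 e2] := UinvP hz.
by rewrite -[RHS](Uinv_eq (l2leD h1 h2)) (UD h1 h2) e1 e2.
Qed.

Lemma UinvZ (c : C) v K : l2le v K -> Uinv (fun i => c * v i) = fun i => c * Uinv v i.
Proof.
move=> hv; have [h1 e1] := UinvP hv.
by rewrite -[RHS](Uinv_eq (l2leZ c h1)) (UZ c h1) e1.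
Qed.

Local Notation e := (bas w b).
Local Notation hat := (fcoef w b).
Local Notation L := (L_op b k w q).
Local Notation S := (synth e).

Let eL2 i : inL2 w (e i). Proof. exact: bas_L2. Qed.
Let e_on i j : inner w (e i) (e j) = (i == j)%:R. Proof. exact: bas_on. Qed.
Let eb i t : cabs (e i t) <= 2. Proof. exact: cabs_bas. Qed.
Let kg : (0 < k)%N. Proof. exact: ltnW. Qed.

Lemma hatB x y i : inL2 w x -> inL2 w y -> hat (fun t => x t - y t) i = hat x i - hat y i.
Proof. by move=> hx hy; rewrite /fcoef innerBl. Qed.

Lemma res_eqnP l x y : inL2 w x -> res_eqn L l x y <->
  [/\ inL2 w y, dom ev (hat y) & forall i, l * hat y i - pert ev Q (hat y) i = hat x i].
Proof.
move=> hx; split=> [|[hy dy hE]].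
  move=> /(L_op_coef w_gt0 kg hq l1dom) [hy hf dy hE]; split=> // i.
  by rewrite -hE hatB ?fcoefZ //; [ring|exact: inL2Z].
have hl := inL2Z w_gt0 l hy.
apply: (L_op_of_coef w_gt0 kg hq l1dom) => //; first exact: inL2B.
by move=> i; rewrite hatB ?fcoefZ // -hE; ring.
Qed.

Lemma A_l2 z : dom ev z -> exists K, l2le (A z) K.
Proof. by move=> [[K hK] [K' hK']]; eexists; exact: l2leB hK' (B_bnd hK). Qed.

(** By [U_dom_surj] the coefficients of a solution are [U z] with [z] in the domain, and the
    equation becomes the one for [Lam - B]. *)
Lemma res_unique l Ml x y : reg ev B l Ml -> inL2 w x -> res_eqn L l x y ->
  hat y = U (res ev B l (Uinv (hat x))).
Proof.
move=> hr hx /(res_eqnP _ _ hx) [hy dy hE].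
have [hz1 e1] := UinvP (fcoef_l2 b w_gt0 hx).
have [z [dz zE]] := U_dom_surj dy; have [[K hK] _] := dz; have [K' hK'] := A_l2 dz.
have [_ iz] := U_intertwine dz.
have lz : (fun i => l * z i - A z i) = Uinv (hat x).
  apply: (U_inj (l2leB (l2leZ l hK) hK') hz1).
  rewrite (UB (l2leZ l hK) hK') (UZ l hK) e1 -iz -zE; exact/funext.
rewrite zE; congr U; apply/esym/(res_eq B_row hr hz1) => // i.
by rewrite -lz.
Qed.

Lemma synth_hat v : dom ev v -> inL2 w (S v) /\ hat (S v) = v.
Proof.
move=> /l1dom [K hK]; split; first exact: (synth_L2 w_gt0 eL2 eb hK).
by apply/funext => i; exact: (fcoef_synth b w_gt0 i hK).
Qed.

Lemma res_exists l Ml x : reg ev B l Ml -> inL2 w x ->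
  res_eqn L l x (S (U (res ev B l (Uinv (hat x))))).
Proof.
move=> hr hx; have [hz1 e1] := UinvP (fcoef_l2 b w_gt0 hx).
have [dz hz _] := resP hr hz1; have [dU iU] := U_intertwine dz.
have [sL sE] := synth_hat dU.
have [[K hK] _] := dz; have [K' hK'] := A_l2 dz.
apply/res_eqnP => //; split; rewrite ?sE // => i.
have := UB (l2leZ l hK) hK'; rewrite (UZ l hK) -iU => /(congr1 (fun f : nat -> C => f i)) <-.
rewrite -[in RHS]e1; congr (U _ i); exact/funext.
Qed.

Lemma reg_exists l : (forall n, ~ evb ev B bl n l) -> exists Ml, reg ev B l Ml.
Proof. exact: (reg_of ev_nonneg ev_large bb_ge0 B_bl B_row B_bnd cuts). Qed.

Lemma l2norm_le x y (K : R) : inL2 w x -> inL2 w y -> 0 <= K -> n2 w y <= K ^+ 2 * n2 w x ->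
  (l2norm w y <= K%:E * l2norm w x)%E.
Proof.
move=> hx hy K0 h; rewrite !l2norm_n2 // -EFinM lee_fin.
rewrite -(@ler_pXn2r _ 2) ?nnegrE ?mulr_ge0 ?sqrtr_ge0 //.
by rewrite exprMn !sqr_sqrtr ?n2_ge0.
Qed.

(** An eigenvector of a block is mapped by [U] to a nonzero solution of the homogeneous equation,
    against the resolvent bound. Conversely, in coefficients the resolvent is [U (l - A)^-1 U^-1],
    with a factor 2 in the bound from each of [U] and its inverse. *)
Lemma resolvent_setP l : resolvent_set w L l <-> forall n, ~ evb ev B bl n l.
Proof.
split=> [[_ [K hK]] n [z [[i zi] sz zE]]|nev].
  have [c [d hcd]] := blocks n.
  have dz : dom ev z.
    apply: (@dom_supp _ ev (c + d)%N) => j cj; apply: sz; rewrite hcd; lia.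
  have [dU iU] := U_intertwine dz; have [sL sE] := synth_hat dU.
  have [[K' hK'] _] := dz.
  have AE : A z = fun i => l * z i by exact/funext.
  have h0 : res_eqn L l (fun=> 0) (S (U z)).
    apply/res_eqnP; first exact: inL2_0.
    split; rewrite ?sE // => j; rewrite iU AE (UZ l hK') subrr.
    by rewrite /fcoef /inner (eq_cintegral (g := fun=> 0)) ?cintegral0 ?mulr0 // => t _; rewrite mul0r.
  have := hK _ _ (inL2_0 w_gt0) h0.
  rewrite !l2norm_n2 //; last exact: inL2_0.
  have -> : n2 w (fun=> 0 : C) = 0.
    rewrite /n2; under eq_Rintegral do rewrite cabs0 expr0n /=.
    by rewrite /Rintegral integral0 mulr0.
  rewrite sqrtr0 mule0 lee_fin => s0.
  have u0 : l2le (U z) 0.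
    by rewrite -[U z]sE; apply: l2le_mono s0 _; exact: fcoef_l2.
  have := l2le_pt i (U_bnd hK' u0); rewrite mulr0 => zi0.
  by move: zi; rewrite -cabs_gt0 ltNge zi0.
have [Ml hr] := reg_exists nev; split.
  by move=> x hx; eexists; exact: res_exists hr hx.
exists (2 * (Ml * 2)) => x y hx hxy; have [Ml0 _ _] := hr.
have [hy dy _] := (res_eqnP l y hx).1 hxy.
have hU := res_unique hr hx hxy.
have [hz1 e1] := UinvP (fcoef_l2 b w_gt0 hx); have [dz _ hz2] := resP hr hz1.
apply: l2norm_le => //; first by rewrite !mulr_ge0.
have [K1 hK1] := l1dom dy.
have yS : l2eq w y (S (hat y)).
  by apply: (l2eq_fcoef w_gt0 hy (synth_L2 w_gt0 eL2 eb hK1)) => i; exact/esym/(fcoef_synth b w_gt0 i hK1).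
rewrite (l2eq_n2 w_gt0 hy (synth_L2 w_gt0 eL2 eb hK1) yS).
have hy2 : l2le (hat y) (2 * (Ml * 2) * Num.sqrt (n2 w x)).
  by rewrite hU; apply: l2le_mono (U_l2 hz2); rewrite !mulrA.
apply: le_trans (n2_synth w_gt0 eL2 e_on eb hK1 hy2) _.
by rewrite exprMn sqr_sqrtr // n2_ge0.
Qed.

Lemma spectrumP l : spectrum w L l <-> exists n, evb ev B bl n l.
Proof.
rewrite /spectrum; split=> [h|[n hn]].
  by apply: contrapT => hn; apply: h; apply/resolvent_setP => n hn'; apply: hn; exists n.
by move=> /resolvent_setP /(_ n).
Qed.

Lemma hat_resolvent l Ml x : reg ev B l Ml -> inL2 w x ->
  [/\ inL2 w (resolvent L l x), dom ev (hat (resolvent L l x)) &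
    hat (resolvent L l x) = U (res ev B l (Uinv (hat x)))].
Proof.
move=> hr hx; have h : res_eqn L l x (resolvent L l x).
  have : [set y | res_eqn L l x y] (resolvent L l x).
    by apply: xgetPex; eexists; exact: res_exists hr hx.
  by [].
have [hy dy _] := (res_eqnP l _ hx).1 h; split=> //; exact: res_unique hr hx h.
Qed.

Lemma inner_hat x y : inL2 w x -> dom ev (hat x) -> inL2 w y ->
  inner w x y = csum (fun i => hat x i * inner w (e i) y).
Proof.
move=> hx dx hy; have [K hK] := l1dom dx; have sL := synth_L2 w_gt0 eL2 eb hK.
rewrite -(inner_synth w_gt0 eL2 eb hK hy); apply: (l2eq_inner w_gt0 hx sL hy).
by apply: (l2eq_fcoef w_gt0 hx sL) => i; exact/esym/(fcoef_synth b w_gt0 i hK).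
Qed.

(** The inner product of [S (U z)] with [y], written through coefficients so that it is defined on
    all of l^2, where the series [S (U z)] need not converge. *)
Definition Psi y z : C := csum (fun i => U z i * inner w (e i) y).

Lemma coef_l2 y : inL2 w y -> l2le (fun i => inner w (e i) y) (Num.sqrt (n2 w y)).
Proof.
move=> hy; apply: l2leW (fcoef_l2 b w_gt0 hy) => i.
by rewrite (inner_conj w_gt0 hy (eL2 i)) cabs_conj.
Qed.

Lemma Psi_l1 y z K : inL2 w y -> l2le z K ->
  l1le (fun i => U z i * inner w (e i) y) (2 * K * Num.sqrt (n2 w y)).
Proof. by move=> hy hz; exact: l2_l1 (U_l2 hz) (coef_l2 hy). Qed.

Lemma PsiD y z v K K' : inL2 w y -> l2le z K -> l2le v K' ->
  Psi y (fun i => z i + v i) = Psi y z + Psi y v.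
Proof.
move=> hy hz hv; rewrite /Psi (UD hz hv) -(csumD (Psi_l1 hy hz) (Psi_l1 hy hv)).
by apply: eq_csum => i; rewrite mulrDl.
Qed.

Lemma PsiZ y (a : C) z K : inL2 w y -> l2le z K -> Psi y (fun i => a * z i) = a * Psi y z.
Proof.
move=> hy hz; rewrite /Psi (UZ a hz) -(csumZ a (Psi_l1 hy hz)).
by apply: eq_csum => i; rewrite mulrA.
Qed.

Lemma Psi_le y z K : inL2 w y -> l2le z K -> cabs (Psi y z) <= 2 * Num.sqrt (n2 w y) * K.
Proof. by move=> hy hz; apply: le_trans (csum_le (Psi_l1 hy hz)) _; rewrite mulrAC. Qed.

Lemma inner_SU y z : dom ev z -> inL2 w y -> inner w (S (U z)) y = Psi y z.
Proof.
move=> dz hy; have [dU _] := U_intertwine dz; have [K hK] := l1dom dU.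
exact: (inner_synth w_gt0 eL2 eb hK hy).
Qed.

(** The requirements of the contour lemmas. They are met by [Psi y], by coordinates, and by [Psi y]
    composed with a resolvent. *)
Definition l2_functional (F : (nat -> C) -> C) (CP : R) : Prop :=
  [/\ 0 <= CP, forall z v K K', l2le z K -> l2le v K' -> F (fun i => z i + v i) = F z + F v,
    forall (a : C) z K, l2le z K -> F (fun i => a * z i) = a * F z &
    forall z K, l2le z K -> cabs (F z) <= CP * K].

Lemma fnl_Psi y : inL2 w y -> l2_functional (Psi y) (2 * Num.sqrt (n2 w y)).
Proof.
move=> hy; split; first by rewrite mulr_ge0 ?sqrtr_ge0.
- by move=> z v K K'; exact: PsiD hy.
- by move=> a z K; exact: PsiZ hy.
- by move=> z K; exact: Psi_le hy.
Qed.

Lemma fnl_coord i : l2_functional (fun z => z i) 1.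
Proof. by split=> // z K hz; rewrite mul1r; exact: l2le_pt hz. Qed.

Lemma fnl_cut F CP z K n : l2_functional F CP -> l2le z K ->
  F (fun i => if (i < n)%N then z i else 0) = \sum_(j < n) z j * F (fun i => (i == j :> nat)%:R).
Proof.
move=> [_ FD FZ Fb] hz.
have d2 j : l2le (fun i => (i == j :> nat)%:R : C) 1.
  apply: (@l2le_supp _ j.+1) => //; first by move=> i ij; rewrite gtn_eqF.
  rewrite big_ord_recr /= big1 ?add0r ?eqxx ?cabs1 // => i _.
  by rewrite ltn_eqF // cabs0 expr0n.
elim: n => [|n IH].
  rewrite big_ord0; apply/eqP; rewrite -cabs_eq0 eq_le cabs_ge0 andbT.
  by have := Fb _ 0 (l2le0 (lexx 0)); rewrite mulr0.
rewrite big_ord_recr /= -IH -(FZ _ _ _ (d2 n)) -(FD _ _ _ _ (l2le_cut n hz) (l2leZ _ (d2 n))).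
congr F; apply/funext => i; rewrite ltnS leq_eqVlt.
by case: ltngtP => //= [_|_|->]; rewrite ?mulr0 ?mulr1 ?addr0 ?add0r.
Qed.

Lemma two_pi_i : 2 * pi *i != 0 :> C.
Proof.
apply: mulf_neq0; first by rewrite pnatr_eq0.
by rewrite eq_complex /= (gt_eqF (pi_gt0 R)) andbF.
Qed.

(** * Riesz projections of the differential operator *)

Section Contour.
Variables (c : C) (r : R).
Hypothesis r_gt0 : 0 < r.
Hypothesis circ : forall l n, cabs (l - c) = r -> ~ evb ev B bl n l.

Local Notation ptc s := (c + r%:C * expi s).
Local Notation Rs := (res ev B).

Lemma circ_reg l : cabs (l - c) = r -> exists Ml, reg ev B l Ml.
Proof. by move=> h; apply: reg_exists => n; exact: circ. Qed.

Lemma on_circle s : cabs (ptc s - c) = r.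
Proof. by rewrite addrC addKr cabsM cabs_expi mulr1 cabs_real gtr0_norm. Qed.

Lemma eq_circle (F F' : C -> C) : (forall l, cabs (l - c) = r -> F l = F' l) ->
  circle_integral c r F = circle_integral c r F'.
Proof. by move=> h; apply: eq_cintegral => s _; rewrite h // on_circle. Qed.

Lemma circle_integrable F : ccont (fun s => F (ptc s)) ->
  cintegrable `[0, 2 * pi] (fun s => F (ptc s) * ((0 +i* 1) * r%:C * expi s)).
Proof.
move=> cF; apply: ccont_integrable; apply: ccontM => //; apply: ccontM; first exact: ccont_cst.
by have := @ccont_expi R 1; congr ccont; apply/funext => s; rewrite mul1r.
Qed.

Let mI : @measurable _ (measurableTypeR R) `[0, 2 * pi].
Proof. exact: measurable_itv. Qed.

Lemma circleD F F' : ccont (fun s => F (ptc s)) -> ccont (fun s => F' (ptc s)) ->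
  circle_integral c r (fun l => F l + F' l) = circle_integral c r F + circle_integral c r F'.
Proof.
move=> h1 h2; rewrite /circle_integral -(cintegralD mI (circle_integrable h1) (circle_integrable h2)).
by apply: eq_cintegral => s _; rewrite mulrDl.
Qed.

Lemma circle_sum n (a : nat -> C) (F : nat -> C -> C) : (forall j, ccont (fun s => F j (ptc s))) ->
  circle_integral c r (fun l => \sum_(j < n) a j * F j l) =
  \sum_(j < n) a j * circle_integral c r (F j).
Proof.
move=> h; rewrite /circle_integral.
have hi j : cintegrable `[0, 2 * pi] (fun s => a j * (F j (ptc s) * ((0 +i* 1) * r%:C * expi s))).
  exact: (cintegrableZ mI _ (circle_integrable (h j))).
rewrite (eq_bigr (fun j : 'I_n => cintegral `[0, 2 * pi] (fun s => a j * (F j (ptc s) * ((0 +i* 1) * r%:C * expi s))))).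
  rewrite -(cintegral_sum mI) //; apply: eq_cintegral => s _; rewrite mulr_suml.
  by apply: eq_bigr => j _; rewrite -mulrA.
by move=> j _; rewrite (cintegralZ mI _ (circle_integrable (h j))).
Qed.

Lemma fnl_ccont F CP z K : l2_functional F CP -> l2le z K -> ccont (fun s => F (Rs (ptc s) z)).
Proof.
move=> [CP0 FD FZ Fb] hz.
exact: (phi_cont B_row r_gt0 circ_reg CP0 FD FZ Fb hz).
Qed.

Lemma circle_resolvent x y : inL2 w x -> inL2 w y ->
  circle_integral c r (fun l => inner w (resolvent L l x) y) =
  circle_integral c r (fun l => Psi y (Rs l (Uinv (hat x)))).
Proof.
move=> hx hy; apply: eq_circle => l /circ_reg [Ml hr].
have [h1 h2 h3] := hat_resolvent hr hx.
by rewrite (inner_hat h1 h2 hy) h3.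
Qed.

Variable J : pred nat.
Hypothesis hJ : blockset bl J.
Hypothesis outside : forall i, ~~ J i -> r + 2 * bb + 1 + 1 <= cabs (c - (ev i)%:C).

Lemma blockset_compl : blockset bl (fun i => ~~ J i).
Proof. by move=> i j /hJ ->. Qed.

(** The coordinates outside [J] contribute nothing, by [contour_outside]. *)
Lemma circle_split F CP z K : l2_functional F CP -> l2le z K ->
  circle_integral c r (fun l => F (Rs l z)) =
  circle_integral c r (fun l => F (Rs l (restr J z))).
Proof.
move=> hF hz; have [CP0 FD FZ Fb] := hF.
have h1 : l2le (restr J z) K by exact: restr_l2.
have h2 : l2le (restr (fun i => ~~ J i) z) K by exact: restr_l2.
rewrite -[RHS]addr0.
rewrite -(contour_outside bb_ge0 B_bl B_row B_bnd r_gt0 circ_reg CP0 FD FZ Fb blockset_compl ltr01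
  outside (@restr_supp _ (fun i => ~~ J i) z) h2).
rewrite -(circleD (fnl_ccont hF h1) (fnl_ccont hF h2)).
apply: eq_circle => l /circ_reg [Ml hr].
have [_ _ b1] := resP hr h1; have [_ _ b2] := resP hr h2.
rewrite -(FD _ _ _ _ b1 b2) -(resD B_row hr h1 h2); congr F; congr res.
by apply/funext => i; rewrite /restr; case: (J i); rewrite ?addr0 ?add0r.
Qed.


Definition proj_on x : R -> C := S (U (restr J (Uinv (hat x)))).

Variable n0 : nat.
Hypothesis J_fin : forall i, J i -> (i < n0)%N.

Lemma restr_dom z : dom ev (restr J z).
Proof.
apply: (@dom_supp _ ev n0) => i ni; rewrite /restr; case: ifPn => // /J_fin; lia.
Qed.

Lemma proj_on_L2 x : inL2 w (proj_on x).
Proof. by have [dU _] := U_intertwine (restr_dom (Uinv (hat x))); have [] := synth_hat dU. Qed.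

Lemma riesz_in (T : set C) (rho : R) : 0 <= rho -> rho + bb < r ->
  (forall i, J i -> cabs (c - (ev i)%:C) <= rho) ->
  T = [set l | (exists n, evb ev B bl n l) /\ cabs (l - c) < r] ->
  riesz_projection w L T proj_on.
Proof.
move=> rho0 rhor inside TE; exists [:: (c, r)]; split.
  split=> //.
  - move=> p0; rewrite inE => /eqP -> /=; split=> // z zr.
    by apply/resolvent_setP => n; exact: circ.
  - rewrite TE; apply/seteqP; split=> l /=; rewrite orbF => -[h1 h2]; split=> //; exact/spectrumP.
move=> x hx; split; first exact: proj_on_L2.
move=> y hy; rewrite big_seq1 /= circle_resolvent //.
have [hz _] := UinvP (fcoef_l2 b w_gt0 hx); have hP := fnl_Psi hy.
have [CP0 FD FZ Fb] := hP.
rewrite (circle_split hP hz).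
rewrite (contour_inside bb_ge0 B_bl B_row B_bnd r_gt0 circ_reg CP0 FD FZ Fb hJ rho0 rhor inside J_fin
  (@restr_supp _ J _) (restr_l2 J hz)).
by rewrite mulKf ?two_pi_i // inner_SU //; exact: restr_dom.
Qed.

End Contour.

(** Supplies the radius of a circle that isolates one eigenvalue from the finitely many others
    nearby. *)
Lemma finite_sep (rs : seq C) l0 : exists r : R,
  [/\ 0 < r, r <= 1 & forall l, l \in rs -> l != l0 -> r < cabs (l - l0)].
Proof.
elim: rs => [|l rs [r [r0 r1 hr]]]; first by exists 1.
have [->|ll] := eqVneq l l0.
  exists r; split=> // l'; rewrite inE => /orP[/eqP ->|]; [by rewrite eqxx|exact: hr].
have d0 : 0 < cabs (l - l0) by rewrite cabs_gt0 subr_eq0.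
exists (Num.min r (cabs (l - l0) / 2)); split.
- by rewrite lt_min r0 divr_gt0.
- by rewrite ge_min r1.
- move=> l'; rewrite inE => /orP[/eqP -> _|h1 h2].
    by rewrite gt_min; apply/orP; right; lra.
  by rewrite gt_min hr.
Qed.

(** A single eigenvalue need not exhaust its block, so [proj_on] does not give its projection.
    Coordinates beyond a cut [a] do not contribute to the contour integral, and below the cut the
    integral is determined by its values on the unit vectors; hence the rank is at most [a]. *)
Lemma discrete : discrete_spectrum w L.
Proof.
move=> l0 sl0; have b0 := bb_ge0.
(* [2 * bb + 3] covers the [r + 2 * bb + 1 + 1] of [circle_split] for a radius [r <= 1]. *)
have [a ha far] := far_index ev_nonneg ev_large cuts l0 (2 * bb + 3).
have seg : blockset bl (fun i => (0 <= i < 0 + a)%N) by move=> i j ij; rewrite /= add0n; exact: ha.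
have [rs [_ hrs]] := eig_roots ev bb_ge0 B_bl seg.
have inrs l n : evb ev B bl n l -> cabs (l - l0) <= 1 -> l \in rs.
  move=> hl ll; apply/hrs; have [i bi h] := evb_near bb_ge0 B_bnd blocks hl ltr01.
  have ia : (i < a)%N.
    apply: contraT => /far h2; have := cabsD (l0 - l) (l - (ev i)%:C).
    have -> : l0 - l + (l - (ev i)%:C) = l0 - (ev i)%:C by ring.
    rewrite [cabs (l0 - l)]cabsBC; lra.
  have [z [z1 z2 z3]] := hl; exists z; split=> // j; rewrite /= add0n => ja; apply: z2.
  by apply: contra ja => /eqP bj; rewrite (ha j i) // bj bi.
have [r [r0 r1 hr]] := finite_sep rs l0.
have circ l n : cabs (l - l0) = r -> ~ evb ev B bl n l.
  move=> lr hl; have lrs : l \in rs by apply: (inrs l n hl); rewrite lr.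
  have ll : l != l0 by rewrite -subr_eq0 -cabs_gt0 lr.
  by have := hr l lrs ll; rewrite lr ltxx.
have out i : ~~ (i < a)%N -> r + 2 * bb + 1 + 1 <= cabs (l0 - (ev i)%:C).
  by move=> /far h; apply: le_trans h; lra.
pose delta j : nat -> C := fun i => (i == j :> nat)%:R.
have d2 j : l2le (delta j) 1.
  apply: (@l2le_supp _ j.+1) => //; first by move=> i ij; rewrite /delta gtn_eqF.
  rewrite big_ord_recr /= big1 ?add0r /delta ?eqxx ?cabs1 // => i _.
  by rewrite ltn_eqF // cabs0 expr0n.
(* The contour integral of the resolvent at [delta j], coordinate by coordinate; for [j < a] the
   resolvent of [delta j] vanishes beyond the cut. *)
pose pj j i : C := if (i < a)%N then
  (2 * pi *i)^-1 * circle_integral l0 r (fun l => res ev B l (delta j) i) else 0.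
have pdom j : dom ev (pj j) by apply: (@dom_supp _ ev a) => i ai; rewrite /pj ltnNge ai.
have vL j : inL2 w (S (U (pj j))).
  by have [dU _] := U_intertwine (pdom j); have [] := synth_hat dU.
have nz := two_pi_i.
have al (u v z : C) : u != 0 -> v * z = u * (u^-1 * z * v) by move=> u0; field.
have block_perturbation y j : inL2 w y -> (j < a)%N ->
    circle_integral l0 r (fun l => Psi y (res ev B l (delta j))) = 2 * pi *i * Psi y (pj j).
  move=> hy ja; have hP := fnl_Psi hy.
  have [[K hK] _] := pdom j.
  have -> : pj j = fun i => if (i < a)%N then pj j i else 0.
    by apply/funext => i; rewrite /pj; case: ifP.
  rewrite (fnl_cut a hP hK) mulr_sumr.
  rewrite (eq_circle r0 (F' := fun l => \sum_(i < a) Psi y (delta i) * res ev B l (delta j) i)).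
    rewrite (circle_sum _ (fun i => Psi y (delta i)) (F := fun i l => res ev B l (delta j) i)).
      by apply: eq_bigr => i _; rewrite /pj ltn_ord; exact: (al _ _ _ nz).
    by move=> i; exact: (fnl_ccont r0 circ (fnl_coord i) (d2 j)).
  move=> l /(circ_reg circ) [Ml hreg]; have [_ _ hb] := resP hreg (d2 j).
  have sx : supp (fun i => (i < a)%N) (delta j).
    by move=> i; rewrite -leqNgt /delta => ai; rewrite gtn_eqF // (leq_trans ja).
  have sr := res_supp B_bl B_row hreg ha (d2 j) sx.
  have {1}-> : res ev B l (delta j) = fun i => if (i < a)%N then res ev B l (delta j) i else 0.
    by apply/funext => i; case: ifPn => // /sr.
  by rewrite (fnl_cut a hP hb); apply: eq_bigr => i _; rewrite mulrC.
exists (fun x t => \sum_(j < a) Uinv (hat x) j * S (U (pj j)) t); split; last first.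
  exists a, (fun j => S (U (pj j))); split=> // x hx.
  by exists (Uinv (hat x)); exact: l2eq_refl.
exists [:: (l0, r)]; split.
  split=> //.
  - move=> p0; rewrite inE => /eqP -> /=; split=> // z zr.
    by apply/resolvent_setP => n; exact: circ.
  - apply/seteqP; split=> l /=; rewrite orbF.
      by move=> ->; split=> //; rewrite subrr cabs0.
    move=> [/spectrumP [n hn] lr]; apply/eqP; apply: contraT => ll.
    have := hr l _ ll; rewrite ltNge ltW //; apply; apply: (inrs l n hn).
    by apply: le_trans (ltW lr) r1.
move=> x hx; have [hz _] := UinvP (fcoef_l2 b w_gt0 hx).
have TL j : inL2 w (fun t => Uinv (hat x) j * S (U (pj j)) t) by exact: inL2Z.
split; first by apply: (@inL2_sum _ w w_gt0 a (fun j t => Uinv (hat x) j * S (U (pj j)) t)).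
move=> y hy; rewrite big_seq1 /= (circle_resolvent r0 circ) //.
have hP := fnl_Psi hy.
rewrite (circle_split r0 circ ha out hP hz).
rewrite (eq_circle r0 (F' := fun l => \sum_(j < a) Uinv (hat x) j * Psi y (res ev B l (delta j)))).
  rewrite (circle_sum _ (Uinv (hat x)) (F := fun j l => Psi y (res ev B l (delta j)))); last first.
    by move=> j; exact: (fnl_ccont r0 circ hP (d2 j)).
  rewrite mulr_sumr (@inner_suml _ w w_gt0 a (fun j t => Uinv (hat x) j * S (U (pj j)) t)) //.
  apply: eq_bigr => j _; rewrite innerZl // block_perturbation // inner_SU // mulrCA mulKf //.
move=> l /(circ_reg circ) [Ml hreg].
have hF : l2_functional (fun z => Psi y (res ev B l z)) (2 * Num.sqrt (n2 w y) * Ml).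
  have [Ml0 _ _] := hreg; have [CP0 FD FZ Fb] := hP; split.
  - by rewrite mulr_ge0.
  - move=> z v K K' h1 h2; have [_ _ b1] := resP hreg h1; have [_ _ b2] := resP hreg h2.
    by rewrite (resD B_row hreg h1 h2) (FD _ _ _ _ b1 b2).
  - move=> c z K h1; have [_ _ b1] := resP hreg h1.
    by rewrite (resZ B_row hreg c h1) (FZ _ _ _ b1).
  - move=> z K h1; have [_ _ b1] := resP hreg h1.
    by apply: le_trans (Fb _ _ b1) _; rewrite !mulrA.
exact: (fnl_cut a hF hz).
Qed.

Lemma far_gap i j : bl i <> bl j -> 10 * (bb + 1) <= `|ev i - ev j|.
Proof.
move=> h; apply: le_trans sep _; apply: le_trans (gap_max h).
by rewrite ler_wpM2l ?(ltW k00) // natX_le //; move: h; rewrite /bl; lia.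
Qed.

(** Eigenvalues lie within [bb + 1] of the diagonal of their block, and by [sep] the diagonals are
    [10 * (bb + 1)] apart. *)
Lemma evb_inj n n' l : evb ev B bl n l -> evb ev B bl n' l -> n = n'.
Proof.
move=> h h'; have b0 := bb_ge0.
have [i bi hi] := evb_near bb_ge0 B_bnd blocks h ltr01.
have [j bj hj] := evb_near bb_ge0 B_bnd blocks h' ltr01.
apply: contrapT => nn; have := far_gap (i := i) (j := j); rewrite bi bj => /(_ nn).
have := cabsB (l - (ev j)%:C) (l - (ev i)%:C).
have -> : l - (ev j)%:C - (l - (ev i)%:C) = (ev i - ev j)%:C by rewrite rmorphB; ring.
rewrite cabs_real; lra.
Qed.

Definition evset n : set C := [set l | evb ev B bl n l].

Lemma splitting : spectral_splitting w L m (evset m) evset.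
Proof.
split; first exact: discrete.
- apply/seteqP; split=> l.
    move=> /spectrumP [n hn]; have [nm|mn|nm] := ltngtP n m; last by left; rewrite /evset -nm.
      by case: (eigen_empty nm hn).
    by right; exists n.
  by move=> [h|[n _ h]]; apply/spectrumP; eexists; exact: h.
- move=> n mn; apply/seteqP; split=> // l [h h'].
  by move: mn; rewrite (evb_inj h h') ltnn.
- move=> n n' _ _ [l [h h']]; exact: evb_inj h h'.
Qed.

Definition Pblock n := proj_on (fun i => bl i == n).

Lemma block_fin n i : bl i == n -> (i < Nn b (maxn m n))%N.
Proof. by move=> /eqP h; rewrite cutE ?leq_maxl // h leq_maxr. Qed.

(** The circle is centred at 0: eigenvalues of the merged block have modulus below
    [lam b k w m + bb + 1], all others above [lam b k w m + 9 * (bb + 1)]. *)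
Lemma riesz_big : riesz_projection w L (evset m) (Pblock m).
Proof.
have b0 := bb_ge0; have l0 := lam_ge0 k w_gt0 b m.
have out i : ~~ (bl i == m) -> lam b k w m + 10 * (bb + 1) <= ev i.
  move=> bi; have mi : (m < blk b i)%N by move: bi; rewrite /bl; lia.
  apply: (@le_trans _ _ (lam b k w m.+1)); last by rewrite evl_lam (lam_mono w_gt0 hk).
  have := lam_step w_gt0 hk b (ltnSn m); move: sep => s; lra.
have near n l : evb ev B bl n l -> n = m \/ lam b k w m + 9 * (bb + 1) < cabs l.
  move=> h; have [i bi hi] := evb_near bb_ge0 B_bnd blocks h ltr01.
  have [->|nm] := eqVneq n m; [by left|right].
  have := out i; rewrite bi nm => /(_ isT) h1.
  have := cabsB l (l - (ev i)%:C); have -> : l - (l - (ev i)%:C) = (ev i)%:C by ring.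
  rewrite cabs_real ger0_norm ?ev_nonneg //; lra.
have nearm l : evb ev B bl m l -> cabs l < lam b k w m + bb + 1.
  move=> h; have [i bi hi] := evb_near bb_ge0 B_bnd blocks h ltr01.
  have evi : ev i <= lam b k w m by rewrite evl_lam (lam_mono w_gt0 hk) //; move: bi; rewrite /bl; lia.
  have := cabsD (l - (ev i)%:C) (ev i)%:C; rewrite subrK cabs_real ger0_norm ?ev_nonneg //; lra.
have r0 : 0 < lam b k w m + 2 * bb + 1 by lra.
apply: (@riesz_in 0 (lam b k w m + 2 * bb + 1) r0 _ (fun i => bl i == m) (block_set m) _ _
  (@block_fin m) _ (lam b k w m)) => //.
- move=> l n; rewrite subr0 => lr h; have [nm|] := near _ _ h; last by rewrite lr; lra.
  by rewrite nm in h; have := nearm _ h; rewrite lr; lra.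
- by move=> i /out h; rewrite sub0r cabsN cabs_real ger0_norm ?ev_nonneg //; lra.
- lra.
- move=> i /eqP bi; rewrite sub0r cabsN cabs_real ger0_norm ?ev_nonneg //.
  by rewrite evl_lam (lam_mono w_gt0 hk) //; move: bi; rewrite /bl; lia.
- apply/seteqP; split=> l /=; rewrite subr0.
    by move=> h; split; [exists m|have := nearm _ h; lra].
  by move=> [[n h] lr]; have [nm|] := near _ _ h; [rewrite -nm|lra].
Qed.

Lemma blk_surj n : (0 < n)%N -> exists j, blk b j = n.
Proof. by case: b => n0; [exists n.*2|exists n.*2|exists n.-1] => /=; lia. Qed.

Lemma evl_block n i : (m < n)%N -> bl i = n -> ev i = lam b k w n.
Proof. by move=> mn bi; rewrite evl_lam; congr lam; move: bi; rewrite /bl; lia. Qed.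

(** [Lam] is the scalar [lam b k w n] on the block; a circle of radius [2 * bb + 1] around it works,
    with [rho = 0]. *)
Lemma riesz_block n : (m < n)%N -> riesz_projection w L (evset n) (Pblock n).
Proof.
move=> mn; have b0 := bb_ge0; have n0 : (0 < n)%N by lia.
have [j0 j0E] := blk_surj n0; have blj : bl j0 = n by rewrite /bl j0E; lia.
have lamj := evl_block mn blj.
have out i : ~~ (bl i == n) -> 10 * (bb + 1) <= `|lam b k w n - ev i|.
  by move=> /eqP bi; rewrite -lamj; apply: far_gap; rewrite blj => /esym.
have near n' l : evb ev B bl n' l -> cabs (l - (lam b k w n)%:C) <= 2 * bb + 1 ->
    n' = n.
  move=> h hl; have [i bi hi] := evb_near bb_ge0 B_bnd blocks h ltr01.
  apply/eqP; apply: contraT => nn; have := out i; rewrite bi nn => /(_ isT).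
  have := cabsB (l - (ev i)%:C) (l - (lam b k w n)%:C).
  have -> : l - (ev i)%:C - (l - (lam b k w n)%:C) = (lam b k w n - ev i)%:C.
    by rewrite rmorphB; ring.
  rewrite cabs_real; lra.
have nearn l : evb ev B bl n l -> cabs (l - (lam b k w n)%:C) < bb + 1.
  move=> h; have [i bi hi] := evb_near bb_ge0 B_bnd blocks h ltr01.
  by rewrite -(evl_block mn bi).
have r0 : 0 < 2 * bb + 1 by lra.
apply: (@riesz_in (lam b k w n)%:C (2 * bb + 1) r0 _ (fun i => bl i == n) (block_set n) _ _
  (@block_fin n) _ 0) => //.
- move=> l n' lr h; have nn : n' = n by apply: near h _; rewrite lr.
  by rewrite nn in h; have := nearn _ h; rewrite lr; lra.
- by move=> i /out h; rewrite -rmorphB cabs_real; lra.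
- lra.
- by move=> i /eqP bi; rewrite (evl_block mn bi) subrr cabs0.
- apply/seteqP; split=> l /=.
    by move=> h; split; [exists n|have := nearn _ h; lra].
  by move=> [[n' h] lr]; rewrite -(near _ _ h (ltW lr)).
Qed.

(** * Number and asymptotics of the eigenvalues *)

Lemma evset_roots n : (m <= n)%N -> exists rs : seq C,
  size rs = (if n == m then Nn b m else Nn b n - Nn b n.-1)%N /\ forall l, evset n l <-> l \in rs.
Proof.
move=> mn; have [c [d [dE hcd]]] : exists c d, d = (if n == m then Nn b m else Nn b n - Nn b n.-1)%N /\
    forall i, (bl i == n) = (c <= i < c + d)%N.
  have [nm|nm] := eqVneq n m.
    exists 0%N, (Nn b m); split=> // i; rewrite /= add0n cutE // nm; apply/eqP/idP; rewrite /bl; lia.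
  have mn' : (m < n)%N by lia.
  exists (Nn b n.-1), (Nn b n - Nn b n.-1)%N; split=> // i.
  rewrite subnKC ?Nn_mono ?leq_pred // cutE // leqNgt cutE; last by lia.
  by rewrite -ltnNge; apply/eqP/andP; lia.
have seg : blockset bl (fun i => (c <= i < c + d)%N) by move=> i j ij; rewrite /= -!hcd ij.
have [rs [rsz hrs]] := eig_roots ev bb_ge0 B_bl seg.
exists rs; split; first by rewrite rsz.
move=> l; rewrite -hrs; split=> -[z [z1 z2 z3]]; exists z; split=> // i.
  by rewrite /= -hcd; exact: z2.
by rewrite /= hcd; exact: z2.
Qed.

(** Inside a block [(Gam X) B] vanishes, because [Gam X] has no entries there; so [B - Q] is the
    block of [Q (Gam X)], which is small by the gaps seen from block [n]. *)
Lemma B_block i j n : (m < n)%N -> bl i = n -> bl j = n ->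
  cabs (B i j - Q i j) <= M * (2 * M * tailc n).
Proof.
move=> mn bi bj; have -> : B i j = X i j by rewrite /dgp bi bj eqxx.
rewrite -eqX /simeq.
have -> : mm (gam ev bl X) B i j = 0.
  rewrite /mm /mv (eq_csum (b := fun=> 0)) ?csum0 // => l.
  rewrite /gam /dgp; have [->|_] := eqVneq (bl l) (bl j); first by rewrite bi bj eqxx mul0r.
  by rewrite mulr0.
have -> : Q i j + mm Q (gam ev bl X) i j - 0 - Q i j = mm Q (gam ev bl X) i j by ring.
have n0 : (0 < n)%N by lia.
have gl : l1le (gam ev bl X ^~ j) (2 * M * tailc n).
  apply: l1leW (l2_l1 (colX j) (l2le_real (x := fun i => (k0 * (maxn n (blk b i))%:R ^+ p)^-1)
    (tailc_ge0 n) (fun J => sum_tail J n0))) => l.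
  have g0 : 0 < k0 * (maxn n (blk b l))%:R ^+ p by rewrite mulr_gt0 // exprn_gt0 // ltr0n; lia.
  rewrite cabsM cabs_real ger0_norm ?invr_ge0 ?(ltW g0) //.
  rewrite /gam; case: eqP => [_|h]; first by rewrite cabs0 mulr_ge0 ?cabs_ge0 // invr_ge0 ltW.
  rewrite cabsM cabsV cabs_real ler_wpM2l ?cabs_ge0 //.
  have gm : k0 * (maxn n (blk b l))%:R ^+ p <= `|ev l - ev j|.
    apply: le_trans (gap_max h); rewrite ler_wpM2l ?(ltW k00) // natX_le //.
    by move: bj; rewrite /bl; lia.
  by rewrite lef_pV2 ?posrE //; exact: lt_le_trans g0 gm.
by apply: csum_le; apply: row_l1 gl => l; exact: colb_pt colQ.
Qed.

(** Gershgorin's argument at a coordinate of largest modulus; the factor 2 counts the indices of the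
    block. *)
Lemma eigen_dist n l (mq : C) (d : R) : (m < n)%N -> 0 <= d ->
  (forall i j, bl i = n -> bl j = n -> cabs (B i j - (i == j)%:R * mq) <= d) ->
  evb ev B bl n l -> cabs (l - ((lam b k w n)%:C - mq)) <= 2 * d.
Proof.
move=> mn d0 hd [z [[i1 zi1] sz zE]].
have [c [d' [d2 hc]]] := block_small mn.
have zin j : z j != 0 -> bl j = n.
  by move=> zj; apply/eqP; apply: contraNT zj => /sz ->.
have z0 j : (j != c) && (j != c.+1) -> z j = 0.
  by move=> jc; apply/eqP; apply: contraT => /zin/eqP; rewrite hc; lia.
have [i0 [hi0 zi0]] : exists i0, (forall j, cabs (z j) <= cabs (z i0)) /\ z i0 != 0.
  have big j0 : (forall j, (j == c) || (j == c.+1) -> cabs (z j) <= cabs (z j0)) ->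
      exists i0, (forall j, cabs (z j) <= cabs (z i0)) /\ z i0 != 0.
    move=> h; have hh j : cabs (z j) <= cabs (z j0).
      have [jc|jc] := boolP ((j == c) || (j == c.+1)); first exact: h.
      by rewrite z0 ?cabs0 ?cabs_ge0 // -negb_or.
    exists j0; split=> //; rewrite -cabs_gt0; apply: lt_le_trans (hh i1).
    by rewrite cabs_gt0.
  have [h|h] := leP (cabs (z c)) (cabs (z c.+1)).
    by apply: (big c.+1) => j /orP[] /eqP ->.
  by apply: (big c) => j /orP[] /eqP -> //; exact: ltW.
have bi0 := zin _ zi0.
have term j : cabs ((B i0 j - (i0 == j)%:R * mq) * z j) <= d * cabs (z i0).
  have [->|zj] := eqVneq (z j) 0; first by rewrite mulr0 cabs0 mulr_ge0 ?cabs_ge0.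
  by rewrite cabsM ler_pM ?cabs_ge0 // hd // zin.
have fin (a : nat -> C) : (forall j, z j = 0 -> a j = 0) -> csum a = a c + a c.+1.
  move=> ha; rewrite (@csum_fin _ c.+2) => [|j cj]; last by apply/ha/z0; lia.
  rewrite !big_ord_recr /= big1 ?add0r // => j _; apply/ha/z0.
  by have := ltn_ord j; lia.
have eB : mv B z i0 = B i0 c * z c + B i0 c.+1 * z c.+1.
  by rewrite /mv fin // => j ->; rewrite mulr0.
have ez : mq * z i0 = (i0 == c)%:R * mq * z c + (i0 == c.+1)%:R * mq * z c.+1.
  have [ic|ic] := eqVneq i0 c; first by rewrite ic ltn_eqF // !mul0r addr0 mul1r.
  have [ic'|ic'] := eqVneq i0 c.+1; first by rewrite ic' mul1r !mul0r add0r.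
  by move: zi0; rewrite z0 ?eqxx // ic.
have key : (l - ((lam b k w n)%:C - mq)) * z i0 =
    - ((B i0 c - (i0 == c)%:R * mq) * z c + (B i0 c.+1 - (i0 == c.+1)%:R * mq) * z c.+1).
  have := zE i0; rewrite /pert (evl_block mn bi0) eB => e1.
  have -> : (l - ((lam b k w n)%:C - mq)) * z i0 = l * z i0 - (lam b k w n)%:C * z i0 + mq * z i0 by ring.
  by rewrite -e1 ez; ring.
have zp : 0 < cabs (z i0) by rewrite cabs_gt0.
rewrite -(ler_pM2r zp) -cabsM key cabsN; apply: le_trans (cabsD _ _) _.
have := lerD (term c) (term c.+1); lra.
Qed.

Lemma l2_small (a : nat -> C) K (r : R) : l2le a K -> 0 < r ->
  exists N, forall n, (N <= n)%N -> cabs (a n) <= r.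
Proof.
move=> [K0 hK] r0; have r2 : 0 < r ^+ 2 by rewrite exprn_gt0.
have [N hN] := real_bounded_cauchy (fun i => sqr_ge0 (cabs (a i))) hK r2.
exists N => n Nn; rewrite -(@ler_pXn2r _ 2) ?nnegrE ?cabs_ge0 ?(ltW r0) //.
apply: le_trans (hN n.+1 (leqW Nn)); rewrite big_nat_recr //= lerDr.
by apply: sumr_ge0 => i _; exact: sqr_ge0.
Qed.

(* Riemann-Lebesgue: the entries of the potential on a block are its mean plus
   Fourier coefficients whose frequency tends to infinity. *)
Lemma Q_block (r : R) : 0 < r -> exists N, forall n, (N <= n)%N -> forall i j,
  blk b i = n -> blk b j = n -> cabs (Q i j - (i == j)%:R * mean w q) <= r.
Proof.
move=> r0; pose g idx := inner w q (bas w per idx).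
have [N hN] : exists N, forall n, (N <= n)%N -> cabs (g n) <= r.
  apply: l2_small (bessel w_gt0 (e := bas w per) _ _ hq) r0.
    by move=> i; exact: bas_L2.
  by move=> i j; exact: bas_on.
have qL1 : inL2 w (fun=> 1 : C).
  by apply: (@bounded_inL2 _ w w_gt0 _ 1 (cmeasurable_cst w 1)) => t _; rewrite cabs1.
have [bd|bd] : b = dir \/ b <> dir by case: b; [right|right|left].
  exists N => n Nn i j bi bj; have ij : i = j by move: bi bj; rewrite bd /=; lia.
  rewrite ij eqxx mul1r -{}ij {j bj}.
  have zp : zidx per i.+1.*2 = i.+1%:Z by rewrite /zidx odd_double uphalf_double.
  have zm : zidx per i.+1.*2.-1 = - i.+1%:Z.
    by rewrite /zidx doubleS /= odd_double /= doubleK.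
  (* With [x = frq w dir i * t], [h] is [2 cos 2x] in the periodic basis, and the square of the sine
     basis function is [2 sin^2 x = 1 - cos 2x]. *)
  pose h t := bas w per i.+1.*2 t + bas w per i.+1.*2.-1 t.
  have hL : inL2 w h by apply: inL2D => //; exact: bas_L2.
  have sL : inL2 w (fun t => (- 2^-1) * h t) by exact: inL2Z.
  have -> : Q i i - mean w q = - (2^-1 * (g i.+1.*2 + g (i.+1.*2.-1))).
    have e1 : inner w q (fun t => 1 + (- 2^-1) * h t) = mean w q + - (2^-1 * (g i.+1.*2 + g (i.+1.*2.-1))).
      rewrite innerDr //; congr (_ + _).
        by rewrite /mean /inner; congr (_ * _); apply: eq_cintegral => t _; rewrite rmorph1 mulr1.
      rewrite (inner_conj w_gt0 sL hq) innerZl // rmorphM /= -(inner_conj w_gt0 hL hq).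
      rewrite rmorphN fmorphV rmorph_nat mulNr; congr (- (_ * _)).
      exact: (innerDr w_gt0 (bas_L2 w_gt0 _ _) (bas_L2 w_gt0 _ _) hq).
    rewrite [X in X - _](_ : _ = inner w q (fun t => 1 + (- 2^-1) * h t)); first by rewrite e1; ring.
    rewrite /qmx /potmx /inner; congr (_ * _); apply: eq_cintegral => t _.
    rewrite -mulrA; congr (_ * _); rewrite /h !basE bd conj_real.
    have -> : frq w per i.+1.*2 = 2 * frq w dir i.
      by rewrite /frq zp /= addr0 intrM -[(i.+1%:Z)%:~R]/(i.+1%:R : R); ring.
    have -> : frq w per i.+1.*2.-1 = - (2 * frq w dir i).
      by rewrite /frq zm /= addr0 intrM mulrNz -[(i.+1%:Z)%:~R]/(i.+1%:R : R); ring.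
    set x := frq w dir i * t; have -> : - (2 * frq w dir i) * t = - (x + x) by rewrite /x; ring.
    have -> : - - (2 * frq w dir i) * t = x + x by rewrite /x; ring.
    have -> : expi (- (x + x)) + expi (x + x) = (2 * cos (x + x))%:C :> C.
      by rewrite /expi cosN sinN; apply/eqP; rewrite eq_complex /=; apply/andP; split; apply/eqP; ring.
    rewrite cosD; have s2 : Num.sqrt 2 * Num.sqrt 2 = 2 :> R by rewrite -expr2 sqr_sqrtr.
    have -> : 1 + - 2^-1 * (2 * (cos x * cos x - sin x * sin x))%:C =
        (1 - (cos x * cos x - sin x * sin x))%:C :> C.
      by rewrite rmorphB rmorph1 rmorphM rmorph_nat; field.
    rewrite conj_real -rmorphM; congr (_%:C); rewrite mulrACA s2.
    by have := cos2Dsin2 x; rewrite !expr2; lra.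
  apply: le_trans (_ : 2^-1 * (r + r) <= r); last by lra.
  rewrite cabsN cabsM cabsV; have -> : cabs (2 : C) = 2 by rewrite -(rmorph_nat (real_complex R)) cabs_real ger0_norm.
  rewrite ler_wpM2l ?invr_ge0 //; apply: le_trans (cabsD _ _) _; apply: lerD; apply: hN; move: bi; rewrite bd /=; lia.
exists N => n Nn i j bi bj.
have [->|ij] := eqVneq i j.
  rewrite mul1r (_ : Q j j = mean w q) ?subrr ?cabs0 ?ltW //.
  rewrite /qmx /potmx /mean /inner; congr (_ * _); apply: eq_cintegral => t _.
  by rewrite -mulrA mulcJ_sqr basE; case: b bd => // _; rewrite cabs_expi expr1n mulr1.
rewrite mul0r subr0.
(* Distinct indices of block [n] have [zidx] differing by [2 * n + theta b], so the entry is a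
   periodic Fourier coefficient of [q] whose index is at least [n]. *)
have [idx [hidx ez]] : exists idx, (n <= idx)%N /\ zidx per idx = zidx b i - zidx b j.
  pose s := (2 * n + theta b)%N.
  have [e1|e1] : zidx b i - zidx b j = s%:Z \/ zidx b i - zidx b j = - s%:Z.
    move: bi bj ij; rewrite /s /zidx; case: b bd => // _ /=; case: (boolP (odd i)); case: (boolP (odd j)); lia.
  - exists s.*2; split; first by rewrite /s; lia.
    by rewrite e1 /zidx odd_double uphalf_double.
  - exists (s.*2.-1); split; first by rewrite /s; lia.
    have s0 : (0 < s)%N by move: bi bj ij; rewrite /s; case: b bd => //= _; lia.
    rewrite e1 -(prednK s0) doubleS /= /zidx /= odd_double /= doubleK; lia.
have -> : Q i j = g idx.
  rewrite /g /qmx /potmx /inner; congr (_ * _); apply: eq_cintegral => t _.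
  rewrite -mulrA; congr (_ * _).
  have fE : frq w per idx = frq w b i - frq w b j.
    have e0 c : frq w c = fun a => if c is dir then pi * a.+1%:R / w else
      pi * (2 * zidx c a + (theta c)%:Z)%:~R / w by case: c.
    by rewrite !e0 ez; case: b bd => // _; rewrite -mulrBl -mulrBr -intrB; congr (_ * (_)%:~R / _); rewrite /=; ring.
  rewrite !basE fE; case: b bd => // _; rewrite -!expiN -expiD; congr expi; ring.
by apply: hN; exact: leq_trans hidx.
Qed.

Lemma eigen_asym (r : R) : 0 < r -> exists N, forall n l, (N <= n)%N -> (m < n)%N ->
  evb ev B bl n l -> cabs (l - ((lam b k w n)%:C - mean w q)) <= r.
Proof.
move=> r0; have M0 := colb_ge0 colQ; have r4 : 0 < r / 4 by rewrite divr_gt0.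
have D0 : 0 < M * (2 * M) + 1 by rewrite ltr_wpDl // mulr_ge0 // mulr_ge0.
have [N1 h1] := Q_block r4.
have [N2 h2] := tailc_small w_gt0 hk (divr_gt0 r4 D0).
exists (maxn N1 N2) => n l; rewrite geq_max => /andP[n1 n2] mn hl.
have -> : r = 2 * (r / 4 + r / 4) by field.
apply: (eigen_dist mn) hl; first by rewrite addr_ge0 // ltW.
move=> i j bi bj; have -> : B i j - (i == j)%:R * mean w q =
  (B i j - Q i j) + (Q i j - (i == j)%:R * mean w q) by ring.
have bE a : bl a = n -> blk b a = n by rewrite /bl; lia.
apply: le_trans (cabsD _ _) _; apply: lerD; last by apply: (h1 n) => //; exact: bE.
apply: le_trans (B_block mn bi bj) _; rewrite mulrA.
have := h2 n n2; rewrite ler_pdivlMr // mulrDr mulr1 => h3.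
have t0 := tailc_ge0 n; rewrite mulrC; lra.
Qed.

(** * The Hilbert-Schmidt estimate *)

Section HilbertSchmidt.
Variable n : nat.
Hypothesis mn : (m < n)%N.
Let N := Nn b n.
Let cut z : nat -> C := restr (fun i => (i < N)%N) z.

Local Notation Gam := (gam ev bl X).

Let n_gt0 : (0 < n)%N. Proof. exact: leq_ltn_trans mn. Qed.

(* The commutator of [Gam] with the projection onto the blocks up to n. *)
Definition cmt i j : C := ((j < N)%N%:R - (i < N)%N%:R) * Gam i j.

(** The first factor of [cmt] vanishes unless [n] separates the blocks of [i] and [j]. Then the
    larger of the two block numbers is at least [n] and at least that of [j], and [gap_max]
    applies. *)
Lemma cmt_le i j : cabs (cmt i j) <= (k0 * (maxn n (blk b j))%:R ^+ p)^-1 * cabs (X i j).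
Proof.
have g0 : 0 < k0 * (maxn n (blk b j))%:R ^+ p by rewrite mulr_gt0 // exprn_gt0 // ltr0n leq_max n_gt0.
have rhs0 : 0 <= (k0 * (maxn n (blk b j))%:R ^+ p)^-1 * cabs (X i j).
  by rewrite mulr_ge0 ?cabs_ge0 // invr_ge0 ltW.
rewrite /cmt cabsM; have [e|ne] := eqVneq (j < N)%N (i < N)%N.
  by rewrite e subrr cabs0 mul0r.
have one : cabs ((j < N)%N%:R - (i < N)%N%:R : C) <= 1.
  by move: ne; case: (j < N)%N; case: (i < N)%N => // _; rewrite ?subr0 ?sub0r ?cabsN cabs1.
apply: le_trans (ler_wpM2r (cabs_ge0 _) one) _; rewrite mul1r /gam.
case: eqP => [_|h]; first by rewrite cabs0.
rewrite cabsM cabsV cabs_real mulrC ler_wpM2r ?cabs_ge0 //.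
have gm : k0 * (maxn n (blk b j))%:R ^+ p <= `|ev i - ev j|.
  apply: le_trans (gap_max h); rewrite ler_wpM2l ?(ltW k00) // natX_le //.
  have mn' := ltnW mn; move: ne; rewrite !cutE // geq_max leq_max; move: mn; rewrite /bl.
  case: (leqP (maxn m (blk b j)) n); case: (leqP (maxn m (blk b i)) n) => //; lia.
by rewrite lef_pV2 ?posrE //; exact: lt_le_trans g0 gm.
Qed.

(** Summation by columns: each column of [X] has norm at most [2 * M], and the squared inverse gaps
    sum to [tailc n ^+ 2] at most. *)
Lemma cmt_hs I J : \sum_(i < I) \sum_(j < J) cabs (cmt i j) ^+ 2 <= (2 * M * tailc n) ^+ 2.
Proof.
have M0 := colb_ge0 colX; rewrite exchange_big /=.
apply: (@le_trans _ _ (\sum_(j < J) (2 * M) ^+ 2 * ((k0 * (maxn n (blk b j))%:R ^+ p)^-1) ^+ 2)).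
  apply: ler_sum => j _; have [_ hX] := colX j; rewrite mulrC.
  apply: le_trans (ler_wpM2l (sqr_ge0 _) (hX I)); rewrite mulr_sumr; apply: ler_sum => i _.
  rewrite -exprMn lerXn2r ?nnegrE ?cabs_ge0 ?cmt_le //.
  exact: le_trans (cabs_ge0 _) (cmt_le i j).
by rewrite -mulr_sumr [leRHS]exprMn; apply: ler_wpM2l; [exact: sqr_ge0|exact: sum_tail].
Qed.

(** Coefficient [i] of the difference of projections at [x], see [projdiffE]. *)
Definition cmtf i x : C := csum (fun j => cmt i j * Uinv (hat x) j).

Lemma hs_rows : exists r : nat -> R, (forall i, l2le (cmt i) (r i)) /\
  forall I, \sum_(i < I) r i ^+ 2 <= (2 * M * tailc n) ^+ 2.
Proof.
apply: (l2_rows (f := cmt)) cmt_hs.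
by rewrite mulr_ge0 // (colb_ge0 colX).
Qed.

Lemma hatDf x y : inL2 w x -> inL2 w y -> hat (fun t => x t + y t) = fun i => hat x i + hat y i.
Proof. by move=> hx hy; apply/funext => i; rewrite fcoefD. Qed.

Lemma hatZf (c : C) x : inL2 w x -> hat (fun t => c * x t) = fun i => c * hat x i.
Proof. by move=> hx; apply/funext => i; rewrite fcoefZ. Qed.

Lemma cmtfD i x y : inL2 w x -> inL2 w y -> cmtf i (fun t => x t + y t) = cmtf i x + cmtf i y.
Proof.
move=> hx hy; have [r [hr _]] := hs_rows.
have h1 := fcoef_l2 b w_gt0 hx; have h2 := fcoef_l2 b w_gt0 hy.
rewrite /cmtf hatDf // (UinvD h1 h2) -(csumD (l2_l1 (hr i) (UinvP h1).1) (l2_l1 (hr i) (UinvP h2).1)).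
by apply: eq_csum => j; rewrite mulrDr.
Qed.

Lemma cmtfZ i (c : C) x : inL2 w x -> cmtf i (fun t => c * x t) = c * cmtf i x.
Proof.
move=> hx; have [r [hr _]] := hs_rows; have h1 := fcoef_l2 b w_gt0 hx.
rewrite /cmtf hatZf // (UinvZ c h1) -(csumZ c (l2_l1 (hr i) (UinvP h1).1)).
by apply: eq_csum => j; rewrite mulrCA.
Qed.

Lemma cmtf_sum i (f : nat -> R -> C) J (a : nat -> C) : (forall j, inL2 w (f j)) ->
  cmtf i (fun t => \sum_(j < J) a j * f j t) = \sum_(j < J) a j * cmtf i (f j).
Proof.
move=> hf; elim: J => [|J IH].
  rewrite [RHS]big_ord0 -[RHS](mul0r (cmtf i (fun=> 0))) -(cmtfZ i 0 (inL2_0 w_gt0)).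
  by congr cmtf; apply/funext => t; rewrite big_ord0 mul0r.
rewrite big_ord_recr /= -IH -cmtfZ // -cmtfD; first by congr cmtf; apply/funext => t; rewrite big_ord_recr.
  by apply: (@inL2_sum _ w w_gt0 J (fun j t => a j * f j t)) => j; exact: inL2Z.
exact: inL2Z.
Qed.

Definition projdiff x : R -> C := fun t => S (U (cut (Uinv (hat x)))) t - S (cut (hat x)) t.

(** With [z = Uinv (hat x)], [U (cut z) - cut (U z)] is the commutator applied to [z], since the
    identity in [U] commutes with [cut]. The result is in l^1 because [U (cut z)] is in the domain
    and the other term is finite. *)
Lemma projdiffE x : inL2 w x -> exists K, l1le (fun i => cmtf i x) K /\
  projdiff x = S (fun i => cmtf i x).
Proof.
move=> hx; have h1 := fcoef_l2 b w_gt0 hx; have [hz ze] := UinvP h1.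
set z := Uinv (hat x) in hz ze *.
have dz : dom ev (cut z) by apply: (@dom_supp _ ev N) => i Ni; rewrite /cut /restr ltnNge Ni.
have [dU _] := U_intertwine dz; have [K hK] := l1dom dU.
have hc : l1le (cut (hat x)) (\sum_(i < N) cabs (cut (hat x) i)).
  by apply: l1le_fin => i Ni; rewrite /cut /restr ltnNge Ni.
have hz' := restr_l2 (fun i => (i < N)%N) hz.
have row i K' v (hy : l2le v K') := gam_rowX Gap_gt0 gap_Gap (tailc_ge0 m) sumG small colX i hy.
have e i : cmtf i x = U (cut z) i + (-1) * cut (hat x) i.
  have hl := row i _ _ hz'.
  have hr : l1le (fun j => (i < N)%N%:R * (Gam i j * z j)) _ := l1leZ _ (row i _ _ hz).
  rewrite mulN1r /opU {3}/cut /restr -{1}ze /opU.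
  have -> : cmtf i x = mv Gam (cut z) i - (i < N)%N%:R * mv Gam z i.
    rewrite /mv -(csumZ _ (row i _ _ hz)) -(csumB hl hr); apply: eq_csum => j.
    by rewrite /cmt /cut /restr -/z; case: (j < N)%N; case: (i < N)%N; rewrite /= ?mulr0n ?mulr1n; ring.
  by rewrite /cut /restr; case: (i < N)%N; rewrite ?mul1r ?mul0r; ring.
exists (K + cabs (-1 : C) * \sum_(i < N) cabs (cut (hat x) i)).
have hs := l1leD hK (l1leZ (-1) hc); split.
  by apply: l1leW hs => i; rewrite e.
apply/funext => t; rewrite /projdiff.
rewrite (_ : (fun i => cmtf i x) = fun i => U (cut z) i + (-1) * cut (hat x) i); last exact/funext.
rewrite (synthD eb t hK (l1leZ (-1) hc)) (synthZ eb _ t hc); ring.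
Qed.

Lemma projdiff_L2 x : inL2 w x -> inL2 w (projdiff x).
Proof. by move=> /projdiffE [K [hK ->]]; exact: (synth_L2 w_gt0 eL2 eb hK). Qed.

(** Rows and basis vectors are exchanged: for fixed [i] the functional [cmtf i] has norm at most
    [2 * r i], the 2 coming from [Uinv], and [bessel_functional] sums its squares over the basis.
    The sum over [i] is at most [4 * (2 * M * tailc n) ^+ 2]. *)
Lemma projdiff_hs (f : nat -> R -> C) J : onb w f -> \sum_(a < J) n2 w (projdiff (f a)) <= (4 * M * tailc n) ^+ 2.
Proof.
move=> [fL fo _]; have [r [hr hr2]] := hs_rows.
have row i : l2le (fun a => cmtf i (f a)) (2 * r i).
  have r0 := l2le_ge0 (hr i); apply: (bessel_functional w_gt0 fL fo).
  - by rewrite mulr_ge0.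
  - by move=> A a; exact: cmtf_sum.
  - move=> x hx; have h1 := fcoef_l2 b w_gt0 hx; have [hz _] := UinvP h1.
    by apply: le_trans (csum_le (l2_l1 (hr i) hz)) _; rewrite mulrCA mulrA.
have M0 := colb_ge0 colX; have T0 : 0 <= 4 * M * tailc n.
  by rewrite mulr_ge0 //; have := M0; lra.
have [|r' [h1 h2]] := @l2_rows R (fun a i => cmtf i (f a)) (4 * M * tailc n) T0.
  move=> A I; rewrite exchange_big /=.
  apply: (@le_trans _ _ (\sum_(i < I) 4 * r i ^+ 2)).
    apply: ler_sum => i _; have [_ h] := row i; apply: le_trans (h A) _.
    by rewrite exprMn le_eqVlt; apply/orP; left; apply/eqP; ring.
  rewrite -mulr_sumr; apply: le_trans (ler_wpM2l _ (hr2 I)) _ => //.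
  by rewrite le_eqVlt; apply/orP; left; apply/eqP; ring.
apply: le_trans (h2 J); apply: ler_sum => a _.
have [K [hK ->]] := projdiffE (fL a).
exact: (n2_synth w_gt0 eL2 e_on eb hK (h1 a)).
Qed.

Lemma sum_blocks x t : inL2 w x ->
  Pblock m x t + \sum_(m.+1 <= j < n.+1) Pblock j x t = S (U (cut (Uinv (hat x)))) t.
Proof.
move=> hx; have [hz _] := UinvP (fcoef_l2 b w_gt0 hx); set z := Uinv (hat x) in hz *.
have dfin (I : pred nat) a : (forall i, I i -> (i < a)%N) -> dom ev (restr I z).
  move=> hI; apply: (@dom_supp _ ev a) => i ai; rewrite /restr; case: ifPn => // /hI; lia.
have -> : cut z = restr (fun i => (bl i <= n)%N) z.
  by apply/funext => i; rewrite /cut /restr /N cutE // ltnW.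
elim: n mn => [//|n' IH]; rewrite ltnS leq_eqVlt => /orP[/eqP <-|mn'].
  rewrite big_nat1 /Pblock /proj_on -/z.
  have d1 := dfin _ _ (@block_fin m); have d2 := dfin _ _ (@block_fin m.+1).
  have [dU1 _] := U_intertwine d1; have [dU2 _] := U_intertwine d2.
  have [K1 hK1] := l1dom dU1; have [K2 hK2] := l1dom dU2.
  rewrite -(synthD eb t hK1 hK2) -(UD (restr_l2 _ hz) (restr_l2 _ hz)).
  congr (S (U _) t); apply/funext => i; rewrite /restr.
  have mb : (m <= bl i)%N by rewrite leq_maxl.
  have [e1|n1] := eqVneq (bl i) m; first by rewrite e1 ltn_eqF // leqW // addr0.
  have [e1|n2] := eqVneq (bl i) m.+1; first by rewrite e1 leqnn add0r.
  by rewrite ifF ?addr0 //; lia.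
rewrite big_nat_recr /=; last by lia.
rewrite addrA IH // /Pblock /proj_on -/z.
have d1 : dom ev (restr (fun i => (bl i <= n')%N) z).
  by apply: (dfin _ (Nn b n')) => i; rewrite cutE // ltnW.
have d2 := dfin _ _ (@block_fin n'.+1).
have [dU1 _] := U_intertwine d1; have [dU2 _] := U_intertwine d2.
have [K1 hK1] := l1dom dU1; have [K2 hK2] := l1dom dU2.
rewrite -(synthD eb t hK1 hK2) -(UD (restr_l2 _ hz) (restr_l2 _ hz)).
congr (S (U _) t); apply/funext => i; rewrite /restr.
have [e1|n2] := eqVneq (bl i) n'.+1; first by rewrite e1 ltnn leqnn add0r.
have -> : (bl i <= n'.+1)%N = (bl i <= n')%N by rewrite leq_eqVlt (negbTE n2).
by rewrite addr0.
Qed.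

Lemma synth_cut x t : S (cut (hat x)) t = \sum_(i < N) hat x i * e i t.
Proof.
rewrite /synth (@csum_fin _ N) => [|i Ni]; last by rewrite /cut /restr ltnNge Ni mul0r.
by apply: eq_bigr => i _; rewrite /cut /restr ltn_ord.
Qed.

End HilbertSchmidt.

(** Passes from integer powers under a root to the real exponent; the summand 1 keeps the constant
    positive even for zero potential. *)
Lemma tailc_powR n : (0 < n)%N ->
  4 * M * tailc n <= (4 * M * Num.sqrt 6 / k0 + 1) / n%:R `^ (2 * k%:R - 3 / 2).
Proof.
move=> n0; have n0' : 0 < n%:R :> R by rewrite ltr0n.
have x0 : 0 < n%:R `^ (2 * k%:R - 3 / 2) :> R by exact: powR_gt0.
have M0 := colb_ge0 colX.
have sq : (n%:R `^ (2 * k%:R - 3 / 2)) ^+ 2 = n%:R ^+ (4 * k - 3) :> R.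
  rewrite -!powR_mulrn ?powR_ge0 // -powRrM; congr (_ `^ _).
  by rewrite natrB ?natrM; [field|lia].
have -> : tailc n = Num.sqrt 6 / n%:R `^ (2 * k%:R - 3 / 2) / k0.
  by rewrite /tailc -sq -exprVn sqrtrM // sqrtr_sqr ger0_norm // invr_ge0 ltW.
have -> : 4 * M * (Num.sqrt 6 / n%:R `^ (2 * k%:R - 3 / 2) / k0) =
  (4 * M * Num.sqrt 6 / k0) / n%:R `^ (2 * k%:R - 3 / 2) by ring.
by rewrite ler_wpM2r ?invr_ge0 ?(ltW x0) // lerDl.
Qed.

Lemma hs_norm_le (T : (R -> C) -> R -> C) (K : R) : 0 <= K ->
  (forall f : nat -> R -> C, onb w f -> (forall a, inL2 w (T (f a))) /\
     forall J, \sum_(a < J) n2 w (T (f a)) <= K ^+ 2) ->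
  (hs_norm w T <= K%:E)%E.
Proof.
move=> K0 hT; apply: ub_ereal_sup => _ [f hf <-]; have [TL hK] := hT f hf.
have -> : K%:E = sqrte ((K ^+ 2)%:E) by rewrite /= sqrtr_sqr ger0_norm.
rewrite lee_sqrt ?lee_fin ?sqr_ge0 //.
have e1 a : ((l2norm w (T (f a))) ^+ 2 = (n2 w (T (f a)))%:E)%E.
  by rewrite l2norm_n2 // -EFin_expe sqr_sqrtr // n2_ge0.
under eq_eseriesr do rewrite e1.
apply: lime_le; first by apply: is_cvg_nneseries => a _ _; rewrite lee_fin n2_ge0.
by apply: nearW => J; rewrite sumEFin lee_fin big_mkord.
Qed.

Lemma hs_bound n (T : (R -> C) -> R -> C) : (m < n)%N ->
  (forall x t, inL2 w x -> T x t =
     Pblock m x t + \sum_(m.+1 <= j < n.+1) Pblock j x t - \sum_(i < Nn b n) hat x i * e i t) ->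
  (hs_norm w T <= ((4 * M * Num.sqrt 6 / k0 + 1) / n%:R `^ (2 * k%:R - 3 / 2))%:E)%E.
Proof.
move=> mn hT; have n0 : (0 < n)%N by exact: leq_ltn_trans mn.
have TE x : inL2 w x -> T x = projdiff n x.
  by move=> hx; apply/funext => t; rewrite hT // (sum_blocks mn t hx) -synth_cut.
apply: (@le_trans _ _ (4 * M * tailc n)%:E); last by rewrite lee_fin tailc_powR.
have M0 := colb_ge0 colX.
apply: hs_norm_le; first by rewrite mulr_ge0 //; lra.
move=> f hf; have [fL _ _] := hf; split=> [a|J].
  by rewrite TE //; exact: projdiff_L2.
under eq_bigr do rewrite TE //.
exact: projdiff_hs.
Qed.

End Similar.
End Model.

(** * Choice of [m] and assembly *)

Section Main.
Context {R : realType}.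
Local Notation C := R[i].
Variables (k : nat) (w : R) (q : R -> C).
Hypotheses (hk : (1 < k)%N) (w_gt0 : 0 < w) (hq : inL2 w q).

(** The size of the merged block enters [bB] linearly: [Nb b m <= 4 * m.+1] bounds the left-hand
    side by [m.+1 * (10 * (8 * M + 1))]. The gap contains at least two factors [m.+1], one of which
    absorbs the constant. *)
Lemma choose_m b : exists m, [/\ (0 < m)%N, 10 * (potnorm w q * tailc w k m) <= 1 &
  10 * (bB (potnorm w q) (Nb b m) + 1) <= kap0 w k * (m.+1)%:R ^+ (2 * k - 1)].
Proof.
set M := potnorm w q; have M0 : 0 <= M by rewrite mulr_ge0 ?sqrtr_ge0.
have k00 := kap0_gt0 k w_gt0.
have d0 : 0 < (10 * (M + 1))^-1 by rewrite invr_gt0; lra.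
have [N hN] := tailc_small w_gt0 hk d0.
pose m := maxn 1 (maxn N (Num.truncn (10 * (8 * M + 1) / kap0 w k)).+1).
exists m; split; first by rewrite leq_max.
  have h := hN m (leq_trans (leq_maxl _ _) (leq_maxr 1 _)).
  have t0 : 0 <= tailc w k m by exact: tailc_ge0.
  have : 10 * (M + 1) * tailc w k m <= 1.
    by rewrite mulrC -ler_pdivlMr ?mul1r //; lra.
  lra.
have h1 : 10 * (8 * M + 1) <= kap0 w k * m.+1%:R.
  rewrite [leRHS]mulrC -ler_pdivrMr //; apply: le_trans (ltW (truncnS_gt _)) _.
  rewrite ler_nat; apply: leqW; rewrite /m; set tr := Num.truncn _; lia.
have h2 : (Nb b m)%:R <= 4 * m.+1%:R :> R.
  by rewrite -natrM ler_nat /Nb; case: b => /=; lia.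
have m1 : 1 <= m.+1%:R :> R by rewrite ler1n.
have h3 : m.+1%:R * m.+1%:R <= m.+1%:R ^+ (2 * k - 1) :> R.
  by rewrite -expr2 -!natrX ler_nat leq_pexp2l //; lia.
apply: (@le_trans _ _ (m.+1%:R * (10 * (8 * M + 1)))).
  rewrite /bB; have := ler_wpM2r (_ : 0 <= 2 * M) h2.
  have mM : 0 <= m.+1%:R * M by rewrite mulr_ge0.
  by rewrite mulr_ge0 // => /(_ isT); nra.
apply: le_trans (ler_wpM2l _ h1) _ => //.
have -> : m.+1%:R * (kap0 w k * m.+1%:R) = kap0 w k * (m.+1%:R * m.+1%:R) by ring.
by rewrite ler_wpM2l // ltW.
Qed.

(** All that the theorem needs, for every boundary condition at once, in terms of block spectra
    [ES n]; the index [m] stands for the merged block. [T] is prescribed by its values on L_2, so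
    that sums of unperturbed projections can be written in the basis. *)
Lemma block_perturbation b : exists (m : nat) (ES : nat -> set C) (PB : nat -> (R -> C) -> R -> C) (c : R),
  [/\ (0 < m)%N /\ 0 < c,
    spectral_splitting w (L_op b k w q) m (ES m) ES /\
      (forall n, (m <= n)%N -> riesz_projection w (L_op b k w q) (ES n) (PB n)),
    forall n, (m <= n)%N -> exists rs : seq C,
      size rs = (if n == m then Nn b m else Nn b n - Nn b n.-1)%N /\ forall l, ES n l <-> l \in rs,
    forall r : R, 0 < r -> exists N, forall n l, (N <= n)%N -> (m < n)%N -> ES n l ->
      cabs (l - ((lam b k w n)%:C - mean w q)) <= r
    & forall n (T : (R -> C) -> R -> C), (m < n)%N ->
      (forall x t, inL2 w x -> T x t = PB m x t + \sum_(m.+1 <= j < n.+1) PB j x t -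
         \sum_(i < Nn b n) inner w x (bas w b i) * bas w b i t) ->
      (hs_norm w T <= (c / n%:R `^ (2 * k%:R - 3 / 2))%:E)%E].
Proof.
have [m [m0 small sep]] := choose_m b; exists m.
have [X [colX eqX]] := simeq_exists (colQ b w_gt0 hq) (Gap_gt0 b k w_gt0 m0) (gap_Gap hk w_gt0 m0 small sep)
  (tailc_ge0 k w_gt0 m) (sumG hk w_gt0 m0 small sep) small.
exists (evset b k m w X), (Pblock b k m w X), (4 * potnorm w q * Num.sqrt 6 / kap0 w k + 1).
split.
- split=> //; rewrite ltr_wpDl // divr_ge0 ?(ltW (kap0_gt0 k w_gt0)) //.
  by rewrite !mulr_ge0 ?sqrtr_ge0.
- split; first exact: splitting.
  move=> n; rewrite leq_eqVlt => /orP[/eqP <-|mn]; first exact: riesz_big.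
  exact: riesz_block.
- by move=> n mn; exact: (evset_roots hk w_gt0 hq m0 small sep X mn).
- by move=> r r0; exact: eigen_asym.
- by move=> n T mn hT; apply: hs_bound hT.
Qed.

End Main.

Section Conclusion.
Context {R : realType}.
Local Notation C := R[i].
Variables (w : R) (q : R -> C).

(** The enumeration of the basis lists the exponentials of [P0 b w 0], [P0 b w 1] and so on in
    order, two for each new block. *)
Lemma sum_P0 b n x t : b <> dir ->
  \sum_(0 <= j < n.+1) P0 b w j x t = \sum_(i < Nn b n) inner w x (bas w b i) * bas w b i t.
Proof.
move=> bd; elim: n => [|n IH].
  rewrite big_nat1; case: b bd => // _; first by rewrite /= big_ord1.
  by rewrite /= !big_ord_recl big_ord0 /= addr0.
have NnS : Nn b n.+1 = (Nn b n).+2 by case: b bd {IH} => // _ /=; lia.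
have e1 : bas w b (Nn b n) = efun b w (- n.+1%:Z - (theta b)%:Z).
  by case: b bd {IH NnS} => // _; congr (efun _ w _); rewrite /zidx /=; case: ifP; lia.
have e2 : bas w b (Nn b n).+1 = efun b w n.+1%:Z.
  by case: b bd {IH NnS e1} => // _; congr (efun _ w _); rewrite /zidx /=; case: ifP; lia.
rewrite big_nat_recr // IH NnS 2!big_ord_recr /= e1 e2 -addrA; congr (_ + _).
by rewrite /P0 andbF.
Qed.

Lemma sum_P0_dir n x t :
  \sum_(1 <= j < n.+1) P0_dir w j x t =
    \sum_(i < n) inner w x (bas w dir i) * bas w dir i t.
Proof. by rewrite big_add1 big_mkord. Qed.

Lemma card_set_seq (E : set C) (rs : seq C) :
  (forall l, E l <-> l \in rs) -> E #<= `I_(size rs).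
Proof.
move=> hE; apply: card_le_trans (card_image_le (nth 0 rs) `I_(size rs)).
apply: subset_card_le => l /hE lr; exists (index l rs); rewrite /= ?index_mem //.
exact: nth_index.
Qed.

Lemma splitting_ext A m (E : set C) (s s' : nat -> set C) :
  (forall n, (m < n)%N -> s n = s' n) ->
  spectral_splitting w A m E s -> spectral_splitting w A m E s'.
Proof.
move=> ss' [h1 h2 h3 h4]; split=> //.
- by rewrite h2; congr (_ `|` _); apply: eq_bigcupr => n /= mn; rewrite ss'.
- by move=> n mn; rewrite -ss' //; exact: h3.
- move=> i j /= mi mj; rewrite -!ss' //; exact: h4.
Qed.

Lemma eigen_asymp_near (la : nat -> R) (lt : nat -> C) :
  (forall r : R, 0 < r -> exists N, forall n, (N <= n)%N ->
     cabs (lt n - ((la n)%:C - mean w q)) <= r) -> eigen_asymp w q la lt.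
Proof.
move=> h; apply/cvgrPdist_le => r r0; have [N hN] := h r r0.
exists N => // n /= Nn; rewrite sub0r normrN ger0_norm ?cabs_ge0 //; exact: hN.
Qed.

Lemma hs_sum (PS : (R -> C) -> R -> C) (Pt P0 : nat -> (R -> C) -> R -> C) a m n x t :
  (PS + \sum_(m.+1 <= j < n.+1) Pt j - \sum_(a <= j < n.+1) P0 j)%R x t =
  PS x t + \sum_(m.+1 <= j < n.+1) Pt j x t - \sum_(a <= j < n.+1) P0 j x t.
Proof.
have sumE l u (P : nat -> (R -> C) -> R -> C) :
    (\sum_(l <= j < u) P j) x t = \sum_(l <= j < u) P j x t.
  by elim/big_rec2: _ => // j y1 y2 _ <-.
by rewrite -!sumE.
Qed.

End Conclusion.

Theorem corollary7 (R : realType) (k : nat) (w : R) (q : R -> R[i])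
    (hk : (1 < k)%N) (hw : 0 < w) (hq : inL2 w q) :
  (forall b : bcond, b = per \/ b = ap ->
     exists (m : nat) (S : set R[i]) (lm lp : nat -> R[i])
            (PS : (R -> R[i]) -> R -> R[i])
            (Pt : nat -> (R -> R[i]) -> R -> R[i]) (c : R),
       [/\ spectral_splitting w (L_op b k w q) m S (fun n => [set lm n; lp n]),
           S #<= `I_(2 * m + 1 + theta b),
           eigen_asymp w q (lambda b k w) lm /\
           eigen_asymp w q (lambda b k w) lp,
           riesz_projection w (L_op b k w q) S PS /\
           (forall n, (m < n)%N ->
              riesz_projection w (L_op b k w q) [set lm n; lp n] (Pt n))
         & 0 < c /\
           forall n, (m < n)%N ->
             (hs_norm w (PS + \sum_(m.+1 <= j < n.+1) Pt j
                            - \sum_(0 <= j < n.+1) P0 b w j)%R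
              <= (c / n%:R `^ (2 * k%:R - 3 / 2))%:E)%E]) /\
  (exists (m : nat) (S : set R[i]) (ld : nat -> R[i])
          (PS : (R -> R[i]) -> R -> R[i])
          (Pt : nat -> (R -> R[i]) -> R -> R[i]) (c : R),
     (0 < m)%N /\
     [/\ spectral_splitting w (L_op dir k w q) m S (fun n => [set ld n]),
         S #<= `I_m,
         eigen_asymp w q (lambda_dir k w) ld,
         riesz_projection w (L_op dir k w q) S PS /\
         (forall n, (m < n)%N ->
            riesz_projection w (L_op dir k w q) [set ld n] (Pt n))
       & 0 < c /\
         forall n, (m < n)%N ->
           (hs_norm w (PS + \sum_(m.+1 <= j < n.+1) Pt j
                          - \sum_(1 <= j < n.+1) P0_dir w j)%R
            <= (c / n%:R `^ (2 * k%:R - 3 / 2))%:E)%E]).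
Proof.
split=> [b bb|].
  have bd : b <> dir by case: bb => ->.
  have [m [ES [PB [c [[m0 c0] [spl rsz] roots asymp hs]]]]] := block_perturbation hk hw hq b.
  have [rs [srs hrs]] := roots m (leqnn m); rewrite eqxx in srs.
  (* A block beyond [m] has two indices, hence two roots, possibly equal, and their order is
     immaterial. [(0, 0)] is a filler for [n <= m]. *)
  have pair n : exists p : R[i] * R[i], (m < n)%N -> ES n = [set p.1; p.2].
    case: (ltnP m n) => [mn|_]; last by exists (0, 0).
    have [r [sr hr]] := roots n (ltnW mn).
    have {sr} : size r = 2%N.
      by rewrite sr gtn_eqF //; case: b bd {bb spl rsz roots asymp hs srs sr} => // _ /=; lia.
    case: r hr => [|l1 [|l2 []]] // hr _; exists (l1, l2) => _.
    apply/seteqP; split=> l; rewrite /= hr !inE; first by case/orP=> /eqP ->; [left|right].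
    by case=> ->; rewrite eqxx ?orbT.
  have [p hp] := choice pair.
  exists m, (ES m), (fun n => (p n).1), (fun n => (p n).2), (PB m), PB, c; split.
  - exact: splitting_ext hp spl.
  - have := card_set_seq hrs; rewrite srs.
    by rewrite (_ : Nn b m = (2 * m + 1 + theta b)%N) //; case: bb => ->/=; lia.
  (* The roots chosen in [pair] are eigenvalues for [n > m], which explains [m.+1] in the
     threshold. *)
  - split; apply: eigen_asymp_near => r r0; have [N hN] := asymp r r0;
      exists (maxn N m.+1) => n; rewrite geq_max => /andP[Nn mn]; rewrite lam_lambda //;
      apply: hN => //; rewrite hp //; by [left|right].
  - split; first exact: rsz.
    by move=> n mn; rewrite -hp //; apply: rsz; exact: ltnW.
  split=> // n mn; apply: hs => // x t hx.
  by rewrite hs_sum sum_P0.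
have [m [ES [PB [c [[m0 c0] [spl rsz] roots asymp hs]]]]] := block_perturbation hk hw hq dir.
have [rs [srs hrs]] := roots m (leqnn m); rewrite eqxx in srs.
have point n : exists l : R[i], (m < n)%N -> ES n = [set l].
  case: (ltnP m n) => [mn|_]; last by exists 0.
  have [r [sr hr]] := roots n (ltnW mn).
  have {sr} : size r = 1%N by rewrite sr gtn_eqF //=; lia.
  case: r hr => [|l1 []] // hr _; exists l1 => _.
  by apply/seteqP; split=> l; rewrite /= hr inE => /eqP.
have [ld hp] := choice point.
exists m, (ES m), ld, (PB m), PB, c; split=> //; split.
- exact: splitting_ext hp spl.
- by have := card_set_seq hrs; rewrite srs.
- apply: eigen_asymp_near => r r0; have [N hN] := asymp r r0.
  exists (maxn N m.+1) => n; rewrite geq_max => /andP[Nn mn]; rewrite lam_lambda_dir.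
  by apply: hN => //; rewrite hp.
- split; first exact: rsz.
  by move=> n mn; rewrite -hp //; apply: rsz; exact: ltnW.
split=> // n mn; apply: hs => // x t hx.
by rewrite hs_sum sum_P0_dir.
Qed.
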